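(* Let $Q=\{F=0\}\subset\mathbb{P}^2$ be an irreducible quartic such that $Q\cup L_\infty$ is one of the thirteen irreducible $QL$-configurations $(1),\dots,(13)$ listed in the context, and let $f(x,y)=F(x,y,1)$. \begin{enumerate} \item If $Q$ is of type $(13)$, then $Q$ has no $(2,3)$ torus decomposition. \item If $Q$ is of type $(5)$, then $Q$ has exactly five $(2,3)$ torus decompositions (up to the equivalence in the context); three of them are visible and two are invisible. \item If $Q$ is of one of the types $(1),(2),(3),(4),(6),(7),(8),(9),(10),(11),(12)$, then $Q$ has exactly one $(2,3)$ torus decomposition (up to equivalence). \end{enumerate}
   Context: Work in $\mathbb{P}^2$ with homogeneous coordinates $[X:Y:Z]$; $L_\infty=\{Z=0\}$ is the line at infinity and $\mathbb{C}^2=\mathbb{P}^2\setminus L_\infty$ with affine coordinates $x=X/Z$, $y=Y/Z$. For $n\ge1$, $a_n$ denotes the topological type of the plane curve germ $x^2+y^{n+1}=0$ at the origin, and $e_6$ that of $x^3+y^4=0$. Positions of a quartic $Q$ relative to $L_\infty$: (i) $Q\cap L_\infty$ consists of two distinct smooth points of $Q$ at each of which $L_\infty$ is tangent to $Q$ (bitangent); (ii) $Q\cap L_\infty$ consists of two points, $L_\infty$ being tangent to $Q$ at a smooth point and passing through a singular point of $Q$; (iv) $Q\cap L_\infty$ is a single smooth point of $Q$ with intersection multiplicity $4$; (v) $Q\cap L_\infty$ is a single singular point of $Q$ with intersection multiplicity $4$. The irreducible $QL$-configurations are the following, where the list gives all singular points of $Q$, a superscript $\infty$ means the singular point lies on $L_\infty$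 and singularities without superscript lie off $L_\infty$: (1) $2a_2$, (i); (2) $2a_2$, (iv); (3) $2a_2+a_1$, (i); (4) $2a_2+a_1$, (iv); (5) $3a_2$, (i); (6) $a_2+a_3^\infty$, (ii); (7) $a_5$, (i); (8) $a_5$, (iv); (9) $a_6^\infty$, (ii); (10) $a_4^\infty+a_2$, (v); (11) $e_6$, (i); (12) $e_6$, (iv); (13) $a_4+a_2^\infty$, (ii). A $(2,3)$ torus decomposition of $Q$ (with respect to $L_\infty$) is a pair $(f_2,f_3)$ of coprime nonconstant polynomials in $\mathbb{C}[x,y]$ with $\deg f_2\le 2$, $\deg f_3\le 3$ and $c\,f=f_2^3+f_3^2$ for some nonzero constant $c$. Equivalently, with $F_2=Z^2f_2(X/Z,Y/Z)$ and $F_3=Z^3f_3(X/Z,Y/Z)$ one has $F_2^3+F_3^2=c\,Z^2F$. The decomposition is called visible if $Z$ divides $F_2$ (i.e. $\deg f_2\le1$; then $F_2=ZF_1'$, $F_3=ZF_2'$ and $cF=F_2'^2+F_1'^3Z$), and invisible otherwise. Two decompositions $(f_2,f_3)$ and $(f_2',f_3')$ are considered the same if $f_2'=\alpha f_2$ and $f_3'=\beta f_3$ for nonzero constants $\alpha,\beta$. *)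

(* Defs.v *)
From HB Require Import structures.
From mathcomp Require Import all_boot all_algebra.
From mathcomp Require Import reals complex mpoly.
Set Implicit Arguments. Unset Strict Implicit. Unset Printing Implicit Defensive.
Import GRing.Theory Num.Theory.
Local Open Scope ring_scope.

Section QL.
Variable R : realType.
Local Notation C := (R[i]).

Definition cnorm (z : C) : R := Normc.normc z.

Definition cball (p : C * C) (e : R) (q : C * C) : Prop :=
  cnorm (q.1 - p.1) < e /\ cnorm (q.2 - p.2) < e.

Definition copen (U : C * C -> Prop) : Prop :=
  forall q, U q -> exists2 e : R, 0 < e & forall q', cball q e q' -> U q'.

Definition ccont_on (U : C * C -> Prop) (h : C * C -> C * C) : Prop :=
  forall q, U q -> forall e : R, 0 < e ->
    exists2 d : R, 0 < d & forall q', U q' -> cball q d q' -> cball (h q) e (h q').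

Definition chomeo (U V : C * C -> Prop) (h : C * C -> C * C) : Prop :=
  (forall q, U q -> V (h q)) /\
  exists g : C * C -> C * C,
    [/\ forall q, V q -> U (g q),
        forall q, U q -> g (h q) = q,
        forall q, V q -> h (g q) = q,
        ccont_on U h & ccont_on V g].

Definition top_equiv_germ (X1 : C * C -> Prop) (p1 : C * C)
    (X2 : C * C -> Prop) (p2 : C * C) : Prop :=
  exists U V h, [/\ copen U, copen V, U p1, V p2 & chomeo U V h] /\
    h p1 = p2 /\ forall q, U q -> (X1 q <-> X2 (h q)).

Inductive sing_type := A of nat | E6.

Definition normal_form (s : sing_type) (q : C * C) : C :=
  match s with
  | A n => q.1 ^+ 2 + q.2 ^+ n.+1
  | E6 => q.1 ^+ 3 + q.2 ^+ 4
  end.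

(* points of P^2 are represented by nonzero vectors v : 'I_3 -> C,
   v = (X, Y, Z); L_infty = {Z = 0} *)
Definition nonzero (v : 'I_3 -> C) : Prop := exists j, v j != 0.
Definition proj_eq (v w : 'I_3 -> C) : Prop :=
  exists2 l : C, l != 0 & forall j, v j = l * w j.
Definition i0 : 'I_3 := @Ordinal 3 0 isT.
Definition i1 : 'I_3 := @Ordinal 3 1 isT.
Definition i2 : 'I_3 := @Ordinal 3 2 isT.
Definition on_Linf (v : 'I_3 -> C) : Prop := v i2 = 0.

Definition on_curve (F : {mpoly C[3]}) (v : 'I_3 -> C) : Prop := F.@[v] = 0.
Definition singular_pt (F : {mpoly C[3]}) (v : 'I_3 -> C) : Prop :=
  nonzero v /\ on_curve F v /\ forall j, (mderiv j F).@[v] = 0.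
Definition smooth_pt (F : {mpoly C[3]}) (v : 'I_3 -> C) : Prop :=
  nonzero v /\ on_curve F v /\ ~ singular_pt F v.

Definition chart_emb (i : 'I_3) (q : C * C) : 'I_3 -> C := fun j =>
  nth 0 (match val i with
         | 0 => [:: 1; q.1; q.2]
         | 1 => [:: q.1; 1; q.2]
         | _ => [:: q.1; q.2; 1] end) j.
Definition chart_coord (i : 'I_3) (v : 'I_3 -> C) : C * C :=
  match val i with
  | 0 => (v i1 / v i0, v i2 / v i0)
  | 1 => (v i0 / v i1, v i2 / v i1)
  | _ => (v i0 / v i2, v i1 / v i2)
  end.

Definition has_type (F : {mpoly C[3]}) (v : 'I_3 -> C) (s : sing_type) : Prop :=
  exists2 i : 'I_3, v i != 0 &
    top_equiv_germ (fun q => F.@[chart_emb i q] = 0) (chart_coord i v)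
                   (fun q => normal_form s q = 0) (0, 0).

Definition sing_config (F : {mpoly C[3]}) (l : seq (sing_type * bool)) : Prop :=
  exists ps : nat -> ('I_3 -> C),
    [/\ forall k, (k < size l)%N ->
          [/\ singular_pt F (ps k), has_type F (ps k) (nth (A 0, false) l k).1
            & on_Linf (ps k) <-> (nth (A 0, false) l k).2 = true],
        forall k k', (k < size l)%N -> (k' < size l)%N -> k <> k' ->
          ~ proj_eq (ps k) (ps k')
      & forall v, singular_pt F v -> exists2 k, (k < size l)%N & proj_eq v (ps k)].

(* intersection multiplicity of Q and L_infty at a point v of L_infty:
   order at t = 0 of F(v + t w), w another point of L_infty *)
Definition other_Linf (v : 'I_3 -> C) : 'I_3 -> C := fun j =>
  if v i0 == 0 then (if j == i0 then 1 else 0) else (if j == i1 then 1 else 0).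
Definition imult_Linf (F : {mpoly C[3]}) (v : 'I_3 -> C) : nat :=
  mup 0 ((map_mpoly polyC F).@[fun j => (v j)%:P + (other_Linf v j)%:P * 'X]).

Definition QLpt (F : {mpoly C[3]}) (v : 'I_3 -> C) : Prop :=
  nonzero v /\ on_Linf v /\ on_curve F v.

Definition pos_i (F : {mpoly C[3]}) : Prop :=
  exists p q, [/\ QLpt F p, QLpt F q, ~ proj_eq p q,
    forall v, QLpt F v -> proj_eq v p \/ proj_eq v q &
    [/\ smooth_pt F p, smooth_pt F q, (2 <= imult_Linf F p)%N & (2 <= imult_Linf F q)%N]].
Definition pos_ii (F : {mpoly C[3]}) : Prop :=
  exists p q, [/\ QLpt F p, QLpt F q, ~ proj_eq p q,
    forall v, QLpt F v -> proj_eq v p \/ proj_eq v q &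
    [/\ smooth_pt F p, (2 <= imult_Linf F p)%N & singular_pt F q]].
Definition pos_iv (F : {mpoly C[3]}) : Prop :=
  exists p, [/\ QLpt F p, forall v, QLpt F v -> proj_eq v p,
    smooth_pt F p & imult_Linf F p = 4%N].
Definition pos_v (F : {mpoly C[3]}) : Prop :=
  exists p, [/\ QLpt F p, forall v, QLpt F v -> proj_eq v p,
    singular_pt F p & imult_Linf F p = 4%N].

Definition irreducible_quartic (F : {mpoly C[3]}) : Prop :=
  [/\ F != 0, F \is 4.-homog &
      forall G H : {mpoly C[3]}, F = G * H -> (msize G <= 1)%N \/ (msize H <= 1)%N].

Definition QL_config (F : {mpoly C[3]}) (n : nat) : Prop :=
  match n with
  | 1 => sing_config F [:: (A 2, false); (A 2, false)] /\ pos_i F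
  | 2 => sing_config F [:: (A 2, false); (A 2, false)] /\ pos_iv F
  | 3 => sing_config F [:: (A 2, false); (A 2, false); (A 1, false)] /\ pos_i F
  | 4 => sing_config F [:: (A 2, false); (A 2, false); (A 1, false)] /\ pos_iv F
  | 5 => sing_config F [:: (A 2, false); (A 2, false); (A 2, false)] /\ pos_i F
  | 6 => sing_config F [:: (A 2, false); (A 3, true)] /\ pos_ii F
  | 7 => sing_config F [:: (A 5, false)] /\ pos_i F
  | 8 => sing_config F [:: (A 5, false)] /\ pos_iv F
  | 9 => sing_config F [:: (A 6, true)] /\ pos_ii F
  | 10 => sing_config F [:: (A 4, true); (A 2, false)] /\ pos_v F
  | 11 => sing_config F [:: (E6, false)] /\ pos_i F
  | 12 => sing_config F [:: (E6, false)] /\ pos_iv F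
  | 13 => sing_config F [:: (A 4, false); (A 2, true)] /\ pos_ii F
  | _ => False
  end.

Definition i2_0 : 'I_2 := @Ordinal 2 0 isT.
Definition i2_1 : 'I_2 := @Ordinal 2 1 isT.

Definition dehom (F : {mpoly C[3]}) : {mpoly C[2]} :=
  F \mPo [tuple 'X_i2_0; 'X_i2_1; 1].

Definition mdvd (g p : {mpoly C[2]}) : Prop := exists h, p = g * h.
Definition mcoprime (p q : {mpoly C[2]}) : Prop :=
  forall g, mdvd g p -> mdvd g q -> (msize g <= 1)%N.

(* d = (f2, f3); msize = total degree + 1 *)
Definition torus_dec (f : {mpoly C[2]}) (d : {mpoly C[2]} * {mpoly C[2]}) : Prop :=
  [/\ mcoprime d.1 d.2, (1 < msize d.1 <= 3)%N, (1 < msize d.2 <= 4)%N &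
      exists2 c : C, c != 0 & c *: f = d.1 ^+ 3 + d.2 ^+ 2].

Definition visible (d : {mpoly C[2]} * {mpoly C[2]}) : Prop := (msize d.1 <= 2)%N.

Definition dec_equiv (d d' : {mpoly C[2]} * {mpoly C[2]}) : Prop :=
  exists a b : C, [/\ a != 0, b != 0, d'.1 = a *: d.1 & d'.2 = b *: d.2].

Definition dec_reps (f : {mpoly C[2]}) (N : nat)
    (ds : nat -> {mpoly C[2]} * {mpoly C[2]}) : Prop :=
  [/\ forall k, (k < N)%N -> torus_dec f (ds k),
      forall k k', (k < N)%N -> (k' < N)%N -> k <> k' -> ~ dec_equiv (ds k) (ds k')
    & forall d, torus_dec f d -> exists2 k, (k < N)%N & dec_equiv d (ds k)].

End QL.

(* Main.v *)
Require Import Defs.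
From HB Require Import structures.
From mathcomp Require Import all_boot all_order all_algebra.
From mathcomp Require Import perm cyclic separable cyclotomic.
From mathcomp Require Import classical_sets boolp reals complex mpoly.
From mathcomp Require Import ring lra zify.
Set Implicit Arguments. Unset Strict Implicit. Unset Printing Implicit Defensive.
Import Order.TTheory GRing.Theory Num.Theory.
Local Open Scope ring_scope.

(** Topology: a homeomorphism between the germs [x^2 + y^k = 0] and [x^2 + y^d = 0] lifts to the dihedral
 covers [(u, v) |-> (i (u^k + v^k)/2, u v)] of the punctured ball branched along them, because a punctured
 cube of [C^2] is simply connected and a function vanishing simply on a mirror has a square root there;
 comparing deck groups gives [k = d]. The same lifting for the [S_4]-cover by the roots of a quartic
 polynomial, together with the count of local branches, separates [x^3 + y^4 = 0] from the [A_n].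
 Conversely completing the square up to units, and the inverse function theorem for strictly
 differentiable maps, put double points in normal form, so topological types can be read off equations.

 Algebra: a visible decomposition is an expression [c F = C^2 + Z l^3], and [F] determines [C] once the
 line [l = 0] is known; this line passes through the singular points of the quartic, which gives both
 uniqueness and, by imposing these singular points, existence. An invisible decomposition can be brought
 to [f_2 = -x^2 + y], [f_3 = x^3 - (3/2) x y + mu], whose quartic has cusps at the three points
 [(t, t^2)] with [t^3 = 2 mu]; hence it occurs only in type (5). There barycentric coordinates of the three cusps turn the
 quartic into [(ab + bc + ca)^2 - 4 abc (a + b + c)], whose five decompositions are explicit: one for each
 line through two cusps and one for each primitive cube root of unity. *)

(** A topological type carries no analytic information, so a type is almost never turned back into
    an equation. Coefficients that violate a desired relation put an explicit equation into the form
    [x^2 + y^k] for some [k] from 2 to 6, and the invariance of [k] contradicts the prescribed type.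
    Hence only [A_1] to [A_5] have to be recognised, and [x^3 + y^4] has to be kept apart from these
    exponents only. The exception is a triple point: there type [E_6] forces the tangent cone to be
    a triple line, and type [A_5] is impossible.

    Since homeomorphisms ignore the complex structure, lifts to the covers are built by continuity
    alone: local sections over boxes are glued by means of uniqueness up to the deck group. These
    sections stand in for the local fundamental group.

    The four positions of the line at infinity have one common consequence: the quartic restricts to
    that line as the square of a quadratic form. This supplies the relations between coefficients
    that the singular points leave open, and irreducibility disposes of all degenerate cases. *)

Lemma cballW (R : realType) (p : R[i]*R[i]) (d e : R) q : d <= e -> cball p d q -> cball p e q.
Proof. by move=> de [h1 h2]; split; apply: lt_le_trans de. Qed.

Ltac minle := rewrite ge_min lexx ?orbT.
Tactic Notation "cmin" constr(b) := apply: (cballW _ b); minle.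
Tactic Notation "exmin" constr(a) constr(b) := exists (Num.min a b); first by rewrite lt_min; apply/andP.

(** * Modulus on [C], and continuity relative to a subset of [C^2] *)

Section Basics.
Variable R : realType.
Local Notation C := (R[i]).
Local Notation P := (C*C)%type.
Implicit Types (x y z : C) (p q : P).

Lemma cnorm0 : cnorm (0 : C) = 0. Proof. exact: Normc.normc0. Qed.
Lemma cnorm1 : cnorm (1 : C) = 1. Proof. exact: Normc.normc1. Qed.
Lemma cnormM x y : cnorm (x*y) = cnorm x*cnorm y. Proof. exact: Normc.normcM. Qed.
Lemma cnormV x : cnorm x^-1 = (cnorm x)^-1. Proof. exact: Normc.normcV. Qed.
Lemma cnormN x : cnorm (- x) = cnorm x. Proof. exact: normcN. Qed.
Lemma cnormD x y : cnorm (x + y) <= cnorm x + cnorm y. Proof. exact: le_normcD. Qed.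
Lemma cnorm_eq0 x : cnorm x = 0 -> x = 0. Proof. exact: Normc.eq0_normc. Qed.
Lemma cnorm_ge0 x : 0 <= cnorm x.
Proof. by case: x => a b; rewrite /cnorm /=; apply: sqrtr_ge0. Qed.
Lemma cnorm_gt0 x : x != 0 -> 0 < cnorm x.
Proof.
move=> x0; rewrite lt_def cnorm_ge0 andbT.
by apply: contra x0 => /eqP/cnorm_eq0->.
Qed.
Lemma cnorm_neq0 x : 0 < cnorm x -> x != 0.
Proof. by move=> h; apply/eqP => x0; move: h; rewrite x0 cnorm0 ltxx. Qed.
Lemma cnormX x n : cnorm (x^+n) = cnorm x^+n.
Proof. by elim: n => [|n IH]; rewrite ?expr0 ?cnorm1 // !exprS cnormM IH. Qed.
Lemma cnormBC x y : cnorm (x - y) = cnorm (y - x).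
Proof. by rewrite -cnormN opprB. Qed.
Lemma cnorm_tri y x z : cnorm (x - z) <= cnorm (x - y) + cnorm (y - z).
Proof. by rewrite -[x - z](subrKA y); apply: cnormD. Qed.
Lemma cnormB x y : cnorm (x - y) <= cnorm x + cnorm y.
Proof. by apply: le_trans (cnormD _ _) _; rewrite cnormN. Qed.
Lemma cnorm_sub_ge x y : cnorm x - cnorm y <= cnorm (x - y).
Proof. by rewrite lerBlDr; apply: le_trans (cnormD _ _); rewrite subrK. Qed.
Lemma cnorm_real (r : R) : cnorm (r%:C)%C = `|r|.
Proof. by rewrite /cnorm /= expr0n addr0 sqrtr_sqr. Qed.
Lemma Re_le_cnorm x : `|complex.Re x| <= cnorm x.
Proof.
case: x => a b; rewrite /cnorm /= -sqrtr_sqr; apply: ler_wsqrtr.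
by rewrite lerDl sqr_ge0.
Qed.
Lemma Im_le_cnorm x : `|complex.Im x| <= cnorm x.
Proof.
case: x => a b; rewrite /cnorm /= -sqrtr_sqr; apply: ler_wsqrtr.
by rewrite lerDr sqr_ge0.
Qed.
Lemma cnorm_i : cnorm ('i : C)%C = 1.
Proof. by rewrite /cnorm /= expr0n expr1n add0r sqrtr1. Qed.
Lemma cnorm_le_ReIm x : cnorm x <= `|complex.Re x| + `|complex.Im x|.
Proof.
rewrite {1}[x]complexE; apply: le_trans (cnormD _ _) _.
by rewrite cnormM cnorm_i mul1r !cnorm_real.
Qed.
Lemma cnorm_small_eq0 x : (forall e : R, 0 < e -> cnorm x <= e) -> x = 0.
Proof.
move=> h; apply: cnorm_eq0; apply/eqP; rewrite eq_le cnorm_ge0 andbT.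
by apply/ler_addgt0Pl => e e0; rewrite addr0; apply: h.
Qed.

Lemma cball_refl p (e : R) : 0 < e -> cball p e p.
Proof. by move=> e0; split; rewrite subrr cnorm0. Qed.
Lemma cball_sym p (e : R) q : cball p e q -> cball q e p.
Proof. by move=> [h1 h2]; split; rewrite cnormBC. Qed.
Lemma cball_open p (e : R) : copen (cball p e).
Proof.
move=> q hq; have [h1 h2] := hq.
exists (Num.min (e - cnorm (q.1 - p.1)) (e - cnorm (q.2 - p.2))).
 by rewrite lt_min !subr_gt0 h1 h2.
move=> q' [k1 k2]; split.
 apply: le_lt_trans (cnorm_tri q.1 _ _) _; rewrite -ltrBrDr.
 by apply: lt_le_trans k1 _; minle.
apply: le_lt_trans (cnorm_tri q.2 _ _) _; rewrite -ltrBrDr.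
by apply: lt_le_trans k2 _; minle.
Qed.
Lemma cball_eq p q : (forall e : R, 0 < e -> cball p e q) -> q = p.
Proof.
move=> h; have e1 : q.1 - p.1 = 0 by apply: cnorm_small_eq0 => e e0; apply: ltW; case: (h e e0).
have e2 : q.2 - p.2 = 0 by apply: cnorm_small_eq0 => e e0; apply: ltW; case: (h e e0).
by move: (subr0_eq e1) (subr0_eq e2); case: q {h e1 e2} => a b; case: p => c d /= -> ->.
Qed.
Lemma copenI (U V : P -> Prop) : copen U -> copen V -> copen (fun q => U q /\ V q).
Proof.
move=> oU oV q [uq vq]; have [d d0 hd] := oU q uq; have [e e0 he] := oV q vq.
exmin d e.
move=> q' hq'; split; first by apply: hd; cmin hq'.
by apply: he; cmin hq'.
Qed.

Definition ctn (D : P -> Prop) (f : P -> C) q :=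
 forall e : R, 0 < e -> exists2 d : R, 0 < d &
  forall q', D q' -> cball q d q' -> cnorm (f q' - f q) < e.

Lemma ctnW (D E : P -> Prop) f q : (forall q', E q' -> D q') -> ctn D f q -> ctn E f q.
Proof. by move=> ED h e e0; have [d d0 hd] := h e e0; exists d => // q' /ED; apply: hd. Qed.

Lemma ctn_local (D : P -> Prop) f q (r : R) : 0 < r ->
 ctn (fun q' => D q' /\ cball q r q') f q -> ctn D f q.
Proof.
move=> r0 h e e0; have [d d0 hd] := h e e0; exmin d r.
move=> q' Dq' b; apply: hd; last by cmin b.
by split => //; cmin b.
Qed.

Lemma ctn_ext (D : P -> Prop) f g q : f q = g q -> (forall q', D q' -> f q' = g q') ->
 ctn D f q -> ctn D g q.
Proof.
by move=> e0 e1 h e eg; have [d d0 hd] := h e eg; exists d => // q' Dq' b; rewrite -e1 // -e0; apply: hd.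
Qed.

Lemma ctn_cst D c q : ctn D (fun=> c) q.
Proof. by move=> e e0; exists 1 => // q' _ _; rewrite subrr cnorm0. Qed.
Lemma ctn_fst D q : ctn D fst q.
Proof. by move=> e e0; exists e => // q' _ []. Qed.
Lemma ctn_snd D q : ctn D snd q.
Proof. by move=> e e0; exists e => // q' _ []. Qed.
Lemma ctnD D f g q : ctn D f q -> ctn D g q -> ctn D (fun w => f w + g w) q.
Proof.
move=> hf hg e e0; have e2 : 0 < e/2 by rewrite divr_gt0.
have [d1 d10 h1] := hf _ e2; have [d2 d20 h2] := hg _ e2.
exmin d1 d2.
move=> q' Dq' b; rewrite opprD addrACA; apply: le_lt_trans (cnormD _ _) _.
rewrite [e](splitr e); apply: ltrD.
 by apply: h1 => //; cmin b.
by apply: h2 => //; cmin b.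
Qed.
Lemma ctnN D f q : ctn D f q -> ctn D (fun w => - f w) q.
Proof.
by move=> hf e e0; have [d d0 h] := hf e e0; exists d => // q' Dq' b; rewrite -opprD cnormN; apply: h.
Qed.
Lemma ctnB D f g q : ctn D f q -> ctn D g q -> ctn D (fun w => f w - g w) q.
Proof. by move=> hf hg; apply: ctnD => //; apply: ctnN. Qed.
Lemma ctnM D f g q : ctn D f q -> ctn D g q -> ctn D (fun w => f w*g w) q.
Proof.
move=> hf hg e e0; set M := 1 + cnorm (f q) + cnorm (g q).
have M0 : 0 < M by rewrite /M; have := cnorm_ge0 (f q); have := cnorm_ge0 (g q); lra.
have M1 : 1 <= M by rewrite /M; have := cnorm_ge0 (f q); have := cnorm_ge0 (g q); lra.
set t := Num.min 1 (e/(M*2)).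
have t0 : 0 < t by rewrite lt_min ltr01 divr_gt0 // mulr_gt0.
have t1 : t <= 1 by minle.
have te : t*(M*2) <= e.
 by rewrite -ler_pdivlMr ?mulr_gt0 // ge_min lexx orbT.
have [d1 d10 h1] := hf _ t0; have [d2 d20 h2] := hg _ t0.
exmin d1 d2.
move=> q' Dq' b.
have k1 : cnorm (f q' - f q) < t by apply: h1 => //; cmin b.
have k2 : cnorm (g q' - g q) < t by apply: h2 => //; cmin b.
have -> : f q'*g q' - f q*g q =
 (f q' - f q)*(g q' - g q) + ((f q' - f q)*g q + f q*(g q' - g q)) by ring.
apply: le_lt_trans (cnormD _ _) _.
have := cnormD ((f q' - f q)*g q) (f q*(g q' - g q)).
rewrite !cnormM.
move: (cnorm_ge0 (f q)) (cnorm_ge0 (g q)) (cnorm_ge0 (f q' - f q)) (cnorm_ge0 (g q' - g q)).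
move: k1 k2 te M0 M1; rewrite /M.
move: (cnorm (f q)) (cnorm (g q)) (cnorm (f q' - f q)) (cnorm (g q' - g q)) => a c x y.
move=> k1 k2 te _ _ a0 c0 x0 y0 hh.
have : x*y <= t*1 by apply: ler_pM => //; apply: ltW => //; apply: lt_le_trans t1.
have : x*c <= t*c by apply: ler_wpM2r => //; apply: ltW.
have : a*y <= a*t by apply: ler_wpM2l => //; apply: ltW.
nra.
Qed.
Lemma ctnX D f q n : ctn D f q -> ctn D (fun w => f w^+n) q.
Proof.
move=> hf; elim: n => [|n IH]; first exact: ctn_cst.
apply: (@ctn_ext D (fun w => f w*f w^+n)); rewrite ?exprS //; first by move=> q' _; rewrite exprS.
exact: ctnM.
Qed.
Lemma ctnV D f q : f q != 0 -> ctn D f q -> ctn D (fun w => (f w)^-1) q.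
Proof.
move=> fq hf e e0; set a := cnorm (f q); have a0 : 0 < a by apply: cnorm_gt0.
set t := Num.min (a/2) (e*a*a/2).
have t0 : 0 < t by rewrite lt_min !divr_gt0 ?mulr_gt0.
have [d d0 h] := hf _ t0; exists d => // q' Dq' b; have k := h q' Dq' b.
have ta : t <= a/2 by minle.
have te : t <= e*a*a/2 by minle.
have b0 : a/2 < cnorm (f q').
 have := cnorm_sub_ge (f q) (f q'); rewrite cnormBC -/a; lra.
have fq' : f q' != 0 by apply: cnorm_neq0; apply: lt_trans b0; rewrite divr_gt0.
have -> : (f q')^-1 - (f q)^-1 = (f q - f q')/(f q'*f q) by field; rewrite fq fq'.
rewrite cnormM cnormV cnormM cnormBC ltr_pdivrMr; last first.
 by apply: mulr_gt0 => //; apply: lt_trans b0; rewrite divr_gt0.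
apply: lt_le_trans k _; apply: le_trans te _.
have h2 : a/2*a <= cnorm (f q')*a by apply: ler_wpM2r; apply: ltW.
by have := ler_wpM2l (ltW e0) h2; rewrite -/a; lra.
Qed.
Lemma ctn_comp (D E : P -> Prop) (f : P -> C) (h1 h2 : P -> C) q :
 ctn E f (h1 q, h2 q) -> ctn D h1 q -> ctn D h2 q -> (forall q', D q' -> E (h1 q', h2 q')) ->
 ctn D (fun w => f (h1 w, h2 w)) q.
Proof.
move=> hf c1 c2 DE e e0; have [d d0 hd] := hf e e0.
have [d1 d10 k1] := c1 _ d0; have [d2 d20 k2] := c2 _ d0.
exmin d1 d2.
move=> q' Dq' b; apply: hd; first exact: DE.
split => /=; first by apply: k1 => //; cmin b.
by apply: k2 => //; cmin b.
Qed.

Lemma ctn_neq0 D f q : ctn D f q -> f q != 0 ->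
 exists2 d : R, 0 < d & forall q', D q' -> cball q d q' -> f q' != 0.
Proof.
move=> hf fq; have [d d0 hd] := hf _ (cnorm_gt0 fq); exists d => // q' Dq' b.
have := hd q' Dq' b; apply: contraTneq => ->; rewrite sub0r cnormN -leNgt //.
Qed.

Lemma ccont_ctn (U : P -> Prop) (h : P -> P) :
 ccont_on U h <-> forall q, U q -> ctn U (fun w => (h w).1) q /\ ctn U (fun w => (h w).2) q.
Proof.
split=> [H q Uq|H q Uq e e0].
 by split=> e e0; have [d d0 hd] := H q Uq e e0; exists d => // q' Uq' b; case: (hd q' Uq' b).
have [h1 h2] := H q Uq; have [d1 d10 k1] := h1 e e0; have [d2 d20 k2] := h2 e e0.
exmin d1 d2.
move=> q' Uq' b; split; first by apply: k1 => //; cmin b.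
by apply: k2 => //; cmin b.
Qed.

Lemma ctn_comp2 (D E : P -> Prop) (f : P -> C) (h : P -> P) q :
 ctn E f (h q) -> ctn D (fun w => (h w).1) q -> ctn D (fun w => (h w).2) q ->
 (forall q', D q' -> E (h q')) -> ctn D (fun w => f (h w)) q.
Proof.
move=> hf c1 c2 DE; apply: (@ctn_ext D (fun w => f ((h w).1, (h w).2))); first by rewrite -surjective_pairing.
 by move=> q' _; rewrite -surjective_pairing.
apply: (ctn_comp (E := E)) => //; first by rewrite -surjective_pairing.
by move=> q' Dq'; rewrite -surjective_pairing; apply: DE.
Qed.

(** * Germs *)

(** The inverse is named because both directions of an equivalence are lifted to covers later. *)
Definition heo (U V : P -> Prop) (h g : P -> P) :=
 [/\ forall q, U q -> V (h q), forall q, V q -> U (g q),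
   forall q, U q -> g (h q) = q, forall q, V q -> h (g q) = q & (ccont_on U h /\ ccont_on V g)].

Lemma top_equivP (X1 : P -> Prop) p1 X2 p2 : top_equiv_germ X1 p1 X2 p2 <->
 exists U V h g, [/\ copen U, copen V, U p1, V p2 & heo U V h g] /\
  h p1 = p2 /\ forall q, U q -> (X1 q <-> X2 (h q)).
Proof.
split=> [[U [V [h [[oU oV U1 V2 [hUV [g [gVU gh hg ch cg]]]] [e HX]]]]]|
  [U [V [h [g [[oU oV U1 V2 [hUV gVU gh hg [ch cg]]] [e HX]]]]]]].
 by exists U, V, h, g.
by exists U, V, h; split => //; split => //; split => //; exists g.
Qed.

Lemma top_equiv_sym (X1 : P -> Prop) p1 X2 p2 :
 top_equiv_germ X1 p1 X2 p2 -> top_equiv_germ X2 p2 X1 p1.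
Proof.
move=> /top_equivP[U [V [h [g [[oU oV U1 V2 [hUV gVU gh hg [ch cg]]] [e HX]]]]]].
apply/top_equivP; exists V, U, g, h; split => //; split; first by rewrite -e gh.
by move=> q Vq; rewrite HX ?hg //; apply: gVU.
Qed.

Lemma ccont_preim_open (U V W : P -> Prop) h : copen U -> copen W -> ccont_on U h ->
 copen (fun q => U q /\ W (h q)).
Proof.
move=> oU oW ch q [Uq Wq]; have [e e0 he] := oW _ Wq; have [d d0 hd] := ch q Uq e e0.
have [c c0 hc] := oU _ Uq; exmin c d.
move=> q' b; have Uq' : U q' by apply: hc; cmin b.
by split => //; apply: he; apply: hd => //; cmin b.
Qed.

Lemma ccontW (U V : P -> Prop) h : (forall q, V q -> U q) -> ccont_on U h -> ccont_on V h.
Proof.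
move=> VU ch q Vq e e0; have [d d0 hd] := ch q (VU q Vq) e e0.
by exists d => // q' /VU; apply: hd.
Qed.

Lemma ccont_comp (U V : P -> Prop) h1 h2 : (forall q, U q -> V (h1 q)) ->
 ccont_on U h1 -> ccont_on V h2 -> ccont_on U (fun q => h2 (h1 q)).
Proof.
move=> UV c1 c2 q Uq e e0; have [d d0 hd] := c2 _ (UV q Uq) e e0.
have [c c0 hc] := c1 q Uq d d0; exists c => // q' Uq' b; apply: hd; first exact: UV.
exact: hc.
Qed.

Lemma top_equiv_trans (X1 : P -> Prop) p1 X2 p2 X3 p3 :
 top_equiv_germ X1 p1 X2 p2 -> top_equiv_germ X2 p2 X3 p3 -> top_equiv_germ X1 p1 X3 p3.
Proof.
move=> /top_equivP[U1 [V1 [h1 [g1 [[oU1 oV1 U1p V1p [hUV1 gVU1 gh1 hg1 [ch1 cg1]]] [e1 HX1]]]]]].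
move=> /top_equivP[U2 [V2 [h2 [g2 [[oU2 oV2 U2p V2p [hUV2 gVU2 gh2 hg2 [ch2 cg2]]] [e2 HX2]]]]]].
apply/top_equivP; exists (fun q => U1 q /\ U2 (h1 q)), (fun q => V2 q /\ V1 (g2 q)).
exists (fun q => h2 (h1 q)), (fun q => g1 (g2 q)); split.
 split.
 - exact: ccont_preim_open.
 - exact: ccont_preim_open.
 - by rewrite e1.
 - by split => //; rewrite -e2 gh2.
 split.
 - by move=> q [uq vq]; split; [exact: hUV2|rewrite gh2 //; exact: hUV1].
 - by move=> q [uq vq]; split; [exact: gVU1|rewrite hg1 //; exact: gVU2].
 - by move=> q [uq vq]; rewrite gh2 // gh1.
 - by move=> q [uq vq]; rewrite hg1 // hg2.
 split.
  apply: (ccont_comp (V := U2)) => //; first by move=> q [].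
  by apply: ccontW ch1 => q [].
 apply: (ccont_comp (V := V1)) => //; first by move=> q [].
 by apply: ccontW cg2 => q [].
split; first by rewrite e1.
by move=> q [uq vq]; rewrite HX1 // HX2.
Qed.

Lemma top_equiv_ext (X1 X1' : P -> Prop) p1 X2 p2 : (forall q, X1 q <-> X1' q) ->
 top_equiv_germ X1 p1 X2 p2 -> top_equiv_germ X1' p1 X2 p2.
Proof.
move=> e [U [V [h [H1 [H2 H3]]]]]; exists U, V, h; split => //; split => // q Uq.
by rewrite -e; apply: H3.
Qed.

End Basics.

Ltac ctnauto := repeat match goal with
| |- ctn _ (fun _ => ?c) _ => exact: ctn_cst
| |- ctn _ fst _ => exact: ctn_fst
| |- ctn _ snd _ => exact: ctn_snd
| |- ctn _ (fun q => fst q) _ => exact: ctn_fst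
| |- ctn _ (fun q => snd q) _ => exact: ctn_snd
| |- ctn _ (fun q => (- @?f q)%R) _ => refine (@ctnN _ _ f _ _)
| |- ctn _ (fun q => (@?f q + @?g q)%R) _ => refine (@ctnD _ _ f g _ _ _)
| |- ctn _ (fun q => (@?f q * @?g q)%R) _ => refine (@ctnM _ _ f g _ _ _)
| |- ctn _ (fun q => (@?f q ^+ ?n)%R) _ => refine (@ctnX _ _ f _ n _) end.

(** * Boxes in the real coordinates of [C^2] *)
Section Boxes.
Variable R : realType.
Local Notation C := (R[i]).
Local Notation P := (C*C)%type.
Implicit Types (p q : P) (lo hi : 'I_4 -> R).

Lemma fin_delta (T : finType) (Q : T -> R -> Prop) :
 (forall t d e, d <= e -> Q t e -> Q t d) -> (forall t, exists2 d, 0 < d & Q t d) ->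
 exists2 d, 0 < d & forall t, Q t d.
Proof.
move=> mono H; have /choice[f hf] : forall t, exists d, 0 < d /\ Q t d by move=> t; have [d] := H t; exists d.
exists (\big[Num.min/1]_t f t).
 by elim/big_ind: _ => [//|x y x0 y0|t _]; [rewrite lt_min x0|case: (hf t)].
by move=> t; have [_ ht] := hf t; apply: mono ht; rewrite (bigD1 t) //= ge_min lexx.
Qed.

(** Connectedness of an interval. If [Q a] failed, let [c] be the supremum of the initial stretch on
    which [Q] fails; the truth value is constant near [c], so the stretch would extend beyond
    [c]. *)
Lemma interval_const (Q : R -> Prop) (a b : R) : a <= b ->
 (forall t, a <= t <= b -> exists2 d, 0 < d &
   forall t', a <= t' <= b -> `|t' - t| < d -> (Q t' <-> Q t)) ->
 Q b -> Q a.
Proof.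
move=> ab loc Qb; apply: contrapT => nQa.
pose S := [set t | a <= t <= b /\ forall t', a <= t' <= t -> ~ Q t']%classic.
have Sa : S a by rewrite /S /= lexx ab; split => // t' /andP[h1 h2]; have -> : t' = a by apply/eqP; rewrite eq_le h1 h2.
have ubS : ubound S b by move=> t [/andP[]].
have supS : has_sup S by split; [exists a|exists b].
set c := sup S.
have ac : a <= c by apply: ub_le_sup => //; exists b.
have cb : c <= b by apply: ge_sup => //; exists a.
have [d d0 hd] := loc c (introT andP (conj ac cb)).
have [t [tab St] tc] := sup_adherent d0 supS.
have tle : t <= c by apply: ub_le_sup => //; exists b.
have nQc : ~ Q c.
 move=> Qc; apply: (St t); first by rewrite lexx andbT; case/andP: tab.
 by apply/(hd t) => //; rewrite -/c in tc; rewrite ltr_norml; apply/andP; split; lra.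
have bc : c < b by rewrite lt_neqAle cb andbT; apply/eqP => e; apply: nQc; rewrite e.
pose u := Num.min b (c + d/2).
have cu : c < u by rewrite lt_min bc; lra.
have ub_ : u <= b by minle.
have ud : u <= c + d/2 by minle.
have : S u.
 split; first by rewrite (le_trans ac (ltW cu)) ub_.
 move=> t' /andP[h1 h2] Qt'; case: (leP t' t) => tt; first by apply: (St t') => //; rewrite h1.
 apply: nQc; apply/(hd t') => //; first by rewrite h1 (le_trans h2).
 by rewrite -/c in tc; rewrite ltr_norml; apply/andP; split; lra.
by move=> /(ub_le_sup (ex_intro _ b ubS)); rewrite -/c => /(lt_le_trans cu); rewrite ltxx.
Qed.

Definition cx (j : 'I_4) q : R :=
 match val j with
 | 0 => complex.Re q.1 | 1 => complex.Im q.1 | 2 => complex.Re q.2 | _ => complex.Im q.2 end.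

Definition pt4 (f : 'I_4 -> R) : P :=
 ((f (inord 0) +i* f (inord 1))%C, (f (inord 2) +i* f (inord 3))%C).

Lemma ord4 (Q : 'I_4 -> Prop) : Q (inord 0) -> Q (inord 1) -> Q (inord 2) -> Q (inord 3) -> forall j, Q j.
Proof.
move=> q0 q1 q2 q3 [[|[|[|[|//]]]] h].
- by have -> : Ordinal h = inord 0 by apply: val_inj; rewrite /= inordK.
- by have -> : Ordinal h = inord 1 by apply: val_inj; rewrite /= inordK.
- by have -> : Ordinal h = inord 2 by apply: val_inj; rewrite /= inordK.
- by have -> : Ordinal h = inord 3 by apply: val_inj; rewrite /= inordK.
Qed.

Lemma cxE q : (cx (inord 0) q = complex.Re q.1)*(cx (inord 1) q = complex.Im q.1) *
 ((cx (inord 2) q = complex.Re q.2)*(cx (inord 3) q = complex.Im q.2)).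
Proof. by rewrite /cx /= !inordK. Qed.

Lemma cx_pt4 f j : cx j (pt4 f) = f j.
Proof. by elim/ord4: j; rewrite /cx /= inordK. Qed.

Lemma cx_ball q d q' j : cball q d q' -> `|cx j q' - cx j q| < d.
Proof.
case: q q' => [[a b] [c e]] [[a' b'] [c' e']] [h1 h2].
by elim/ord4: j; rewrite !cxE /=;
 [apply: le_lt_trans (Re_le_cnorm _) h1|apply: le_lt_trans (Im_le_cnorm _) h1
 |apply: le_lt_trans (Re_le_cnorm _) h2|apply: le_lt_trans (Im_le_cnorm _) h2].
Qed.

Lemma ball_cx q d q' : (forall j, `|cx j q' - cx j q| < d/2) -> cball q d q'.
Proof.
move=> h; have h0 := h (inord 0); have h1 := h (inord 1); have h2 := h (inord 2); have h3 := h (inord 3).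
move: h0 h1 h2 h3; rewrite !cxE /= {h}.
case: q q' => [[a b] [c e]] [[a' b'] [c' e']] /= h0 h1 h2 h3.
by split; apply: le_lt_trans (cnorm_le_ReIm _) _; rewrite /= [d]splitr ltrD.
Qed.

Definition seg p q (t : R) : P :=
 ((1 - t)%:C%C * p.1 + t%:C%C*q.1, (1 - t)%:C%C * p.2 + t%:C%C*q.2).

Lemma cx_seg p q t j : cx j (seg p q t) = (1 - t)*cx j p + t*cx j q.
Proof.
case: p q => [[a b] [c d]] [[a' b'] [c' d']].
by elim/ord4: j; rewrite !cxE /=; ring.
Qed.
Lemma seg0 p q : seg p q 0 = p.
Proof. by case: p => a b; rewrite /seg /= subr0 !mul1r !mul0r !addr0. Qed.
Lemma seg1 p q : seg p q 1 = q.
Proof. by case: q => a b; rewrite /seg /= subrr !mul1r !mul0r !add0r. Qed.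

Lemma ctn_seg (D : P -> Prop) p q t (f : P -> C) (a b : R) : a <= t <= b ->
 ctn D f (seg p q t) -> (forall t', a <= t' <= b -> D (seg p q t')) ->
 forall e, 0 < e -> exists2 d, 0 < d &
  forall t', a <= t' <= b -> `|t' - t| < d -> cnorm (f (seg p q t') - f (seg p q t)) < e.
Proof.
move=> tab cf hD e e0; have [d d0 hd] := cf e e0.
pose M := 1 + cnorm (q.1 - p.1) + cnorm (q.2 - p.2).
have M1 : 1 <= M by rewrite /M; have := cnorm_ge0 (q.1 - p.1); have := cnorm_ge0 (q.2 - p.2); lra.
have M0 : 0 < M by apply: lt_le_trans M1.
exists (d/M); first by rewrite divr_gt0.
move=> t' t'ab ht; apply: hd; first exact: hD.
move: ht; rewrite ltr_pdivlMr // => ht.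
have E x y : (1 - t')%:C%C*x + t'%:C%C*y - ((1 - t)%:C%C*x + t%:C%C*y)
  = (t' - t)%:C%C*(y - x) :> C.
 by rewrite !rmorphB; ring.
split; rewrite /seg /= E cnormM cnorm_real; apply: le_lt_trans ht; apply: ler_wpM2l => //.
 by rewrite /M; have := cnorm_ge0 (q.2 - p.2); lra.
by rewrite /M; have := cnorm_ge0 (q.1 - p.1); lra.
Qed.

Definition convex (N : P -> Prop) :=
 forall p q t, N p -> N q -> 0 <= t <= 1 -> N (seg p q t).
Definition fat (N : P -> Prop) := exists c : P, exists2 r : R, 0 < r & forall q, cball c r q -> N q.

Definition box lo hi q := forall j, lo j <= cx j q <= hi j.

Lemma box_convex lo hi : convex (box lo hi).
Proof.
move=> p q t hp hq /andP[t0 t1] j; rewrite cx_seg.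
have /andP[a1 a2] := hp j; have /andP[b1 b2] := hq j.
have t1' : 0 <= 1 - t by lra.
have := ler_wpM2l t1' a1; have := ler_wpM2l t1' a2; have := ler_wpM2l t0 b1; have := ler_wpM2l t0 b2.
by move=> *; apply/andP; split; lra.
Qed.
Lemma box_fat lo hi : (forall j, lo j < hi j) -> fat (box lo hi).
Proof.
move=> lh; exists (pt4 (fun j => (lo j + hi j)/2)).
have [||d d0 hd] := @fin_delta 'I_4 (fun j d => d <= (hi j - lo j)/2).
- by move=> t d e de; apply: le_trans.
- by move=> t; exists ((hi t - lo t)/2) => //; have := lh t; lra.
exists d => // q hq j; have := cx_ball j hq; rewrite cx_pt4 ltr_norml => /andP[h1 h2].
by have := hd j; move=> h3; apply/andP; split; lra.
Qed.

Definition upd (f : 'I_4 -> R) j a := fun i => if i == j then a else f i.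

Lemma geom_small (M d : R) : 0 < d -> exists n, (2/3)^+n*M < d.
Proof.
move=> d0; have [M0|M0] := leP M 0; first by exists 0; rewrite expr0 mul1r; apply: le_lt_trans d0.
have B n : 1 + n%:R/2 <= (3/2 : R)^+n.
 elim: n => [|n IH]; first by rewrite expr0 mul0r addr0.
 by rewrite exprS -natr1; have := ler_wpM2l (_ : 0 <= 3/2) IH; have : 0 <= n%:R :> R by []; lra.
have x0 : 0 <= 2*M/d by rewrite divr_ge0 ?mulr_ge0 // ltW.
have := archi_boundP x0; set n := Num.bound _ => hn; exists n.
have -> : (2/3 : R) = (3/2)^-1 by field.
rewrite exprVn mulrC ltr_pdivrMr; last by apply: exprn_gt0; lra.
have := ler_wpM2l (ltW d0) (B n); move: hn; rewrite ltr_pdivrMr // => h1 h2.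
by apply: lt_le_trans h2; lra.
Qed.

(** Compactness of a box in the form needed for gluing. The pieces are two thirds of a side rather
    than halves, so that two neighbouring pieces overlap in a box with interior, on which sections
    can be compared. *)
Lemma bisection (Good : ('I_4 -> R) -> ('I_4 -> R) -> Prop) lo0 hi0 :
 (forall j, lo0 j < hi0 j) ->
 (forall lo hi j, (forall i, lo i < hi i) -> (forall q, box lo hi q -> box lo0 hi0 q) ->
   Good lo (upd hi j ((lo j + 2*hi j)/3)) -> Good (upd lo j ((2 * lo j + hi j)/3)) hi ->
   Good lo hi) ->
 (forall q, box lo0 hi0 q -> exists2 d, 0 < d & forall lo hi, (forall i, lo i < hi i) ->
   (forall q', box lo hi q' -> box lo0 hi0 q' /\ cball q d q') -> Good lo hi) ->
 Good lo0 hi0.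
Proof.
move=> lh0 split_ loc; apply: contrapT => bad0.
pose BT := (('I_4 -> R)*('I_4 -> R))%type.
(* A bad box has a bad piece among its two pieces in direction [j]; passing to it shortens that side
   by the factor 2/3. *)
pose step (j : 'I_4) (B : BT) : BT :=
 if `[< Good B.1 (upd B.2 j ((B.1 j + 2*B.2 j)/3)) >]
 then (upd B.1 j ((2*B.1 j + B.2 j)/3), B.2) else (B.1, upd B.2 j ((B.1 j + 2*B.2 j)/3)).
pose ok (B : BT) := [/\ ~ Good B.1 B.2, forall i, B.1 i < B.2 i & forall i, lo0 i <= B.1 i /\ B.2 i <= hi0 i].
pose nest (B B' : BT) := forall i, B.1 i <= B'.1 i /\ B'.2 i <= B.2 i.
have okstep j B : ok B -> ok (step j B) /\ nest B (step j B) /\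
  (forall i, (step j B).2 i - (step j B).1 i = (if i == j then 2/3 else 1)*(B.2 i - B.1 i)).
 move=> [nG lh sub].
 have key i : (2*B.1 i + B.2 i)/3 > B.1 i /\ (2*B.1 i + B.2 i)/3 < B.2 i
   /\ (B.1 i + 2*B.2 i)/3 < B.2 i /\ (B.1 i + 2*B.2 i)/3 > B.1 i.
  by have := lh i; split; [|split; [|split]]; lra.
 have subq q : box B.1 B.2 q -> box lo0 hi0 q.
  by move=> hq i; have /andP[h1 h2] := hq i; have [h3 h4] := sub i; apply/andP; split; lra.
 rewrite /step; case: asboolP => G1; split; first split => /=.
 - by move=> G2; apply: nG; apply: split_ G1 G2.
 - by move=> i; rewrite /upd; case: eqP => [->|_]; [case: (key j) => _ []|exact: lh].
 - by move=> i; rewrite /upd; have [s1 s2] := sub i; case: eqP => [->|_]; split => //;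
   have := key j; have := sub j; lra.
 - split=> i /=; rewrite /upd; first by case: eqP => [->|//]; have := key j; lra.
  by case: eqP => [->|]; [field|rewrite mul1r].
 - split => /=; first by [].

 - by move=> i; rewrite /upd; case: eqP => [->|_]; [have := key j; lra|exact: lh].
 - by move=> i; rewrite /upd; have [s1 s2] := sub i; case: eqP => [->|_]; split => //;
   have := key j; have := sub j; lra.
 - split=> i /=; rewrite /upd; first by case: eqP => [->|//]; have := key j; lra.
  by case: eqP => [->|]; [field|rewrite mul1r].
pose step4 B := step (inord 3) (step (inord 2) (step (inord 1) (step (inord 0) B))).
have nest_trans B1 B2 B3 : nest B1 B2 -> nest B2 B3 -> nest B1 B3.
 by move=> h1 h2 i; have := h1 i; have := h2 i; lra.
have ok4 B : ok B -> ok (step4 B) /\ nest B (step4 B) /\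
  (forall i, (step4 B).2 i - (step4 B).1 i = 2/3*(B.2 i - B.1 i)).
 move=> o0; have [o1 [n1 w1]] := okstep (inord 0) _ o0.
 have [o2 [n2 w2]] := okstep (inord 1) _ o1; have [o3 [n3 w3]] := okstep (inord 2) _ o2.
 have [o4 [n4 w4]] := okstep (inord 3) _ o3; split => //; split.
  exact: (nest_trans _ _ _ (nest_trans _ _ _ (nest_trans _ _ _ n1 n2) n3) n4).
 move=> i; rewrite /step4 w4 w3 w2 w1; elim/ord4: i; rewrite -!val_eqE /= !inordK //=; ring.
pose S n := iter n step4 (lo0, hi0).
have okS n : ok (S n).
 by elim: n => [|n IH]; [split => //= i; split|rewrite /S iterS; case: (ok4 _ IH)].
have nestS n m : (n <= m)%N -> nest (S n) (S m).
 elim: m => [|m IH]; first by rewrite leqn0 => /eqP->; move=> i; split.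
 rewrite leq_eqVlt => /orP[/eqP->|/IH h]; first by move=> i; split.
 by apply: (nest_trans _ _ _ h); rewrite /S iterS; case: (ok4 _ (okS m)) => _ [].
have widS n i : (S n).2 i - (S n).1 i = (2/3)^+n*(hi0 i - lo0 i).
 elim: n => [|n IH]; first by rewrite mul1r.
 by rewrite /S iterS; case: (ok4 _ (okS n)) => _ [_ ->]; rewrite IH exprS mulrA.
pose A i := [set (S n).1 i | n in setT]%classic.
have ubA n i : ubound (A i) ((S n).2 i).
 move=> _ [m _ <-]; case: (leqP n m) => h.
  have [_ lt _] := okS m; have [_ h2] := nestS _ _ h i; have := lt i; lra.
 have [_ lt _] := okS n; have [h2 _] := nestS _ _ (ltnW h) i; have := lt i; lra.
pose q := pt4 (fun i => sup (A i)).
have inq n i : (S n).1 i <= cx i q <= (S n).2 i.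
 rewrite cx_pt4; apply/andP; split.
  by apply: ub_le_sup; [exists ((S n).2 i)|exists n].
 by apply: ge_sup; [exists ((S n).1 i), n|].
have [d d0 hd] := loc q (inq 0).
have [M hM] : exists M, forall i, hi0 i - lo0 i <= M.
 exists (\sum_i (hi0 i - lo0 i)) => i; rewrite (bigD1 i) //= lerDl sumr_ge0 // => k _.
 by rewrite subr_ge0 ltW.
have [n hn] := @geom_small M (d/2) (divr_gt0 d0 (ltr0Sn _ 1)).
have [nG lt sub] := okS n; apply: nG; apply: hd => // q' hq'; split.
 by move=> i; have /andP[h1 h2] := hq' i; have [h3 h4] := sub i; apply/andP; split; lra.
apply: ball_cx => i; have /andP[h1 h2] := hq' i; have /andP[h3 h4] := inq n i.
have w := widS n i; have := ler_wpM2l (exprn_ge0 n (_ : 0 <= 2/3 :> R)) (hM i).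
by move=> /(_ ltac:(lra)) h5; rewrite ltr_norml; apply/andP; split; lra.
Qed.

End Boxes.

(** * Sections of a branched cover *)
Section Sections.
Variable R : realType.
Local Notation C := (R[i]).
Local Notation P := (C*C)%type.
Implicit Types (p q : P) (lo hi : 'I_4 -> R).

Lemma nonroot_near (p : {poly R}) (d : R) : 0 < d -> p != 0 ->
 exists2 t, 0 < t < d & p.[t] != 0.
Proof.
move=> d0 p0; pose rs := [seq d/i.+2%:R | i <- iota 0 (size p)].
have urs : uniq rs.
 rewrite map_inj_uniq ?iota_uniq // => i j /(mulfI (lt0r_neq0 d0)) /invr_inj /eqP.
 by rewrite eqr_nat => /eqP [].
have /allPn[t ht nt] : ~~ all (root p) rs.
 by apply/negP => h; have := max_poly_roots p0 h urs; rewrite size_map size_iota ltnn.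
exists t => //; case/mapP: ht => i _ ->; rewrite divr_gt0 ?ltr0n //= ltr_pdivrMr ?ltr0n //.
by rewrite -[ltLHS]mulr1 ltr_pM2l // ltr1n.
Qed.

Definition lform (z : C) q : C := q.1 - z*q.2.
Definition bad (ls : seq C) q := has (fun z => lform z q == 0) ls.

Lemma lform_seg z p q t : lform z (seg p q t) = (1 - t)%:C%C * lform z p + t%:C%C * lform z q.
Proof. by rewrite /lform /seg /=; ring. Qed.

(** A complex line has real codimension two, so it is missed by the segments from a given point to
    almost every endpoint. The endpoint moves along [t + i t^2], an arc lying on no real line, which
    makes each obstruction a nonzero polynomial in [t]. *)
Lemma generic_point (ls : seq C) (ps : seq P) c (r : R) : 0 < r ->
 exists2 c', cball c r c' & forall p t, p \in ps -> 0 < t <= 1 -> ~~ bad ls (seg p c' t).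
Proof.
move=> r0.
(* If the form takes the value [a != 0] at [p], it can vanish on the segment only if its value at
   the endpoint is a real multiple of [a]; the imaginary part of the quotient detects this. If
   [a = 0], a nonzero real part at the endpoint suffices. *)
pose pol z p : {poly R} :=
 let a := lform z p in let b := lform z c in
 if a == 0 then (complex.Re b)%:P + 'X
 else (complex.Im (b/a))%:P + (complex.Im a^-1) *: 'X + (complex.Re a^-1) *: 'X^2.
have pol0 z p : pol z p != 0.
 rewrite /pol; case: ifPn => [_|a0]; apply/eqP => /polyP E.
  by have := E 1; rewrite !coefE /= add0r => /eqP; rewrite oner_eq0.
 have E1 := E 1; have E2 := E 2; move: E1 E2; rewrite !coefE /= !mulr1 !mulr0 !addr0 !add0r => h1 h2.
 by move: (invr_neq0 a0); rewrite eq_complex /= h1 h2 eqxx.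
have prod0 : \prod_(z <- ls) \prod_(p <- ps) pol z p != 0.
 by rewrite prodf_seq_neq0; apply/allP => z _ /=; rewrite prodf_seq_neq0; apply/allP => p _ /=.
have d0 : 0 < Num.min 1 (r/2) by rewrite lt_min ltr01 divr_gt0.
have [t /andP[t0 t1] nt] := nonroot_near d0 prod0.
have {}nt z p : z \in ls -> p \in ps -> (pol z p).[t] != 0.
 move=> zl pps; move: nt; rewrite horner_prod prodf_seq_neq0 => /allP/(_ z zl) /=.
 by rewrite horner_prod prodf_seq_neq0 => /allP/(_ p pps).
pose w : C := (t +i* t^+2)%C.
exists (c.1 + w, c.2).
 split => /=; last by rewrite subrr cnorm0.
 have -> : c.1 + w - c.1 = w by ring.
 apply: le_lt_trans (cnorm_le_ReIm _) _ => /=; rewrite normrX gtr0_norm //.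
 move: t1; rewrite lt_min => /andP[t1 t2].
 have : t^+2 <= t by rewrite expr2 -[leRHS]mulr1 ler_wpM2l // ltW.
 lra.
move=> p s pps /andP[s0 s1]; apply/hasPn => z zl; rewrite lform_seg.
have -> : lform z (c.1 + w, c.2) = lform z c + w by rewrite /lform /=; ring.
have := nt z p zl pps; rewrite /pol; case: ifPn => [/eqP->|a0].
 rewrite mulr0 add0r !hornerE => h; rewrite mulf_eq0 negb_or; apply/andP; split.
  by apply/eqP => /complexI E; move: s0; rewrite E ltxx.
 apply: contraNneq h => E; have := congr1 (@complex.Re R) E; case: (lform z c) => a b /= ->.
 by [].
rewrite !hornerE => h; apply: contraNneq h => E.
have := congr1 (fun x => complex.Im (x/lform z p)) E; rewrite mul0r /=.
have -> : ((1 - s)%:C%C * lform z p + s%:C%C*(lform z c + w))/lform z p =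
  (1 - s)%:C%C + s%:C%C*(lform z c/lform z p + w*(lform z p)^-1) by field.
case: (lform z c/lform z p) => e f; case: (lform z p)^-1 => g h.
rewrite /w /=; move=> E2; have s0' : s != 0 by rewrite gt_eqF.
apply/eqP; apply: (mulfI s0'); rewrite mulr0 -{}E2; ring.
Qed.

Local Notation Y := ('I_4 -> C).

(** [Rel q] is the fibre over [q] of a branched cover, written in [C^4] with the finite group [G] acting
 by monomial matrices; it is a torsor under [G] off the complex lines [ls] through the origin. *)
Section Torsor.
Variables (ls : seq C) (G : finType) (ai : G -> 'I_4 -> 'I_4) (am : G -> 'I_4 -> C) (e : G).
Variables (Dom : P -> Prop) (Rel : P -> Y -> Prop).

Definition act g (y : Y) : Y := fun j => am g j*y (ai g j).

Hypothesis act1 : forall y, act e y =1 y.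
Hypothesis relE : forall q y y', y =1 y' -> Rel q y -> Rel q y'.
Hypothesis relA : forall q y g, Rel q y -> Rel q (act g y).
Hypothesis relT : forall q y y', Dom q -> ~~ bad ls q -> Rel q y -> Rel q y' ->
 exists g, y' =1 act g y.
Hypothesis relF : forall q y g g', Dom q -> ~~ bad ls q -> Rel q y -> act g y =1 act g' y -> g = g'.

Definition Sec (N : P -> Prop) (s : P -> Y) :=
 (forall q, N q -> Rel q (s q)) /\ forall q j, N q -> ctn N (fun w => s w j) q.

Lemma Sec_act N s g : Sec N s -> Sec N (fun q => act g (s q)).
Proof.
move=> [h1 h2]; split=> [q Nq|q j Nq]; first by apply: relA; apply: h1.
by apply: ctnM; [exact: ctn_cst|exact: h2].
Qed.

Lemma Sec_local N s : (forall q, N q -> exists2 d : R, 0 < d & exists N' s', Sec N' s' /\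
  forall q', N q' -> cball q d q' -> N' q' /\ s q' =1 s' q') -> Sec N s.
Proof.
move=> H; split=> [q Nq|q j Nq].
 have [d d0 [N' [s' [[h1 h2] h]]]] := H q Nq; have [N'q E] := h q Nq (cball_refl q d0).
 by apply: relE (h1 q N'q) => j; rewrite E.
have [d d0 [N' [s' [[h1 h2] h]]]] := H q Nq; have [N'q E] := h q Nq (cball_refl q d0).
apply: (ctn_local d0); apply: (@ctn_ext _ _ (fun w => s' w j)) => //.
 by move=> q' [Nq' b]; have [_ ->] := h q' Nq' b.
by apply: ctnW (h2 q j N'q) => q' [Nq' b]; case: (h q' Nq' b).
Qed.

Lemma Sec_sub N N' s : (forall q, N' q -> N q) -> Sec N s -> Sec N' s.
Proof.
move=> NN [h1 h2]; split=> [q /NN|q j N'q]; first exact: h1.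
by apply: ctnW (h2 q j (NN q N'q)).
Qed.

(** The deck element carrying [s] to [s'] is locally constant: for each of the finitely many other
    elements the inequality at one point persists nearby by continuity. *)
Lemma Sec_seg N s s' g p c' : (forall q, N q -> Dom q) -> Sec N s -> Sec N s' ->
 (forall t, 0 < t <= 1 -> N (seg p c' t) /\ ~~ bad ls (seg p c' t)) ->
 s' c' =1 act g (s c') -> forall t, 0 < t <= 1 -> s' (seg p c' t) =1 act g (s (seg p c' t)).
Proof.
move=> ND Ss Ss' H E0 t0 /andP[t00 t01].
apply: (@interval_const _ (fun t => s' (seg p c' t) =1 act g (s (seg p c' t))) t0 1) => //; last first.
 by rewrite seg1.
move=> t /andP[tt0 t1]; have tp : 0 < t <= 1 by rewrite (lt_le_trans t00).
have [Nt nbt] := H t tp.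
have [gt hgt] := relT (ND _ Nt) nbt (Ss.1 _ Nt) (Ss'.1 _ Nt).
pose Q (k : G) (d : R) := k != gt -> forall t', t0 <= t' <= 1 -> `|t' - t| < d ->
 ~ s' (seg p c' t') =1 act k (s (seg p c' t')).
have [||d d0 hd] := @fin_delta _ G Q.
- by move=> k d1 d2 d12 hq kg t' t'b td; apply: hq => //; apply: lt_le_trans d12.
- move=> k; case: (eqVneq k gt) => [->|kg]; first by exists 1 => //; rewrite /Q eqxx.
 have [j hj] : exists j, s' (seg p c' t) j != act k (s (seg p c' t)) j.
  apply: contrapT => /forallNP hn; move/eqP: kg; apply.
  apply: (relF (ND _ Nt) nbt (Ss.1 _ Nt)) => j; rewrite -hgt.
  by have /negP := hn j; rewrite negbK => /eqP.
 pose f q := s' q j - act k (s q) j.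
 have cf : ctn N f (seg p c' t).
  by apply: ctnB; [exact: (Ss'.2)|exact: (Sec_act k Ss).2].
 have fn : 0 < cnorm (f (seg p c' t)) by apply: cnorm_gt0; rewrite subr_eq0.
 have tb : t0 <= t <= 1 by rewrite tt0.
 have Nb t' : t0 <= t' <= 1 -> N (seg p c' t').
  by move=> /andP[a b]; apply: (H t' _).1; rewrite (lt_le_trans t00).
 have [d d0 hd] := ctn_seg tb cf Nb fn.
 exists d => // _ t' t'b td E; have := hd t' t'b td.
 by rewrite /f E subrr sub0r cnormN -/(f _) ltxx.
exists d => // t' t'b td.
have t'p : 0 < t' <= 1 by case/andP: t'b => a b; rewrite (lt_le_trans t00).
have [Nt' nbt'] := H t' t'p.
have [gt' hgt'] := relT (ND _ Nt') nbt' (Ss.1 _ Nt') (Ss'.1 _ Nt').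
have gg : gt' = gt by apply/eqP; apply: contrapT => /negP h; apply: (hd gt' h t' t'b td).
rewrite gg in hgt'; split=> E.
 suff -> : g = gt by [].
 by apply: (relF (ND _ Nt') nbt' (Ss.1 _ Nt')) => j; rewrite -E hgt'.
suff -> : g = gt by [].
by apply: (relF (ND _ Nt) nbt (Ss.1 _ Nt)) => j; rewrite -E hgt.
Qed.

Lemma fat_generic N : fat N -> exists2 c, N c & ~~ bad ls c.
Proof.
move=> [c [r r0 hc]]; have [c' bc h] := generic_point ls [:: c] c r0.
by exists c'; [exact: hc|have := h c 1; rewrite seg1; apply; rewrite ?inE ?eqxx // ltr01 lexx].
Qed.

(** The lines do not disconnect the domain: [q] and [c] are joined to one generic point by segments
    that can meet the lines only at their end [t = 0], where the relation between the sections
    passes to the limit. *)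
Lemma Sec_unique_from N s s' g c : (forall q, N q -> Dom q) -> convex N -> fat N ->
 Sec N s -> Sec N s' -> N c -> ~~ bad ls c -> s' c =1 act g (s c) ->
 forall q, N q -> s' q =1 act g (s q).
Proof.
move=> ND cN [c0 [r r0 hc0]] Ss Ss' Nc nbc Ec q Nq.
have [c' bc' hc'] := generic_point ls [:: q; c] c0 r0.
have Nc' := hc0 _ bc'.
have Hs p : N p -> p \in [:: q; c] -> forall t, 0 < t <= 1 -> N (seg p c' t) /\ ~~ bad ls (seg p c' t).
 move=> Np ps t tb; split; last exact: hc'.
 by apply: cN => //; case/andP: tb => /ltW -> ->.
have nbc' : ~~ bad ls c' by have := hc' q 1; rewrite seg1; apply; rewrite ?inE ?eqxx // ltr01 lexx.
have [g' hg'] := relT (ND _ Nc') nbc' (Ss.1 _ Nc') (Ss'.1 _ Nc').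
have lim p : N p -> p \in [:: q; c] -> s' p =1 act g' (s p).
 move=> Np ps; have K := Sec_seg ND Ss Ss' (Hs p Np ps) hg'.
 move=> j; apply: subr0_eq.
 apply: cnorm_small_eq0 => eps eps0.
 pose f w := s' w j - act g' (s w) j.
 have cf : ctn N f (seg p c' 0).
  by rewrite seg0; apply: ctnB; [exact: (Ss'.2)|exact: (Sec_act g' Ss).2].
 have tb : 0 <= (0 : R) <= 1 by rewrite lexx ler01.
 have Nb t' : 0 <= t' <= 1 -> N (seg p c' t') by move=> h; apply: cN.
 have [d d0 hd] := ctn_seg tb cf Nb eps0.
 pose t := Num.min 1 (d/2).
 have t0 : 0 < t by rewrite lt_min ltr01 divr_gt0.
 have t1 : t <= 1 by minle.
 have td : t <= d/2 by minle.
 have := hd t; rewrite subr0 seg0 (ltW t0) t1 gtr0_norm //.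
 rewrite /f (K t) ?t0 // subrr sub0r cnormN => /(_ isT) h.
 by apply: ltW; apply: h; lra.
have -> : g = g'.
 apply: (relF (ND _ Nc) nbc (Ss.1 _ Nc)) => j; rewrite -Ec; apply: lim => //.
 by rewrite !inE eqxx orbT.
by apply: lim => //; rewrite inE eqxx.
Qed.

Lemma Sec_unique N s s' : (forall q, N q -> Dom q) -> convex N -> fat N ->
 Sec N s -> Sec N s' -> exists g, forall q, N q -> s' q =1 act g (s q).
Proof.
move=> ND cN fN Ss Ss'; have [c Nc nbc] := fat_generic fN.
have [g hg] := relT (ND _ Nc) nbc (Ss.1 _ Nc) (Ss'.1 _ Nc).
by exists g; apply: (Sec_unique_from ND cN fN Ss Ss' Nc nbc hg).
Qed.

Lemma Sec_agree N M s s' : (forall q, N q -> Dom q) -> convex N -> fat N -> fat M ->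
 (forall q, M q -> N q) -> Sec N s -> Sec N s' -> (forall q, M q -> s' q =1 s q) ->
 forall q, N q -> s' q =1 s q.
Proof.
move=> ND cN fN fM MN Ss Ss' E q Nq j; have [c Mc nbc] := fat_generic fM.
rewrite (@Sec_unique_from N s s' e c) ?act1 //; first exact: MN.
by move=> i; rewrite act1 E.
Qed.

Hypothesis relL : forall q, Dom q -> exists2 d : R, 0 < d & exists s,
 Sec (fun q' => Dom q' /\ cball q d q') s.

(** On the overlap of two pieces the sections differ by one deck element; applying it to the second
    section makes them agree, and the two are pasted along a hyperplane inside the overlap. *)
Lemma Sec_box lo hi : (forall j, lo j < hi j) -> (forall q, box lo hi q -> Dom q) ->
 exists s, Sec (box lo hi) s.
Proof.
move=> lh sub; apply: (bisection (Good := fun lo hi => exists s, Sec (box lo hi) s)) => //; last first.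
 move=> q /sub Dq; have [d d0 [s Ss]] := relL Dq; exists d => // lo' hi' lh' sub'.
 by exists s; apply: Sec_sub Ss => q' /sub' [/sub].
move=> lo' hi' j lh' sub' [s1 S1] [s2 S2].
set a := (2 * lo' j + hi' j)/3 in S2; set b := (lo' j + 2*hi' j)/3 in S1.
have ab : a < b by rewrite /a /b; have := lh' j; lra.
have la : lo' j < a by rewrite /a; have := lh' j; lra.
have bh : b < hi' j by rewrite /b; have := lh' j; lra.
pose M := box (upd lo' j a) (upd hi' j b).
have M1 q : M q -> box lo' (upd hi' j b) q.
 move=> Mq i; have /andP[h1 h2] := Mq i; rewrite h2 andbT; move: h1; rewrite /upd.
 by case: eqP => // ->; lra.
have M2 q : M q -> box (upd lo' j a) hi' q.
 move=> Mq i; have /andP[h1 h2] := Mq i; rewrite h1 /=; move: h2; rewrite /upd.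
 by case: eqP => // ->; lra.
have B1 q : box lo' (upd hi' j b) q -> box lo' hi' q.
 by move=> Mq i; have /andP[-> /=] := Mq i; rewrite /upd; case: eqP => // ->; lra.
have B2 q : box (upd lo' j a) hi' q -> box lo' hi' q.
 by move=> Mq i; have /andP[h ->] := Mq i; rewrite andbT; move: h; rewrite /upd; case: eqP => // ->; lra.
have fM : fat M.
 by apply: box_fat => i; rewrite /upd; case: eqP => // _; exact: lh'.
have MD q : M q -> Dom q by move=> /M1/B1/sub'/sub.
have [g hg] := Sec_unique MD (@box_convex _ _ _) fM (Sec_sub M2 S2) (Sec_sub M1 S1).
pose s q := if cx j q <= b then s1 q else act g (s2 q).
exists s; apply: Sec_local => q Bq.
have inB1 q' : box lo' hi' q' -> cx j q' <= b -> box lo' (upd hi' j b) q'.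
 by move=> B cb i; have /andP[h1 h2] := B i; rewrite h1 /= /upd; case: eqP => // ->.
have inB2 q' : box lo' hi' q' -> a <= cx j q' -> box (upd lo' j a) hi' q'.
 by move=> B cb i; have /andP[h1 h2] := B i; rewrite h2 andbT /upd; case: eqP => // ->.
have inM q' : box lo' hi' q' -> a <= cx j q' -> cx j q' <= b -> M q'.
 by move=> B ca cb i; have /andP[h1 h2] := B i; rewrite /upd; case: eqP => [->|_]; apply/andP; split.
have [qb|qb] := ltP (cx j q) b.
 exists (b - cx j q); first by rewrite subr_gt0.
 exists (box lo' (upd hi' j b)), s1; split => // q' B' bq'.
 have := cx_ball j bq'; rewrite ltr_norml => /andP[_ h].
 have cb : cx j q' <= b by lra.
 by split; [exact: inB1|rewrite /s cb].
exists (b - a); first by rewrite subr_gt0.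
exists (box (upd lo' j a) hi'), (fun q => act g (s2 q)); split; first exact: Sec_act.
move=> q' B' bq'; have := cx_ball j bq'; rewrite ltr_norml => /andP[h _].
have ca : a <= cx j q' by lra.
split; first exact: inB2.
by rewrite /s; case: ifP => // cb; apply: hg; apply: inM.
Qed.

(** All stages are normalised to agree with one section on [K 0]. Uniqueness makes them agree
    wherever both are defined, so the value may be taken from any stage that contains the point. *)
Lemma Sec_exhaust (K : nat -> P -> Prop) (D : P -> Prop) :
 (forall n m q, (n <= m)%N -> K n q -> K m q) ->
 (forall n, convex (K n) /\ fat (K n)) -> (forall n q, K n q -> Dom q) ->
 (forall n, exists s, Sec (K n) s) ->
 (forall q, D q -> exists n, exists2 d : R, 0 < d & forall q', D q' -> cball q d q' -> K n q') ->
 exists s, Sec D s.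
Proof.
move=> mono geo KD ex cov; have [s0 S0] := ex 0%N.
have /choice[sg hsg] : forall n, exists s, Sec (K n) s /\ forall q, K 0%N q -> s q =1 s0 q.
 move=> n; have [s Ss] := ex n; have Ss' := Sec_sub (fun q => mono 0%N n q isT) Ss.
 have [g hg] := Sec_unique (KD 0%N) (geo 0%N).1 (geo 0%N).2 Ss' S0.
 by exists (fun q => act g (s q)); split; [exact: Sec_act|move=> q Kq j; rewrite hg].
have comp n m q : (n <= m)%N -> K n q -> sg m q =1 sg n q.
 move=> nm; have [Sn En] := hsg n; have [Sm Em] := hsg m.
 apply: (@Sec_agree (K n) (K 0%N)) => //.
 - exact: KD. - exact: (geo n).1. - exact: (geo n).2. - exact: (geo 0%N).2.
 - by move=> w; apply: mono.
 - by apply: Sec_sub Sm => w; apply: mono.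
 - by move=> w Kw j; rewrite En // Em.
have comp2 n m q : K n q -> K m q -> sg m q =1 sg n q.
 move=> Kn Km j; case: (leqP n m) => h; first exact: comp.
 by rewrite (comp m n) // ltnW.
have /choice[nu hnu] : forall q, exists n, D q -> K n q.
 move=> q; case: (pselect (D q)) => Dq; last by exists 0%N.
 by have [n [d d0 h]] := cov q Dq; exists n => _; apply: h => //; apply: cball_refl.
exists (fun q => sg (nu q) q); apply: Sec_local => q Dq.
have [n [d d0 h]] := cov q Dq; exists d => //; exists (K n), (sg n); split; first by case: (hsg n).
move=> q' Dq' b; have Kq' := h q' Dq' b; split => //.
by apply: comp2 => //; apply: hnu.
Qed.

End Torsor.
End Sections.

(** * The punctured cube, glued from eight half-cubes *)
Section PuncturedCube.
Variable R : realType.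
Local Notation C := (R[i]).
Local Notation P := (C*C)%type.
Local Notation Y := ('I_4 -> C).
Implicit Types (p q : P).

Definition cube (r : R) q := forall j, `|cx j q| <= r.
Definition pcube (r : R) q := cube r q /\ q <> (0, 0).

Definition sgb (b : bool) : R := if b then -1 else 1.
Definition halfcube (r : R) (b : 'I_4*bool) q := cube r q /\ 0 < sgb b.2*cx b.1 q.

Lemma cx0 j : cx j (0, 0) = 0 :> R.
Proof. by elim/ord4: j; rewrite !cxE. Qed.

Lemma halfcube_sub r b q : halfcube r b q -> pcube r q.
Proof. by move=> [cq h]; split => // E; move: h; rewrite E cx0 mulr0 ltxx. Qed.

Lemma pcube_cover r q : pcube r q -> exists b, halfcube r b q.
Proof.
move=> [cq q0]; apply: contrapT => H; apply: q0.
have z j : cx j q = 0.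
 apply/eqP; apply: contrapT => /negP; rewrite neq_lt => /orP[h|h]; apply: H.
  by exists (j, true); split => //=; rewrite mulN1r oppr_gt0.
 by exists (j, false); split => //=; rewrite mul1r.
move: (z (inord 0)) (z (inord 1)) (z (inord 2)) (z (inord 3)); rewrite !cxE.
by case: q {cq H z} => [[a b] [c d]] /= -> -> -> ->.
Qed.

Lemma cube_convex r : convex (cube r).
Proof.
move=> p q t hp hq tb j.
have bx w : cube r w -> box (fun=> - r) (fun=> r) w by move=> h i; rewrite -ler_norml.
by have := @box_convex _ _ _ _ _ _ (bx _ hp) (bx _ hq) tb j; rewrite -ler_norml.
Qed.

Lemma halfcube_convex r b : convex (halfcube r b).
Proof.
move=> p q t [hp sp] [hq sq] tb; split; first exact: cube_convex.
rewrite cx_seg; case/andP: tb => t0 t1.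
have -> : sgb b.2*((1 - t)*cx b.1 p + t*cx b.1 q) =
 (1 - t)*(sgb b.2*cx b.1 p) + t*(sgb b.2*cx b.1 q) by ring.
move: sp sq; set x := _*cx b.1 p; set y := _*cx b.1 q => sp sq.
move: t0; rewrite le_eqVlt => /orP[/eqP<-|t0]; first by rewrite mul0r subr0 mul1r addr0.
by apply: ltr_wpDl; [apply: mulr_ge0; [lra|exact: ltW]|apply: mulr_gt0].
Qed.

Lemma convexI (N M : P -> Prop) : convex N -> convex M -> convex (fun q => N q /\ M q).
Proof. by move=> cN cM p q t [n1 m1] [n2 m2] tb; split; [apply: cN|apply: cM]. Qed.

(** Not opposite: two half-cubes are disjoint exactly when they use the same coordinate with
    different signs. *)
Definition nopp (b b' : 'I_4*bool) := (b.1 == b'.1) ==> (b.2 == b'.2).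

Lemma noppC b b' : nopp b b' = nopp b' b.
Proof. by rewrite /nopp eq_sym [b.2 == _]eq_sym. Qed.

(** These are the triangles in the nerve of the cover by half-cubes, which is the boundary of the
    four-dimensional cross-polytope, a 3-sphere. The centre of the ball has coordinates [r/2] or
    [-r/2] in the chosen directions. *)
Lemma halfcube_fat3 r b1 b2 b3 : 0 < r -> nopp b1 b2 -> nopp b1 b3 -> nopp b2 b3 ->
 fat (fun q => [/\ halfcube r b1 q, halfcube r b2 q & halfcube r b3 q]).
Proof.
move=> r0 n12 n13 n23.
pose e i : R := if i == b1.1 then sgb b1.2 else if i == b2.1 then sgb b2.2
 else if i == b3.1 then sgb b3.2 else 0.
exists (pt4 (fun i => e i*(r/2))); exists (r/2); first by rewrite divr_gt0.
move=> q hq.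
have sgbE b : sgb b = 1 \/ sgb b = -1 by case: b; [right|left].
have cq : cube r q.
 move=> j; have := cx_ball j hq; rewrite cx_pt4 ltr_norml ler_norml => /andP[h1 h2].
 have [he|[he|he]] : e j = 1 \/ e j = -1 \/ e j = 0.
  by rewrite /e; do 3?[case: ifP => _]; [case: (sgbE b1.2)=> ->|case: (sgbE b2.2)=> ->|case: (sgbE b3.2)=> ->|]; auto.
 - by move: h1 h2; rewrite he; move=> *; apply/andP; split; lra.
 - by move: h1 h2; rewrite he; move=> *; apply/andP; split; lra.
 - by move: h1 h2; rewrite he; move=> *; apply/andP; split; lra.
have key b : e b.1 = sgb b.2 -> halfcube r b q.
 move=> eb; split => //; have := cx_ball b.1 hq; rewrite cx_pt4 eb ltr_norml => /andP[h1 h2].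
 by case: (sgbE b.2) h1 h2 => ->; lra.
have nE b b' : nopp b b' -> b'.1 = b.1 -> sgb b.2 = sgb b'.2.
 by move=> + E; rewrite /nopp E eqxx /= => /eqP ->.
split; apply: key; rewrite /e ?eqxx //; first by case: eqP => // /(nE _ _ n12).
by case: eqP => [/(nE _ _ n13)//|_]; case: eqP => // /(nE _ _ n23).
Qed.

Lemma nopp_refl b : nopp b b. Proof. by rewrite /nopp !eqxx. Qed.

Lemma fatW (N M : P -> Prop) : (forall q, N q -> M q) -> fat N -> fat M.
Proof. by move=> NM [c [r r0 h]]; exists c, r => // q /h/NM. Qed.

Lemma halfcube_fat r b : 0 < r -> fat (halfcube r b).
Proof.
move=> r0; apply: fatW (halfcube_fat3 r0 (nopp_refl b) (nopp_refl b) (nopp_refl b)).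
by move=> q [].
Qed.

Lemma halfcube_near r b q : halfcube r b q -> exists2 d : R, 0 < d &
 forall q', cube r q' -> cball q d q' -> halfcube r b q'.
Proof.
move=> [cq h]; exists (sgb b.2*cx b.1 q) => // q' cq' bq; split => //.
have := cx_ball b.1 bq; move: h; rewrite /sgb; case: b.2 => h; rewrite ltr_norml => /andP[h1 h2]; lra.
Qed.

Section Shell.
Variables (ls : seq C) (G : finType) (ai : G -> 'I_4 -> 'I_4) (am : G -> 'I_4 -> C) (e : G).
Variables (Dom : P -> Prop) (Rel : P -> Y -> Prop).
Local Notation act := (act ai am).
Local Notation Sec := (Sec Rel).
Hypothesis act1 : forall y, act e y =1 y.
Hypothesis relE : forall q y y', y =1 y' -> Rel q y -> Rel q y'.
Hypothesis relA : forall q y g, Rel q y -> Rel q (act g y).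
Hypothesis relT : forall q y y', Dom q -> ~~ bad ls q -> Rel q y -> Rel q y' ->
 exists g, y' =1 act g y.
Hypothesis relF : forall q y g g', Dom q -> ~~ bad ls q -> Rel q y -> act g y =1 act g' y -> g = g'.

(** Overlapping half-cubes share their deck element, and two opposite half-cubes both overlap a
    third one. *)
Lemma Sec_pcube_unique r s s' : 0 < r -> (forall q, pcube r q -> Dom q) ->
 Sec (pcube r) s -> Sec (pcube r) s' -> exists g, forall q, pcube r q -> s' q =1 act g (s q).
Proof.
move=> r0 rD Ss Ss'.
have HD b q : halfcube r b q -> Dom q by move=> /halfcube_sub/rD.
have /choice[gb hgb] : forall b, exists g, forall q, halfcube r b q -> s' q =1 act g (s q).
 move=> b; apply: (Sec_unique relA relT relF (HD b) (@halfcube_convex r b) (halfcube_fat b r0)).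
  by apply: Sec_sub Ss => q /halfcube_sub.
 by apply: Sec_sub Ss' => q /halfcube_sub.
have same b b' : nopp b b' -> gb b = gb b'.
 move=> n; have F : fat (fun q => halfcube r b q /\ halfcube r b' q).
  by apply: fatW (halfcube_fat3 r0 (nopp_refl b) n n) => q [].
 have [c [h1 h2] nb] := fat_generic ls F.
 apply: (relF (HD _ _ h1) nb (Ss.1 _ (halfcube_sub h1))) => j.
 by rewrite -hgb // -hgb.
have all b : gb b = gb (inord 0, false).
 have n1 : nopp (inord 1, false) (inord 0, false) by rewrite /nopp /= -val_eqE /= !inordK.
 rewrite -(same _ _ n1); case: b => [i c].
 have [E|E] := eqVneq i (inord 1); last by apply: same; rewrite /nopp /= (negbTE E).
 rewrite (same (i, c) (inord 0, false)) ?(same _ _ n1) //.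
 by rewrite /nopp /= E -val_eqE /= !inordK.
by exists (gb (inord 0, false)) => q /pcube_cover[b hb]; rewrite -(all b); apply: hgb.
Qed.

(** A half-cube is open along its face through the origin, so it is exhausted by the boxes at
    distance at least [r/(n+2)] from that face; the shift by 2 keeps the interiors nonempty. *)
Lemma Sec_halfcube_exists r b : 0 < r -> (forall q, halfcube r b q -> Dom q) ->
 (forall q, Dom q -> exists2 d : R, 0 < d & exists s,
   Sec (fun q' => Dom q' /\ cball q d q') s) ->
 exists s, Sec (halfcube r b) s.
Proof.
move=> r0 HD relL.
 pose t n : R := r/n.+2%:R.
 have t0 n : 0 < t n by rewrite divr_gt0 ?ltr0n.
 have tr n : t n < r by rewrite ltr_pdivrMr ?ltr0n // -[ltLHS]mulr1 ltr_pM2l // ltr1n.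
 pose K n q := cube r q /\ t n <= sgb b.2*cx b.1 q.
 pose lo n := if b.2 then (fun=> - r) else upd (fun=> - r) b.1 (t n).
 pose hi n := if b.2 then upd (fun=> r) b.1 (- t n) else (fun=> r).
 have KB n q : K n q <-> box (lo n) (hi n) q.
  rewrite /K /lo /hi /sgb; case: (b.2).
   split=> [[cq h] i|H].
    have := cq i; rewrite ler_norml => /andP[h1 h2]; rewrite h1 /= /upd; case: eqP => // ->; lra.
   split; last by have /andP[_] := H b.1; rewrite /upd eqxx; lra.
   move=> i; rewrite ler_norml; have /andP[-> /=] := H i; rewrite /upd; case: eqP => // _.
   by have := t0 n; lra.
  split=> [[cq h] i|H].
   have := cq i; rewrite ler_norml => /andP[h1 h2]; rewrite h2 andbT /= /upd; case: eqP => // ->; lra.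
  split; last by have /andP[+ _] := H b.1; rewrite /upd eqxx; lra.
  move=> i; rewrite ler_norml; have /andP[+ ->] := H i; rewrite /upd; case: eqP => // _; rewrite andbT //.
  by have := t0 n; lra.
 have lh n j : lo n j < hi n j.
  rewrite /lo /hi; have := tr n; have := t0 n; case: b.2; rewrite /upd; case: eqP => _ *; lra.
 have KH n q : K n q -> halfcube r b q by move=> [cq h]; split => //; apply: lt_le_trans h.
 apply: (@Sec_exhaust _ ls G ai am e Dom Rel act1 relE relA relT relF K).
 - move=> n m q nm [cq h]; split => //; apply: le_trans h.
  by rewrite ler_pM2l // lef_pV2 ?posrE ?ltr0n // ler_nat !ltnS.
 - move=> n; split.
   move=> p q u /KB hp /KB hq ub; apply/KB; exact: box_convex.
  by apply: fatW (box_fat (lh n)) => q /KB.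
 - by move=> n q /KH/HD.
 - move=> n; have BD q : box (lo n) (hi n) q -> Dom q by move=> /KB/KH/HD.
  have [s Ss] := Sec_box relE relA relT relF relL (lh n) BD.
  by exists s; apply: Sec_sub Ss => q /KB.
 move=> q [cq h]; set x := sgb b.2*cx b.1 q in h.
 have xr : 0 <= r/(x/2) by rewrite divr_ge0 ?divr_ge0 ?ltW.
 have := archi_boundP xr; set n := Num.bound _ => hn; exists n, (x/2); first by rewrite divr_gt0.
 move=> q' [cq' _] bq; split => //.
 have h2 : x/2 <= sgb b.2*cx b.1 q'.
  have := cx_ball b.1 bq; rewrite /x /sgb; case: b.2; rewrite ltr_norml => /andP[h1 h2]; lra.
 apply: le_trans h2; rewrite ler_pdivrMr ?ltr0n // mulrC -ler_pdivrMr ?divr_gt0 //.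
 by apply: ltW; apply: lt_trans hn _; rewrite ltr_nat.
Qed.

(** The 3-sphere is simply connected, by hand on its nerve. Everything except the half-cube opposite
    to [b0] meets [b0] and is normalised there; the triple overlaps make the choices compatible. *)
Lemma Sec_pcube_exists r : 0 < r -> (forall q, pcube r q -> Dom q) ->
 (forall q, Dom q -> exists2 d : R, 0 < d & exists s,
   Sec (fun q' => Dom q' /\ cball q d q') s) ->
 exists s, Sec (pcube r) s.
Proof.
move=> r0 rD relL.
have HD b q : halfcube r b q -> Dom q by move=> /halfcube_sub/rD.
have ex b : exists s, Sec (halfcube r b) s by apply: Sec_halfcube_exists (HD b) relL.
have adj b b0 s0 : nopp b b0 -> Sec (halfcube r b0) s0 -> exists s, Sec (halfcube r b) s /\
  forall q, halfcube r b q -> halfcube r b0 q -> s q =1 s0 q.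
 move=> n S0; have [s Ss] := ex b; pose M q := halfcube r b q /\ halfcube r b0 q.
 have fM : fat M by apply: fatW (halfcube_fat3 r0 (nopp_refl b) n n) => q [].
 have MD q : M q -> Dom q by move=> [/HD].
 have [g hg] := Sec_unique relA relT relF MD (convexI (@halfcube_convex _ _) (@halfcube_convex _ _)) fM
  (Sec_sub (fun q (h : M q) => h.1) Ss) (Sec_sub (fun q (h : M q) => h.2) S0).
 exists (fun q => act g (s q)); split; first exact: Sec_act.
 by move=> q h1 h2 j; rewrite (hg q (conj h1 h2)).
(* Agreement on the triple overlap spreads to the double overlap, which is convex with interior. *)
have tri b b' b'' s s' s'' : nopp b b' -> nopp b b'' -> nopp b' b'' ->
  Sec (halfcube r b) s -> Sec (halfcube r b') s' ->
  (forall q, halfcube r b q -> halfcube r b'' q -> s q =1 s'' q) ->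
  (forall q, halfcube r b' q -> halfcube r b'' q -> s' q =1 s'' q) ->
  forall q, halfcube r b q -> halfcube r b' q -> s q =1 s' q.
 move=> n1 n2 n3 Sb Sb' E E' q hb hb'.
 pose N q := halfcube r b q /\ halfcube r b' q.
 have fN : fat N by apply: fatW (halfcube_fat3 r0 (nopp_refl b) n1 n1) => w [].
 have ND w : N w -> Dom w by move=> [/HD].
 apply: (Sec_agree act1 relA relT relF ND (convexI (@halfcube_convex _ _) (@halfcube_convex _ _)) fN
  (halfcube_fat3 r0 n1 n2 n3) _ (Sec_sub (fun q (h : N q) => h.2) Sb') (Sec_sub (fun q (h : N q) => h.1) Sb)) => //.
  by move=> w [].
 by move=> w [h1 h2 h3] j; rewrite E // E'.
pose b0 : 'I_4*bool := (inord 0, false); pose b1 : 'I_4*bool := (inord 1, false).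
pose b2 : 'I_4*bool := (inord 2, false); pose bo : 'I_4*bool := (inord 0, true).
have [s0 S0] := ex b0.
have /choice[sa hsa] : forall b, exists s, nopp b b0 -> Sec (halfcube r b) s /\
  forall q, halfcube r b q -> halfcube r b0 q -> s q =1 s0 q.
 move=> b; case: (boolP (nopp b b0)) => n; last by exists s0.
 by have [s hs] := adj b b0 s0 n S0; exists s.
have sa_ok b b' : nopp b b0 -> nopp b' b0 -> nopp b b' ->
  forall q, halfcube r b q -> halfcube r b' q -> sa b q =1 sa b' q.
 move=> n n' nn; have [Sb Eb] := hsa b n; have [Sb' Eb'] := hsa b' n'.
 exact: (tri b b' b0 (sa b) (sa b') s0).
have ne (i j : nat) (hi : (i < 4)%N) (hj : (j < 4)%N) : i != j -> (inord i : 'I_4) != inord j.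
 by move=> ij; rewrite -val_eqE /= !inordK.
have npi (i j : 'I_4) c d : i != j -> nopp (i, c) (j, d) by move=> ij; rewrite /nopp /= (negbTE ij).
have n10 : nopp b1 b0 by apply: npi; apply: ne.
have n20 : nopp b2 b0 by apply: npi; apply: ne.
have no1 : nopp bo b1 by apply: npi; apply: ne.
have no2 : nopp bo b2 by apply: npi; apply: ne.
have n12 : nopp b1 b2 by apply: npi; apply: ne.
(* The half-cube [bo] does not meet [b0], so its section is normalised on [b1]. *)
have [so [So Eo]] := adj bo b1 (sa b1) no1 (hsa b1 n10).1.
have Eo2 : forall q, halfcube r bo q -> halfcube r b2 q -> so q =1 sa b2 q.
 have n21 : nopp b2 b1 by rewrite noppC.
 apply: (tri bo b2 b1 so (sa b2) (sa b1)) => //; first exact: (hsa b2 n20).1.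
 by apply: sa_ok.
(* At most one of [b1] and [b2] is opposite to [b]; the other one transports the agreement. *)
have Eall b : b.1 != inord 0 -> forall q, halfcube r bo q -> halfcube r b q -> so q =1 sa b q.
 case: b => i c /= i0; have nb0 : nopp (i, c) b0 by apply: npi.
 have nob : nopp bo (i, c) by apply: npi; rewrite eq_sym.
 have [i1|i1] := eqVneq i (inord 1).
  have nb2 : nopp (i, c) b2 by apply: npi; rewrite i1; apply: ne.
  apply: (tri bo (i, c) b2 so (sa (i, c)) (sa b2)) => //; first exact: (hsa _ nb0).1.
  exact: sa_ok.
 have nb1 : nopp (i, c) b1 by apply: npi.
 apply: (tri bo (i, c) b1 so (sa (i, c)) (sa b1)) => //; first exact: (hsa _ nb0).1.
 exact: sa_ok.
pose sf b := if b == bo then so else sa b.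
have nb b : b != bo -> nopp b b0.
 by case: b => i c; rewrite /nopp /= xpair_eqE; case: (i == _) => //=; case: c.
have Sf b : Sec (halfcube r b) (sf b).
 rewrite /sf; case: eqP => [->//|/eqP/nb n]; exact: (hsa b n).1.
have comp b b' q : halfcube r b q -> halfcube r b' q -> sf b q =1 sf b' q.
 move=> h h'; have nn : nopp b b'.
  case: b b' h h' => i c [i' c'] [_ /= h] [_ /= h']; apply/implyP => /= /eqP E; move: h h'; rewrite -E.
  by case: c; case: c' => //=; rewrite /sgb; lra.
 have aux d : d != bo -> nopp bo d -> d.1 != inord 0.
  case: d => i c nd; rewrite /nopp /= => n; apply/eqP => E; move: nd n; rewrite E xpair_eqE eqxx /=.
  by case: c.
 rewrite /sf; case: eqP h h' nn => [->|/eqP nb1] h h' nn; case: eqP h' nn => [->//|/eqP nb2] h' nn.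
 - by apply: Eall => //; apply: aux.
 - by move=> j; rewrite (Eall b) //; apply: aux => //; rewrite noppC.
 by apply: sa_ok => //; apply: nb.
have /choice[beta hbeta] : forall q, exists b, pcube r q -> halfcube r b q.
 move=> q; case: (pselect (pcube r q)) => [/pcube_cover[b hb]|h]; first by exists b.
 by exists b0.
exists (fun q => sf (beta q) q); apply: (Sec_local relE) => q pq.
have [d d0 hd] := halfcube_near (hbeta q pq); exists d => //.
exists (halfcube r (beta q)), (sf (beta q)); split => // q' pq' bq.
have h := hd q' pq'.1 bq; split => //; apply: comp => //; exact: hbeta.
Qed.

End Shell.
End PuncturedCube.

(** * Continuous roots, and square roots of even functions *)

Section Roots.
Variable R : realType.
Local Notation C := (R[i]).
Local Notation P := (C*C)%type.
Local Notation Y := ('I_4 -> C).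
Implicit Types (q : P) (z : C).

Lemma unity_roots_ex n : exists U : seq C, (0 < n)%N ->
 [/\ uniq U, size U = n, (forall z, (z \in U) = (z^+n == 1)) & ('X^n - 1 = \prod_(z <- U) ('X - z%:P))%R].
Proof.
case: (posnP n) => [->|n0]; first by exists [::].
have [U HU] := closed_field_poly_normal ('X^n - 1 : {poly C}).
have sn : (1 < (size ('X^n : {poly C})))%N by rewrite size_polyXn.
have E : 'X^n - 1 = \prod_(z <- U) ('X - z%:P) :> {poly C}.
 by rewrite HU lead_coefDl ?lead_coefXn ?scale1r // size_polyN size_poly1.
exists U => _; split => //.
- rewrite -separable_prod_XsubC -E separable_Xn_sub_1 //.
 by rewrite pnatr_eq0 -lt0n.
- apply/eqP; rewrite -eqSS -(size_prod_XsubC U id) -E size_polyDl ?size_polyXn //.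
 by rewrite size_polyN size_poly1.
- by move=> z; rewrite -root_prod_XsubC -E /root !hornerE subr_eq0.
Qed.

Definition uroots n : seq C := projT1 (cid (unity_roots_ex n)).
Lemma urootsP n : (0 < n)%N -> [/\ uniq (uroots n), size (uroots n) = n,
 (forall z, (z \in uroots n) = (z^+n == 1)) & ('X^n - 1 = \prod_(z <- uroots n) ('X - z%:P))%R].
Proof. by rewrite /uroots; case: cid. Qed.

Lemma uroot_neq0 n z : (0 < n)%N -> z^+n = 1 -> z != 0.
Proof. by move=> n0 h; apply/eqP => z0; move/eqP: h; rewrite z0 expr0n gtn_eqF // eq_sym oner_eq0. Qed.

Lemma uroot_norm n z : (0 < n)%N -> z^+n = 1 -> cnorm z = 1.
Proof.
move=> n0 /(congr1 (@cnorm R)); rewrite cnormX cnorm1 => h.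
by apply/eqP; rewrite -(@pexpr_eq1 _ _ n) ?cnorm_ge0 // h.
Qed.

Lemma pow_sub n (x y : C) : (0 < n)%N -> x^+n - y^+n = \prod_(z <- uroots n) (x - z*y) :> C.
Proof.
move=> n0; have [_ sU _ E] := urootsP n0.
have [->|y0] := eqVneq y 0.
 rewrite expr0n gtn_eqF // subr0; under eq_bigr do rewrite mulr0 subr0.
 by rewrite big_const_seq count_predT sU iter_mulr_1.
have := congr1 (fun p : {poly C} => p.[x/y]) E; rewrite /= !hornerE horner_prod => H.
have -> : x^+n - y^+n = y^+n*((x/y)^+n - 1) by rewrite expr_div_n mulrBr mulrCA divff ?expf_neq0 // !mulr1.
rewrite H -{1}sU -[LHS]mulr1; transitivity ((\prod_(z <- uroots n) y) * \prod_(z <- uroots n) (x/y - z)).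
 by rewrite mulr1 big_const_seq count_predT iter_mulr_1; congr (_*_); apply: eq_bigr => z _; rewrite !hornerE.
by rewrite -big_split /=; apply: eq_bigr => z _; field.
Qed.

Lemma pow_eq n (x y : C) : (0 < n)%N -> x^+n = y^+n -> exists2 z, z^+n = 1 & x = z*y.
Proof.
move=> n0 h; have [_ _ hU _] := urootsP n0.
have /eqP : \prod_(z <- uroots n) (x - z*y) = 0 by rewrite -pow_sub // h subrr.
rewrite prodf_seq_eq0 => /hasP[z zU /=]; rewrite subr_eq0 => /eqP ->.
by exists z => //; apply/eqP; rewrite -hU.
Qed.

Lemma nroot_ex n z : (0 < n)%N -> exists c : C, c^+n = z.
Proof. by move=> n0; exists (n.-root z); rewrite rootCK. Qed.

(** The product of the distances from [c0] to all the [n]-th roots of [z] is the modulus of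
    [c0^n - z], so one of them is small. *)
Lemma root_near n (c0 : C) (e : R) z : (0 < n)%N -> 0 < e -> cnorm (z - c0^+n) < e^+n ->
 exists2 c : C, c^+n = z & cnorm (c - c0) < e.
Proof.
move=> n0 e0 h; have [r hr] := nroot_ex z n0; have [_ sU hU _] := urootsP n0.
apply: contrapT => H.
have far u : u \in uroots n -> e <= cnorm (c0 - u*r).
 move=> uU; rewrite leNgt; apply/negP => hl; apply: H; exists (u*r).
  by rewrite exprMn hr; move: uU; rewrite hU => /eqP ->; rewrite mul1r.
 by rewrite cnormBC.
suff : e^+n <= cnorm (c0^+n - z) by rewrite cnormBC leNgt h.
rewrite -hr pow_sub // -{1}sU.
have -> : cnorm (\prod_(u <- uroots n) (c0 - u*r)) = \prod_(u <- uroots n) cnorm (c0 - u*r).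
 by elim: (uroots n) => [|u s IH]; rewrite ?big_nil ?cnorm1 // !big_cons cnormM IH.
rewrite -[e^+_]mulr1 -iter_mulr -(count_predT (uroots n)) -big_const_seq.
rewrite [leLHS]big_seq [leRHS]big_seq; apply: ler_prod => u uU.
by rewrite ltW //= far.
Qed.

(** Two numbers with equal [n]-th powers differ by a root of unity [u], and [|u - 1|] has a positive
    minimum over [u != 1]. *)
Lemma root_sep n (c0 : C) : (0 < n)%N -> c0 != 0 -> exists2 e : R, 0 < e &
 forall c c' : C, cnorm (c - c0) < e -> cnorm (c' - c0) < e -> c^+n = c'^+n -> c = c'.
Proof.
move=> n0 c00; have [_ _ hU _] := urootsP n0.
have cn := cnorm_gt0 c00.
have [m m0 hm] : exists2 m : R, 0 < m & forall u, u \in uroots n -> u != 1 -> m <= cnorm (u - 1).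
 elim: (uroots n) => [|u s [m m0 IH]]; first by exists 1.
 have [u1|u1] := eqVneq u 1.
  by exists m => // v; rewrite inE => /orP[/eqP->|/IH//]; rewrite u1 eqxx.
 exists (Num.min m (cnorm (u - 1))); first by rewrite lt_min m0 cnorm_gt0 // subr_eq0.
 by move=> v; rewrite inE ge_min => /orP[/eqP-> _|/IH h /h ->//]; rewrite lexx orbT.
exists (Num.min (cnorm c0/2) (m*cnorm c0/4)); first by rewrite lt_min !divr_gt0 ?mulr_gt0.
move=> c c'; rewrite !lt_min => /andP[h1 h2] /andP[h3 h4] /(pow_eq n0)[u un E].
have [u1|u1] := eqVneq u 1; first by rewrite E u1 mul1r.
have := hm u; rewrite hU un eqxx => /(_ isT u1) mu.
have : cnorm (c - c') = cnorm (u - 1)*cnorm c'.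
 by rewrite E -cnormM; congr (cnorm _); ring.
have : cnorm c0/2 < cnorm c'.
 have := cnorm_sub_ge c0 c'; rewrite cnormBC; lra.
have := cnorm_tri c0 c c'; rewrite [cnorm (c0 - c')]cnormBC => h5 h6 h7.
have : m*(cnorm c0/2) <= cnorm (u - 1)*cnorm c' by apply: ler_pM => //; [exact: ltW|rewrite divr_ge0 ?cnorm_ge0|exact: ltW].
by move=> h8; exfalso; lra.
Qed.

(** Roots near [c0] exist by [root_near] and are unique by [root_sep]; a uniquely determined nearby
    root is continuous. *)
Lemma local_nroot (D : P -> Prop) (f : P -> C) n q0 c0 : (0 < n)%N -> D q0 ->
 (forall q, D q -> ctn D f q) -> c0^+n = f q0 -> c0 != 0 ->
 forall e0 : R, 0 < e0 ->
 exists2 d : R, 0 < d & exists s, s q0 = c0 /\ forall q, D q -> cball q0 d q ->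
  [/\ s q^+n = f q, cnorm (s q - c0) < e0 & ctn (fun q' => D q' /\ cball q0 d q') s q].
Proof.
move=> n0 Dq0 cf E c00 e0 e00; have [e1 e10 sep] := root_sep n0 c00.
pose e := Num.min e0 e1.
have ep : 0 < e by rewrite lt_min e00.
have ee0 : e <= e0 by minle.
have ee1 : e <= e1 by minle.
have [d d0 hd] := cf q0 Dq0 _ (exprn_gt0 n ep).
have /choice[s hs] : forall q, exists c, D q -> cball q0 d q -> c^+n = f q /\ cnorm (c - c0) < e.
 move=> q; case: (pselect (D q /\ cball q0 d q)) => [[Dq b]|H]; last by exists 0 => Dq b; case: H.
 have := hd q Dq b; rewrite -E => /(root_near n0 ep)[c hc1 hc2]; by exists c.
exists d => //; exists s; split.
 have [h1 h2] := hs q0 Dq0 (cball_refl q0 d0).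
 apply: sep; [exact: lt_le_trans ee1|by rewrite subrr cnorm0|by rewrite h1].
move=> q Dq b; have [h1 h2] := hs q Dq b; split => //; first exact: lt_le_trans ee0.
move=> eps eps0; pose e2 := Num.min eps (e - cnorm (s q - c0)).
have e20 : 0 < e2 by rewrite lt_min eps0 subr_gt0.
have [d2 d20 hd2] := cf q Dq _ (exprn_gt0 n e20); exists d2 => // q' [Dq' b'] bq.
have [k1 k2] := hs q' Dq' b'.
have := hd2 q' Dq' bq; rewrite -h1 => /(root_near n0 e20)[c hc1 hc2].
have cc0 : cnorm (c - c0) < e.
 apply: le_lt_trans (cnorm_tri (s q) _ _) _; rewrite -ltrBrDr.
 by apply: lt_le_trans hc2 _; minle.
have -> : s q' = c.
 by apply: sep; [exact: lt_le_trans ee1|exact: lt_le_trans ee1|rewrite hc1].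
by apply: lt_le_trans hc2 _; minle.
Qed.

Section EvenSqrt.
Variables (psi : P -> C) (r : R).
Hypothesis r0 : 0 < r.
Hypothesis cpsi : forall q, cube r q -> ctn (cube r) psi q.
Hypothesis evenpsi : forall q, cube r q -> psi (q.1, - q.2) = psi q.
Hypothesis psi0 : forall q, cube r q -> (psi q = 0 <-> q.2 = 0).

Let D q := cube r q /\ q.2 != 0.
(** The double cover by square roots is placed on the diagonal of [C^4] to fit the torsor setting;
    it has no mirrors over [D]. *)
Let Rl q (y : Y) := (forall j, y j = y ord0) /\ (y ord0)^+2 = psi q.
Let ai (g : bool) (j : 'I_4) := j.
Let am (g : bool) (j : 'I_4) : C := if g then -1 else 1.
Local Notation act := (act ai am).

Let act1 y : act false y =1 y. Proof. by move=> j; rewrite /act /am mul1r. Qed.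
Let relE q y y' : y =1 y' -> Rl q y -> Rl q y'.
Proof. by move=> E [h1 h2]; split; [move=> j; rewrite -!E|rewrite -E]. Qed.
Let relA q y g : Rl q y -> Rl q (act g y).
Proof.
move=> [h1 h2]; split; first by move=> j; rewrite /act /am /ai h1.
by rewrite /act /am -h2; case: g; ring.
Qed.
Let relT q y y' : D q -> ~~ bad [::] q -> Rl q y -> Rl q y' -> exists g, y' =1 act g y.
Proof.
move=> _ _ [h1 h2] [k1 k2]; have /eqP : y' ord0^+2 = y ord0^+2 by rewrite h2 k2.
rewrite eqf_sqr => /orP[/eqP E|/eqP E]; [exists false|exists true] => j; rewrite /act /am /ai k1 h1 E.
 by rewrite mul1r.
by rewrite mulN1r.
Qed.
Let Rl_neq0 q y : D q -> Rl q y -> y ord0 != 0.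
Proof.
move=> [cq q2] [h1 h2]; apply: contraNneq q2 => y0; apply/eqP/(psi0 cq).
by rewrite -h2 y0 expr0n.
Qed.
Let relF q y g g' : D q -> ~~ bad [::] q -> Rl q y -> act g y =1 act g' y -> g = g'.
Proof.
move=> Dq _ Rq /(_ ord0); rewrite /act /am => /(mulIf (Rl_neq0 Dq Rq)).
by case: g; case: g' => // /eqP; rewrite ?(eq_sym 1) eqNr oner_eq0.
Qed.
Let relL q : D q -> exists2 d : R, 0 < d & exists s, Sec Rl (fun q' => D q' /\ cball q d q') s.
Proof.
move=> Dq; have [c hc] := nroot_ex (psi q) (isT : (0 < 2)%N).
have c0 : c != 0.
 apply: contraNneq (Dq.2) => z; apply/eqP/(psi0 Dq.1); by rewrite -hc z expr0n.
have cD w : D w -> ctn D psi w by move=> [cw _]; apply: ctnW (cpsi cw) => x [].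
have [d d0 [s [_ hs]]] := local_nroot (isT : (0 < 2)%N) Dq cD hc c0 ltr01.
exists d => //; exists (fun q _ => s q); split=> [w [Dw b]|w j [Dw b]]; last by case: (hs w Dw b).
by split => //; case: (hs w Dw b).
Qed.

Let hD (b : 'I_4*bool) q : (1 < b.1)%N -> halfcube r b q -> D q.
Proof.
move=> b1 [cq h]; split => //; apply: contraTneq h => q2.
suff -> : cx b.1 q = 0 by rewrite mulr0 ltxx.
by case: (b.1) b1 => [[|[|[|[|//]]]] hi] // _; rewrite /cx /= q2.
Qed.

Let iota q : P := (q.1, - q.2).
Let iotaK q : iota (iota q) = q. Proof. by case: q => a b; rewrite /iota /= opprK. Qed.
Let iota_cube q : cube r q -> cube r (iota q).
Proof.
move=> cq j; move: (cq j); case: q {cq} => [[a b] [c d]].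
by elim/ord4: j; rewrite !cxE //= normrN.
Qed.
Let iota_half (b : 'I_4*bool) q : (1 < b.1)%N -> halfcube r b q -> halfcube r (b.1, ~~ b.2) (iota q).
Proof.
move=> b1 [cq h]; split; first exact: iota_cube.
have -> : cx b.1 (iota q) = - cx b.1 q.
 by case: (b.1) b1 => [[|[|[|[|//]]]] hi] // _; rewrite /cx /=; case: (q.2).
by move: h; rewrite /sgb /=; case: (b.2) => /=; lra.
Qed.
Let iota_ball q d q' : cball q d q' -> cball (iota q) d (iota q').
Proof. by move=> [h1 h2]; split => //=; rewrite -opprD cnormN. Qed.

Let Sec_iota (b : 'I_4*bool) s : (1 < b.1)%N -> Sec Rl (halfcube r b) s ->
 Sec Rl (halfcube r (b.1, ~~ b.2)) (fun q => s (iota q)).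
Proof.
move=> b1 [h1 h2].
have back q : halfcube r (b.1, ~~ b.2) q -> halfcube r b (iota q).
 by move=> h; have := iota_half (b := (b.1, ~~ b.2)) b1 h; rewrite /= negbK -surjective_pairing.
split=> [q hq|q j hq].
 have [k1 k2] := h1 _ (back _ hq); split => //; rewrite k2 evenpsi //; exact: hq.1.
move=> e e0; have [d d0 hd] := h2 _ j (back _ hq) e e0; exists d => // q' hq' bq.
by apply: hd; [exact: back|exact: iota_ball].
Qed.

(** One turn around [q.2 = 0] is a half turn from [q] to [iota q] followed by the image of that half
    turn under [iota]. Evenness gives both the same sign, so the total sign is a square and the root
    closes up. *)
Lemma even_sqrt : exists s : P -> C, forall q, cube r q -> s q^+2 = psi q /\ ctn (cube r) s q.
Proof.
pose b2 (c : bool) : 'I_4*bool := (inord 2, c); pose b3 (c : bool) : 'I_4*bool := (inord 3, c).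
have g2 (c : bool) : (1 < (b2 c).1)%N by rewrite /= inordK.
have g3 (c : bool) : (1 < (b3 c).1)%N by rewrite /= inordK.
have ex (b : 'I_4*bool) : (1 < b.1)%N -> exists s, Sec Rl (halfcube r b) s.
 move=> hb; exact: (Sec_halfcube_exists act1 relE relA relT relF r0 (fun q => hD hb) relL).
have uniq_ (c d : bool) s s' : Sec Rl (halfcube r (b2 c)) s -> Sec Rl (halfcube r (b3 d)) s' ->
  exists g, forall q, halfcube r (b2 c) q -> halfcube r (b3 d) q -> s q =1 act g (s' q).
 move=> S S'; pose M q := halfcube r (b2 c) q /\ halfcube r (b3 d) q.
 have n23 : nopp (b2 c) (b3 d) by rewrite /nopp /= -val_eqE /= !inordK.
 have fM : fat M by apply: fatW (halfcube_fat3 r0 (nopp_refl (b2 c)) n23 n23) => q [].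
 have MD q : M q -> D q by move=> [/(hD (g2 c))].
 have [g hg] := Sec_unique relA relT relF MD (convexI (@halfcube_convex _ _ _) (@halfcube_convex _ _ _)) fM
  (Sec_sub (fun q (h : M q) => h.2) S') (Sec_sub (fun q (h : M q) => h.1) S).
 by exists g => q h1 h2; apply: hg.
have actK g y : act g (act g y) =1 y.
 by move=> j; rewrite /act /am /ai; case: g; rewrite ?mulN1r ?mulN1r ?opprK ?mul1r.
have actE g y y' : y =1 y' -> act g y =1 act g y' by move=> E j; rewrite /act E.
have [sR SR] := ex (b2 false) (g2 _); have [sT0 ST0] := ex (b3 false) (g3 _).
have [g0 hg0] := uniq_ _ _ _ _ SR ST0.
pose sT q := act g0 (sT0 q); have ST : Sec Rl (halfcube r (b3 false)) sT by apply: Sec_act.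
(* [gL] is the sign of the half turn. Used for both the left and the bottom half-cube, it makes all
   four overlaps match. *)
have [gL hgL] := uniq_ _ _ _ _ (Sec_iota (g2 _) SR) ST.
pose sL q := act gL (sR (iota q)).
have SL : Sec Rl (halfcube r (b2 true)) sL by apply: Sec_act => //; exact: (Sec_iota (g2 _) SR).
pose sB q := act gL (sT (iota q)).
have SB : Sec Rl (halfcube r (b3 true)) sB by apply: Sec_act => //; exact: (Sec_iota (g3 _) ST).
have iR q : halfcube r (b2 true) q -> halfcube r (b2 false) (iota q) by move/(iota_half (g2 _)).
have iL q : halfcube r (b2 false) q -> halfcube r (b2 true) (iota q) by move/(iota_half (g2 _)).
have iT q : halfcube r (b3 true) q -> halfcube r (b3 false) (iota q) by move/(iota_half (g3 _)).
have eLT q : halfcube r (b2 true) q -> halfcube r (b3 false) q -> sL q =1 sT q.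
 by move=> h1 h2 j; rewrite /sL (actE _ _ _ (hgL q h1 h2)) actK.
have eRT q : halfcube r (b2 false) q -> halfcube r (b3 false) q -> sR q =1 sT q by exact: hg0.
have eRB q : halfcube r (b2 false) q -> halfcube r (b3 true) q -> sR q =1 sB q.
 move=> h1 h2 j; rewrite /sB.
 have E := hgL (iota q) (iL _ h1) (iT _ h2); rewrite iotaK in E; exact: E.
have eLB q : halfcube r (b2 true) q -> halfcube r (b3 true) q -> sL q =1 sB q.
 by move=> h1 h2; apply: actE; apply: eRT; [exact: iR|exact: iT].
pose sf (b : 'I_4*bool) := if b.1 == inord 2 then (if b.2 then sL else sR) else (if b.2 then sB else sT).
have Sf (b : 'I_4*bool) : (1 < b.1)%N -> Sec Rl (halfcube r b) (sf b).
 case: b => i c /= hi; have [E|E] : i = inord 2 \/ i = inord 3.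
  by case: i hi => [[|[|[|[|//]]]] hi] // _; [left|right]; apply: val_inj; rewrite /= inordK.
  by rewrite /sf /= E eqxx; case: c.
 by rewrite /sf /= E -val_eqE /= !inordK //=; case: c.
have comp (b b' : 'I_4*bool) q : (1 < b.1)%N -> (1 < b'.1)%N -> halfcube r b q -> halfcube r b' q -> sf b q =1 sf b' q.
 have hE (i : 'I_4) : (1 < i)%N -> i = inord 2 \/ i = inord 3 :> 'I_4.
  by case: i => [[|[|[|[|//]]]] hi] // _; [left|right]; apply: val_inj; rewrite /= inordK.
 case: b b' => i c [i' c'] /= /hE hi /hE hi'.
 have n32 : (inord 3 == inord 2 :> 'I_4) = false by rewrite -val_eqE /= !inordK.
 have opp_ k : halfcube r (k, true) q -> halfcube r (k, false) q -> False.
  by move=> [_ /= h1] [_ /= h2]; move: h1 h2; rewrite /sgb; lra.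
 case: hi => ->; case: hi' => ->; rewrite /sf /= ?eqxx ?n32; case: c; case: c' => // h1 h2;
  first [by case: (opp_ _ h1 h2)|by case: (opp_ _ h2 h1)|by apply: eLT|by apply: eRT|by apply: eRB
   |by apply: eLB|by move=> j; apply: esym; first [exact: eLT|exact: eRT|exact: eRB|exact: eLB]].
have cov q : D q -> exists b : 'I_4*bool, (1 < b.1)%N /\ halfcube r b q.
 move=> [cq q2]; apply: contrapT => H; move/eqP: q2; apply.
 have z (j : 'I_4) : (1 < j)%N -> cx j q = 0.
  move=> hj; apply/eqP; apply: contrapT => /negP; rewrite neq_lt => /orP[h|h]; apply: H.
   by exists (j, true); split => //; split => //=; rewrite /sgb; lra.
  by exists (j, false); split => //; split => //=; rewrite /sgb; lra.
 have := z (inord 2) (g2 true); have := z (inord 3) (g3 true); rewrite !cxE.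
 by case: q {cq H z} => a [c d] /= -> ->.
have /choice[beta hbeta] : forall q, exists b : 'I_4*bool, D q -> (1 < b.1)%N /\ halfcube r b q.
 move=> q; case: (pselect (D q)) => [/cov[b hb]|h]; first by exists b.
 by exists (b2 true).
pose s q := sf (beta q) q.
have [Ss1 Ss2] : Sec Rl D s.
 apply: (Sec_local relE) => q Dq; have [hb1 hb2] := hbeta q Dq.
 have [d d0 hd] := halfcube_near hb2; exists d => //.
 exists (halfcube r (beta q)), (sf (beta q)); split; first exact: Sf.
 move=> q' Dq' bq; have h := hd q' Dq'.1 bq; split => //.
 by have [k1 k2] := hbeta q' Dq'; apply: comp.
(* Across the mirror the root is extended by 0; it is continuous there because its square [psi]
   tends to 0. *)
exists (fun q => if q.2 == 0 then 0 else s q ord0) => q cq.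
have [q2|q2] := eqVneq q.2 0.
 have pq := (psi0 cq).2 q2; split; first by rewrite expr0n pq.
 move=> e e0; have [d d0 hd] := cpsi cq (exprn_gt0 2 e0); exists d => // q' cq' bq.
 rewrite q2 eqxx subr0; case: eqVneq => [_|q2']; first by rewrite cnorm0.
 have [_ E] := Ss1 q' (conj cq' q2'); have := hd q' cq' bq; rewrite pq subr0 -E cnormX.
 by rewrite ltr_pXn2r ?nnegrE ?cnorm_ge0 // ltW.
have Dq : D q by split.
split; first by case: (Ss1 q Dq).
have [d d0 hd] := ctn_neq0 (ctn_snd (cube r) q) q2.
apply: (ctn_local d0); apply: (@ctn_ext _ _ (fun w => s w ord0)); first by rewrite (negbTE q2).
 by move=> q' [cq' bq]; rewrite (negbTE (hd q' cq' bq)).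
by apply: ctnW (Ss2 q ord0 Dq) => q' [cq' bq]; split => //; apply: hd.
Qed.

End EvenSqrt.
End Roots.

(** * The dihedral cover branched along [x^2 + y^k = 0] *)
Section Dihedral.
Variable R : realType.
Local Notation C := (R[i]).
Local Notation P := (C*C)%type.
Local Notation Y := ('I_4 -> C).
Implicit Types (q : P) (z : C).

Let I : C := 'i%C.
Let II : I^+2 = -1. Proof. exact: sqr_i. Qed.
Let I0 : I != 0. Proof. by apply: (@uroot_neq0 _ 4) => //; rewrite (exprM I 2 2) II sqrrN expr1n. Qed.
Let two0 : (2 : C) != 0. Proof. by rewrite pnatr_eq0. Qed.

Definition nf k q : C := q.1^+2 + q.2^+k.
(** The quotient of [C^2] by the dihedral group of order [2k], with discriminant [nf k]. *)
Definition rho k q : P := (I*(q.1^+k + q.2^+k)/2, q.1*q.2).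

(** For [(x, y) = rho k (u, v)] the numbers [u^k] and [v^k] are the roots of [T^2 + 2 i x T + y^k],
    whose discriminant is [-4 (x^2 + y^k)]. *)
Lemma rho_nf k q : nf k (rho k q) = - ((q.1^+k - q.2^+k)/2)^+2.
Proof.
rewrite /nf /rho /= [(q.1*q.2)^+k]exprMn; move: (q.1^+k) (q.2^+k) => a b.
by rewrite !exprMn II; field.
Qed.

Lemma rho_nf0 k q : nf k (rho k q) = 0 <-> q.1^+k = q.2^+k.
Proof.
rewrite rho_nf; split=> [/eqP|->]; last by rewrite subrr mul0r expr0n oppr0.
by rewrite oppr_eq0 expf_eq0 mulf_eq0 invr_eq0 (negbTE two0) orbF subr_eq0 => /eqP.
Qed.

Lemma badP k q : (0 < k)%N -> bad (uroots R k) q <-> q.1^+k = q.2^+k.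
Proof.
move=> k0; have [_ _ hU _] := urootsP R k0; split=> [/hasP[z]|].
 rewrite hU /lform subr_eq0 => /eqP zk /eqP ->; by rewrite exprMn zk mul1r.
move=> /(pow_eq k0)[z zk E]; apply/hasP; exists z; first by rewrite hU zk.
by rewrite /lform E subrr.
Qed.

Lemma rho0 k : (0 < k)%N -> rho k (0, 0) = (0, 0).
Proof. by move=> k0; rewrite /rho /= expr0n gtn_eqF // addr0 mulr0 !mul0r. Qed.

Lemma rho_eq0 k q : (0 < k)%N -> rho k q = (0, 0) -> q = (0, 0).
Proof.
case: q => u v k0 [/eqP]; rewrite !mulf_eq0 invr_eq0 (negbTE two0) (negbTE I0) orbF /= => /eqP h1 /eqP.
rewrite mulf_eq0 => /orP[/eqP h|/eqP h]; move: h1; rewrite h expr0n gtn_eqF // ?add0r ?addr0 => /eqP.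
 by rewrite expf_eq0 k0 /= => /eqP ->.
by rewrite expf_eq0 k0 /= => /eqP ->.
Qed.

Lemma ctn_rho D k q : ctn D (fun w => (rho k w).1) q /\ ctn D (fun w => (rho k w).2) q.
Proof.
by split; rewrite /=; ctnauto.
Qed.

Lemma cnorm_I : cnorm I = 1. Proof. exact: cnorm_i. Qed.

Lemma cnorm_nat n : cnorm (n%:R : C) = n%:R.
Proof. by rewrite -[n%:R in LHS](rmorph_nat (real_complex R)) cnorm_real normr_nat. Qed.

(** Properness at the origin: if [u] stays large while [u v] is small, then [v] is small, and [u^k]
    dominates the sum [u^k + v^k]. *)
Lemma rho_small k (e : R) : (0 < k)%N -> 0 < e -> exists2 d : R, 0 < d &
 forall q, cball (0, 0) d (rho k q) -> cball (0, 0) e q.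
Proof.
move=> k0 e0; have ek := exprn_gt0 k e0.
pose d := Num.min e (e^+k/(2 + e^-1)).
have ep : 0 < 2 + e^-1 by apply: addr_gt0 => //; rewrite invr_gt0.
have d0 : 0 < d by rewrite lt_min e0 divr_gt0.
have d1 : d <= e by minle.
have d2 : d*(2 + e^-1) <= e^+k by rewrite -ler_pdivlMr // ge_min lexx orbT.
have key (u v : C) : cnorm (u^+k + v^+k) < 2*d -> cnorm (u*v) < d -> cnorm u < e.
 move=> h1 h2; rewrite ltNge; apply/negP => ue.
 have vd : cnorm v <= d/e.
  rewrite ler_pdivlMr //; apply: ltW; apply: le_lt_trans h2; rewrite cnormM mulrC.
  by apply: ler_wpM2r => //; exact: cnorm_ge0.
 have de1 : d/e <= 1 by rewrite ler_pdivrMr // mul1r.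
 have vk : cnorm v^+k <= d/e.
  have v1 : cnorm v <= 1 by apply: le_trans de1.
  apply: le_trans vd; rewrite -(prednK k0) exprS -[leRHS]mulr1.
  by rewrite ler_wpM2l ?cnorm_ge0 // exprn_ile1 ?cnorm_ge0.
 have : e^+k <= cnorm u^+k by rewrite lerXn2r ?nnegrE ?cnorm_ge0 // ltW.
 have := cnorm_sub_ge (u^+k) (- v^+k); rewrite opprK cnormN !cnormX.
 have : d*(2 + e^-1) = 2*d + d/e by ring.
 lra.
exists d => // q []; rewrite !subr0 /rho /= => h1 h2.
have h1' : cnorm (q.1^+k + q.2^+k) < 2*d.
 move: h1; rewrite !cnormM cnorm_I mul1r cnormV cnorm_nat ltr_pdivrMr //; lra.
split; rewrite subr0; first exact: key h1' h2.
by apply: (key _ q.1); [rewrite addrC|rewrite mulrC].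
Qed.

Definition zr k (i : 'I_k) : C := nth 1 (uroots R k) i.
(** The deck group of [rho k]; the boolean marks the reflections. *)
Definition dk k (g : 'I_k*bool) q : P :=
 if g.2 then (zr g.1*q.2, (zr g.1)^-1*q.1) else (zr g.1*q.1, (zr g.1)^-1*q.2).

Lemma zrP k (i : 'I_k) : zr i^+k = 1.
Proof.
have k0 : (0 < k)%N by case: i => i; exact: leq_ltn_trans.
have [_ sU hU _] := urootsP R k0; apply/eqP; rewrite -hU; apply: mem_nth; by rewrite sU.
Qed.
Lemma zr_neq0 k (i : 'I_k) : zr i != 0.
Proof. by apply: uroot_neq0 (zrP i); case: i => i; exact: leq_ltn_trans. Qed.
Lemma zr_inj k : injective (@zr k).
Proof.
move=> i j; have k0 : (0 < k)%N by case: i => i; exact: leq_ltn_trans.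
have [uU sU _ _] := urootsP R k0; move=> /eqP; rewrite nth_uniq ?sU // => /eqP E; exact: val_inj.
Qed.
Lemma zr_surj k z : (0 < k)%N -> z^+k = 1 -> exists i : 'I_k, zr i = z.
Proof.
move=> k0 zk; have [_ sU hU _] := urootsP R k0.
have zU : z \in uroots R k by rewrite hU zk.
have hi : (index z (uroots R k) < k)%N by rewrite -{2}sU index_mem.
by exists (Ordinal hi); rewrite /zr /= nth_index.
Qed.

Lemma rho_dk k (g : 'I_k*bool) q : rho k (dk g q) = rho k q.
Proof.
have z0 := zr_neq0 g.1; have zk := zrP g.1.
rewrite /rho /dk; case: (g.2) => /=; rewrite !exprMn exprVn zk invr1 !mul1r ?[q.2^+k + _]addrC; congr pair.
 by field.
by field.
Qed.

(** [u'^k] is a root of the same quadratic polynomial, so it equals [u^k] or [v^k]. *)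
Lemma rho_fibre k q q' : (0 < k)%N -> rho k q = rho k q' -> exists g : 'I_k*bool, q' = dk g q.
Proof.
case: q q' => u v [u' v'] k0 [E1 E2].
have {}E1 : u^+k + v^+k = u'^+k + v'^+k.
 by apply: (mulfI I0); apply: (mulIf (invr_neq0 two0)).
have key (a c a' c' : C) : a^+k + c^+k = a'^+k + c'^+k -> a*c = a'*c' -> a'^+k = a^+k ->
  exists i : 'I_k, a' = zr i*a /\ c' = (zr i)^-1*c.
 move=> F1 F2 F3; have F4 : c'^+k = c^+k by move: F1; rewrite F3 => /addrI ->.
 have [a0|a0] := eqVneq a 0.
  have a'0 : a' = 0.
   by apply/eqP; move/eqP: F3; rewrite a0 expr0n gtn_eqF // expf_eq0 k0.
  have [z zk E] := pow_eq k0 F4.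
  have [|i hi] := @zr_surj k z^-1 k0; first by rewrite exprVn zk invr1.
  by exists i; rewrite a'0 a0 mulr0 hi invrK.
 have [z zk E] := pow_eq k0 F3; have [i hi] := zr_surj k0 zk; exists i; rewrite hi; split => //.
 have z0 := uroot_neq0 k0 zk; move: F2; rewrite E => F2; apply: (mulfI a0).
 by rewrite mulrCA F2; field.
have F : (u'^+k - u^+k)*(u'^+k - v^+k) = 0.
 have -> : (u'^+k - u^+k)*(u'^+k - v^+k) = u'^+k*(u'^+k - (u^+k + v^+k)) + (u*v)^+k.
  by rewrite exprMn; ring.
 by rewrite E1 E2 exprMn; ring.
move/eqP: F; rewrite mulf_eq0 !subr_eq0 => /orP[/eqP F|/eqP F].
 by have [i [-> ->]] := key _ _ _ _ E1 E2 F; exists (i, false).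
have [||i [-> ->]] := key v u u' v' _ _ F; [by rewrite addrC|by rewrite mulrC|].
by exists (i, true).
Qed.

Lemma dk_free k (g g' : 'I_k*bool) q : q.1^+k <> q.2^+k -> dk g q = dk g' q -> g = g'.
Proof.
case: g g' q => i b [i' b'] [u v] /= nb.
have k0 : (0 < k)%N by case: i => i; exact: leq_ltn_trans.
have z0 := zr_neq0 i; have z0' := zr_neq0 i'.
have cross (a c : C) z z' : z^+k = 1 -> z'^+k = 1 -> z*a = z'*c -> a^+k = c^+k.
 by move=> h1 h2 /(congr1 (fun x => x^+k)); rewrite !exprMn h1 h2 !mul1r.
have same (a c : C) : a^+k <> c^+k -> zr i*a = zr i'*a -> (zr i)^-1*c = (zr i')^-1*c -> i = i'.
 move=> ac h1 h2; apply: zr_inj; have [a0|a0] := eqVneq a 0; last exact: (mulIf a0).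
 have c0 : c != 0 by apply/eqP => c0; apply: ac; rewrite a0 c0.
 by apply: invr_inj; apply: (mulIf c0).
rewrite /dk; case: b; case: b' => /= -[h1 h2].
- by rewrite (same v u) // => /esym.
- by case: nb; apply: esym; apply: (cross _ _ _ _ (zrP i) (zrP i') h1).
- by case: nb; apply: (cross _ _ _ _ (zrP i) (zrP i') h1).
- by rewrite (same u v).
Qed.

Lemma dk_cont D k (g : 'I_k*bool) q : ctn D (fun w => (dk g w).1) q /\ ctn D (fun w => (dk g w).2) q.
Proof.
rewrite /dk; case: (g.2) => /=; split; ctnauto.
Qed.

Lemma dk_norm k (g : 'I_k*bool) q (e : R) : cball (0, 0) e q -> cball (0, 0) e (dk g q).
Proof.
have k0 : (0 < k)%N by case: (g.1) => i; exact: leq_ltn_trans.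
have z1 : cnorm (zr g.1) = 1 := uroot_norm k0 (zrP g.1).
rewrite /cball /dk /= !subr0 => -[h1 h2]; case: (g.2) => /=; rewrite ?subr0 !cnormM cnormV z1 invr1 !mul1r; by split.
Qed.

Section Lift.
Variables (d : nat) (d0 : (0 < d)%N) (ls : seq C) (Dom : P -> Prop) (phi : P -> P).
Hypothesis phi0 : forall q, Dom q -> phi q <> (0, 0).
Hypothesis phib : forall q, Dom q -> (bad ls q <-> nf d (phi q) = 0).
Hypothesis phic : forall q, Dom q -> ctn Dom (fun w => (phi w).1) q /\ ctn Dom (fun w => (phi w).2) q.
Hypothesis phis : forall q, Dom q -> bad ls q -> exists2 e : R, 0 < e & exists s : P -> C,
 forall q', Dom q' -> cball q e q' -> s q'^+2 = - nf d (phi q') /\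
  ctn (fun w => Dom w /\ cball q e w) s q'.

Let j0 : 'I_4 := inord 0.
Let j1 : 'I_4 := inord 1.
Let prY (y : Y) : P := (y j0, y j1).
Let mkY (q : P) : Y := fun j => if j == j0 then q.1 else if j == j1 then q.2 else 0.
(** A point of the cover occupies two slots of [C^4]; the others are zero. *)
Let Rl q (y : Y) := (forall j, j != j0 -> j != j1 -> y j = 0) /\ rho d (prY y) = phi q.
Let ai (g : 'I_d*bool) (j : 'I_4) : 'I_4 :=
 if g.2 then (if j == j0 then j1 else if j == j1 then j0 else j) else j.
Let am (g : 'I_d*bool) (j : 'I_4) : C :=
 if j == j0 then zr g.1 else if j == j1 then (zr g.1)^-1 else 1.
Local Notation act := (act ai am).
Let j10 : (j1 == j0) = false. Proof. by rewrite -val_eqE /= !inordK. Qed.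

Let prY_mk q : prY (mkY q) = q.
Proof. by case: q => a b; rewrite /prY /mkY eqxx j10 eqxx. Qed.
Let prY_act g y : prY (act g y) = dk g (prY y).
Proof. by rewrite /prY /act /ai /am /dk eqxx j10 eqxx; case: (g.2). Qed.
Let act_oth g y j : j != j0 -> j != j1 -> act g y j = y j.
Proof. by move=> h0 h1; rewrite /act /ai /am (negbTE h0) (negbTE h1) mul1r; case: (g.2). Qed.
Let Yext (y y' : Y) : (forall j, j != j0 -> j != j1 -> y j = y' j) -> prY y = prY y' -> y =1 y'.
Proof.
move=> h [h0 h1] j; have [->//|n0] := eqVneq j j0; have [->//|n1] := eqVneq j j1; exact: h.
Qed.

Let e1_ex : exists e : 'I_d*bool, forall y, act e y =1 y.
Proof.
have [|i hi] := @zr_surj d 1 d0; first by rewrite expr1n.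
exists (i, false) => y j; rewrite /act /ai /am /= hi invr1; by do 2?case: ifP => _; rewrite mul1r.
Qed.
Let e := projT1 (cid e1_ex).
Let act1 y : act e y =1 y. Proof. exact: (projT2 (cid e1_ex)). Qed.
Let relE q y y' : y =1 y' -> Rl q y -> Rl q y'.
Proof.
by move=> E [h1 h2]; split; [move=> j n0 n1; rewrite -E; apply: h1|rewrite /prY -!E].
Qed.
Let relA q y g : Rl q y -> Rl q (act g y).
Proof.
move=> [h1 h2]; split; last by rewrite prY_act rho_dk.
by move=> j n0 n1; rewrite act_oth // h1.
Qed.
Let relT q y y' : Dom q -> ~~ bad ls q -> Rl q y -> Rl q y' -> exists g, y' =1 act g y.
Proof.
move=> _ _ [h1 h2] [k1 k2]; have [g hg] := @rho_fibre d (prY y) (prY y') d0 (etrans h2 (esym k2)).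
exists g; apply: Yext; last by rewrite prY_act.
by move=> j n0 n1; rewrite act_oth // h1 // k1.
Qed.
Let relF q y g g' : Dom q -> ~~ bad ls q -> Rl q y -> act g y =1 act g' y -> g = g'.
Proof.
move=> Dq nb [h1 h2] E; apply: (@dk_free d g g' (prY y)).
 by move=> /rho_nf0; rewrite h2 => /(phib Dq); rewrite (negbTE nb).
by rewrite -!prY_act /prY !E.
Qed.
Let relL q : Dom q -> exists2 d : R, 0 < d & exists s, Sec Rl (fun q' => Dom q' /\ cball q d q') s.
Proof.
move=> Dq.
have [e1 e10 [s hs]] : exists2 e : R, 0 < e & exists s : P -> C,
 forall q', Dom q' -> cball q e q' -> s q'^+2 = - nf d (phi q') /\
  ctn (fun w => Dom w /\ cball q e w) s q'.
 case: (boolP (bad ls q)) => [b|nb]; first exact: phis.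
 have [c hc] := nroot_ex (- nf d (phi q)) (isT : (0 < 2)%N).
 have c0 : c != 0.
  apply: contraNneq nb => z; apply/(phib Dq); apply/eqP; by rewrite -oppr_eq0 -hc z expr0n.
 have cf w : Dom w -> ctn Dom (fun w => - nf d (phi w)) w.
  by move=> Dw; have [h1 h2] := phic Dw; apply: ctnN; apply: ctnD; apply: ctnX.
 have [r r0 [s [_ hs]]] := local_nroot (isT : (0 < 2)%N) Dq cf hc c0 ltr01.
 by exists r => //; exists s => w Dw b; case: (hs w Dw b).
pose D1 w := Dom w /\ cball q e1 w.
have D1q : D1 q by split => //; apply: cball_refl.
(* [xi + s] and [xi - s] are the two candidates for the [d]-th power of the first coordinate of a
   lift. *)
pose xi w := - I*(phi w).1.
have cxi w : D1 w -> ctn D1 xi w.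
 move=> [Dw b]; apply: ctnM; first exact: ctn_cst.
 by apply: ctnW (phic Dw).1 => x [].
have cs w : D1 w -> ctn D1 s w by move=> [Dw b]; case: (hs w Dw b).
have xis w : D1 w -> (xi w + s w)*(xi w - s w) = (phi w).2^+d.
 move=> [Dw b]; have [E _] := hs w Dw b.
 have -> : (xi w + s w)*(xi w - s w) = xi w^+2 - s w^+2 by ring.
 by rewrite E /xi exprMn sqrrN II /nf; ring.
(* Both candidates vanish only over the origin, which [phi] avoids. A nonzero one has a continuous
   [d]-th root, and the second coordinate follows by division. *)
have [sg [sg1 sg0]] : exists sg : C, sg^+2 = 1 /\ xi q + sg*s q != 0.
 have [z|nz] := eqVneq (xi q + s q) 0; last by exists 1; rewrite expr1n mul1r.
 exists (-1); rewrite sqrrN expr1n mulN1r; split => //; apply/eqP => z2.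
 apply: (phi0 Dq); have x0 : xi q = 0.
  by apply: (mulfI two0); rewrite mulr0; transitivity ((xi q + s q) + (xi q - s q)); [ring|rewrite z z2 addr0].
 have := xis q D1q; rewrite z mul0r => /esym/eqP; rewrite expf_eq0 d0 /= => /eqP y0.
 move/eqP: x0; rewrite /xi mulf_eq0 oppr_eq0 (negbTE I0) /= => /eqP x0.
 by rewrite [phi q]surjective_pairing x0 y0.
pose f w := xi w + sg*s w.
have cf w : D1 w -> ctn D1 f w.
 by move=> Dw; apply: ctnD; [exact: cxi|apply: ctnM; [exact: ctn_cst|exact: cs]].
have [c hc] := nroot_ex (f q) d0.
have c0 : c != 0 by apply: contraNneq sg0 => z; rewrite -/(f q) -hc z expr0n gtn_eqF.
have [r r0 [a [_ ha]]] := local_nroot d0 D1q cf hc c0 (cnorm_gt0 c0).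
have a0 w : D1 w -> cball q r w -> a w != 0.
 move=> Dw b; have [_ h _] := ha w Dw b; apply/eqP => z; move: h; by rewrite z sub0r cnormN ltxx.
exmin e1 r.
have split_ w : Dom w /\ cball q (Num.min e1 r) w -> D1 w /\ cball q r w.
 move=> [Dw b]; split; [split => //|]; apply: cballW b; by minle.
exists (fun w => mkY (a w, (phi w).2/a w)); split=> [w /split_[Dw b]|w j h].
 split; first by move=> j n0 n1; rewrite /mkY (negbTE n0) (negbTE n1).
 rewrite prY_mk /rho /=; have [E _ _] := ha w Dw b; have aw := a0 w Dw b.
 have fw : f w != 0 by rewrite -E expf_neq0.
 have E2 : ((phi w).2/a w)^+d = xi w - sg*s w.
  rewrite expr_div_n E -(xis w Dw); apply: (mulIf fw); rewrite divfK // /f.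
  have -> : (xi w + s w)*(xi w - s w) = xi w^+2 - sg^+2*s w^+2 by rewrite sg1; ring.
  ring.
 rewrite E E2 /f [RHS]surjective_pairing; congr pair; last by field.
 have -> : I*(xi w + sg*s w + (xi w - sg*s w))/2 = I*xi w by field.
 by rewrite /xi mulrA mulrN -expr2 II opprK mul1r.
have [Dw b] := split_ w h; have aw := a0 w Dw b; have [_ _ ca] := ha w Dw b.
have ca' : ctn (fun q' => Dom q' /\ cball q (Num.min e1 r) q') a w by apply: ctnW ca => x /split_.
rewrite /mkY; case: (j == j0) => //=; case: (j == j1); last exact: ctn_cst.
apply: ctnM; last exact: ctnV.
by apply: ctnW (phic Dw.1).2 => x [].
Qed.

Definition isLift (N : P -> Prop) (H : P -> P) :=
 (forall q, N q -> rho d (H q) = phi q) /\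
 forall q, N q -> ctn N (fun w => (H w).1) q /\ ctn N (fun w => (H w).2) q.

Lemma lift_exists r : 0 < r -> (forall q, pcube r q -> Dom q) -> exists H, isLift (pcube r) H.
Proof.
move=> r0 rD; have [s [h1 h2]] := Sec_pcube_exists act1 relE relA relT relF r0 rD relL.
exists (fun q => prY (s q)); split=> [q pq|q pq]; first by case: (h1 q pq).
by split; apply: h2.
Qed.

Lemma lift_unique r H H' : 0 < r -> (forall q, pcube r q -> Dom q) ->
 isLift (pcube r) H -> isLift (pcube r) H' ->
 exists g : 'I_d*bool, forall q, pcube r q -> H' q = dk g (H q).
Proof.
move=> r0 rD [h1 h2] [k1 k2].
have toS K : isLift (pcube r) K -> Sec Rl (pcube r) (fun q => mkY (K q)).
 move=> [l1 l2]; split=> [q pq|q j pq].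
  split; first by move=> j n0 n1; rewrite /mkY (negbTE n0) (negbTE n1).
  by rewrite prY_mk l1.
 rewrite /mkY; case: (j == j0); first by case: (l2 q pq).
 by case: (j == j1); [case: (l2 q pq)|exact: ctn_cst].
have [g hg] := Sec_pcube_unique relA relT relF r0 rD (toS H (conj h1 h2)) (toS H' (conj k1 k2)).
exists g => q pq; rewrite -[H q]prY_mk -prY_act -[LHS]prY_mk /prY.
by have E := hg q pq; rewrite !E.
Qed.

End Lift.

(** Near a mirror of the dihedral group the reflection makes any invariant function even. *)
Lemma mirror_sqrt k (f : P -> C) (Dom : P -> Prop) q0 : (0 < k)%N ->
 (exists2 r : R, 0 < r & forall q, cball q0 r q -> Dom q) -> Dom q0 -> q0 <> (0, 0) ->
 (forall q, Dom q -> ctn Dom f q) ->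
 (forall q q', Dom q -> Dom q' -> rho k q = rho k q' -> f q = f q') ->
 (forall q, Dom q -> (f q = 0 <-> q.1^+k = q.2^+k)) -> f q0 = 0 ->
 exists2 e : R, 0 < e & exists s : P -> C,
 forall q', Dom q' -> cball q0 e q' -> s q'^+2 = f q' /\ ctn (fun w => Dom w /\ cball q0 e w) s q'.
Proof.
move=> k0 [r1 r10 hr1] D0 q00 cf inv f0 fq0.
have [z zk Ez] := pow_eq k0 ((f0 q0 D0).1 fq0).
have z0 := uroot_neq0 k0 zk; have z1 := uroot_norm k0 zk.
have u0 : q0.1 != 0.
 apply/eqP => u0; apply: q00; move/eqP: (Ez); rewrite u0 eq_sym mulf_eq0 (negbTE z0) /= => /eqP v0.
 by rewrite [q0]surjective_pairing u0 v0.
have [r2 r20 sep] := root_sep k0 u0.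
(* [back] inverts the coordinates along and across the mirror [q.1 = z q.2], centred at [q0]. The
   reflection exchanges [q.1] and [z q.2], so it changes the sign of the second coordinate only. *)
pose p0 := q0.1 + z*q0.2.
pose back (w : P) : P := ((w.1 + p0 + w.2)/2, z^-1*(w.1 + p0 - w.2)/2).
pose r := Num.min (r1/4) (r2/4).
have r0 : 0 < r by rewrite lt_min !divr_gt0.
have rr1 : r <= r1/4 by minle.
have rr2 : r <= r2/4 by minle.
have cubeN w : cube r w -> cnorm w.1 <= 2*r /\ cnorm w.2 <= 2*r.
 move=> cw; have c0 := cw (inord 0); have c1 := cw (inord 1); have c2 := cw (inord 2); have c3 := cw (inord 3).
 move: c0 c1 c2 c3; rewrite !cxE => c0 c1 c2 c3.
 have := cnorm_le_ReIm w.1; have := cnorm_le_ReIm w.2; move=> *; split; lra.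
have b1 w : (back w).1 - q0.1 = (w.1 + w.2)/2.
 by rewrite /back /= /p0 Ez; field.
have b2 w : (back w).2 - q0.2 = z^-1*(w.1 - w.2)/2.
 by rewrite /back /= /p0 Ez; field.
have b2' w : z*(back w).2 - q0.1 = (w.1 - w.2)/2.
 by rewrite /back /= /p0 Ez; field.
have half_le (a b : C) : cnorm a <= 2*r -> cnorm b <= 2*r -> cnorm ((a + b)/2) <= 2*r.
 move=> ha hb; rewrite cnormM cnormV cnorm_nat ler_pdivrMr //; have := cnormD a b; lra.
have bN w : cube r w -> [/\ cnorm ((back w).1 - q0.1) <= 2*r, cnorm ((back w).2 - q0.2) <= 2*r
   & cnorm (z*(back w).2 - q0.1) <= 2*r].
 move=> /cubeN[h1 h2]; rewrite b1 b2 b2'.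
 have -> : cnorm (z^-1*(w.1 - w.2)/2) = cnorm ((w.1 - w.2)/2).
  by rewrite -(mulrA z^-1) (cnormM z^-1) (cnormV z) z1 invr1 mul1r.
 by split; [exact: half_le|apply: half_le; rewrite ?cnormN|apply: half_le; rewrite ?cnormN].
have bD w : cube r w -> Dom (back w).
 by move=> cw; apply: hr1; have [h1 h2 _] := bN w cw; split; lra.
pose psi w := f (back w).
have cpsi w : cube r w -> ctn (cube r) psi w.
 move=> cw; apply: (ctn_comp2 (E := Dom)) => //; first exact: cf (bD w cw).
  by rewrite /=; ctnauto.
 by rewrite /=; ctnauto.
have cubeo w : cube r w -> cube r (w.1, - w.2).
 move=> cw j; move: (cw j); case: w {cw} => [[a b] [c d]].
 by elim/ord4: j; rewrite !cxE //= normrN.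
have evenpsi w : cube r w -> psi (w.1, - w.2) = psi w.
 move=> cw; apply: inv; [exact: bD (cubeo w cw)|exact: bD|].
 have [i hi] := zr_surj k0 zk.
 rewrite -[RHS](rho_dk (i, true)) /dk /= hi; congr rho; rewrite /back /=; congr pair; by field.
have psi0 w : cube r w -> (psi w = 0 <-> w.2 = 0).
 move=> cw; have [h1 h2 h3] := bN w cw; rewrite /psi f0; last exact: bD.
 have E : (z*(back w).2)^+k = (back w).2^+k by rewrite exprMn zk mul1r.
 have D : (back w).1 - z*(back w).2 = w.2 by rewrite /back /=; field.
 split=> [F|w2].
  rewrite -D; apply/eqP; rewrite subr_eq0; apply/eqP.
  apply: sep; [lra|lra|by rewrite E].
 by rewrite -E; congr (_^+_); apply/eqP; rewrite -subr_eq0 D w2.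
have [s hs] := even_sqrt r0 cpsi evenpsi psi0.
pose fwd q : P := (q.1 + z*q.2 - p0, q.1 - z*q.2).
have fb q : back (fwd q) = q by case: q => a b; rewrite /back /fwd /=; congr pair; field.
exists (r/2); first by rewrite divr_gt0.
have fc q : cball q0 (r/2) q -> cube r (fwd q).
 move=> [h1 h2].
 have n1 : cnorm (fwd q).1 <= r.
  have -> : (fwd q).1 = (q.1 - q0.1) + z*(q.2 - q0.2) by rewrite /fwd /p0 /=; ring.
  apply: le_trans (cnormD _ _) _; rewrite cnormM z1 mul1r; lra.
 have n2 : cnorm (fwd q).2 <= r.
  have -> : (fwd q).2 = (q.1 - q0.1) - z*(q.2 - q0.2) by rewrite /fwd /= Ez; ring.
  apply: le_trans (cnormB _ _) _; rewrite cnormM z1 mul1r; lra.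
 move=> j; elim/ord4: j; rewrite !cxE.
 - exact: le_trans (Re_le_cnorm _) n1. - exact: le_trans (Im_le_cnorm _) n1.
 - exact: le_trans (Re_le_cnorm _) n2. - exact: le_trans (Im_le_cnorm _) n2.
exists (fun q => s (fwd q)) => q' Dq' bq; have [E cs] := hs _ (fc _ bq).
split; first by rewrite E /psi fb.
apply: (ctn_comp2 (E := cube r)) => //; last by move=> w [_ /fc].
 by rewrite /=; ctnauto.
by rewrite /=; ctnauto.
Qed.

End Dihedral.

(** * The exponent of [x^2 + y^k] as a topological invariant *)

Section NormalFormsA.
Variable R : realType.
Local Notation C := (R[i]).
Local Notation P := (C*C)%type.
Implicit Types (q : P) (z : C).

Lemma pcube_ball (r : R) q : 0 < r -> cball (0, 0) r q -> cube r q.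
Proof. by move=> r0 b j; have := cx_ball j b; rewrite cx0 subr0 => /ltW. Qed.
Lemma cube_ball (r : R) q : 0 < r -> cube r q -> cball (0, 0) (4*r) q.
Proof.
move=> r0 cq; apply: ball_cx => j; rewrite cx0 subr0; apply: le_lt_trans (cq j) _; lra.
Qed.

Lemma copen_neq0 : copen (fun q : P => q <> (0, 0)).
Proof.
move=> q q0; apply: contrapT => H; apply: q0; apply: cball_eq => e e0; apply: contrapT => nb.
apply: H; exists e => // q' b E; apply: nb; rewrite E in b; exact: cball_sym.
Qed.

Section Pull.
Variables (k : nat) (k0 : (0 < k)%N) (X2 : P -> Prop) (U V : P -> Prop) (h g : P -> P).
Hypotheses (oU : copen U) (U0 : U (0, 0)) (he : heo U V h g) (h0 : h (0, 0) = (0, 0)).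
Hypothesis hX : forall q, U q -> (nf k q = 0 <-> X2 (h q)).

Definition pdom q := U (rho k q) /\ q <> (0, 0).
Definition pphi q := h (rho k q).

Lemma pdom_open : copen pdom.
Proof.
apply: copenI copen_neq0; move=> q Uq; have [e e0 hd] := oU Uq.
have cr : ccont_on (fun=> True) (rho k : P -> P) by apply/ccont_ctn => w _; exact: ctn_rho.
by have [d d0 hd'] := cr q I e e0; exists d => // q' b; apply: hd; apply: hd'.
Qed.

Lemma pphi_neq0 q : pdom q -> pphi q <> (0, 0).
Proof.
move=> [Uq q0] E; apply: q0; apply: (rho_eq0 k0); have [_ _ gh _ _] := he.
by rewrite -(gh _ Uq) -/(pphi q) E -h0 gh.
Qed.

Lemma pphi_bad q : pdom q -> (bad (uroots R k) q <-> X2 (pphi q)).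
Proof. by move=> [Uq _]; rewrite badP // -rho_nf0 hX. Qed.

Lemma pphi_ctn q : pdom q -> ctn pdom (fun w => (pphi w).1) q /\ ctn pdom (fun w => (pphi w).2) q.
Proof.
move=> [Uq _]; have [_ _ _ _ [/ccont_ctn ch _]] := he; have [c1 c2] := ch _ Uq.
have [r1 r2] := @ctn_rho R pdom k q.
split; first by apply: (@ctn_comp2 R pdom U (fun p => (h p).1) (rho k)) => // w [].
by apply: (@ctn_comp2 R pdom U (fun p => (h p).2) (rho k)) => // w [].
Qed.

Lemma pphi_small (e : R) : 0 < e -> exists2 d : R, 0 < d &
 forall q, cball (0, 0) d q -> U (rho k q) /\ cball (0, 0) e (pphi q).
Proof.
move=> e0; have [_ _ _ _ [ch _]] := he; have [e1 e10 h1] := ch _ U0 e e0.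
have [e2 e20 h2] := oU U0; pose e3 := Num.min e1 e2.
have e30 : 0 < e3 by rewrite lt_min e10.
have cr : ccont_on (fun=> True) (rho k : P -> P) by apply/ccont_ctn => w _; exact: ctn_rho.
have [d d0 hd] := cr (0, 0) I e3 e30; exists d => // q b.
have := hd q I b; rewrite rho0 // => b3.
have Uq : U (rho k q) by apply: h2; cmin b3.
split => //; rewrite -h0; apply: h1 => //; apply: cballW b3; by minle.
Qed.

Lemma pdom_cube : exists2 r : R, 0 < r & forall q, pcube r q -> pdom q.
Proof.
have [d d0 hd] := pphi_small ltr01; exists (d/4); first by rewrite divr_gt0.
move=> q [cq q0]; split => //; apply: (hd q _).1.
have := cube_ball (divr_gt0 d0 _) cq; have -> : 4*(d/4) = d by field.
by apply.
Qed.

Lemma pphi_inv q q' : rho k q = rho k q' -> pphi q = pphi q'.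
Proof. by rewrite /pphi => ->. Qed.
End Pull.

(** The function [- nf d (h (rho k q))] is constant on the fibres of [rho k] and vanishes exactly on
    its mirrors, so [mirror_sqrt] gives the square root near the mirrors that the lift requires. *)
Lemma pull_lift k d (k0 : (0 < k)%N) (d0 : (0 < d)%N) (U V : P -> Prop) (h g : P -> P) :
 copen U -> U (0, 0) -> heo U V h g -> h (0, 0) = (0, 0) ->
 (forall q, U q -> (nf k q = 0 <-> nf d (h q) = 0)) ->
 forall r, 0 < r -> (forall q, pcube r q -> pdom k U q) ->
 exists H, isLift d (pphi k h) (pcube r) H.
Proof.
move=> oU U0 he h0 hX r r0 rD.
apply: (lift_exists d0 (ls := uroots R k) (Dom := pdom k U)) => //.
- by move=> q; apply: (pphi_neq0 k0 U0 he).
- by move=> q; apply: (pphi_bad k0 (X2 := fun p => nf d p = 0) hX).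
- by move=> q; apply: (pphi_ctn he).
move=> q Dq bq; apply: (@mirror_sqrt R k (fun w => - nf d (pphi k h w)) (pdom k U) q) => //.
- by have [e e0 hee] := pdom_open oU Dq; exists e.
- by case: Dq.
- move=> w Dw; have [c1 c2] := pphi_ctn he Dw; apply: ctnN; apply: ctnD; exact: ctnX.
- by move=> w w' _ _ E; rewrite (pphi_inv h E).
- move=> w Dw; rewrite -badP // (pphi_bad k0 (X2 := fun p => nf d p = 0) hX Dw).
 by split=> [/eqP|->]; rewrite ?oppr0 // oppr_eq0 => /eqP.
by apply/eqP; rewrite oppr_eq0; apply/eqP/(pphi_bad k0 (X2 := fun p => nf d p = 0) hX Dq).
Qed.

Lemma dk_inj k (g : 'I_k*bool) : injective (@dk R k g).
Proof.
move=> [u v] [u' v']; have z0 := zr_neq0 R g.1.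
rewrite /dk; case: (g.2) => /= -[/(mulfI z0) -> /(mulfI (invr_neq0 z0)) -> //].
Qed.

Lemma dk_neq0 k (g : 'I_k*bool) q : (0 < k)%N -> q <> (0, 0) -> @dk R k g q <> (0, 0).
Proof.
move=> k0 q0 E; apply: q0; apply: (dk_inj (g := g)); rewrite E /dk.
by case: (g.2); rewrite /= !mulr0.
Qed.

(** A lift [H] of [h] transports deck elements from order [2k] to order [2d]. A lift of the inverse
    composed with [H] covers the identity, hence is a deck element itself; this makes the transport
    injective. *)
Lemma nf_equiv_le k d : (0 < k)%N -> (0 < d)%N ->
 top_equiv_germ (fun q : P => nf k q = 0) (0, 0) (fun q : P => nf d q = 0) (0, 0) -> (k <= d)%N.
Proof.
move=> k0 d0 /top_equivP[U [V [h [g [[oU oV U0 V0 he] [h0 hX]]]]]].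
have [hUV gVU gh hg [ch cg]] := he.
have g0 : g (0, 0) = (0, 0) by rewrite -{1}h0 gh.
have he' : heo V U g h by split.
have hX' q : V q -> (nf d q = 0 <-> nf k (g q) = 0).
 by move=> Vq; rewrite (hX _ (gVU _ Vq)) hg.
have [r r0 rD] := pdom_cube k0 oU U0 he h0; have [r' r'0 rD'] := pdom_cube d0 oV V0 he' g0.
have [H lH] := pull_lift k0 d0 oU U0 he h0 hX r0 rD.
have [H' lH'] := pull_lift d0 k0 oV V0 he' g0 hX' r'0 rD'.
have Hn q : pcube r q -> H q <> (0, 0).
 by move=> pq E; have [h1 _] := lH; apply: (pphi_neq0 k0 U0 he h0 (rD q pq)); rewrite -(h1 q pq) E rho0.
have [r1 r10 [r1r hr1]] : exists2 r1, 0 < r1 & r1 <= r /\ forall q, pcube r1 q -> pcube r' (H q).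
 have [e e0 he1] := rho_small d0 r'0.
 have [d1 d10 hd1] := pphi_small k0 oU U0 he h0 e0.
 have d14 : 0 < d1/4 by rewrite divr_gt0.
 exmin r (d1/4).
 split; first by minle.
 move=> q [cq q0]; have pq : pcube r q by split => // j; apply: le_trans (cq j) _; minle.
 split; last exact: Hn.
 apply: pcube_ball => //; apply: he1; have [-> // _] := lH.
 apply: (hd1 q _).2; have c4 : cube (d1/4) q by move=> j; apply: le_trans (cq j) _; minle.
 by have := cube_ball d14 c4; have -> : 4*(d1/4) = d1 by field.
have pcubeW (a b : R) q : a <= b -> pcube a q -> pcube b q.
 by move=> ab [cq q0]; split => // j; apply: le_trans ab.
pose r2 := r1/4; have r20 : 0 < r2 by rewrite divr_gt0.
have r21 : r2 <= r1 by rewrite /r2; lra.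
have dkc (G : 'I_k*bool) q : pcube r2 q -> pcube r1 (dk G q).
 move=> [cq q0]; split; last exact: dk_neq0.
 apply: pcube_ball => //; apply: dk_norm; have := cube_ball r20 cq; by have -> : 4*r2 = r1 by rewrite /r2; field.
have ctr r3 K : r3 <= r -> (forall q, pcube r3 q -> pcube r (K q)) ->
  (forall q, pcube r3 q -> ctn (pcube r3) (fun w => (K w).1) q /\ ctn (pcube r3) (fun w => (K w).2) q) ->
  forall q, pcube r3 q -> ctn (pcube r3) (fun w => (H (K w)).1) q /\ ctn (pcube r3) (fun w => (H (K w)).2) q.
 move=> _ hK cK q pq; have [c1 c2] := cK q pq; have [_ cH] := lH; have [d1 d2] := cH _ (hK q pq).
 split; first exact: (@ctn_comp2 R _ (pcube r) (fun p => (H p).1) K).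
 exact: (@ctn_comp2 R _ (pcube r) (fun p => (H p).2) K).
(* [H] composed with a deck element lifts the same map, so it is [H] followed by a deck element of
   the target. The smaller cube is mapped into the domain of [H] by every deck element. *)
have /choice[th hth] : forall G : 'I_k*bool, exists G' : 'I_d*bool,
  forall q, pcube r2 q -> H (dk G q) = dk G' (H q).
 move=> G; apply: (lift_unique d0 (ls := uroots R k) (Dom := pdom k U) (phi := pphi k h)) => //.
 - by move=> q; apply: (pphi_bad k0 (X2 := fun p => nf d p = 0) hX).
 - by move=> q /(pcubeW _ _ _ r21)/(pcubeW _ _ _ r1r)/rD.
 - have [l1 l2] := lH; split=> [q /(pcubeW _ _ _ r21)/(pcubeW _ _ _ r1r)/l1 //|q pq].
  have [c1 c2] := l2 q (pcubeW _ _ _ r1r (pcubeW _ _ _ r21 pq)).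
  by split; [apply: ctnW c1|apply: ctnW c2] => w /(pcubeW _ _ _ r21)/(pcubeW _ _ _ r1r).
 - split=> [q pq|].
   have [l1 _] := lH; rewrite l1; last by apply: (pcubeW _ _ _ r1r); apply: dkc.
   by apply: pphi_inv; rewrite rho_dk.
  apply: ctr; [by apply: le_trans r1r|by move=> q /(dkc G)/(pcubeW _ _ _ r1r)|by move=> q _; exact: dk_cont].
(* Both [H' H] and the identity lift [rho k] itself. *)
have [G0 hG0] : exists G0 : 'I_k*bool, forall q, pcube r1 q -> H' (H q) = dk G0 q.
 apply: (lift_unique k0 (ls := uroots R k) (Dom := fun q => q <> (0, 0)) (phi := rho k)) => //.
 - by move=> q _; rewrite badP // -rho_nf0.
 - by move=> q [].
 - by split => // q _; split; [exact: ctn_fst|exact: ctn_snd].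
 - split=> [q pq|q pq].
   have [l1 _] := lH; have [l1' _] := lH'; rewrite l1'; last exact: hr1.
   rewrite /pphi l1; last exact: pcubeW pq.
   rewrite /pphi gh //; exact: (rD q (pcubeW _ _ _ r1r pq)).1.
  have [_ cH] := lH; have [c1 c2] := cH q (pcubeW _ _ _ r1r pq).
  have [_ cH'] := lH'; have [d1 d2] := cH' _ (hr1 q pq).
  have c1' := ctnW (fun w => @pcubeW r1 r w r1r) c1; have c2' := ctnW (fun w => @pcubeW r1 r w r1r) c2.
  split; first exact: (@ctn_comp2 R _ (pcube r') (fun p => (H' p).1) H).
  exact: (@ctn_comp2 R _ (pcube r') (fun p => (H' p).2) H).
have inj : injective th.
 move=> G G' E.
 have F : fat (pcube r2) by apply: fatW (halfcube_fat (inord 0, false) r20) => q /halfcube_sub.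
 have [q pq nb] := fat_generic (uroots R k) F.
 apply: (dk_free (q := q)); first by move/badP => /(_ k0); rewrite (negbTE nb).
 apply: (dk_inj (g := G0)); rewrite -!hG0; try exact: dkc.
 by rewrite !hth // E.
have := leq_card th inj; rewrite !card_prod !card_ord card_bool leq_pmul2r //.
Qed.

Lemma nf_equiv_eq k d : (0 < k)%N -> (0 < d)%N ->
 top_equiv_germ (fun q : P => nf k q = 0) (0, 0) (fun q : P => nf d q = 0) (0, 0) -> k = d.
Proof.
move=> k0 d0 H; apply/eqP; rewrite eqn_leq (nf_equiv_le k0 d0 H).
exact: nf_equiv_le d0 k0 (top_equiv_sym H).
Qed.

End NormalFormsA.

(** * Connectedness of the punctured disc *)

Section PuncturedDisc.
Variable R : realType.
Local Notation C := (R[i]).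

(** The segment between two points avoids 0 unless they lie on opposite rays; in that case the path
    turns at [i t]. *)
Lemma disc_const (Q : C -> Prop) (c : R) :
 (forall t, t != 0 -> cnorm t < c -> exists2 d : R, 0 < d &
   forall t', t' != 0 -> cnorm t' < c -> cnorm (t' - t) < d -> (Q t' <-> Q t)) ->
 forall t t', t != 0 -> t' != 0 -> cnorm t < c -> cnorm t' < c -> Q t' -> Q t.
Proof.
move=> loc.
pose ln (x y : C) (s : R) := (1 - s)%:C%C*x + s%:C%C*y.
have ln0 x y : ln x y 0 = x by rewrite /ln subr0 mul1r mul0r addr0.
have ln1 x y : ln x y 1 = y by rewrite /ln subrr mul1r mul0r add0r.
have lnB x y s s' : ln x y s' - ln x y s = (s' - s)%:C%C*(y - x) by rewrite /ln !rmorphB; ring.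
have lnN x y s : 0 <= s <= 1 -> cnorm x < c -> cnorm y < c -> cnorm (ln x y s) < c.
 move=> /andP[s0 s1] hx hy; apply: le_lt_trans (cnormD _ _) _; rewrite !cnormM !cnorm_real.
 have s1' : 0 <= 1 - s by lra.
 rewrite !ger0_norm //; move: s1'; rewrite le_eqVlt => /orP[/eqP e|h].
  have -> : s = 1 by lra.
  by rewrite subrr mul0r add0r mul1r.
 have := ltr_pM2l h (cnorm x) c; rewrite hx => h1.
 by have := ler_wpM2l s0 (ltW hy); lra.
have direct x y : x != 0 -> y != 0 -> cnorm x < c -> cnorm y < c ->
  (forall s, 0 <= s <= 1 -> ln x y s != 0) -> Q y -> Q x.
 move=> x0 y0 hx hy nz Qy; rewrite -(ln0 x y).
 apply: (@interval_const _ (fun s => Q (ln x y s)) 0 1) => //; last by rewrite ln1.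
 move=> s sb; have [d d0 hd] := loc _ (nz s sb) (lnN _ _ _ sb hx hy).
 pose M := 1 + cnorm (y - x); have M0 : 0 < M by rewrite /M; have := cnorm_ge0 (y - x); lra.
 exists (d/M); first by rewrite divr_gt0.
 move=> s' sb' hs; apply: hd; [exact: nz|exact: lnN|].
 rewrite lnB cnormM cnorm_real; move: hs; rewrite ltr_pdivlMr // => hs; apply: le_lt_trans hs.
 by apply: ler_wpM2l => //; rewrite /M lerDr.
move=> t t' t0 t'0 ht ht' Qt'.
case: (pselect (forall s, 0 <= s <= 1 -> ln t t' s != 0)) => [nz|]; first exact: direct ht ht' nz Qt'.
move=> /existsNP[s0 /not_implyP[sb /negP]]; rewrite negbK => /eqP E.
have I2 : ('i : C)%C^+2 = -1 by exact: sqr_i.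
pose m := ('i : C)%C*t.
have i0 : ('i : C)%C != 0 by apply: cnorm_neq0; rewrite cnorm_i.
have m0 : m != 0 by rewrite mulf_neq0.
have hm : cnorm m < c by rewrite /m cnormM cnorm_i mul1r.
case/andP: sb => s00 s01.
have s0p : 0 < s0.
 by rewrite lt_neqAle s00 andbT; apply/eqP => z; move: E; rewrite -z ln0 => /eqP; rewrite (negbTE t0).
have Et' : t' = (- ((1 - s0)/s0))%:C%C*t.
 have s0c : s0%:C%C != 0 :> C by apply/eqP => /complexI z; rewrite z ltxx in s0p.
 apply: (mulfI s0c); rewrite mulrA -rmorphM mulrN mulrCA divff ?gt_eqF // mulr1 rmorphN mulNr.
 by apply/eqP; rewrite -addr_eq0 addrC; apply/eqP.
have tm : forall s, 0 <= s <= 1 -> ln t m s != 0.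
 move=> s _; rewrite /ln /m mulrA -mulrDl mulf_neq0 //; apply/eqP => z.
 have := congr1 (@complex.Re R) z; have := congr1 (@complex.Im R) z => /=; lra.
have mt : forall s, 0 <= s <= 1 -> ln m t' s != 0.
 move=> s _; rewrite /ln /m Et' !mulrA -mulrDl mulf_neq0 //; apply/eqP => z.
 have h1 := congr1 (@complex.Im R) z; move: h1 => /= h1.
 have s1 : s = 1 by lra.
 have := congr1 (@complex.Re R) z; rewrite s1 /= => h2.
 have h3 : (1 - s0)/s0 = 0 by lra.
 by move: t'0; rewrite Et' h3 oppr0 mul0r eqxx.
exact: (direct t m t0 m0 ht hm tm (direct m t' m0 t'0 hm ht' mt Qt')).
Qed.

End PuncturedDisc.

(** * Surjectivity and openness of [rho] *)

Section RhoOpen.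
Variable R : realType.
Local Notation C := (R[i]).
Local Notation P := (C*C)%type.
Implicit Types (q : P).
Let I : C := 'i%C.
Let II : I^+2 = -1. Proof. exact: sqr_i. Qed.
Let two0 : (2 : C) != 0. Proof. by rewrite pnatr_eq0. Qed.

Lemma quad_roots (s p : C) : exists a b : C, a + b = s /\ a*b = p.
Proof.
have [d hd] := nroot_ex (s^+2 - 4 * p) (isT : (0 < 2)%N).
exists ((s + d)/2), ((s - d)/2); split; first by field.
have -> : (s + d)/2*((s - d)/2) = (s^+2 - d^+2)/4 by field.
by rewrite hd; field.
Qed.

Lemma rho_surj k (p : P) : (0 < k)%N -> exists q, rho k q = p.
Proof.
move=> k0; case: p => x y; have [a [b [h1 h2]]] := quad_roots (- (2*I)*x) (y^+k).
have aux : forall a b : C, a + b = - (2*I)*x -> a*b = y^+k -> a != 0 -> exists q, rho k q = (x, y).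
 move=> {h1 h2 a b} a b e1 e2 a0; have [u hu] := nroot_ex a k0.
 have u0 : u != 0 by apply: contraNneq a0 => z; rewrite -hu z expr0n gtn_eqF.
 exists (u, y/u); rewrite /rho /= expr_div_n hu -e2; congr pair; last by field.
 have -> : a + a*b/a = a + b by field.
 have -> : 'i%C*(a + b)/2 = I*(a + b)/2 by [].
 rewrite e1; have -> : I*(- (2*I)*x)/2 = - I^+2*x by field.
 by rewrite II opprK mul1r.
have [a0|a0] := eqVneq a 0; last exact: (aux a b).
have [b0|b0] := eqVneq b 0; last by apply: (aux b a) => //; [rewrite addrC|rewrite mulrC].
exists (0, 0); rewrite rho0 //; congr pair.
 move/eqP: h1; rewrite a0 b0 addr0 eq_sym mulf_eq0 oppr_eq0 mulf_eq0 (negbTE two0) /= => /orP[/eqP z|/eqP->//].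
 by have := II; rewrite z expr0n /= => /eqP; rewrite eq_sym oppr_eq0 oner_eq0.
by move/eqP: h2; rewrite a0 mul0r eq_sym expf_eq0 k0 /= => /eqP ->.
Qed.

(** By symmetry [u1 != 0]. For a target near [rho k q1] the quadratic polynomial with roots [u^k],
    [v^k] is small at [u1^k], so one of its roots is near [u1^k]; a [k]-th root gives [u] near [u1],
    and [v = y/u]. *)
Lemma rho_open k q1 (e : R) : (0 < k)%N -> q1 <> (0, 0) -> 0 < e -> exists2 d : R, 0 < d &
 forall p, cball (rho k q1) d p -> exists2 q, rho k q = p & cball q1 e q.
Proof.
move=> k0; wlog u1 : q1/q1.1 != 0.
 move=> W n0 e0; have [u0|u0] := eqVneq q1.1 0; last exact: W.
 have v0 : q1.2 != 0 by apply/eqP => v0; apply: n0; rewrite [q1]surjective_pairing u0 v0.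
 have [|d d0 hd] := W (q1.2, q1.1) v0 _ e0; first by case=> z; rewrite z eqxx in v0.
 exists d => // p b.
 have sw q : rho k (q.2, q.1) = rho k q by rewrite /rho /= [q.2^+k + _]addrC [q.2*_]mulrC.
 have [|q <- [b1 b2]] := hd p; first by rewrite sw.
 by exists (q.2, q.1); [rewrite sw|split].
case: q1 u1 => u1 v1 /= u1n _ e0.
pose x1 := (rho k (u1, v1)).1; pose D (p : P) := True.
(* The value at [u1^k] of [T^2 + 2 i x T + y^k]. *)
pose sq (p : P) : C := u1^+k*(u1^+k + 2*I * p.1) + p.2^+k.
have csq : ctn D sq (rho k (u1, v1)).
 by rewrite /sq; ctnauto.
have sq0 : sq (rho k (u1, v1)) = 0.
 rewrite /sq /rho /= exprMn.
 have -> : 2*I*('i%C*(u1^+k + v1^+k)/2) = I^+2*(u1^+k + v1^+k).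
  by rewrite /I; field.
 by rewrite II; ring.
have cu1 : 0 < cnorm u1 by apply: cnorm_gt0.
have cdiv : ctn (fun=> True) (fun q : P => q.2/q.1) (u1, u1*v1).
 by apply: ctnM; [exact: ctn_snd|apply: ctnV => //; exact: ctn_fst].
have [d1 d10 hd1] := cdiv e e0.
pose eta := Num.min e (Num.min d1 (cnorm u1)).
have eta0 : 0 < eta by rewrite !lt_min e0 d10.
have ek : 0 < (eta^+k)^+2 by rewrite !exprn_gt0.
have [d2 d20 hd2] := csq _ ek.
exmin d1 d2.
move=> [x y] b; have b1 : cball (rho k (u1, v1)) d1 (x, y) by cmin b.
have b2 : cball (rho k (u1, v1)) d2 (x, y) by cmin b.
have := hd2 (x, y) Logic.I b2; rewrite sq0 subr0 => small.
have [a [c [h1 h2]]] := quad_roots (- (2*I)*x) (y^+k).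
have fac : sq (x, y) = (u1^+k - a)*(u1^+k - c).
 have -> : (u1^+k - a)*(u1^+k - c) = u1^+k*(u1^+k - (a + c)) + a*c by ring.
 by rewrite h1 h2 /sq /=; ring.
have key : forall a c : C, a + c = - (2*I)*x -> a*c = y^+k -> cnorm (u1^+k - a) < eta^+k ->
  exists2 q, rho k q = (x, y) & cball (u1, v1) e q.
 move=> {h1 h2 fac a c} a c e1 e2; rewrite cnormBC => /(root_near k0 eta0)[u hu un].
 have une : cnorm (u - u1) < e by apply: lt_le_trans un _; minle.
 have und : cnorm (u - u1) < d1 by apply: lt_le_trans un _; rewrite !ge_min lexx orbT.
 have unu : cnorm (u - u1) < cnorm u1 by apply: lt_le_trans un _; rewrite !ge_min lexx !orbT.
 have u0 : u != 0 by apply: contraTneq unu => ->; rewrite sub0r cnormN ltxx.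
 have a0 : a != 0 by rewrite -hu expf_neq0.
 exists (u, y/u).
  rewrite /rho /= expr_div_n hu -e2; congr pair; last by field.
  have -> : a + a*c/a = a + c by field.
  have -> : 'i%C*(a + c)/2 = I*(a + c)/2 by [].
  rewrite e1; have -> : I*(- (2*I)*x)/2 = - I^+2*x by field.
  by rewrite II opprK mul1r.
 split => //=; have := hd1 (u, y) Logic.I; rewrite /=.
 have -> : u1*v1/u1 = v1 by field.
 by apply; split => //=; case: b1.
move: small; rewrite fac cnormM => small.
have [lt|ge] := ltP (cnorm (u1^+k - a)) (eta^+k); first exact: (key a c).
have [lt|ge'] := ltP (cnorm (u1^+k - c)) (eta^+k).
 by apply: (key c a) => //; [rewrite addrC|rewrite mulrC].
move: small; rewrite ltNge expr2 => /negP []; apply: ler_pM => //; exact: exprn_ge0 (ltW eta0).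
Qed.

End RhoOpen.

(** * The quartic cover branched along [x^3 + y^4 = 0] *)
Section QuarticCover.
Variable R : realType.
Local Notation C := (R[i]).
Local Notation P := (C*C)%type.
Local Notation Y := ('I_4 -> C).
Implicit Types (q p : P).

Definition nfE p : C := p.1^+3 + p.2^+4.

(** The discriminant of [T^4 + a y T + 3 x] is [6912 (x^3 + y^4)] as soon as [a^4 = -256]. *)
Variable a : C.
Hypothesis a4 : a^+4 = - 256.
Definition qv p (t : C) : C := t^+4 + a * p.2*t + 3 * p.1.
Definition qd p (t : C) : C := 4*t^+3 + a * p.2.
Definition qpol p : {poly C} := 'X^4 + (a * p.2) *: 'X + (3 * p.1)%:P.

Let nz n : (n.+1%:R : C) != 0. Proof. by rewrite pnatr_eq0. Qed.
Let a0 : a != 0.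
Proof. by apply/eqP => z; move: a4; rewrite z expr0n /= => /eqP; rewrite eq_sym oppr_eq0 pnatr_eq0. Qed.

Lemma qpolE p t : (qpol p).[t] = qv p t.
Proof. by rewrite /qpol /qv !hornerE. Qed.
Lemma size_qpol p : size (qpol p) = 5%N.
Proof.
rewrite /qpol -addrA size_polyDl size_polyXn // ltnS; apply: leq_trans (size_polyD _ _) _.
rewrite geq_max (leq_trans (size_scale_leq _ _)) ?size_polyX //=.
by rewrite (leq_trans (size_polyC_leq1 _)).
Qed.
Lemma lead_qpol p : lead_coef (qpol p) = 1.
Proof. by rewrite lead_coefE size_qpol /qpol !coefE /= !mulr0 !addr0. Qed.

Lemma qpol_split p : exists y : Y, qpol p = \prod_j ('X - (y j)%:P).
Proof.
have [r hr] := closed_field_poly_normal (qpol p : {poly C}).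
rewrite lead_qpol scale1r in hr; have sr : size r = 4%N.
 by have := size_qpol p; rewrite hr size_prod_XsubC => -[].
by exists (fun j => nth 0 r j); rewrite hr (big_nth 0) big_mkord sr.
Qed.

Lemma qroot_mem p (y : Y) t : qpol p = \prod_j ('X - (y j)%:P) -> qv p t = 0 -> exists j, t = y j.
Proof.
move=> E; rewrite -qpolE E horner_prod => /eqP; rewrite prodf_seq_eq0 => /hasP[j _ /=].
by rewrite !hornerE subr_eq0 => /eqP ->; exists j.
Qed.
Lemma qroot_val p (y : Y) j : qpol p = \prod_j ('X - (y j)%:P) -> qv p (y j) = 0.
Proof. by move=> E; rewrite -qpolE E horner_prod (bigD1 j) //= !hornerE subrr mul0r. Qed.

Lemma qdouble p r : qv p r = 0 -> qd p r = 0 -> nfE p = 0.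
Proof.
rewrite /qv /qd => h1 h2.
have e2 : a * p.2 = - (4*r^+3) by apply/eqP; rewrite -addr_eq0 addrC h2.
have e1 : p.1 = r^+4.
 by apply: (mulfI (nz 2)); apply: subr0_eq; move: h1; rewrite e2 => h1;
   transitivity (r^+4 + - (4*r^+3)*r + 3 * p.1); [ring|].
have e3 : a^+4 * p.2^+4 = 256*r^+12 by rewrite -exprMn e2; ring.
rewrite /nfE; apply: (mulfI (nz 255)); rewrite mulr0 mulrDr e1 -exprM -e3 a4; ring.
Qed.

Lemma qrep_double p (y : Y) i j : qpol p = \prod_j ('X - (y j)%:P) -> i != j -> y i = y j -> nfE p = 0.
Proof.
move=> E ij yij; apply: (@qdouble p (y i)); first exact: qroot_val.
have : (qpol p)^`().[y i] = 0.
 rewrite E (bigD1 i) //= (bigD1 j) /=; last by rewrite eq_sym.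
 by rewrite !derivE !hornerE yij subrr; ring.
rewrite /qpol !derivE !hornerE /= /qd; move=> <-; ring.
Qed.

(** Off the origin the discriminant curve is parametrised by the double root [r]. *)
Lemma qnode p : nfE p = 0 -> p <> (0, 0) -> exists r, [/\ r != 0, p.1 = r^+4 & a * p.2 = - (4*r^+3)].
Proof.
case: p => x y; rewrite /nfE /= => h n0.
have y4 : y^+4 = - x^+3 by apply/eqP; rewrite -addr_eq0 addrC h.
have x0 : x != 0.
 apply/eqP => z; apply: n0; move/eqP: y4; rewrite z expr0n oppr0 expf_eq0 /= => /eqP ->; by [].
have y0 : y != 0.
 apply/eqP => z; move/eqP: y4; rewrite z expr0n eq_sym oppr_eq0 expf_eq0 /= (negbTE x0) //.
have E4 : (a*y)^+4 = 256*x^+3 by rewrite exprMn a4 y4; ring.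
(* From [x = r^4] and [a y = - 4 r^3]. *)
exists (- 4*x/(a*y)).
have ay : a*y != 0 by rewrite mulf_neq0.
split; first by rewrite !mulf_neq0 ?invr_eq0 ?oppr_eq0.
 rewrite expr_div_n E4; field; rewrite x0 /=; by [].
have -> : - (4*(- 4*x/(a*y))^+3) = (a*y)*(256*x^+3)/(a*y)^+4.
 by field; rewrite y0 a0.
by rewrite E4 mulfK // mulf_neq0 ?expf_neq0.
Qed.

Lemma qnear p t0 (e : R) : 0 < e -> cnorm (qv p t0) < e^+4 -> exists2 t, qv p t = 0 & cnorm (t - t0) < e.
Proof.
move=> e0 h; have [y E] := qpol_split p; apply: contrapT => H.
have far j : e <= cnorm (t0 - y j).
 rewrite leNgt; apply/negP => hl; apply: H; exists (y j); first exact: qroot_val.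
 by rewrite cnormBC.
move: h; rewrite -qpolE E horner_prod (big_morph _ (@cnormM R) (cnorm1 R)) ltNge => /negP; apply.
have -> : e^+4 = \prod_(j < 4) e by rewrite prodr_const card_ord.
by apply: ler_prod => j _; rewrite (ltW e0) /= !hornerE.
Qed.

(** The difference quotient of the quartic polynomial at two nearby arguments is close to its
    derivative at [t0], hence nonzero. *)
Lemma qsep (p0 : P) t0 : qd p0 t0 != 0 -> exists2 e : R, 0 < e & forall p t t', cball p0 e p ->
 cnorm (t - t0) < e -> cnorm (t' - t0) < e -> qv p t = 0 -> qv p t' = 0 -> t = t'.
Proof.
move=> d0; set n := cnorm (qd p0 t0); have n0 : 0 < n by apply: cnorm_gt0.
pose f (w : P) := w.1^+3 + w.1^+2*w.2 + w.1*w.2^+2 + w.2^+3.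
have cf : ctn (fun=> True) f (t0, t0).
 by rewrite /f; ctnauto.
have n2 : 0 < n/2 by rewrite divr_gt0.
have [e1 e10 h1] := cf _ n2.
have ca : ctn (fun=> True) (fun w : P => a*w.2) p0 by ctnauto.
have [e2 e20 h2] := ca _ n2.
exmin e1 e2.
move=> p t t' bp; rewrite !lt_min => /andP[ht _] /andP[ht' _] r1 r2.
have : (t - t')*(f (t, t') + a * p.2) = 0.
 transitivity (qv p t - qv p t'); last by rewrite r1 r2 subrr.
 by rewrite /f /qv /=; ring.
move=> /eqP; rewrite mulf_eq0 => /orP[|/eqP z]; first by rewrite subr_eq0 => /eqP.
have k1 := h1 (t, t') Logic.I (conj ht ht').
have k2 : cnorm (a * p.2 - a * p0.2) < n/2 by apply: h2 => //; cmin bp.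
exfalso.
have E : qd p0 t0 = - ((f (t, t') - f (t0, t0)) + (a * p.2 - a * p0.2)).
 have -> : - ((f (t, t') - f (t0, t0)) + (a * p.2 - a * p0.2)) = - (f (t, t') + a * p.2) + (f (t0, t0) + a * p0.2) by ring.
 by rewrite z /f /qd /=; ring.
have : n <= cnorm (f (t, t') - f (t0, t0)) + cnorm (a * p.2 - a * p0.2).
 by rewrite /n E cnormN; exact: cnormD.
lra.
Qed.

Lemma simple_root_fun (p0 : P) t0 (e0 : R) : qv p0 t0 = 0 -> qd p0 t0 != 0 -> 0 < e0 ->
 exists2 d : R, 0 < d & exists tf : P -> C, forall p, cball p0 d p ->
  [/\ qv p (tf p) = 0, cnorm (tf p - t0) < e0, qd p (tf p) != 0 & ctn (cball p0 d) tf p].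
Proof.
move=> v0 d0 e00; have [e1 e10 sep] := qsep d0.
pose dd (w : P) : C := 4*w.1^+3 + w.2.
have cd : ctn (fun=> True) dd (t0, a * p0.2).
 by rewrite /dd; ctnauto.
have [e2 e20 hd2] := ctn_neq0 cd d0.
have cv t (D : P -> Prop) p : ctn D (fun w => qv w t) p by rewrite /qv; ctnauto.
pose e := Num.min e0 (Num.min e1 e2).
have ep : 0 < e by rewrite !lt_min e00 e10.
have ee0 : e <= e0 by minle.
have ee1 : e <= e1 by rewrite !ge_min lexx orbT.
have ee2 : e <= e2 by rewrite !ge_min lexx !orbT.
have [d1 d10 hd1] := cv t0 (fun=> True) p0 _ (exprn_gt0 4 ep).
have ca : ctn (fun=> True) (fun w : P => a*w.2) p0 by ctnauto.
have [d3 d30 hd3] := ca _ e20.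
pose d := Num.min e1 (Num.min d1 d3).
have dp : 0 < d by rewrite !lt_min e10 d10.
have de1 : d <= e1 by minle.
have dd1 : d <= d1 by rewrite !ge_min lexx orbT.
have dd3 : d <= d3 by rewrite !ge_min lexx !orbT.
have /choice[tf htf] : forall p, exists t, cball p0 d p -> qv p t = 0 /\ cnorm (t - t0) < e.
 move=> p; case: (pselect (cball p0 d p)) => [b|nb]; last by exists 0.
 have := hd1 p Logic.I (cballW dd1 b); rewrite v0 subr0 => /(qnear ep)[t h1 h2].
 by exists t.
exists d => //; exists tf => p b; have [h1 h2] := htf p b; split => //.
- exact: lt_le_trans ee0.
- have := hd2 (tf p, a * p.2) Logic.I; apply; split => /=; first exact: lt_le_trans ee2.
 exact: (hd3 p Logic.I (cballW dd3 b)).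
move=> eps eps0; pose e3 := Num.min eps (e - cnorm (tf p - t0)).
have e30 : 0 < e3 by rewrite lt_min eps0 subr_gt0.
have [d4 d40 hd4] := cv (tf p) (fun=> True) p _ (exprn_gt0 4 e30); exists d4 => // p' b' bp.
have [k1 k2] := htf p' b'.
have := hd4 p' Logic.I bp; rewrite h1 subr0 => /(qnear e30)[t g1 g2].
have tt0 : cnorm (t - t0) < e.
 apply: le_lt_trans (cnorm_tri (tf p) _ _) _; rewrite -ltrBrDr.
 by apply: lt_le_trans g2 _; minle.
have -> : tf p' = t.
 apply: (sep p') => //; [exact: cballW b'|exact: lt_le_trans ee1|exact: lt_le_trans ee1].
by apply: lt_le_trans g2 _; minle.
Qed.

Lemma qpol_four p (t : Y) : (forall j, qv p (t j) = 0) -> injective t -> qpol p = \prod_j ('X - (t j)%:P).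
Proof.
move=> r inj; pose rs := [seq t j | j <- enum 'I_4].
have ar : all (root (qpol p)) rs.
 by apply/allP => x /mapP[j _ ->]; rewrite /root qpolE r.
have ur : uniq_roots rs by rewrite uniq_rootsE map_inj_uniq ?enum_uniq.
have sz : size (qpol p) = (size rs).+1 by rewrite size_qpol size_map size_enum_ord.
by rewrite (all_roots_prod_XsubC sz ar ur) lead_qpol scale1r big_map big_enum.
Qed.

(** Without cubic and quadratic terms, two roots determine the quadratic cofactor
    [T^2 + (s + t) T + (s + t)^2 - s t]; its discriminant is [4 s t - 3 (s + t)^2]. *)
Lemma qpol_pair p s t D : qv p s = 0 -> qv p t = 0 -> s != t -> D^+2 = 4*(s*t) - 3*(s + t)^+2 ->
 qpol p = ('X - s%:P)*('X - t%:P)*('X - ((- (s + t) + D)/2)%:P)*('X - ((- (s + t) - D)/2)%:P).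
Proof.
move=> vs vt st hD; have st0 : s - t != 0 by rewrite subr_eq0.
have eb : a * p.2 = - (s^+3 + s^+2*t + s*t^+2 + t^+3).
 apply: (mulfI st0); apply: subr0_eq.
 transitivity (qv p s - qv p t); last by rewrite vs vt subrr.
 by rewrite /qv; ring.
have ec : 3 * p.1 = s^+3*t + s^+2*t^+2 + s*t^+3.
 apply: subr0_eq; transitivity (qv p s); last exact: vs.
 by rewrite /qv eb; ring.
set u := (- (s + t) + D)/2; set v := (- (s + t) - D)/2.
have euv : u + v = - (s + t) by rewrite /u /v; field.
have puv : u*v = (s + t)^+2 - s*t.
 have -> : u*v = ((s + t)^+2 - D^+2)/4 by rewrite /u /v; field.
 by rewrite hD; field.
move: u v euv puv => u v euv puv.
have F : ('X - u%:P)*('X - v%:P) = 'X^2 - (u + v)%:P * 'X + (u*v)%:P :> {poly C}.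
 by rewrite polyCD polyCM; ring.
rewrite -[RHS]mulrA F euv puv /qpol ec eb -mul_polyC.
rewrite !(polyCD, polyCN, polyCM, polyC_exp); ring.
Qed.

Section LiftE.
Variables (ls : seq C) (Dom : P -> Prop) (phi : P -> P).
Hypothesis phi0 : forall q, Dom q -> phi q <> (0, 0).
Hypothesis phib : forall q, Dom q -> (bad ls q <-> nfE (phi q) = 0).
Hypothesis phic : forall q, Dom q -> ctn Dom (fun w => (phi w).1) q /\ ctn Dom (fun w => (phi w).2) q.
Hypothesis phis : forall q f (d : R), Dom q -> bad ls q -> 0 < d ->
 (forall p, cball (phi q) d p -> ctn (cball (phi q) d) f p) ->
 (forall p, cball (phi q) d p -> (f p = 0 <-> nfE p = 0)) ->
 exists2 e : R, 0 < e & exists s : P -> C, forall q', Dom q' -> cball q e q' ->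
  [/\ cball (phi q) d (phi q'), s q'^+2 = f (phi q') & ctn (fun w => Dom w /\ cball q e w) s q'].

Definition RlE q (y : Y) := qpol (phi q) = \prod_j ('X - (y j)%:P).
Definition aiE (g : {perm 'I_4}) (j : 'I_4) := g j.
Definition amE (g : {perm 'I_4}) (j : 'I_4) : C := 1.
Local Notation act := (act aiE amE).

Lemma RlE_inj q y : Dom q -> ~~ bad ls q -> RlE q y -> injective y.
Proof.
move=> Dq nb E i j yij; apply/eqP; apply: contraNT nb => ij.
by apply/(phib Dq); exact: qrep_double E ij yij.
Qed.

Let act1 y : act 1%g y =1 y. Proof. by move=> j; rewrite /act /amE /aiE mul1r perm1. Qed.
Let relE q y y' : y =1 y' -> RlE q y -> RlE q y'.
Proof. by rewrite /RlE => E ->; apply: eq_bigr => j _; rewrite E. Qed.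
Let relA q y g : RlE q y -> RlE q (act g y).
Proof.
by rewrite /RlE => ->; rewrite (reindex_inj (@perm_inj _ g)); apply: eq_bigr => j _; rewrite /act /amE /aiE mul1r.
Qed.
Let relT q y y' : Dom q -> ~~ bad ls q -> RlE q y -> RlE q y' -> exists g, y' =1 act g y.
Proof.
move=> Dq nb h1 h2; have inj := RlE_inj Dq nb h2.
have /choice[f hf] : forall j, exists i, y' j = y i.
 by move=> j; apply: qroot_mem h1 _; exact: qroot_val h2.
have finj : injective f by move=> i j fij; apply: inj; rewrite !hf fij.
by exists (perm finj) => j; rewrite /act /amE /aiE mul1r permE.
Qed.
Let relF q y g g' : Dom q -> ~~ bad ls q -> RlE q y -> act g y =1 act g' y -> g = g'.
Proof.
move=> Dq nb h E; apply/permP => j; apply: (RlE_inj Dq nb h).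
by have := E j; rewrite /act /amE /aiE !mul1r.
Qed.
Let ctn_phi q (d : R) f e : Dom q -> (forall p, cball (phi q) d p -> ctn (cball (phi q) d) f p) ->
 (forall q', Dom q' -> cball q e q' -> cball (phi q) d (phi q')) ->
 forall q', Dom q' -> cball q e q' -> ctn (fun w => Dom w /\ cball q e w) (fun w => f (phi w)) q'.
Proof.
move=> Dq cf hb q' Dq' b; have [c1 c2] := phic Dq'.
apply: (@ctn_comp2 R _ (cball (phi q) d) f phi); [exact: cf (hb _ Dq' b)|by apply: ctnW c1 => w []|by apply: ctnW c2 => w []|].
by move=> w [Dw bw]; apply: hb.
Qed.
Let phi_near q (d : R) : Dom q -> 0 < d -> exists2 e, 0 < e & forall q', Dom q' -> cball q e q' -> cball (phi q) d (phi q').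
Proof.
move=> Dq d0; have [c1 c2] := phic Dq; have [e1 e10 h1] := c1 _ d0; have [e2 e20 h2] := c2 _ d0.
exmin e1 e2.
move=> q' Dq' b; split; first by apply: h1 => //; cmin b.
by apply: h2 => //; cmin b.
Qed.

(** Away from the branch curve all four roots are simple and continue. On it two roots [s], [t]
    remain simple, and the colliding pair is governed by the discriminant of the cofactor, whose
    square root is what [phis] provides. *)
Let relL q : Dom q -> exists2 d : R, 0 < d & exists s, Sec RlE (fun q' => Dom q' /\ cball q d q') s.
Proof.
move=> Dq; case: (boolP (bad ls q)) => [b|nb].
 have [r [r0 e1 e2]] := qnode ((phib Dq).1 b) (phi0 Dq).
 (* [T^4 - 4 r^3 T + 3 r^4 = (T - r)^2 (T^2 + 2 r T + 3 r^2)]; [s] and [t] are the roots of the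
    second factor. *)
 have [s [t [st1 st2]]] := quad_roots (- (2*r)) (3*r^+2).
 have qs : s^+2 = - (2*r)*s - 3*r^+2 by rewrite -st1 -st2; ring.
 have qt : t^+2 = - (2*r)*t - 3*r^+2 by rewrite -st1 -st2; ring.
 have simple x : x^+2 = - (2*r)*x - 3*r^+2 -> qv (phi q) x = 0 /\ qd (phi q) x != 0.
  move=> qx; rewrite /qv /qd e1 e2; split.
   have -> : x^+4 + - (4*r^+3)*x + 3*r^+4 = (x - r)^+2*(x^+2 - (- (2*r)*x - 3*r^+2)) by ring.
   by rewrite qx subrr mulr0.
  have -> : 4*x^+3 + - (4*r^+3) = 4*x*x^+2 - 4*r^+3 by ring.
  rewrite qx; have -> : 4*x*(- (2*r)*x - 3*r^+2) - 4*r^+3 =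
   - (8*r)*x^+2 - 12*r^+2*x - 4*r^+3 by ring.
  rewrite qx; have -> : - (8*r)*(- (2*r)*x - 3*r^+2) - 12*r^+2*x - 4*r^+3 =
    4*r^+2*(x + 5*r) by ring.
  rewrite !mulf_neq0 ?expf_neq0 //; apply/eqP => z.
  have xr : x = - (5*r) by apply/eqP; rewrite -addr_eq0 z.
  move: qx; rewrite xr => /eqP; rewrite -subr_eq0.
  have -> : (- (5*r))^+2 - (- (2*r) * - (5*r) - 3*r^+2) = 18*r^+2 by ring.
  by rewrite mulf_eq0 expf_eq0 (negbTE r0) /= (negbTE (nz 17)).
 have st : s != t.
  apply/eqP => E; move: st1 st2; rewrite -E => w1 w2.
  have sr : s = - r by apply: (mulfI (nz 1)); rewrite mulrN -w1; ring.
  move: w2; rewrite sr => /eqP; rewrite -subr_eq0.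
  have -> : - r * - r - 3*r^+2 = - (2*r^+2) by ring.
  by rewrite oppr_eq0 mulf_eq0 expf_eq0 (negbTE r0) /= (negbTE (nz 1)).
 have [vs ds] := simple s qs; have [vt dt] := simple t qt.
 have ed : 0 < cnorm (s - t)/2 by rewrite divr_gt0 // cnorm_gt0 // subr_eq0.
 have [d1 d10 [sf hsf]] := simple_root_fun vs ds ed.
 have [d2 d20 [tf htf]] := simple_root_fun vt dt ed.
 have [d3 d30 hd3] := @copen_neq0 R (phi q) (phi0 Dq).
 pose d := Num.min d1 (Num.min d2 d3).
 have dp : 0 < d by rewrite !lt_min d10 d20.
 have dd1 : d <= d1 by minle.
 have dd2 : d <= d2 by rewrite !ge_min lexx orbT.
 have dd3 : d <= d3 by rewrite !ge_min lexx !orbT.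
 have stf p : cball (phi q) d p -> sf p != tf p.
  move=> bp; have [_ h1 _ _] := hsf p (cballW dd1 bp); have [_ h2 _ _] := htf p (cballW dd2 bp).
  apply/eqP => E; move: h1; rewrite E => h1; have := cnorm_tri (tf p) s t; rewrite (cnormBC s (tf p)); lra.
 pose f p := 4*(sf p*tf p) - 3*(sf p + tf p)^+2.
 have csf p : cball (phi q) d p -> ctn (cball (phi q) d) sf p.
  by move=> bp; have [_ _ _ c] := hsf p (cballW dd1 bp); apply: ctnW c => w; exact: cballW.
 have ctf p : cball (phi q) d p -> ctn (cball (phi q) d) tf p.
  by move=> bp; have [_ _ _ c] := htf p (cballW dd2 bp); apply: ctnW c => w; exact: cballW.
 have cf p : cball (phi q) d p -> ctn (cball (phi q) d) f p.
  move=> bp; have c1 := csf p bp; have c2 := ctf p bp.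
  by rewrite /f; ctnauto.
 have zf p : cball (phi q) d p -> (f p = 0 <-> nfE p = 0).
  move=> bp; have [v1 _ d1' _] := hsf p (cballW dd1 bp); have [v2 _ d2' _] := htf p (cballW dd2 bp).
  have ne := stf p bp; split=> [fp|np].
   have h0 : (0 : C)^+2 = 4*(sf p*tf p) - 3*(sf p + tf p)^+2 by rewrite expr0n -/(f p) fp.
   have E := qpol_pair v1 v2 ne h0; move: E; rewrite addr0 subr0; move: (- _/2) => u E.
   apply: (@qdouble p u); first by rewrite -qpolE E !hornerE subrr !mulr0.
   have : (qpol p)^`().[u] = 0.
    by rewrite E derivM [('X - u%:P)^`()]derivB derivX derivC !hornerE subrr ?(mulr0, mul0r, addr0, add0r, subr0, mulr1).
   rewrite /qpol !derivE !hornerE /= /qd; move=> <-; ring.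
  have [r' [r'0 f1 f2]] := qnode np (hd3 p (cballW dd3 bp)).
  have quad x : qv p x = 0 -> qd p x != 0 -> x^+2 + 2*r'*x + 3*r'^+2 = 0.
   rewrite /qv /qd f1 f2 => vx dx.
   have : (x - r')^+2*(x^+2 + 2*r'*x + 3*r'^+2) = 0 by rewrite -vx; ring.
   move=> /eqP; rewrite mulf_eq0 expf_eq0 /= => /orP[|/eqP//]; rewrite subr_eq0 => /eqP E.
   by move: dx; rewrite E subrr eqxx.
  have q1 := quad _ v1 d1'; have q2 := quad _ v2 d2'.
  have sm : sf p + tf p = - (2*r').
   have z : sf p - tf p != 0 by rewrite subr_eq0.
   apply: (mulfI z); apply: subr0_eq.
   transitivity ((sf p^+2 + 2*r'*sf p + 3*r'^+2) - (tf p^+2 + 2*r'*tf p + 3*r'^+2)); first by ring.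
   by rewrite q1 q2 subrr.
  have pm : sf p*tf p = 3*r'^+2.
   have et : tf p = - (2*r') - sf p by rewrite -sm; ring.
   rewrite et; apply/eqP; rewrite -subr_eq0 -oppr_eq0 -[X in _ == X]q1; apply/eqP; ring.
  by rewrite /f sm pm; ring.
 have [e e0 [D hD]] := phis Dq b dp cf zf.
 exists e => //.
 have hb q' : Dom q' -> cball q e q' -> cball (phi q) d (phi q') by move=> Dq' bq; case: (hD q' Dq' bq).
 have c1 := ctn_phi Dq csf hb; have c2 := ctn_phi Dq ctf hb.
 exists (fun w j => match val j with 0 => sf (phi w) | 1 => tf (phi w)
   | 2 => (- (sf (phi w) + tf (phi w)) + D w)/2 | _ => (- (sf (phi w) + tf (phi w)) - D w)/2 end).
 split=> [w [Dw bw]|w j [Dw bw]].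
  have [bp ED _] := hD w Dw bw; have [v1 _ _ _] := hsf _ (cballW dd1 bp); have [v2 _ _ _] := htf _ (cballW dd2 bp).
  by rewrite /RlE (qpol_pair v1 v2 (stf _ bp) ED) !big_ord_recl big_ord0 /= mulr1 !mulrA.
 have [_ _ cD] := hD w Dw bw; have k1 := c1 w Dw bw; have k2 := c2 w Dw bw.
 case: j => [[|[|[|j]]] hj] //=; apply: ctnM; try exact: ctn_cst.
  by apply: ctnD => //; apply: ctnN; exact: ctnD.
 by apply: ctnB => //; apply: ctnN; exact: ctnD.
have [y E] := qpol_split (phi q); have inj := RlE_inj Dq nb E.
have [||ed ed0 hed] := @fin_delta R ('I_4 * 'I_4)%type (fun ij d => ij.1 != ij.2 -> 2*d <= cnorm (y ij.1 - y ij.2)).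
- by move=> ij d e de h /h; lra.
- move=> [i j] /=; case: (eqVneq i j) => [->|ij]; first by exists 1.
 exists (cnorm (y i - y j)/2); last by move=> _; lra.
 by rewrite divr_gt0 // cnorm_gt0 // subr_eq0; apply: contraNneq ij => /inj ->.
have /choice[tf htf] : forall j, exists t : R*(P -> C), 0 < t.1 /\ forall p, cball (phi q) t.1 p ->
  [/\ qv p (t.2 p) = 0, cnorm (t.2 p - y j) < ed & ctn (cball (phi q) t.1) t.2 p].
 move=> j; have v := qroot_val j E.
 have d0 : qd (phi q) (y j) != 0.
  by apply: contraNneq nb => z; apply/(phib Dq); exact: qdouble v z.
 have [d dp [t ht]] := simple_root_fun v d0 ed0.
 by exists (d, t); split => // p b; case: (ht p b).
have [||d dp hd] := @fin_delta R 'I_4 (fun j d => d <= (tf j).1).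
- by move=> j d e de; exact: le_trans.
- by move=> j; exists (tf j).1 => //; case: (htf j).
have [e e0 he] := phi_near Dq dp; exists e => //.
exists (fun w j => (tf j).2 (phi w)); split=> [w [Dw bw]|w j [Dw bw]].
 have bp := he w Dw bw; apply: qpol_four => [j|i j F].
  by have [_ h] := htf j; case: (h _ (cballW (hd j) bp)).
 apply/eqP; apply: contrapT => /negP ij; have := hed (i, j) ij => /=.
 have [_ hi] := htf i; have [_ hj] := htf j.
 have [_ h1 _] := hi _ (cballW (hd i) bp); have [_ h2 _] := hj _ (cballW (hd j) bp).
 rewrite -F in h2; have := cnorm_tri ((tf i).2 (phi w)) (y i) (y j); rewrite (cnormBC (y i) (_ (phi w))); lra.
apply: (@ctn_phi q d ((tf j).2) e) => // p bp; have [_ h] := htf j.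
by have [_ _ c] := h p (cballW (hd j) bp); apply: ctnW c => x; apply: cballW (hd j).
Qed.

Lemma liftE_exists r : 0 < r -> (forall q, pcube r q -> Dom q) -> exists s, Sec RlE (pcube r) s.
Proof. by move=> r0 rD; exact: (Sec_pcube_exists act1 relE relA relT relF r0 rD relL). Qed.

Lemma liftE_unique r s s' : 0 < r -> (forall q, pcube r q -> Dom q) ->
 Sec RlE (pcube r) s -> Sec RlE (pcube r) s' ->
 exists g : {perm 'I_4}, forall q, pcube r q -> forall j, s' q j = s q (g j).
Proof.
move=> r0 rD S S'; have [g hg] := Sec_pcube_unique relA relT relF r0 rD S S'.
by exists g => q pq j; rewrite hg // /act /amE /aiE mul1r.
Qed.
End LiftE.
End QuarticCover.

(** A permutation of four points whose order divides 3 or 5 moves at most three of them. All maps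
    from four points to themselves are checked by computation. *)
Lemma iter_fixpoint (f : 'I_4 -> 'I_4) (k : nat) : (k == 3%N) || (k == 5%N) ->
 (forall j, iter k f j = j) -> exists j, f j = j.
Proof.
move=> hk it; pose l := [seq val (f j) | j <- [:: inord 0; inord 1; inord 2; inord 3]].
pose fn (l : seq nat) i := nth 0%N l i.
have fE (j : 'I_4) : fn l j = f j.
 by case: j => [[|[|[|[|//]]]] h]; rewrite /fn /= ; congr (val (f _)); apply: val_inj; rewrite /= inordK.
have itE n (j : 'I_4) : iter n (fn l) (val j) = val (iter n f j).
 by elim: n => //= n ->; rewrite fE.
have chk : all (fun a => all (fun b => all (fun c => all (fun d => all (fun k =>
  all (fun i => iter k (fn [:: a; b; c; d]) i == i) (iota 0 4) ==>
  has (fun i => fn [:: a; b; c; d] i == i) (iota 0 4)) [:: 3; 5]%N)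
  (iota 0 4)) (iota 0 4)) (iota 0 4)) (iota 0 4) by vm_compute.
have inI (j : 'I_4) : val (f j) \in iota 0 4 by rewrite mem_iota /=.
have k35 : k \in [:: 3; 5]%N by rewrite !inE.
move/allP: chk => /(_ _ (inI (inord 0)))/allP/(_ _ (inI (inord 1)))/allP/(_ _ (inI (inord 2))).
move=> /allP/(_ _ (inI (inord 3)))/allP/(_ _ k35)/implyP -/(_ _)/hasP[].
 apply/allP => i; rewrite mem_iota /= => i4; have := itE k (Ordinal i4).
 by rewrite it /= => ->.
move=> i; rewrite mem_iota /= => i4 /eqP; have := fE (Ordinal i4); rewrite /= => -> E.
by exists (Ordinal i4); apply: val_inj.
Qed.

(** * Separation of [x^3 + y^4] from [x^2 + y^3] and [x^2 + y^5] *)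

Section E6vsA.
Variable R : realType.
Local Notation C := (R[i]).
Local Notation P := (C*C)%type.
Implicit Types (q p : P).

(** The dihedral group permutes the four sheets of the quartic cover. A rotation of order 3 or 5
    fixes a sheet, so that sheet has an orbit of at most two; but over [y = 0] turning around the
    origin moves one root to all four. *)
Lemma nfE_not_nf k : (k == 3%N) || (k == 5%N) ->
 ~ top_equiv_germ (fun q : P => nf k q = 0) (0, 0) (fun q : P => nfE q = 0) (0, 0).
Proof.
move=> hk /top_equivP[U [V [h [g [[oU oV U0 V0 he] [h0 hX]]]]]].
have k0 : (0 < k)%N by case/orP: hk => /eqP->.
have [hUV gVU gh hg [ch cg]] := he.
have g0 : g (0, 0) = (0, 0) by rewrite -{1}h0 gh.
have [a a4] := nroot_ex (- 256 : C) (isT : (0 < 4)%N).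
have [r r0 rD] := pdom_cube k0 oU U0 he h0.
pose D := pdom k U; pose phi := pphi k h; pose ls := uroots R k.
have phi0 q : D q -> phi q <> (0, 0) by exact: (pphi_neq0 k0 U0 he h0).
have phib q : D q -> (bad ls q <-> nfE (phi q) = 0).
 by apply: (pphi_bad k0 (X2 := fun p => nfE p = 0) hX).
have phic q : D q -> ctn D (fun w => (phi w).1) q /\ ctn D (fun w => (phi w).2) q by exact: (pphi_ctn he).
have phis q f (d : R) : D q -> bad ls q -> 0 < d ->
 (forall p, cball (phi q) d p -> ctn (cball (phi q) d) f p) ->
 (forall p, cball (phi q) d p -> (f p = 0 <-> nfE p = 0)) ->
 exists2 e : R, 0 < e & exists s : P -> C, forall q', D q' -> cball q e q' ->
  [/\ cball (phi q) d (phi q'), s q'^+2 = f (phi q') & ctn (fun w => D w /\ cball q e w) s q'].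
 move=> Dq bq d0 cf zf.
 pose D' w := D w /\ cball (phi q) d (phi w).
 have D'q : D' q by split => //; exact: cball_refl.
 have oD' : copen D'.
  apply: (ccont_preim_open (fun=> True)) (@cball_open _ _ _) _; first exact: pdom_open.
  by apply/ccont_ctn => w; exact: phic.
 have [e1 e10 he1] := oD' q D'q.
 have [||||||e2 e20 [s hs]] := @mirror_sqrt R k (fun w => f (phi w)) D' q k0 _ D'q.
 - by exists e1.
 - by case: Dq.
 - move=> w [Dw bw]; have [c1 c2] := phic w Dw.
  apply: (@ctn_comp2 R _ (cball (phi q) d) f phi) => //; first exact: cf.
  + by apply: ctnW c1 => x []. + by apply: ctnW c2 => x []. + by move=> x [].
 - by move=> w w' _ _ E; rewrite /phi (pphi_inv h E).
 - by move=> w [Dw bw]; rewrite zf // -phib // badP.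
 - by apply/zf; [exact: cball_refl|apply/phib].
 exmin e1 e2.
 have sub w : D w -> cball q (Num.min e1 e2) w -> D' w /\ cball q e2 w.
  by move=> Dw b; split; [apply: he1|]; cmin b.
 exists s => q' Dq' b; have [Dq'' b2] := sub q' Dq' b; have [E c] := hs q' Dq'' b2; split => //.
  by case: Dq''.
 by apply: ctnW c => w [Dw bw]; exact: sub.
have [T ST] := liftE_exists a4 phi0 phib phic phis r0 rD.
pose r2 := r/4; have r20 : 0 < r2 by rewrite divr_gt0.
have r2r : r2 <= r by rewrite /r2; lra.
pose B q := q <> (0, 0) /\ cball (0, 0) r2 q.
have Bp q : B q -> pcube r2 q by move=> [n b]; split => //; exact: pcube_ball.
have pW q : pcube r2 q -> pcube r q by move=> [c n]; split => // j; apply: le_trans r2r.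
have BD q : B q -> D q by move=> /Bp/pW/rD.
have dkp (G : 'I_k*bool) q : pcube r2 q -> pcube r (dk G q).
 move=> [cq n]; split; last exact: dk_neq0.
 apply: pcube_ball => //; apply: dk_norm; have := cube_ball r20 cq; by have -> : 4*r2 = r by rewrite /r2; field.
have dkB (G : 'I_k*bool) q : B q -> B (dk G q) by move=> [n b]; split; [exact: dk_neq0|exact: dk_norm].
have Tc G j q : B q -> ctn B (fun w => T (@dk R k G w) j) q.
 move=> Bq; have [c1 c2] := @dk_cont R B k G q.
 apply: (@ctn_comp2 R B (pcube r) (fun w => T w j) (dk G)) => //; last by move=> w /Bp/dkp.
 exact: ST.2 (dkp G q (Bp q Bq)).
have /choice[th hth] : forall G : 'I_k*bool, exists g : {perm 'I_4},
  forall q, B q -> forall j, T (dk G q) j = T q (g j).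
 move=> G; have [|||G' hG'] := @liftE_unique R a a4 ls D phi phib r2 T (fun q => T (dk G q)) r20.
 - by move=> q /pW/rD.
 - by apply: Sec_sub ST.
 - split=> [q pq|q j pq].
   rewrite /RlE /phi -(@pphi_inv R k h (dk G q) q) ?rho_dk //; exact: (ST.1 _ (dkp G q pq)).
  have [c1 c2] := @dk_cont R (pcube r2) k G q.
  apply: (@ctn_comp2 R _ (pcube r) (fun w => T w j) (dk G)) => //; last by move=> w /dkp.
  exact: ST.2 (dkp G q pq).
 - by exists G' => q /Bp pq j; exact: hG'.
have Tinj q : B q -> ~~ bad ls q -> injective (T q).
 move=> Bq nb; apply: (RlE_inj a4 phib (BD q Bq) nb); exact: ST.1 (pW q (Bp q Bq)).
have Troot q j : B q -> qv a (phi q) (T q j) = 0.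
 by move=> Bq; apply: qroot_val; exact: ST.1 (pW q (Bp q Bq)).
have [z zp] : exists z : C, k.-primitive_root z.
 have [uU sU hU _] := urootsP R k0.
 have /hasP[z _ hz] : has k.-primitive_root (uroots R k).
  apply: has_prim_root => //; last by rewrite sU.
  by apply/allP => x; rewrite hU unity_rootE.
 by exists z.
have zk := prim_expr_order zp.
have [i1 hi1] := zr_surj k0 zk.
pose rot := dk (i1, false) : P -> P.
have rotE m q : iter m rot q = (z^+m*q.1, z^-1^+m*q.2).
 elim: m => [|m IH]; first by rewrite !expr0 !mul1r -surjective_pairing.
 by rewrite iterS IH /rot /dk /= hi1 !exprS !mulrA.
have Brot m q : B q -> B (iter m rot q) by move=> Bq; elim: m => //= m; exact: dkB.
pose pi := th (i1, false).
have Trot m q j : B q -> T (iter m rot q) j = T q (iter m pi j).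
 move=> Bq; elim: m j => // m IH j; rewrite iterS hth; last exact: Brot.
 by rewrite IH -iterSr.
have fB : fat B.
 apply: fatW (fun q => _) (halfcube_fat (inord 0, false) (divr_gt0 r20 (ltr0Sn R 3))) => q /halfcube_sub[c n].
 by split => //; have := cube_ball (divr_gt0 r20 (ltr0Sn R 3)) c; have -> : 4*(r2/4) = r2 by field.
have [qs Bqs nbs] := fat_generic ls fB.
have [i0 hi0] : exists j, pi j = j.
 apply: (iter_fixpoint hk) => j; apply: (Tinj qs Bqs nbs); rewrite -Trot //.
 by rewrite rotE exprVn zk invr1 !mul1r -surjective_pairing.
have Trot0 m q : B q -> T (iter m rot q) i0 = T q i0.
 by move=> Bq; rewrite Trot //; congr (T q); elim: m => //= m ->.
pose sw q : P := (q.2, q.1).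
have [i2 hi2] := @zr_surj R k 1 k0 (expr1n _ _).
have swE q : sw q = dk (i2, true) q by rewrite /dk /= hi2 invr1 !mul1r.
(* Every rotation is a power of [rot] and fixes the sheet [i0], so only a reflection can move it. *)
have two (G : 'I_k*bool) q : B q -> T (dk G q) i0 = T q i0 \/ T (dk G q) i0 = T q (th (i2, true) i0).
 case: G => i b Bq; have [m hm] := prim_rootP zp (zrP R i).
 have dkE w : dk (i, false) w = iter m rot w.
  by rewrite rotE /dk /= hm exprVn.
 case: b; last by left; rewrite dkE Trot0.
 have -> : dk (i, true) q = dk (i, false) (sw q) by [].
 by right; rewrite dkE Trot0; rewrite swE ?hth //; exact: dkB.
(* the curve [y = 0]: the four roots are permuted cyclically when [x] turns around [0] *)
pose pt (t : C) : P := (- t^+4/3, 0).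
have three0 : (3 : C) != 0 by rewrite pnatr_eq0.
have ptq t x : qv a (pt t) x = x^+4 - t^+4 by rewrite /qv /pt /=; field.
have [c c0 hc] : exists2 c : R, 0 < c & forall t, cnorm t < c ->
  V (pt t) /\ (forall w, rho k w = g (pt t) -> cball (0, 0) r2 w).
 have [e1 e10 he1] := rho_small k0 r20; have [e2 e20 he2] := cg _ V0 e1 e10.
 have [e3 e30 he3] := oV _ V0.
 have cp : ctn (fun=> True) (fun w : P => - w.1^+4/3) (0, 0). by ctnauto.
 have e40 : 0 < Num.min e2 e3 by rewrite lt_min e20.
 have [c c0 hc] := cp _ e40; exists c => // t tc.
 have bt : cball (0, 0) (Num.min e2 e3) (pt t).
  have z2 : (pt t).2 - ((0, 0) : P).2 = 0 by rewrite subrr.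
  split; last by rewrite z2 cnorm0.
  have z1 : (pt t).1 - ((0, 0) : P).1 = - ((t, 0) : P).1^+4/3 - - ((0, 0) : P).1^+4/3.
   by rewrite /pt /=; ring.
  rewrite z1; apply: (hc (t, 0)) => //; split; first by rewrite subr0.
  by rewrite subrr cnorm0.
 have Vt : V (pt t) by apply: he3; cmin bt.
 split => // w E; apply: he1; rewrite E -g0; apply: he2 => //.
 by cmin bt.
have ptn t : t != 0 -> pt t <> (0, 0).
 by move=> t0 [/eqP]; rewrite mulf_eq0 oppr_eq0 expf_eq0 invr_eq0 (negbTE t0) (negbTE three0).
have over t w : t != 0 -> cnorm t < c -> rho k w = g (pt t) -> B w /\ phi w = pt t.
 move=> t0 tc E; have [Vt hw] := hc t tc; split; last by rewrite /phi /pphi E hg.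
 split; last exact: hw.
 by move=> w0; apply: (ptn t t0); rewrite -(hg _ Vt) -E w0 rho0.
have nbad t w : t != 0 -> cnorm t < c -> rho k w = g (pt t) -> ~~ bad ls w.
 move=> t0 tc E; have [Bw pw] := over t w t0 tc E; apply/negP => /(phib w (BD w Bw)).
 rewrite pw /nfE /pt /= expr0n addr0 => /eqP; rewrite expf_eq0 /= mulf_eq0 oppr_eq0 expf_eq0 invr_eq0.
 by rewrite (negbTE t0) (negbTE three0).
(* The root [t] of [T^4 = t^4] lies on the sheet [i0] at some point of the fibre over [pt t]. *)
pose Q t := exists w, rho k w = g (pt t) /\ T w i0 = t.
have QG t w : t != 0 -> cnorm t < c -> rho k w = g (pt t) -> (Q t <-> exists G : 'I_k*bool, T (dk G w) i0 = t).
 move=> t0 tc E; split=> [[w' [E' Tw]]|[G Tw]].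
  by have [G EG] := rho_fibre k0 (etrans E (esym E')); exists G; rewrite -EG.
 by exists (dk G w); rewrite rho_dk.
(* A nearby point of the curve lifts to a nearby point of the cover by [rho_open]. There the
   finitely many translates of the sheet are continuous, and fourth roots of equal powers are
   separated. *)
have loc t : t != 0 -> cnorm t < c -> exists2 d : R, 0 < d &
   forall t', t' != 0 -> cnorm t' < c -> cnorm (t' - t) < d -> (Q t' <-> Q t).
 move=> t0 tc; have [w Ew] := rho_surj (g (pt t)) k0; have [Bw pw] := over t w t0 tc Ew.
 have [es es0 sep] := root_sep (isT : (0 < 4)%N) t0.
 pose bet (G : 'I_k*bool) (e : R) := forall w' t', B w' -> cball w e w' -> cnorm (t' - t) < e ->
   T (dk G w') i0^+4 = t'^+4 -> (T (dk G w') i0 = t' <-> T (dk G w) i0 = t).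
 have [||e e0 hee] := @fin_delta R ('I_k*bool)%type bet.
 - move=> G d e de H w' t' Bw' b bt; apply: H => //; [exact: cballW b|exact: lt_le_trans de].
 - move=> G; case: (pselect (T (dk G w) i0 = t)) => [Et|Nt].
   have [d d0 hd] := Tc G i0 w Bw es es0.
   exmin d es.
   move=> w' t' Bw' b; rewrite lt_min => /andP[_ bt] F; split => // _.
   apply: sep => //; rewrite -Et; apply: hd => //; apply: cballW b; by minle.
  pose n := cnorm (T (dk G w) i0 - t).
  have n0 : 0 < n by apply: cnorm_gt0; rewrite subr_eq0; apply/eqP.
  have n2 : 0 < n/2 by rewrite divr_gt0.
  have [d d0 hd] := Tc G i0 w Bw _ n2.
  exmin d (n/2).
  move=> w' t' Bw' b; rewrite lt_min => /andP[_ bt] F; split => // E; exfalso.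
  have bd : cball w d w' by cmin b.
  have := hd w' Bw' bd; rewrite E => h1; have := cnorm_tri t' (T (dk G w) i0) t; rewrite -/n (cnormBC _ t'); lra.
 have wn : w <> (0, 0) by case: Bw.
 have [d1 d10 hd1] := rho_open k0 wn e0.
 have Vt := (hc t tc).1; have [d2 d20 hd2] := cg _ Vt d1 d10.
 have cp : ctn (fun=> True) (fun w : P => - w.1^+4/3) (t, 0). by ctnauto.
 have [d3 d30 hd3] := cp _ d20.
 exmin e d3.
 move=> t' t'0 t'c; rewrite lt_min => /andP[te td].
 have b3 : cball (pt t) d2 (pt t').
  have z2 : (pt t').2 - (pt t).2 = 0 by rewrite subrr.
  split; last by rewrite z2 cnorm0.
  by apply: (hd3 (t', 0) Logic.I); split => //; rewrite subrr cnorm0.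
 have := hd2 _ (hc t' t'c).1 b3; rewrite -Ew => b4.
 have [w' Ew' bw'] := hd1 _ b4; have [Bw' pw'] := over t' w' t'0 t'c Ew'.
 rewrite (QG t' w') // (QG t w) //.
 have F (G : 'I_k*bool) : T (dk G w') i0^+4 = t'^+4.
  have := Troot _ i0 (dkB G w' Bw'); rewrite /phi (@pphi_inv R k h (dk G w') w') ?rho_dk //.
  by rewrite -/(phi w') pw' ptq => /eqP; rewrite subr_eq0 => /eqP.
 by split=> -[G HG]; exists G; [apply/(hee G w' t' Bw' bw' te (F G))|apply/(hee G w' t' Bw' bw' te (F G))].
have [t [t0 tc]] : exists t : C, t != 0 /\ cnorm t < c.
 exists (c/2)%:C%C; rewrite cnorm_real gtr0_norm ?divr_gt0 //; split; last by lra.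
 by apply/eqP => /complexI E; have := divr_gt0 c0 (ltr0Sn R 1); rewrite E ltxx.
have [w Ew] := rho_surj (g (pt t)) k0; have [Bw pw] := over t w t0 tc Ew.
have T4 j : T w j^+4 = t^+4.
 by have := Troot w j Bw; rewrite pw ptq => /eqP; rewrite subr_eq0 => /eqP.
have ptE j : pt (T w j) = pt t by rewrite /pt T4.
have Tn j : T w j != 0.
 by apply/eqP => z0; have := T4 j; rewrite z0 expr0n /= => /esym/eqP; rewrite expf_eq0 /= (negbTE t0).
have TN j : cnorm (T w j) < c.
 suff -> : cnorm (T w j) = cnorm t by [].
 apply/eqP; rewrite -(@eqrXn2 _ 4) ?cnorm_ge0 //; by rewrite -!cnormX T4.
have Q0 : Q (T w i0) by exists w; rewrite ptE.
have Qall j : Q (T w j) := disc_const loc (Tn j) (Tn i0) (TN j) (TN i0) Q0.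
have nb := nbad t w t0 tc Ew; have inj := Tinj w Bw nb.
(* All four roots over [pt t] occur on the orbit of the sheet [i0], which has at most two
   elements. *)
have cover j : j \in [:: i0; th (i2, true) i0].
 have [w' [E' Tw]] := Qall j; rewrite ptE in E'.
 have [G Ew'] := rho_fibre k0 (etrans Ew (esym E')); rewrite Ew' in Tw.
 by rewrite !inE; case: (two G w Bw); rewrite Tw => /inj ->; rewrite eqxx ?orbT.
have := uniq_leq_size (enum_uniq 'I_4) (fun j _ => cover j).
by rewrite size_enum_ord.
Qed.

End E6vsA.

(** * Strict differentiability and local normal forms *)
Section StrictDiff.
Variable R : realType.
Local Notation C := (R[i]).
Local Notation P := (C*C)%type.
Implicit Types (q p : P) (f g : P -> C).

Definition nd q q' : R := Num.max (cnorm (q.1 - q'.1)) (cnorm (q.2 - q'.2)).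
Local Notation B0 d := (cball ((0, 0) : P) d).

Lemma nd_ge1 q q' : cnorm (q.1 - q'.1) <= nd q q'. Proof. by rewrite /nd le_max lexx. Qed.
Lemma nd_ge2 q q' : cnorm (q.2 - q'.2) <= nd q q'. Proof. by rewrite /nd le_max lexx orbT. Qed.
Lemma nd_ge0 q q' : 0 <= nd q q'. Proof. exact: le_trans (cnorm_ge0 _) (nd_ge1 q q'). Qed.
Lemma nd_refl q : nd q q = 0. Proof. by rewrite /nd !subrr cnorm0 maxxx. Qed.
Lemma nd_ball q q' (e : R) : cball q e q' <-> nd q' q < e.
Proof. by rewrite /nd gt_max; split=> [[-> ->]|/andP[]]. Qed.

(** Stated for an arbitrary increment [D q q']: products, inverses and roots all amount to
    multiplying an increment by a factor that has a limit. *)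
Definition sdl (D : P -> P -> C) (al be : C) := forall e : R, 0 < e -> exists2 d : R, 0 < d &
 forall q q', B0 d q -> B0 d q' -> cnorm (D q q' - (al*(q.1 - q'.1) + be*(q.2 - q'.2))) <= e*nd q q'.

(** Strict differentiability at the origin: [sdl] for the increment of [f], spelled out. *)
Definition sdiff f (al be : C) := forall e : R, 0 < e -> exists2 d : R, 0 < d &
 forall q q', B0 d q -> B0 d q' -> cnorm (f q - f q' - (al*(q.1 - q'.1) + be*(q.2 - q'.2))) <= e*nd q q'.
Definition sd f := exists al be, sdiff f al be.

Lemma lin_nd a b q q' : cnorm (a*(q.1 - q'.1) + b*(q.2 - q'.2)) <= (cnorm a + cnorm b)*nd q q'.
Proof.
by apply: le_trans (cnormD _ _) _; rewrite !cnormM mulrDl lerD // ler_wpM2l ?cnorm_ge0 ?nd_ge1 ?nd_ge2.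
Qed.

Lemma sdl_ext (D D' : P -> P -> C) a b a' b' (r : R) : a = a' -> b = b' -> 0 < r ->
 (forall q q', B0 r q -> B0 r q' -> D q q' = D' q q') -> sdl D a b -> sdl D' a' b'.
Proof.
move=> <- <- r0 E h e e0; have [d d0 hd] := h e e0; exmin r d.
move=> q q' b1 b2; rewrite -E; [apply: hd; [apply: cballW b1|apply: cballW b2]|apply: cballW b1|apply: cballW b2]; by minle.
Qed.

Lemma sdlD D1 D2 a b c d : sdl D1 a b -> sdl D2 c d -> sdl (fun q q' => D1 q q' + D2 q q') (a + c) (b + d).
Proof.
move=> hf hg e e0; have e2 : 0 < e/2 by rewrite divr_gt0.
have [d1 d10 h1] := hf _ e2; have [d2 d20 h2] := hg _ e2.
exmin d1 d2.
have w1 : Num.min d1 d2 <= d1 by minle. have w2 : Num.min d1 d2 <= d2 by minle.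
move=> q q' b1 b2; have k1 := h1 _ _ (cballW w1 b1) (cballW w1 b2); have k2 := h2 _ _ (cballW w2 b1) (cballW w2 b2).
have -> : D1 q q' + D2 q q' - ((a + c)*(q.1 - q'.1) + (b + d)*(q.2 - q'.2)) =
 (D1 q q' - (a*(q.1 - q'.1) + b*(q.2 - q'.2))) + (D2 q q' - (c*(q.1 - q'.1) + d*(q.2 - q'.2))) by ring.
by apply: le_trans (cnormD _ _) _; lra.
Qed.

Lemma sdlM D (m : P -> P -> C) m0 a b : sdl D a b -> (forall e : R, 0 < e -> exists2 d : R, 0 < d &
  forall q q', B0 d q -> B0 d q' -> cnorm (m q q' - m0) < e) -> sdl (fun q q' => D q q' * m q q') (a * m0) (b * m0).
Proof.
move=> hD hm e e0; have na := cnorm_ge0 a; have nb := cnorm_ge0 b; have nm := cnorm_ge0 m0.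
pose K := 1 + cnorm m0 + (cnorm a + cnorm b); have K1 : 1 <= K by rewrite /K; lra.
pose t := Num.min 1 (e/(2*K)).
have t0 : 0 < t by rewrite lt_min ltr01 divr_gt0 // mulr_gt0 //; lra.
have t1 : t <= 1 by minle.
have tK : t*(2*K) <= e by rewrite -ler_pdivlMr ?mulr_gt0 //; [minle|lra].
have [d1 d10 h1] := hD t t0; have [d2 d20 h2] := hm t t0.
exmin d1 d2.
have w1 : Num.min d1 d2 <= d1 by minle. have w2 : Num.min d1 d2 <= d2 by minle.
move=> q q' b1 b2; have k1 := h1 _ _ (cballW w1 b1) (cballW w1 b2); have k2 := h2 _ _ (cballW w2 b1) (cballW w2 b2).
set L := a*(q.1 - q'.1) + b*(q.2 - q'.2) in k1.
have -> : D q q' * m q q' - (a * m0*(q.1 - q'.1) + b * m0*(q.2 - q'.2)) = (D q q' - L) * m q q' + L*(m q q' - m0) by rewrite /L; ring.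
have nS : cnorm (m q q') <= cnorm m0 + 1 by have := cnorm_sub_ge (m q q') m0; lra.
have n0 := nd_ge0 q q'; apply: le_trans (cnormD _ _) _; rewrite !cnormM.
have z1 : cnorm (D q q' - L)*cnorm (m q q') <= (t*nd q q')*K.
 by apply: ler_pM => //; rewrite ?cnorm_ge0 //; apply: le_trans nS _; rewrite /K; lra.
have z2 : cnorm L*cnorm (m q q' - m0) <= (K*nd q q')*t.
 apply: ler_pM => //; rewrite ?cnorm_ge0 ?(ltW k2) //; apply: le_trans (lin_nd _ _ _ _) _; apply: ler_wpM2r => //; rewrite /K; lra.
have := ler_wpM2r n0 tK; lra.
Qed.

Lemma sdiff_cst c : sdiff (fun=> c) 0 0.
Proof.
move=> e e0; exists 1 => // q q' _ _; rewrite !mul0r !subrr addr0 oppr0 addr0 cnorm0.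
by rewrite mulr_ge0 ?nd_ge0 // ltW.
Qed.
Lemma sdiff_fst : sdiff fst 1 0.
Proof.
move=> e e0; exists 1 => // q q' _ _; rewrite mul0r mul1r addr0 subrr cnorm0.
by rewrite mulr_ge0 ?nd_ge0 // ltW.
Qed.
Lemma sdiff_snd : sdiff snd 0 1.
Proof.
move=> e e0; exists 1 => // q q' _ _; rewrite mul0r mul1r add0r subrr cnorm0.
by rewrite mulr_ge0 ?nd_ge0 // ltW.
Qed.
Lemma sdiffD f g a b c d : sdiff f a b -> sdiff g c d -> sdiff (fun q => f q + g q) (a + c) (b + d).
Proof.
move=> hf hg; change (sdl (fun q q' => f q + g q - (f q' + g q')) (a + c) (b + d)).
by apply: (sdl_ext (r := 1) _ _ _ _ (sdlD (hf : sdl _ _ _) hg)) => // q q' _ _; ring.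
Qed.
Lemma sdiff_lip f a b : sdiff f a b -> exists L : R, 0 <= L /\ exists2 d : R, 0 < d &
 forall q q', B0 d q -> B0 d q' -> cnorm (f q - f q') <= L*nd q q'.
Proof.
move=> hf; have [d d0 h] := hf 1 ltr01; exists (1 + cnorm a + cnorm b); split.
 by have := cnorm_ge0 a; have := cnorm_ge0 b; lra.
exists d => // q q' b1 b2; have := h q q' b1 b2; set x := (X in cnorm X <= _) => hx.
have -> : f q - f q' = x + (a*(q.1 - q'.1) + b*(q.2 - q'.2)) by rewrite /x; ring.
by apply: le_trans (cnormD _ _) _; have := lin_nd a b q q'; lra.
Qed.
Lemma sdiff_ctn f a b : sdiff f a b -> exists2 d : R, 0 < d & forall q, B0 d q -> ctn (B0 d) f q.
Proof.
move=> /sdiff_lip[L [L0 [d d0 h]]]; exists d => // q bq e e0.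
have L1 : 0 < L + 1 by lra.
exists (e/(L + 1)); first by rewrite divr_gt0.
move=> q' bq' /nd_ball; rewrite ltr_pdivlMr // => hn; apply: le_lt_trans (h _ _ bq' bq) _.
by apply: le_lt_trans hn; have := nd_ge0 q' q; nra.
Qed.
Lemma sdiff_near f a b (e : R) : sdiff f a b -> 0 < e -> exists2 d : R, 0 < d & forall q, B0 d q -> cnorm (f q - f (0, 0)) < e.
Proof.
move=> /sdiff_ctn[d d0 h] e0; have [d' d'0 h'] := h _ (cball_refl _ d0) e e0.
exmin d d'.
by move=> q bq; apply: h'; cmin bq.
Qed.
Lemma sdiffM f g a b c d : sdiff f a b -> sdiff g c d ->
 sdiff (fun q => f q*g q) (f (0, 0)*c + g (0, 0)*a) (f (0, 0)*d + g (0, 0)*b).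
Proof.
move=> hf hg; change (sdl (fun q q' => f q*g q - f q'*g q') (f (0, 0)*c + g (0, 0)*a) (f (0, 0)*d + g (0, 0)*b)).
have mg (e : R) : 0 < e -> exists2 d : R, 0 < d & forall q q', B0 d q -> B0 d q' -> cnorm (g q - g (0, 0)) < e.
 by move=> e0; have [r r0 h] := sdiff_near hg e0; exists r => // q q' b1 _; exact: h.
have mf (e : R) : 0 < e -> exists2 d : R, 0 < d & forall q q', B0 d q -> B0 d q' -> cnorm (f q' - f (0, 0)) < e.
 by move=> e0; have [r r0 h] := sdiff_near hf e0; exists r => // q q' _; exact: h.
by apply: (sdl_ext (r := 1) _ _ _ _ (sdlD (sdlM (hf : sdl _ _ _) mg) (sdlM (hg : sdl _ _ _) mf))) => // [||q q' _ _]; ring.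
Qed.
Lemma sd_ext f g : f =1 g -> sd f -> sd g.
Proof. by move=> E [a [b s]]; exists a, b => e e0; have [d d0 hd] := s e e0; exists d => // q q' h h'; rewrite -!E; exact: hd. Qed.
Lemma sd_cst c : sd (fun=> c). Proof. by do 2!eexists; exact: sdiff_cst. Qed.
Lemma sd_fst : sd fst. Proof. by do 2!eexists; exact: sdiff_fst. Qed.
Lemma sd_snd : sd snd. Proof. by do 2!eexists; exact: sdiff_snd. Qed.
Lemma sdD f g : sd f -> sd g -> sd (fun q => f q + g q).
Proof. by move=> [a [b hf]] [c [d hg]]; do 2!eexists; apply: sdiffD hf hg. Qed.
Lemma sdM f g : sd f -> sd g -> sd (fun q => f q*g q).
Proof. by move=> [a [b hf]] [c [d hg]]; do 2!eexists; apply: sdiffM hf hg. Qed.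
Lemma sdN f : sd f -> sd (fun q => - f q).
Proof. by move=> hf; apply: sd_ext (sdM (sd_cst (-1)) hf) => q; rewrite mulN1r. Qed.
Lemma sdB f g : sd f -> sd g -> sd (fun q => f q - g q).
Proof. by move=> hf hg; apply: sdD => //; exact: sdN. Qed.
Lemma sdX f n : sd f -> sd (fun q => f q^+n).
Proof.
move=> hf; elim: n => [|n IH]; first exact: sd_cst.
by apply: sd_ext (sdM hf IH) => q; rewrite exprS.
Qed.

Lemma ctn_sum D (n : nat) (F : 'I_n -> P -> C) q : (forall i, ctn D (F i) q) -> ctn D (fun w => \sum_i F i w) q.
Proof.
move=> H; elim: n F H => [|n IH] F H.
 by apply: (@ctn_ext _ _ (fun=> 0)); rewrite ?big_ord0 //; [move=> w _; rewrite big_ord0|exact: ctn_cst].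
apply: (@ctn_ext _ _ (fun w => F ord0 w + \sum_i F (lift ord0 i) w)); rewrite ?big_ord_recl //.
 by move=> w _; rewrite big_ord_recl.
by apply: ctnD => //; apply: IH.
Qed.

(** Differentiates a function known only through the factorisation of its increments; [M] is
    [-1/(f f')] in disguise for inverses, and the inverse of the sum [s^(n-1) + ... + s'^(n-1)] for
    [n]-th roots. *)
Lemma sd_factor f s (M : P -> C) (r : R) : sd f -> 0 < r -> ctn (B0 r) s (0, 0) -> ctn (fun=> True) M (s (0, 0), s (0, 0)) ->
 (forall q q', B0 r q -> B0 r q' -> s q - s q' = (f q - f q')*M (s q, s q')) -> sd s.
Proof.
move=> [a [b hf]] r0 cs cM E; set m0 := M (s (0, 0), s (0, 0)); exists (a * m0), (b * m0).
have mM (e : R) : 0 < e -> exists2 d : R, 0 < d & forall q q', B0 d q -> B0 d q' -> cnorm (M (s q, s q') - m0) < e.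
 move=> e0; have [e1 e10 h1] := cM e e0; have [d d0 hd] := cs _ e10; exmin r d.
 by move=> q q' b1 b2; apply: h1 => //; split; apply: hd; [apply: cballW b1|apply: cballW b1|apply: cballW b2|apply: cballW b2]; minle.
change (sdl (fun q q' => s q - s q') (a * m0) (b * m0)).
by apply: (sdl_ext _ _ r0 _ (sdlM (hf : sdl _ _ _) mM)) => // q q' b1 b2; rewrite E.
Qed.

Lemma sdV f : sd f -> f (0, 0) != 0 -> sd (fun q => (f q)^-1).
Proof.
move=> sf f0; have [a [b hf]] := sf; have [d d0 cf] := sdiff_ctn hf; have [r r0 hr] := ctn_neq0 (cf _ (cball_refl _ d0)) f0.
have m0 : 0 < Num.min d r by rewrite lt_min d0.
apply: (sd_factor (M := fun w => - (w.1*w.2)) sf m0).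
- by apply: ctnW (ctnV f0 (cf _ (cball_refl _ d0))) => q; apply: cballW; minle.
- by ctnauto.
have nz q : B0 (Num.min d r) q -> f q != 0 by move=> b1; apply: hr; cmin b1.
by move=> q q' /nz n1 /nz n2 /=; field; rewrite n1 n2.
Qed.

Lemma sd_root f n : (0 < n)%N -> sd f -> f (0, 0) != 0 ->
 exists k : P -> C, [/\ sd k, k (0, 0) != 0 & exists2 d : R, 0 < d & forall q, B0 d q -> k q^+n = f q].
Proof.
move=> n0 sf f0; have [a [b hf]] := sf; have [c hc] := nroot_ex (f (0, 0)) n0.
have c0 : c != 0 by apply: contraNneq f0 => z; rewrite -hc z expr0n gtn_eqF.
have [d1 d10 h1] := sdiff_ctn hf.
have [d2 d20 [s [s0 hs]]] := local_nroot n0 (cball_refl _ d10) h1 hc c0 ltr01.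
pose d3 := Num.min d1 d2; have d30 : 0 < d3 by rewrite lt_min d10.
have b3 q : B0 d3 q -> B0 d1 q /\ B0 d2 q by move=> bq; split; cmin bq.
exists s; split; [|by rewrite s0|by exists d3 => // q /b3[b1 b2]; case: (hs q b1 b2)].
pose S (w : P) := \sum_(i < n) w.1^+(n.-1 - i)*w.2^+i.
have S0 : S (c, c) = n%:R*c^+n.-1.
 rewrite /S (eq_bigr (fun=> c^+n.-1)); first by rewrite sumr_const card_ord mulr_natl.
 by move=> i _ /=; rewrite -exprD subnK // -ltnS prednK.
have Sn : S (c, c) != 0 by rewrite S0 mulf_neq0 ?expf_neq0 // pnatr_eq0 -lt0n.
have cS : ctn (fun=> True) S (c, c).
 by apply: ctn_sum => i; ctnauto.
have [_ _ cs] := hs _ (cball_refl _ d10) (cball_refl _ d20).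
have [e e0 he] := ctn_neq0 cS Sn; have [d4 d40 hd4] := cs _ e0.
have m0 : 0 < Num.min d3 d4 by rewrite lt_min d30.
apply: (sd_factor (M := fun w => (S w)^-1) sf m0); rewrite ?s0; last 1 first.
- move=> q q' bq bq'; have w3 : Num.min d3 d4 <= d3 by minle. have w4 : Num.min d3 d4 <= d4 by minle.
 have [b1 b2] := b3 q (cballW w3 bq); have [b1' b2'] := b3 q' (cballW w3 bq').
 have Sz : S (s q, s q') != 0.
  by apply: he => //; split; rewrite /= -s0; apply: hd4 => //; [exact: cballW w4 bq|exact: cballW w4 bq'].
 by have [<- _ _] := hs q b1 b2; have [<- _ _] := hs q' b1' b2'; rewrite subrXX mulfK.
- by apply: ctnW cs => q bq; apply: b3; cmin bq.
- exact: ctnV.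
Qed.

(** [x n - 2 M / 2^n] increases, [x n + 2 M / 2^n] decreases, and the limit is the supremum of the
    former. *)
Lemma real_limit (x : nat -> R) (M : R) : (forall n, `|x n.+1 - x n| <= M*2^-1^+n) ->
 exists L, forall n, `|x n - L| <= 2*M*2^-1^+n.
Proof.
move=> H; pose a n := x n - 2*M*2^-1^+n; pose b n := x n + 2*M*2^-1^+n.
have M0 : 0 <= M by have := H 0%N; rewrite expr0 mulr1; exact: le_trans.
have hp n : 0 <= M*2^-1^+n by rewrite mulr_ge0 // exprn_ge0 // invr_ge0.
have am n m : (n <= m)%N -> a n <= a m.
 elim: m => [|m IH]; first by rewrite leqn0 => /eqP->.
 rewrite leq_eqVlt => /orP[/eqP->//|/IH h]; apply: le_trans h _.
 by rewrite /a exprS; have := H m; rewrite ler_norml => /andP[]; lra.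
have bm n m : (n <= m)%N -> b m <= b n.
 elim: m => [|m IH]; first by rewrite leqn0 => /eqP->.
 rewrite leq_eqVlt => /orP[/eqP->//|/IH h]; apply: le_trans h.
 by rewrite /b exprS; have := H m; rewrite ler_norml => /andP[]; lra.
have ab n m : a n <= b m.
 have nm : a (maxn n m) <= b (maxn n m) by rewrite /a /b; have := hp (maxn n m); lra.
 by apply: le_trans (am _ _ (leq_maxl n m)) (le_trans nm (bm _ _ (leq_maxr n m))).
pose A := [set a n | n in setT]%classic.
exists (sup A) => n; rewrite ler_norml.
have : a n <= sup A by apply: ub_le_sup; [exists (b 0%N) => _ [m _ <-]|exists n].
have : sup A <= b n by apply: ge_sup; [exists (a 0%N), 0%N|move=> _ [m _ <-]].
by rewrite /a /b => h1 h2; apply/andP; split; lra.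
Qed.

Lemma cplx_limit (x : nat -> C) (M : R) : (forall n, cnorm (x n.+1 - x n) <= M*2^-1^+n) ->
 exists L, forall n, cnorm (x n - L) <= 4*M*2^-1^+n.
Proof.
move=> H.
have [r hr] : exists L, forall n, `|complex.Re (x n) - L| <= 2*M*2^-1^+n.
 apply: real_limit => n; apply: le_trans (H n); apply: le_trans (Re_le_cnorm _).
 by case: (x n.+1) => ? ?; case: (x n).
have [i hi] : exists L, forall n, `|complex.Im (x n) - L| <= 2*M*2^-1^+n.
 apply: real_limit => n; apply: le_trans (H n); apply: le_trans (Im_le_cnorm _).
 by case: (x n.+1) => ? ?; case: (x n).
exists (r +i* i)%C => n; apply: le_trans (cnorm_le_ReIm _) _.
have := hr n; have := hi n; case: (x n) => c d /=; lra.
Qed.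

Lemma half_small (M e : R) : 0 < e -> exists n, M*2^-1^+n < e.
Proof.
move=> e0; have [n hn] := geom_small `|M| e0; exists n; apply: le_lt_trans hn.
apply: le_trans (ler_norm _) _; rewrite normrM mulrC; apply: ler_wpM2r => //.
rewrite ger0_norm ?exprn_ge0 ?invr_ge0 // lerXn2r ?nnegrE ?invr_ge0 //; lra.
Qed.

(** The inverse function theorem for derivative the identity: [F] minus the identity contracts
    distances by the factor 1/2 near the origin. *)
Lemma inv_heo (F1 F2 : P -> C) (d0 : R) :
 sdiff F1 1 0 -> sdiff F2 0 1 -> F1 (0, 0) = 0 -> F2 (0, 0) = 0 -> 0 < d0 ->
 exists U V G, [/\ copen U, copen V, U (0, 0), V (0, 0) & heo U V (fun q => (F1 q, F2 q)) G] /\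
  forall q, U q -> B0 d0 q.
Proof.
move=> s1 s2 z1 z2 d00; pose F q : P := (F1 q, F2 q).
have hf : 0 < 2^-1 :> R by rewrite invr_gt0.
have [d1 d10 h1] := s1 _ hf; have [d2 d20 h2] := s2 _ hf.
pose d := Num.min d0 (Num.min d1 d2); have dp : 0 < d by rewrite !lt_min d00 d10.
have w0 : d <= d0 by minle. have w1 : d <= d1 by rewrite !ge_min lexx orbT.
have w2 : d <= d2 by rewrite !ge_min lexx !orbT.
pose N1 q := F1 q - q.1; pose N2 q := F2 q - q.2.
have l1 q q' : B0 d q -> B0 d q' -> cnorm (N1 q - N1 q') <= 2^-1*nd q q'.
 move=> b b'; have := h1 q q' (cballW w1 b) (cballW w1 b'); congr (cnorm _ <= _); rewrite /N1; ring.
have l2 q q' : B0 d q -> B0 d q' -> cnorm (N2 q - N2 q') <= 2^-1*nd q q'.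
 move=> b b'; have := h2 q q' (cballW w2 b) (cballW w2 b'); congr (cnorm _ <= _); rewrite /N2; ring.
have N10 : N1 (0, 0) = 0 by rewrite /N1 z1 subr0.
have N20 : N2 (0, 0) = 0 by rewrite /N2 z2 subr0.
have expand q q' : B0 d q -> B0 d q' -> nd q q' <= 2*nd (F q) (F q').
 move=> b b'; have k1 := l1 q q' b b'; have k2 := l2 q q' b b'.
 have e1 : cnorm (q.1 - q'.1) <= nd (F q) (F q') + 2^-1*nd q q'.
  have -> : q.1 - q'.1 = ((F q).1 - (F q').1) - (N1 q - N1 q') by rewrite /N1 /F /=; ring.
  by apply: le_trans (cnormB _ _) _; have := nd_ge1 (F q) (F q'); lra.
 have e2 : cnorm (q.2 - q'.2) <= nd (F q) (F q') + 2^-1*nd q q'.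
  have -> : q.2 - q'.2 = ((F q).2 - (F q').2) - (N2 q - N2 q') by rewrite /N2 /F /=; ring.
  by apply: le_trans (cnormB _ _) _; have := nd_ge2 (F q) (F q'); lra.
 have : nd q q' <= nd (F q) (F q') + 2^-1*nd q q' by rewrite {1}/nd ge_max e1 e2.
 lra.
have surj p : B0 (d/2) p -> exists2 q, B0 d q & F q = p.
 move=> /nd_ball; set m := nd p (0, 0) => hm.
 (* A solution of [F q = p] is a fixed point of [st]; the iterates converge geometrically and stay
    within distance [2 m < d] of the origin. *)
 pose st q : P := (p.1 - N1 q, p.2 - N2 q); pose x n := iter n st (0, 0).
 have inv n : nd (x n) (0, 0) <= 2 * m*(1 - 2^-1^+n) /\ nd (x n.+1) (x n) <= m*2^-1^+n.
  have m0 : 0 <= m by exact: nd_ge0.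
  have tri q q' : nd q (0, 0) <= nd q q' + nd q' (0, 0).
   rewrite {1}/nd ge_max; apply/andP; split.
    by apply: le_trans (cnorm_tri q'.1 _ _) _; apply: lerD; [exact: nd_ge1|exact: (nd_ge1 q' (0, 0))].
   by apply: le_trans (cnorm_tri q'.2 _ _) _; apply: lerD; [exact: nd_ge2|exact: (nd_ge2 q' (0, 0))].
  elim: n => [|n [i1 i2]].
   rewrite expr0 subrr !mulr0 mulr1; split; first by rewrite -[x 0%N]/((0, 0) : P) nd_refl.
   by rewrite /x /= /st N10 N20 !subr0 -surjective_pairing.
  have p0 : 0 <= 2^-1^+n :> R by rewrite exprn_ge0 // invr_ge0.
  have p1 : m*2^-1^+n.+1 = m*2^-1^+n/2 by rewrite exprS; ring.
  have q0 : 0 <= m*2^-1^+n by exact: mulr_ge0.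
  have a1 : nd (x n.+1) (0, 0) <= 2 * m*(1 - 2^-1^+n.+1) by have := tri (x n.+1) (x n); lra.
  split => //.
  have bn : B0 d (x n) by apply/nd_ball; lra.
  have bn1 : B0 d (x n.+1) by apply/nd_ball; lra.
  have k1 := l1 _ _ bn1 bn; have k2 := l2 _ _ bn1 bn.
  have E k : x k.+1 = st (x k) by [].
  rewrite {1}/nd ge_max (E n.+1) (E n) /= -(E n); apply/andP; split.
   have -> : p.1 - N1 (x n.+1) - (p.1 - N1 (x n)) = - (N1 (x n.+1) - N1 (x n)) by ring.
   rewrite cnormN; lra.
  have -> : p.2 - N2 (x n.+1) - (p.2 - N2 (x n)) = - (N2 (x n.+1) - N2 (x n)) by ring.
  rewrite cnormN; lra.
 have [a ha] : exists L, forall n, cnorm ((x n).1 - L) <= 4 * m*2^-1^+n.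
  by apply: cplx_limit => n; apply: le_trans (nd_ge1 _ _) (inv n).2.
 have [b hb] : exists L, forall n, cnorm ((x n).2 - L) <= 4 * m*2^-1^+n.
  by apply: cplx_limit => n; apply: le_trans (nd_ge2 _ _) (inv n).2.
 have m0 : 0 <= m by exact: nd_ge0.
 have p0 n : 0 <= m*2^-1^+n :> R by rewrite mulr_ge0 // exprn_ge0 // invr_ge0.
 have hab n : nd (x n) (a, b) <= 4 * m*2^-1^+n by rewrite /nd ge_max ha hb.
 have xn n : nd (x n) (0, 0) <= 2 * m by have := (inv n).1; have := p0 n; lra.
 have bab : B0 d (a, b).
  apply/nd_ball; suff : nd (a, b) (0, 0) <= 2 * m by lra.
  have key (L : C) (y : nat -> C) : (forall n, cnorm (y n - L) <= 4 * m*2^-1^+n) ->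
    (forall n, cnorm (y n - 0) <= 2 * m) -> cnorm (L - 0) <= 2 * m.
   move=> h1' h2'; apply/ler_addgt0Pl => e e0; have [n hn] := half_small (4 * m) e0.
   have := cnorm_tri (y n) L 0; rewrite (cnormBC L (y n)); have := h1' n; have := h2' n; lra.
  rewrite /nd ge_max; apply/andP; split; apply: key.
  - exact: ha. - by move=> n; apply: le_trans (nd_ge1 _ (0, 0)) (xn n).
  - exact: hb. - by move=> n; apply: le_trans (nd_ge2 _ (0, 0)) (xn n).
 have bx n : B0 d (x n) by apply/nd_ball; have := xn n; lra.
 exists (a, b) => //.
 have lim (Fi pr : P -> C) : (forall q q', B0 d q -> B0 d q' -> cnorm ((Fi q - pr q) - (Fi q' - pr q')) <= 2^-1*nd q q') ->
   (forall q q', cnorm (pr q - pr q') <= nd q q') -> (forall n, pr (x n.+1) = pr p - (Fi (x n) - pr (x n))) -> Fi (a, b) - pr p = 0.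
  move=> hN hp hs; apply: cnorm_small_eq0 => e e0; have [n hn] := half_small (8 * m) e0.
  have -> : Fi (a, b) - pr p = ((Fi (a, b) - pr (a, b)) - (Fi (x n) - pr (x n))) + (pr (a, b) - pr (x n.+1)) by rewrite hs; ring.
  apply: le_trans (cnormD _ _) _; rewrite (cnormBC (pr (a, b))).
  have := hN (a, b) (x n) bab (bx n); have := le_trans (hp (x n.+1) (a, b)) (hab n.+1); have := hab n; rewrite exprS.
  have -> : nd (a, b) (x n) = nd (x n) (a, b) by rewrite /nd !(cnormBC (x n).1) (cnormBC (x n).2).
  by have := p0 n; lra.
 have lim1 := lim F1 fst l1 nd_ge1 (fun=> erefl); have lim2 := lim F2 snd l2 nd_ge2 (fun=> erefl).
 by rewrite /F (subr0_eq lim1) (subr0_eq lim2) -surjective_pairing.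
have /choice[G hG] : forall p, exists q, B0 (d/2) p -> B0 d q /\ F q = p.
 move=> p; case: (pselect (B0 (d/2) p)) => [/surj[q b E]|n]; first by exists q.
 by exists p.
have d2' : 0 < d/2 by rewrite divr_gt0.
have nd0 q q' : nd q q' <= 0 -> q = q'.
 rewrite /nd ge_max => /andP[a b]; case: q q' a b => u v [u' v'] /= a b.
 have -> : u = u' by apply/subr0_eq/cnorm_eq0/eqP; rewrite eq_le a cnorm_ge0.
 by have -> : v = v' by apply/subr0_eq/cnorm_eq0/eqP; rewrite eq_le b cnorm_ge0.
have inj q q' : B0 d q -> B0 d q' -> F q = F q' -> q = q'.
 move=> b b' E; apply: nd0; have := expand q q' b b'; rewrite E.
 by rewrite nd_refl mulr0.
have lipF q q' : B0 d q -> B0 d q' -> nd (F q) (F q') <= 2*nd q q'.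
 move=> b b'; have k1 := l1 q q' b b'; have k2 := l2 q q' b b'.
 rewrite {1}/nd ge_max; apply/andP; split.
  have -> : (F q).1 - (F q').1 = (q.1 - q'.1) + (N1 q - N1 q') by rewrite /N1 /F /=; ring.
  by apply: le_trans (cnormD _ _) _; have := nd_ge0 q q'; have := nd_ge1 q q'; lra.
 have -> : (F q).2 - (F q').2 = (q.2 - q'.2) + (N2 q - N2 q') by rewrite /N2 /F /=; ring.
 by apply: le_trans (cnormD _ _) _; have := nd_ge0 q q'; have := nd_ge2 q q'; lra.
have cF : ccont_on (B0 d) F.
 move=> q b e e0; exists (e/2); first by rewrite divr_gt0.
 by move=> q' b' /nd_ball h; apply/nd_ball; have := lipF q' q b' b; lra.
exists (fun q => B0 d q /\ B0 (d/2) (F q)), (B0 (d/2)), G.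
have F0 : F (0, 0) = (0, 0) by rewrite /F z1 z2.
split.
 split.
 - by apply: (ccont_preim_open (fun=> True)) => //; exact: cball_open.
 - exact: cball_open.
 - by rewrite F0; split; exact: cball_refl.
 - exact: cball_refl.
 split.
 - by move=> q [].
 - by move=> p bp; have [h3 h4] := hG p bp; rewrite h4.
 - by move=> q [b b']; have [h3 h4] := hG _ b'; apply: inj.
 - by move=> p bp; case: (hG p bp).
 split; first by apply: ccontW cF => q [].
 move=> p bp e e0; exists (e/2); first by rewrite divr_gt0.
 move=> p' bp' /nd_ball h; apply/nd_ball.
 have [g1 g2] := hG p bp; have [g3 g4] := hG p' bp'; have := expand _ _ g3 g1; rewrite g2 g4; lra.
by move=> q [b _]; exact: cballW b.
Qed.

Lemma inv_germ (F1 F2 : P -> C) (X1 X2 : P -> Prop) :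
 sdiff F1 1 0 -> sdiff F2 0 1 -> F1 (0, 0) = 0 -> F2 (0, 0) = 0 ->
 (exists2 d : R, 0 < d & forall q, B0 d q -> (X1 q <-> X2 (F1 q, F2 q))) ->
 top_equiv_germ X1 (0, 0) X2 (0, 0).
Proof.
move=> s1 s2 z1 z2 [d d0 hX]; have [U [V [G [H hU]]]] := inv_heo s1 s2 z1 z2 d0.
by apply/top_equivP; exists U, V, (fun q => (F1 q, F2 q)), G; split => //; rewrite z1 z2; split => // q /hU; exact: hX.
Qed.

Lemma lin_germ (a b c d : C) (X : P -> Prop) : a*d - b*c != 0 ->
 top_equiv_germ (fun q => X (a*q.1 + b*q.2, c*q.1 + d*q.2)) (0, 0) X (0, 0).
Proof.
move=> D0; apply/top_equivP; exists (fun=> True), (fun=> True).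
exists (fun q => (a*q.1 + b*q.2, c*q.1 + d*q.2)).
exists (fun q => ((d*q.1 - b*q.2)/(a*d - b*c), (a*q.2 - c*q.1)/(a*d - b*c))).
have lc (u v : C) q : ctn (fun=> True) (fun w : P => u*w.1 + v*w.2) q. by ctnauto.
have dv q : a*q.1*d - b*q.1*c = q.1*(a*d - b*c) by ring.
split; last by split => //; rewrite !mulr0 addr0.
split => //; try by move=> q _; exists 1.
split => //.
- by move=> [u v] _ /=; congr pair; field.
- by move=> [u v] _ /=; congr pair; field.
by split; apply/ccont_ctn => q _ /=; split; ctnauto.
Qed.

Lemma sdiff_germ (F1 F2 : P -> C) a b c d (X1 X2 : P -> Prop) :
 sdiff F1 a b -> sdiff F2 c d -> a*d - b*c != 0 -> F1 (0, 0) = 0 -> F2 (0, 0) = 0 ->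
 (exists2 r : R, 0 < r & forall q, B0 r q -> (X1 q <-> X2 (F1 q, F2 q))) ->
 top_equiv_germ X1 (0, 0) X2 (0, 0).
Proof.
move=> h1 h2 D0 z1 z2 [r r0 hX]; set D := a*d - b*c.
apply: top_equiv_trans (lin_germ X2 D0).
pose G1 q := (d/D)*F1 q + (- b/D)*F2 q; pose G2 q := (- c/D)*F1 q + (a/D)*F2 q.
have ch f al be al' be' : al = al' -> be = be' -> sdiff f al be -> sdiff f al' be' by move=> -> ->.
apply: (@inv_germ G1 G2).
- apply: ch (sdiffD (sdiffM (sdiff_cst (d/D)) h1) (sdiffM (sdiff_cst (- b/D)) h2)); rewrite !mulr0 !addr0 /D; field => //.
- apply: ch (sdiffD (sdiffM (sdiff_cst (- c/D)) h1) (sdiffM (sdiff_cst (a/D)) h2)); rewrite !mulr0 !addr0 /D; field => //.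
- by rewrite /G1 z1 z2 !mulr0 addr0.
- by rewrite /G2 z1 z2 !mulr0 addr0.
exists r => // q bq; rewrite hX //= /G1 /G2.
have -> : a*(d/D*F1 q + - b/D*F2 q) + b*(- c/D*F1 q + a/D*F2 q) = F1 q by rewrite /D; field.
by have -> : c*(d/D*F1 q + - b/D*F2 q) + d*(- c/D*F1 q + a/D*F2 q) = F2 q by rewrite /D; field.
Qed.

(** A function which is, up to a unit, quadratic in [Y] with coefficients of weights [j] and [k]
  in [X] defines a germ of type [A_(k-1)]: complete the square. *)
Lemma local_A (f X Y a b c u : P -> C) x1 x2 y1 y2 j k : (0 < k)%N -> (k <= j.*2)%N ->
 sdiff X x1 x2 -> sdiff Y y1 y2 -> x1*y2 - x2*y1 != 0 -> X (0, 0) = 0 -> Y (0, 0) = 0 ->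
 sd a -> sd b -> sd c -> sd u -> b (0, 0) != 0 -> u (0, 0) != 0 ->
 (forall q, u q*f q = b q*Y q^+2 + X q^+j*a q*Y q + X q^+k*c q) ->
 (if k == j.*2 then a (0, 0)^+2 - 4*b (0, 0)*c (0, 0) != 0 else c (0, 0) != 0) ->
 top_equiv_germ (fun q => f q = 0) (0, 0) (fun q => nf k q = 0) (0, 0).
Proof.
move=> k0 kj hX hY D0 X0 Y0 sa sb sc su b0 u0 hf he.
have four0 : (4 : C) != 0 by rewrite pnatr_eq0.
(* [4 b u f = (2 b Y + X^j a)^2 - X^k e]. A [k]-th root of [-e], a unit by the hypothesis on the
   leading terms, is absorbed into [X]. *)
pose e q := X q^+(j.*2 - k)*a q^+2 - 4*b q*c q.
have sX : sd X by do 2!eexists; exact: hX.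
have se : sd (fun q => - e q).
 apply: sdN; apply: sdB; first by apply: sdM; exact: sdX.
 by apply: sdM => //; apply: sdM => //; exact: sd_cst.
have e0 : - e (0, 0) != 0.
 rewrite oppr_eq0 /e X0; move: he; case: eqVneq => [E|nk] he.
  by rewrite E subnn expr0 mul1r.
 have jk : (0 < j.*2 - k)%N by rewrite subn_gt0 ltn_neqAle nk kj.
 by rewrite expr0n gtn_eqF // mul0r sub0r oppr_eq0 !mulf_neq0.
have [kap [sk k00 [r1 r10 hk]]] := sd_root k0 se e0.
have [k1 [k2 hkd]] := sk.
have j0 : (0 < j)%N by rewrite -double_gt0; exact: leq_trans kj.
have [m1 [m2 hm]] := sdM (sdX j.-1 sX) sa; have [b1 [b2 hb]] := sb.
pose G q := 2*b q*Y q + X q*(X q^+j.-1*a q).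
have hG := sdiffD (sdiffM (sdiffM (sdiff_cst 2) hb) hY) (sdiffM hX hm).
have hK := sdiffM hX hkd.
have [ub [ub' hub]] := sdM su sb.
have [r2 r20 hr2] : exists2 r : R, 0 < r & forall q, B0 r q -> u q*b q != 0.
 have n0 : 0 < cnorm (u (0, 0)*b (0, 0)) by apply: cnorm_gt0; rewrite mulf_neq0.
 have [r r0 hr] := sdiff_near hub n0; exists r => // q bq; apply/eqP => z.
 by have := hr q bq; rewrite z sub0r cnormN ltxx.
apply: (sdiff_germ hG hK).
- move: (X (0, 0)^+j.-1*a (0, 0)) (kap (0, 0)) (k00) => g kk kk0.
 rewrite X0 Y0 ?(mul0r, mulr0, addr0, add0r).
 have -> : (2*b (0, 0)*y1 + g*x1)*(kk*x2) - (2*b (0, 0)*y2 + g*x2)*(kk*x1) =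
   - (2*b (0, 0)*kk*(x1*y2 - x2*y1)) by ring.
 by rewrite oppr_eq0 !mulf_neq0 // pnatr_eq0.
- by rewrite /= X0 Y0 mul0r mulr0 addr0.
- by rewrite /= X0 mul0r.
exmin r1 r2.
move=> q bq; have bq1 : B0 r1 q by cmin bq.
have bq2 : B0 r2 q by cmin bq.
have := hr2 q bq2; rewrite mulf_eq0 negb_or => /andP[uq bq0].
have E : 4*b q*(u q*f q) = nf k (2*b q*Y q + X q*(X q^+j.-1*a q), X q*kap q).
 rewrite hf /nf /= mulrA -exprS prednK // [(X q*kap q)^+k]exprMn hk // /e.
 have E2 : X q^+k*X q^+(j.*2 - k) = X q^+j*X q^+j.
  by rewrite -!exprD subnKC // addnn.
 have -> : X q^+k * - (X q^+(j.*2 - k)*a q^+2 - 4*b q*c q) =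
   - (X q^+k*X q^+(j.*2 - k))*a q^+2 + 4*b q*(X q^+k*c q) by ring.
 by rewrite E2; ring.
rewrite -E; split=> [->|/eqP]; first by rewrite !mulr0.
by rewrite !mulf_eq0 (negbTE four0) (negbTE bq0) (negbTE uq) /= => /eqP.
Qed.

End StrictDiff.

Ltac sdauto := repeat match goal with
 | |- sd (fun _ => ?c) => exact: sd_cst
 | H : sd ?f |- sd ?f => exact H
 | H : sd ?f |- sd (fun q => ?f q) => exact H
 | |- sd (fun q => fst q) => exact: sd_fst
 | |- sd (fun q => snd q) => exact: sd_snd
 | |- sd fst => exact: sd_fst
 | |- sd snd => exact: sd_snd
 | |- sd (fun q => (@?f q + @?g q)%R) => refine (@sdD _ f g _ _)
 | |- sd (fun q => (- @?f q)%R) => refine (@sdN _ f _)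
 | |- sd (fun q => (@?f q * @?g q)%R) => refine (@sdM _ f g _ _)
 | |- sd (fun q => (@?f q^+?n)%R) => refine (@sdX _ f n _)
 end.
Ltac pring := rewrite ?[(_, _).1]/= ?[(_, _).2]/=; ring.

(** * Branches of germs *)
Section Branches.
Variable R : realType.
Local Notation C := (R[i]).
Local Notation P := (C*C)%type.
Implicit Types (q p : P).
Local Notation B0 d := (cball ((0, 0) : P) d).
Let I : C := 'i%C.
Let II : I^+2 = -1. Proof. exact: sqr_i. Qed.
Let I0 : I != 0. Proof. by apply: cnorm_neq0; rewrite cnorm_i. Qed.
Let two0 : (2 : C) != 0. Proof. by rewrite pnatr_eq0. Qed.

Definition param (X : P -> Prop) (k : C -> P) (c : R) :=
 [/\ 0 < c, k 0 = (0, 0), forall t, cnorm t < c -> forall e : R, 0 < e -> exists2 d : R, 0 < d &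
    forall t', cnorm t' < c -> cnorm (t' - t) < d -> cball (k t) e (k t')
  & forall t, cnorm t < c -> t != 0 -> X (k t) /\ k t <> (0, 0)].

(** [L] cuts out an open and closed part of the punctured germ, that is, a union of branches. *)
Definition loc_const (X : P -> Prop) (r : R) (L : P -> Prop) :=
 forall q, B0 r q -> q <> (0, 0) -> X q -> exists2 d : R, 0 < d &
  forall q', B0 r q' -> q' <> (0, 0) -> X q' -> cball q d q' -> (L q' <-> L q).

(** A parametrised branch is the image of a punctured disc, which is connected; its pull-back cannot
    cross from [L] to the complement of [L]. *)
Lemma branch_const (X1 X2 : P -> Prop) U V h g r L k c : copen V -> U (0, 0) -> V (0, 0) ->
 heo U V h g -> h (0, 0) = (0, 0) -> (forall q, U q -> (X1 q <-> X2 (h q))) ->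
 0 < r -> loc_const X1 r L -> param X2 k c ->
 exists2 c' : R, 0 < c' <= c & (forall t, cnorm t < c' -> V (k t)) /\
  forall t t', t != 0 -> t' != 0 -> cnorm t < c' -> cnorm t' < c' -> L (g (k t')) -> L (g (k t)).
Proof.
move=> oV U0 V0 he h0 hX r0 lc [c0 k0 kc kX].
have [hUV gVU gh hg [ch cg]] := he.
have g0 : g (0, 0) = (0, 0) by rewrite -{1}h0 gh.
have [e1 e10 he1] := oV _ V0; have [e2 e20 he2] := cg _ V0 r r0.
have e30 : 0 < Num.min e1 e2 by rewrite lt_min e10.
have [|d d0 hd] := kc 0 _ _ e30; first by rewrite cnorm0.
pose c' := Num.min c d; have c'0 : 0 < c' by rewrite lt_min c0.
have cc : c' <= c by minle. have cd : c' <= d by minle.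
have near0 t : cnorm t < c' -> B0 (Num.min e1 e2) (k t).
 move=> tc; rewrite -k0; apply: hd; first exact: lt_le_trans cc.
 by rewrite subr0; exact: lt_le_trans cd.
have Vk t : cnorm t < c' -> V (k t).
 by move=> tc; apply: he1; cmin (near0 t tc).
have gk t : cnorm t < c' -> t != 0 -> [/\ B0 r (g (k t)), g (k t) <> (0, 0) & X1 (g (k t))].
 move=> tc t0; have [Xk kn] := kX t (lt_le_trans tc cc) t0; split.
 - by rewrite -g0; apply: he2; [exact: Vk|cmin (near0 t tc)].
 - by move=> z; apply: kn; rewrite -(hg _ (Vk t tc)) z h0.
 - by apply/hX; [apply: gVU; exact: Vk|rewrite hg //; exact: Vk].
exists c'; first by rewrite c'0.
split => // t t' t0 t'0 tc tc' Lt.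
apply: (disc_const (Q := fun t => L (g (k t))) (c := c') _ t0 t'0 tc tc' Lt) => s s0 sc.
have [b1 b2 b3] := gk s sc s0; have [d1 d10 hd1] := lc _ b1 b2 b3.
have [d2 d20 hd2] := cg _ (Vk s sc) _ d10.
have [d3 d30 hd3] := kc s (lt_le_trans sc cc) _ d20.
exists d3 => // s' s'0 s'c ss; have [b1' b2' b3'] := gk s' s'c s'0.
apply: hd1 => //; apply: hd2; [exact: Vk|apply: hd3 => //; exact: lt_le_trans cc].
Qed.

(** If two closed pieces meet only at the origin, each is also open in the punctured germ. *)
Lemma loc_const_factor (X : P -> Prop) (F G : P -> C) r :
 (forall q, B0 r q -> ctn (B0 r) F q) -> (forall q, B0 r q -> ctn (B0 r) G q) ->
 (forall q, B0 r q -> (X q <-> F q*G q = 0)) ->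
 (forall q, B0 r q -> F q = 0 -> G q = 0 -> q = (0, 0)) -> loc_const X r (fun q => F q = 0).
Proof.
move=> cF cG hX h0 q b q0 Xq.
have [Fq|Fq] := eqVneq (F q) 0.
 have Gq : G q != 0 by apply/eqP => z; exact: q0 (h0 q b Fq z).
 have [d d0 hd] := ctn_neq0 (cG q b) Gq; exists d => // q' b' _ /(hX _ b') /eqP.
 rewrite mulf_eq0 => /orP[/eqP-> // _|/eqP z b'']; by have := hd q' b' b''; rewrite z eqxx.
have [d d0 hd] := ctn_neq0 (cF q b) Fq; exists d => // q' b' _ _ b''.
by split=> z; [have := hd q' b' b''; rewrite z eqxx|rewrite z eqxx in Fq].
Qed.

Section Even.
Variables (m : nat) (m0 : (0 < m)%N).
(** The two smooth branches of [x^2 + y^(2m)], as equations; [evk] parametrises them by [y]. *)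
Definition evb (s : bool) q : C := q.1 + (if s then I else - I)*q.2^+m.
Definition evk (s : bool) (t : C) : P := (- (if s then I else - I)*t^+m, t).

Lemma evb_ctn s D q : ctn D (evb s) q.
Proof. by rewrite /evb; ctnauto. Qed.
Lemma nf_even q : nf m.*2 q = evb true q*evb false q.
Proof.
rewrite /nf /evb -addnn exprD.
have -> : (q.1 + I*q.2^+m)*(q.1 + - I*q.2^+m) = q.1^+2 - I^+2*(q.2^+m*q.2^+m) by ring.
by rewrite II; ring.
Qed.
Lemma evb_common q : evb true q = 0 -> evb false q = 0 -> q = (0, 0).
Proof.
rewrite /evb => h1 h2.
have x0 : q.1 = 0.
 by apply: (mulfI two0); rewrite mulr0; transitivity (q.1 + I*q.2^+m + (q.1 + - I*q.2^+m)); [ring|rewrite h1 h2 addr0].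
move/eqP: h1; rewrite x0 add0r mulf_eq0 (negbTE I0) /= expf_eq0 m0 /= => /eqP y0.
by rewrite [q]surjective_pairing x0 y0.
Qed.
Lemma evb_evk s t : evb s (evk s t) = 0.
Proof. by rewrite /evb /evk /= mulNr addNr. Qed.
Lemma evb_eq s q : evb s q = 0 -> q = evk s q.2.
Proof. by case: q => x y /eqP; rewrite /evb /evk /= addr_eq0 => /eqP ->; rewrite mulNr. Qed.
Lemma evk_param s : param (fun q => nf m.*2 q = 0) (evk s) 1.
Proof.
split => //; first by rewrite /evk expr0n gtn_eqF // mulr0.
 move=> t _ e e0.
 have c1 : ctn (fun=> True) (fun w : P => - (if s then I else - I)*w.1^+m) (t, 0). by ctnauto.
 have [d d0 hd] := c1 e e0; exmin d e.
 move=> t' _; rewrite lt_min => /andP[h1 h2]; split => //=.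
 by apply: (hd (t', 0) Logic.I); split => //; rewrite subrr cnorm0.
move=> t _ t0; split; last by case=> _ z; rewrite z eqxx in t0.
by rewrite nf_even; case: s; rewrite evb_evk ?mul0r ?mulr0.
Qed.
End Even.

Definition ek (t : C) : P := (- t^+4, t^+3).
Lemma ek_param : param (fun q => nfE q = 0) ek 1.
Proof.
split => //; first by rewrite /ek !expr0n /= oppr0.
 move=> t _ e e0.
 have c1 : ctn (fun=> True) (fun w : P => - w.1^+4) (t, 0) by apply: ctnN; apply: ctnX; exact: ctn_fst.
 have c2 : ctn (fun=> True) (fun w : P => w.1^+3) (t, 0) by apply: ctnX; exact: ctn_fst.
 have [d d0 hd] := c1 e e0; have [d' d'0 hd'] := c2 e e0.
 exmin d d'.
 move=> t' _; rewrite lt_min => /andP[h1 h2]; split => /=.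
  by apply: (hd (t', 0) Logic.I); split => //; rewrite subrr cnorm0.
 by apply: (hd' (t', 0) Logic.I); split => //; rewrite subrr cnorm0.
move=> t _ t0; split; first by rewrite /nfE /ek /= exprNn -!exprM; ring.
by case=> _ /eqP; rewrite expf_eq0 /= (negbTE t0).
Qed.
Lemma ek_surj q : nfE q = 0 -> exists2 t, q = ek t & cnorm t^+3 = cnorm q.2.
Proof.
case: q => x y; rewrite /nfE /= => h.
have [y0|y0] := eqVneq y 0.
 move/eqP: h; rewrite y0 expr0n addr0 expf_eq0 /= => /eqP ->.
 by exists 0; [rewrite /ek !expr0n /= oppr0|rewrite -cnormX expr0n].
have y4 : x^+3 = - y^+4 by apply/eqP; rewrite -addr_eq0 h.
have e3 : (- x/y)^+3 = y by rewrite expr_div_n exprNn y4; field.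
exists (- x/y); last by rewrite -cnormX e3.
rewrite /ek e3; congr pair.
have -> : - (- x/y)^+4 = (- x/y)^+3*x/y by field.
by rewrite e3; field.
Qed.

Lemma small_pow n (e : R) : (0 < n)%N -> 0 < e -> exists2 d : R, 0 < d & forall x : R, 0 <= x -> x^+n < d -> x < e.
Proof.
move=> n0 e0; exists (e^+n); first exact: exprn_gt0.
by move=> x x0; rewrite ltr_pXn2r ?nnegrE // ltW.
Qed.

Definition psurj (X : P -> Prop) (k : C -> P) := forall e : R, 0 < e -> exists2 d : R, 0 < d &
 forall q, B0 d q -> q <> (0, 0) -> X q -> exists t, [/\ t != 0, cnorm t < e & q = k t].

Lemma ek_psurj : psurj (fun q => nfE q = 0) ek.
Proof.
move=> e e0; have [d d0 hd] := small_pow (isT : (0 < 3)%N) e0; exists d => // q b q0 Xq.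
have [t E nt] := ek_surj Xq; exists t; split => //.
 by apply/eqP => t0; apply: q0; rewrite E t0 /ek !expr0n /= oppr0.
by apply: hd; [exact: cnorm_ge0|rewrite nt; case: b => _; rewrite subr0].
Qed.

(** A germ covered by one parametrised branch is connected off the origin, so a locally constant
    predicate cannot both hold and fail arbitrarily near it. *)
Lemma unibranch_connected (X X2 : P -> Prop) (L : P -> Prop) k c (r : R) :
 param X2 k c -> psurj X2 k -> 0 < r -> loc_const X r L ->
 (forall e : R, 0 < e -> exists q, [/\ B0 e q, q <> (0, 0), X q & L q]) ->
 (forall e : R, 0 < e -> exists q, [/\ B0 e q, q <> (0, 0), X q & ~ L q]) ->
 ~ top_equiv_germ X (0, 0) X2 (0, 0).
Proof.
move=> pk sk r0 lc acc1 acc2 /top_equivP[U [V [h [g [[oU oV U0 V0 he] [h0 hX]]]]]].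
have [c' /andP[c0 c1] [Vk Lc]] := branch_const oV U0 V0 he h0 hX r0 lc pk.
have [hUV gVU gh hg [ch cg]] := he.
have [e1 e10 he1] := sk _ c0.
have [e2 e20 he2] := ch _ U0 e1 e10; have [e3 e30 he3] := oU _ U0.
have key q : B0 (Num.min e2 e3) q -> q <> (0, 0) -> X q -> exists t, [/\ t != 0, cnorm t < c' & q = g (k t)].
 move=> b q0 Xq; have Uq : U q by apply: he3; cmin b.
 have b1 : B0 e1 (h q) by rewrite -h0; apply: he2 => //; cmin b.
 have hq0 : h q <> (0, 0) by move=> z; apply: q0; rewrite -(gh _ Uq) z -h0 gh.
 have [t [t0 tc E]] := he1 _ b1 hq0 ((hX q Uq).1 Xq); exists t; split => //; by rewrite -E gh.
have mp : 0 < Num.min e2 e3 by rewrite lt_min e20.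
have [q [b n Xq Lq]] := acc1 _ mp; have [q' [b' n' Xq' Lq']] := acc2 _ mp.
have [t [t0 tc E]] := key q b n Xq; have [t' [t'0 tc' E']] := key q' b' n' Xq'.
by apply: Lq'; rewrite E'; apply: (Lc t' t) => //; rewrite -E.
Qed.

Lemma evk_acc m s (e : R) : (0 < m)%N -> 0 < e -> exists t, t != 0 /\ B0 e (evk m s t).
Proof.
move=> m0 e0; have [_ k0 kc _] := evk_param m0 s; have [|d d0 hd] := kc 0 _ e e0; first by rewrite cnorm0.
pose t : C := (Num.min (2^-1) (d/2))%:C%C.
have t0 : 0 < Num.min (2^-1) (d/2) by rewrite lt_min invr_gt0 ltr0Sn divr_gt0.
have nt : cnorm t = Num.min (2^-1) (d/2) by rewrite cnorm_real gtr0_norm.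
have m1 : Num.min (2^-1) (d/2) <= 2^-1 by minle.
have m2 : Num.min (2^-1) (d/2) <= d/2 by minle.
exists t; split; first by apply: cnorm_neq0; rewrite nt.
rewrite -k0; apply: hd; rewrite ?subr0 nt; lra.
Qed.

Lemma nf_even_lc m r : (0 < m)%N -> loc_const (fun q => nf m.*2 q = 0) r (fun q => evb m true q = 0).
Proof.
move=> m0; apply: (loc_const_factor (G := evb m false)) => q b; try exact: evb_ctn; first by rewrite nf_even.
exact: evb_common.
Qed.

Lemma even_not_unibranch m (X2 : P -> Prop) k c : (0 < m)%N -> param X2 k c -> psurj X2 k ->
 ~ top_equiv_germ (fun q : P => nf m.*2 q = 0) (0, 0) X2 (0, 0).
Proof.
move=> m0 pk sk; have lc := @nf_even_lc m 1 m0.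
apply: (unibranch_connected pk sk (ltr01 : 0 < 1 :> R) lc) => e e0.
 have [t [t0 b]] := evk_acc true m0 e0; exists (evk m true t); split => //; first by case=> _ z; rewrite z eqxx in t0.
  by rewrite nf_even evb_evk mul0r.
 exact: evb_evk.
have [t [t0 b]] := evk_acc false m0 e0; exists (evk m false t); split => //; first by case=> _ z; rewrite z eqxx in t0.
 by rewrite nf_even evb_evk mulr0.
by move=> z; have := evb_common m0 z (evb_evk m false t); case=> _ z'; rewrite z' eqxx in t0.
Qed.

Lemma nfE_not_even m : (0 < m)%N -> ~ top_equiv_germ (fun q : P => nf m.*2 q = 0) (0, 0) (fun q => nfE q = 0) (0, 0).
Proof. by move=> m0; exact: (even_not_unibranch m0 ek_param ek_psurj). Qed.

End Branches.

(** * Triple points *)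
Section Triple.
Variable R : realType.
Local Notation C := (R[i]).
Local Notation P := (C*C)%type.
Implicit Types (q p : P).
Local Notation B0 d := (cball ((0, 0) : P) d).

Lemma inv_sdiff (F1 F2 : P -> C) U V G : copen V -> U (0, 0) -> V (0, 0) ->
 heo U V (fun q => (F1 q, F2 q)) G -> sdiff F1 1 0 -> sdiff F2 0 1 -> F1 (0, 0) = 0 -> F2 (0, 0) = 0 ->
 sdiff (fun q => (G q).1) 1 0 /\ sdiff (fun q => (G q).2) 0 1.
Proof.
move=> oV U0 V0 he s1 s2 z1 z2; have [hUV gVU gh hg [ch cg]] := he.
have G0 : G (0, 0) = (0, 0) by have := gh _ U0; rewrite z1 z2.
suff main (e : R) : 0 < e -> exists2 d : R, 0 < d & forall w w', B0 d w -> B0 d w' ->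
  cnorm ((G w).1 - (G w').1 - (w.1 - w'.1)) <= e*nd w w' /\ cnorm ((G w).2 - (G w').2 - (w.2 - w'.2)) <= e*nd w w'.
 split=> e e0; have [d d0 hd] := main e e0; exists d => // q q' b b'; have [h1 h2] := hd q q' b b'.
  by rewrite mul0r addr0 mul1r.
 by rewrite mul0r add0r mul1r.
move=> e0; pose e' := Num.min (e/2) (2^-1); have e'0 : 0 < e' by rewrite lt_min divr_gt0 //= invr_gt0.
have [d1 d10 h1] := s1 _ e'0; have [d2 d20 h2] := s2 _ e'0.
pose dm := Num.min d1 d2; have dm0 : 0 < dm by rewrite lt_min d10.
have [d3 d30 h3] := cg _ V0 dm dm0; have [d4 d40 h4] := oV _ V0.
exmin d3 d4.
have bG w : B0 (Num.min d3 d4) w -> V w /\ B0 dm (G w).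
 move=> b; have Vw : V w by apply: h4; cmin b.
 split=> //; rewrite -G0; apply: h3 => //; apply: cballW b; by minle.
move=> w w' /bG[Vw b] /bG[Vw' b'].
have m1 : dm <= d1 by minle. have m2 : dm <= d2 by minle.
have k1 := h1 _ _ (cballW m1 b) (cballW m1 b'); have k2 := h2 _ _ (cballW m2 b) (cballW m2 b').
have [E1 E2] : F1 (G w) = w.1 /\ F2 (G w) = w.2 by split; rewrite -[in RHS](hg _ Vw).
have [E1' E2'] : F1 (G w') = w'.1 /\ F2 (G w') = w'.2 by split; rewrite -[in RHS](hg _ Vw').
move: k1 k2; rewrite E1 E2 E1' E2' !mul0r !mul1r addr0 add0r => k1 k2.
have {}k1 : cnorm ((G w).1 - (G w').1 - (w.1 - w'.1)) <= e'*nd (G w) (G w') by rewrite cnormBC.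
have {}k2 : cnorm ((G w).2 - (G w').2 - (w.2 - w'.2)) <= e'*nd (G w) (G w') by rewrite cnormBC.
have el1 : e' <= e/2 by minle. have el2 : e' <= 2^-1 by minle.
have N0 := nd_ge0 (G w) (G w').
have bnd : nd (G w) (G w') <= 2*nd w w'.
 suff : nd (G w) (G w') <= nd w w' + e'*nd (G w) (G w') by nra.
 rewrite {1}/nd ge_max; apply/andP; split.
  have := cnorm_tri 0 ((G w).1 - (G w').1 - (w.1 - w'.1)) (- (w.1 - w'.1)).
  by rewrite !subr0 !sub0r !opprK subrK => /le_trans; apply; have := nd_ge1 w w'; lra.
 have := cnorm_tri 0 ((G w).2 - (G w').2 - (w.2 - w'.2)) (- (w.2 - w'.2)).
 by rewrite !subr0 !sub0r !opprK subrK => /le_trans; apply; have := nd_ge2 w w'; lra.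
by split; [apply: le_trans k1 _|apply: le_trans k2 _]; nra.
Qed.

Lemma sdiff_prod0 (f g : P -> C) : sd f -> sd g -> f (0, 0) = 0 -> g (0, 0) = 0 -> sdiff (fun q => f q*g q) 0 0.
Proof.
move=> [a [b sf]] [c [d sg]] f0 g0; have := sdiffM sf sg.
by rewrite f0 g0 !mul0r !addr0.
Qed.

Lemma sdiff_snd_comp (f : P -> C) a b : sdiff f a b -> sdiff (fun q => f (q.2, 0)) 0 a.
Proof.
move=> H e e0; have [d d0 hd] := H e e0; exists d => // q q' [_ b1] [_ b2].
have bb (w : P) : cnorm (w.2 - 0) < d -> B0 d (w.2, 0) by move=> h; split; [exact: h|rewrite subrr cnorm0].
have := hd _ _ (bb q b1) (bb q' b2); rewrite /= subrr mulr0 addr0 mul0r add0r => /le_trans; apply.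
by rewrite ler_wpM2l ?(ltW e0) // ge_max nd_ge2 subrr cnorm0 nd_ge0.
Qed.

(** Substituting [x = y t] in a triple point with tangent factor [x] and dividing by [y^3] leaves
    this equation for [t], solvable because [a != 0]. The solution depends on [y] alone and is
    written on [C^2] only to fit [sd]. *)
Lemma smooth_branch (a b c k0 k1 k2 k3 k4 : C) : a != 0 -> exists t : P -> C, [/\ sd t, t (0, 0) = 0, forall q, t q = t (0, q.2) &
 exists2 d : R, 0 < d & forall q, B0 d q ->
  t q*(a + b*t q + c*t q^+2) +
  q.2*(k4 + k3*t q + k2*t q^+2 + k1*t q^+3 + k0*t q^+4) = 0].
Proof.
move=> a0; pose tt q := q.2 - k4/a*q.1.
pose F2 q := q.2 + tt q*(tt q*(b + c*tt q)/a) +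
 q.1*(tt q*(k3 + k2*tt q + k1*tt q^+2 + k0*tt q^+3)/a).
have stt : sd tt by rewrite /tt; sdauto.
have t0 : tt (0, 0) = 0 by rewrite /tt /= mulr0 subr0.
have s1 := @sdiff_fst R.
have s2 : sdiff F2 0 1.
 have := sdiffD (sdiffD (@sdiff_snd R) (_ : sdiff (fun q => tt q*(tt q*(b + c*tt q)/a)) 0 0))
  (_ : sdiff (fun q => q.1*(tt q*(k3 + k2*tt q + k1*tt q^+2 + k0*tt q^+3)/a)) 0 0).
 rewrite !addr0; apply; apply: sdiff_prod0; rewrite ?t0 ?mul0r //; sdauto.
have z2 : F2 (0, 0) = 0 by rewrite /F2 t0 /= !mul0r !addr0.
have [U [V [G [[oU oV U0 V0 he] _]]]] := inv_heo s1 s2 (erefl _) z2 ltr01.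
have [sG1 sG2] := inv_sdiff oV U0 V0 he s1 s2 (erefl _) z2; have [hUV gVU gh hg [ch cg]] := he.
have [r r0 hr] := oV _ V0.
exists (fun q => (G (q.2, 0)).2 - k4/a*q.2); split.
- by apply: sdB; [exists 0, 0; exact: sdiff_snd_comp sG2|sdauto].
- by have := gh _ U0; rewrite /= z2 => ->; rewrite /= mulr0 subr0.
- by [].
exists r => // q [_ b2]; have Vq : V (q.2, 0) by apply: hr; split; [exact: b2|rewrite subrr cnorm0].
have [e1 e2] : (G (q.2, 0)).1 = q.2 /\ F2 (G (q.2, 0)) = 0 by have [] := hg _ Vq.
set s := (G (q.2, 0)).2; have ttE : tt (G (q.2, 0)) = s - k4/a*q.2 by rewrite /tt e1.
move: e2; rewrite /F2 ttE e1 -/s; set t := s - _ => e2.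
have -> : t*(a + b*t + c*t^+2) + q.2*(k4 + k3*t + k2*t^+2 + k1*t^+3 + k0*t^+4) =
 a*(t + k4/a*q.2 + t*(t*(b + c*t)/a) +
 q.2*(t*(k3 + k2*t + k1*t^+2 + k0*t^+3)/a)) by field.
by rewrite /t subrK -/t e2 mulr0.
Qed.

Definition accum (X : P -> Prop) := forall e : R, 0 < e -> exists q, [/\ B0 e q, q <> (0, 0) & X q].

Lemma small_ctn (k : P -> P) (e : R) : 0 < e -> k (0, 0) = (0, 0) -> sd (fun q => (k q).1) -> sd (fun q => (k q).2) ->
 exists2 t : C, t != 0 & B0 e (k (0, t)).
Proof.
move=> e0 k0 [a [b s1]] [a' [b' s2]]; have [d d0 h] := sdiff_near s1 e0; have [d' d'0 h'] := sdiff_near s2 e0.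
have m0 : 0 < Num.min d d'/2 by rewrite divr_gt0 // lt_min d0.
pose t : C := (Num.min d d'/2)%:C%C.
have nt : cnorm t = Num.min d d'/2 by rewrite cnorm_real gtr0_norm.
have m1 : Num.min d d' <= d by minle. have m2 : Num.min d d' <= d' by minle.
have bt (r : R) : Num.min d d' <= r -> B0 r (0, t).
 by move=> ?; split; rewrite subr0 ?cnorm0; [lra|rewrite nt; lra].
exists t; first by apply: cnorm_neq0; rewrite nt.
by rewrite -k0; split; [apply: h; exact: bt|apply: h'; exact: bt].
Qed.

Lemma accum_top (X1 X2 : P -> Prop) : top_equiv_germ X1 (0, 0) X2 (0, 0) -> accum X2 -> accum X1.
Proof.
move=> /top_equivP[U [V [h [g [[oU oV U0 V0 [hUV gVU gh hg [ch cg]]] [h0 hX]]]]]] ac e e0.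
have g0 : g (0, 0) = (0, 0) by rewrite -{1}h0 gh.
have [d d0 hd] := cg _ V0 e e0; have [d' d'0 hd'] := oV _ V0.
have m0 : 0 < Num.min d d' by rewrite lt_min d0.
have [q [b q0 Xq]] := ac _ m0.
have Vq : V q by apply: hd'; cmin b.
exists (g q); split.
- by rewrite -g0; apply: hd => //; cmin b.
- by move=> z; apply: q0; rewrite -(hg _ Vq) z h0.
- by apply/hX; [exact: gVU|rewrite hg].
Qed.

Lemma nf_accum k : (0 < k)%N -> accum (fun q : P => nf k q = 0).
Proof.
move=> k0 e e0; pose I : C := 'i%C; have II : I^+2 = -1 by exact: sqr_i.
have [||| t t0 b] := @small_ctn (fun q => (I*q.2^+k, q.2^+2)) e e0; try by rewrite /=; sdauto.
 by rewrite /= !expr0n gtn_eqF //= mulr0.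
exists (I*t^+k, t^+2); split => //.
 by case=> _ /eqP; rewrite expf_eq0 /= (negbTE t0).
by rewrite /nf /= exprMn II -!exprM mulnC mulN1r addNr.
Qed.

(** A smooth branch is [x^2 + y = 0] up to equivalence, so the invariance of the exponent with value
    1 separates it from a singular factor. *)
Lemma evb_nf1 m s : top_equiv_germ (fun q : P => nf 1 q = 0) (0, 0) (fun q : P => evb m.+1 s q = 0) (0, 0).
Proof.
apply: top_equiv_sym; have se : sd (fun q : P => (if s then 'i%C else - 'i%C)*q.2^+m.+1) by sdauto.
pose J : C := if s then 'i%C else - 'i%C.
have sq : sdiff (fun q : P => q.2*q.2) 0 0 by apply: sdiff_prod0 => //; sdauto.
have sp : exists b, sdiff (fun q : P => J*q.2^+m*q.2) 0 b.
 have [a [b sf]] : sd (fun q : P => J*q.2^+m) by sdauto.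
 by exists (J*0^+m); have := sdiffM sf (@sdiff_snd R); rewrite /= !mul0r mulr0 mulr1 !addr0.
have [b sb] := sp.
apply: (sdiff_germ (F1 := snd) (F2 := fun q => q.1 + J*q.2^+m*q.2 + (-1)*(q.2*q.2))
 (@sdiff_snd R) (sdiffD (sdiffD (@sdiff_fst R) sb) (sdiffM (@sdiff_cst R (-1)) sq))) => //=.
- by rewrite !(mulr0, mul0r, addr0, mulr1, mul1r, sub0r) oppr_eq0 oner_neq0.
- by rewrite !mulr0 !addr0.
exists 1 => // q _; rewrite /nf /evb /= -/J exprSr mulrA.
have -> : q.2^+2 + (q.1 + J*q.2^+m*q.2 + -1*(q.2*q.2))^+1 = q.1 + J*q.2^+m*q.2 by ring.
by [].
Qed.

Section Split.
Variables (X : P -> Prop) (F G : P -> C) (r : R) (k : nat).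
Hypotheses (r0 : 0 < r) (k1 : (1 < k)%N).
Hypothesis cF : forall q, B0 r q -> ctn (B0 r) F q.
Hypothesis cG : forall q, B0 r q -> ctn (B0 r) G q.
Hypothesis hX : forall q, B0 r q -> (X q <-> F q*G q = 0).
Hypothesis hFG : forall q, B0 r q -> F q = 0 -> G q = 0 -> q = (0, 0).
Hypothesis aF : accum (fun q => F q = 0).
Hypothesis G0 : G (0, 0) = 0.
Hypothesis tG : top_equiv_germ (fun q => G q = 0) (0, 0) (fun q : P => nf k q = 0) (0, 0).

Let aG : accum (fun q => G q = 0). Proof. exact: accum_top tG (nf_accum (ltnW k1)). Qed.
Let lc : loc_const X r (fun q => F q = 0). Proof. exact: loc_const_factor cF cG hX hFG. Qed.
Let accF (e : R) : 0 < e -> exists q, [/\ B0 e q, q <> (0, 0), X q & F q = 0].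
Proof.
move=> e0; have m0 : 0 < Num.min e r by rewrite lt_min e0.
have [q [b q0 Fq]] := aF m0; exists q; split => //; first by cmin b.
by apply/hX; [cmin b|rewrite Fq mul0r].
Qed.
Let accG (e : R) : 0 < e -> exists q, [/\ B0 e q, q <> (0, 0), X q & F q <> 0].
Proof.
move=> e0; have m0 : 0 < Num.min e r by rewrite lt_min e0.
have [q [b q0 Gq]] := aG m0.
have b' : B0 r q by cmin b.
exists q; split => //; first by cmin b.
 by apply/hX => //; rewrite Gq mulr0.
by move=> Fq; apply: q0; exact: hFG.
Qed.

Lemma split_not_E6 : ~ top_equiv_germ X (0, 0) (fun q : P => nfE q = 0) (0, 0).
Proof. exact: (unibranch_connected (@ek_param R) (@ek_psurj R) r0 lc accF accG). Qed.

(** An equivalence would match the part [F = 0] with one of the two smooth branches and hence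
    [G = 0] with the other, although [G] has exponent [k > 1]. *)
Lemma split_not_even m : (0 < m)%N -> ~ top_equiv_germ X (0, 0) (fun q : P => nf m.*2 q = 0) (0, 0).
Proof.
case: m => // m m0 /top_equivP[U [V [h [g [[oU oV U0 V0 he] [h0 hX']]]]]].
have [hUV gVU gh hg [ch cg]] := he.
have bc s := branch_const oV U0 V0 he h0 hX' r0 lc (evk_param R m0 s).
have [c1 /andP[c10 _] [_ L1]] := bc true; have [c2 /andP[c20 _] [_ L2]] := bc false.
pose c := Num.min c1 c2; have c0 : 0 < c by rewrite lt_min c10.
have {bc}L (s : bool) t t' : t != 0 -> t' != 0 -> cnorm t < c -> cnorm t' < c ->
  F (g (evk m.+1 s t')) = 0 -> F (g (evk m.+1 s t)) = 0.
 rewrite !lt_min => t0 t'0 /andP[x1 x2] /andP[y1 y2]; case: s; first exact: L1.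
 exact: L2.
have [d1 d10 hd1] := ch _ U0 c c0; have [d2 d20 hd2] := oU _ U0.
pose d := Num.min (Num.min d1 d2) r; have d0 : 0 < d by rewrite !lt_min d10 d20.
have dr : d <= r by minle.
have near q : B0 d q -> q <> (0, 0) -> X q -> exists s t, [/\ t != 0, cnorm t < c, h q = evk m.+1 s t & q = g (evk m.+1 s t)].
 move=> b q0 Xq; have Uq : U q by apply: hd2; apply: cballW b; rewrite ge_min ge_min lexx orbT.
 have [_ n2] : B0 c (h q) by rewrite -h0; apply: hd1 => //; apply: cballW b; rewrite ge_min ge_min lexx.
 have [s Es] : exists s, evb m.+1 s (h q) = 0.
  have := (hX' q Uq).1 Xq; rewrite nf_even => /eqP; rewrite mulf_eq0.
  by case/orP=> /eqP z; [exists true|exists false].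
 exists s, (h q).2; rewrite -(evb_eq Es); split; rewrite ?gh //; last by move: n2; rewrite subr0.
 apply/eqP => z; apply: q0; rewrite -(gh _ Uq) (evb_eq Es) z -(gh _ U0) h0 /evk expr0n /=.
 by rewrite mulr0.
have [q [b q0 Xq Fq]] := accF d0; have [s [t [t0 tc hq Eq]]] := near q b q0 Xq.
have [q' [b' q'0 Xq' Fq']] := accG d0; have [s' [t' [t'0 tc' hq' Eq']]] := near q' b' q'0 Xq'.
(* [F] vanishes along all of the branch [s] and not along [s'], so the two branches are
   different. *)
have ss : s' = ~~ s.
 by case: (s =P s') => [ss|]; [case: Fq'; rewrite Eq' -ss; apply: (L s t' t) => //; rewrite -Eq|case: s {hq Eq}; case: s' {hq' Eq'}].
have Fs q1 : B0 d q1 -> q1 <> (0, 0) -> X q1 -> F q1 = 0 <-> evb m.+1 s (h q1) = 0.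
 move=> b1 q10 Xq1; have [s1 [t1 [t10 tc1 hq1 Eq1]]] := near q1 b1 q10 Xq1.
 have [E|E] : s1 = s \/ s1 = ~~ s by case: (s1); case: (s); auto.
  split=> _; first by rewrite hq1 E evb_evk.
  by rewrite Eq1 E; apply: (L s t1 t) => //; rewrite -Eq.
 split=> z.
  by case: Fq'; rewrite Eq' ss; apply: (L (~~ s) t' t1) => //; rewrite -E -Eq1.
 have : evk m.+1 s1 t1 = (0, 0).
  move: z; rewrite hq1 E; have := evb_evk m.+1 (~~ s) t1.
  by case: (s) => z1 z2; apply: (@evb_common _ m.+1 isT).
 by case=> _ z1; rewrite z1 eqxx in t10.
have eqv : top_equiv_germ (fun q => G q = 0) (0, 0) (fun q : P => evb m.+1 (~~ s) q = 0) (0, 0).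
 have tX : top_equiv_germ X (0, 0) (fun q : P => nf m.+1.*2 q = 0) (0, 0).
  by apply/top_equivP; exists U, V, h, g.
 apply/top_equivP; exists (fun q => U q /\ B0 d q), (fun q => V q /\ B0 d (g q)), h, g; split; last first.
  split=> // q1 [Uq1 b1]; have b1r := cballW dr b1.
  have [->|/eqP q10] := eqVneq q1 (0, 0); first by rewrite h0 G0 /evb /= expr0n /= mulr0 addr0.
  split=> z.
   have Xq1 : X q1 by apply/hX => //; rewrite z mulr0.
   have := (hX' q1 Uq1).1 Xq1; rewrite nf_even => /eqP; rewrite mulf_eq0.
   have nF : evb m.+1 s (h q1) = 0 -> False.
    by move=> /(Fs q1 b1 q10 Xq1) Fz; apply: q10; exact: hFG.
   by case: (s) nF => nF /orP[/eqP|/eqP] //.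
  have Xq1 : X q1 by apply/hX' => //; rewrite nf_even; case: (s) z => ->; rewrite ?mul0r ?mulr0.
  move/(hX b1r)/eqP: Xq1 (Xq1); rewrite mulf_eq0 => /orP[/eqP Fz Xq1|/eqP //].
  have z' := (Fs q1 b1 q10 Xq1).1 Fz; case: q10; rewrite -(gh _ Uq1) -(gh _ U0) h0; congr g.
  by case: (s) z z' => z z'; apply: (@evb_common _ m.+1 isT).
 split.
 - exact: copenI oU (@cball_open _ _ _).
 - exact: (ccont_preim_open (fun=> True) oV (@cball_open _ _ _) cg).
 - by split => //; exact: cball_refl.
 - by split=> //; have := gh _ U0; rewrite h0 => ->; exact: cball_refl.
 split=> [q1 [Uq1 b1]|q1 [Vq1 b1]|q1 [Uq1 _]|q1 [Vq1 _]|].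
 - by split; [exact: hUV|rewrite gh].
 - by split; [exact: gVU|].
 - exact: gh.
 - exact: hg.
 - by split; [apply: ccontW ch|apply: ccontW cg] => ? [].
have := top_equiv_trans (evb_nf1 m (~~ s)) (top_equiv_trans (top_equiv_sym eqv) tG).
by move/(nf_equiv_eq (isT : (0 < 1)%N) (ltnW k1)) => E; move: k1; rewrite -E.
Qed.
End Split.

Definition quartic_form (k0 k1 k2 k3 k4 : C) (x y : C) :=
 k0*x^+4 + k1*x^+3*y + k2*x^+2*y^+2 + k3*x*y^+3 + k4*y^+4.

Lemma sdiff_ball (f : P -> C) : sd f -> exists2 d : R, 0 < d & forall q, B0 d q -> ctn (B0 d) f q.
Proof. by case=> a [b s]; exact: sdiff_ctn s. Qed.

(** The simple tangent [x = 0] carries the smooth branch [x = y t]. The cofactor [G] is a double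
    point with exponent 2 if the remaining tangents differ, and exponent 3 if they coincide in
    [y = 0]. *)
Lemma simple_root_split (a b c k0 k1 k2 k3 k4 : C) (X : P -> Prop) : a != 0 ->
 (b^+2 - 4*a*c != 0) || [&& b == 0, c == 0 & k0 != 0] ->
 (forall q, X q <-> q.1*(a*q.2^+2 + b*q.1*q.2 + c*q.1^+2) + quartic_form k0 k1 k2 k3 k4 q.1 q.2 = 0) ->
 ~ top_equiv_germ X (0, 0) (fun q : P => nfE q = 0) (0, 0) /\
 forall m, (0 < m)%N -> ~ top_equiv_germ X (0, 0) (fun q : P => nf m.*2 q = 0) (0, 0).
Proof.
move=> a0 hb hX; have [t [st t0 tE [d d0 ht]]] := smooth_branch b c k0 k1 k2 k3 k4 a0.
pose F q := q.1 - q.2*t q.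
pose p q := q.2*t q.
pose G q := (a*q.2^+2 + k3*q.2^+3) + (b*q.2 + k2*q.2^+2)*(q.1 + p q) +
 (c + k1*q.2)*(q.1^+2 + q.1 * p q + p q^+2) + k0*(q.1^+3 + q.1^+2 * p q + q.1 * p q^+2 + p q^+3).
have sp : sd p by rewrite /p; sdauto.
have sF : sd F by rewrite /F; sdauto.
have sG : sd G by rewrite /G; sdauto.
(* On the branch [F = 0] the cofactor is [y^2 W]. [W] is the derivative in [t] of the equation of
   [smooth_branch], so it is a unit and the two parts meet only at the origin. *)
pose W q := a + k3*q.2 + 2*(b + k2*q.2)*t q + 3*(c + k1*q.2)*t q^+2 + 4*k0*q.2*t q^+3.
have sW : sd W by rewrite /W; sdauto.
have W0 : W (0, 0) != 0 by rewrite /W t0 /= ?(mulr0, mul0r, addr0, expr0n) /= ?(mulr0, mul0r, addr0).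
have [d1 d10 cF] := sdiff_ball sF; have [d2 d20 cG] := sdiff_ball sG.
have [d3 d30 cW] := sdiff_ball sW; have [d4 d40 nW] := ctn_neq0 (cW _ (cball_refl _ d30)) W0.
have tG : exists2 k, (1 < k)%N & top_equiv_germ (fun q => G q = 0) (0, 0) (fun q : P => nf k q = 0) (0, 0).
 have D1 : (1 : C)*1 - 0*0 != 0 by rewrite mulr1 mulr0 subr0 oner_neq0.
 case/orP: hb => [hb|/and3P[/eqP b0 /eqP c0 k00]].
  exists 2%N => //.
  pose a1 q := b + k2*q.2 + (c + k1*q.2)*t q + k0*q.2*t q^+2.
  pose b1 q := a + k3*q.2 + (b + k2*q.2)*t q + (c + k1*q.2)*t q^+2 + k0*q.2*t q^+3.
  pose c1 q := c + k1*q.2 + k0*q.2*t q + k0*q.1.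
  have E q : 1*G q = b1 q*q.2^+2 + q.1^+1*a1 q*q.2 + q.1^+2*c1 q.
   by rewrite /G /p /a1 /b1 /c1; ring.
  have [sa sb sc] : [/\ sd a1, sd b1 & sd c1] by rewrite /a1 /b1 /c1; split; sdauto.
  have b10 : b1 (0, 0) = a by rewrite /b1 t0 [(_, _).2]/=; ring.
  have a10 : a1 (0, 0) = b by rewrite /a1 t0 [(_, _).2]/=; ring.
  have c10 : c1 (0, 0) = c by rewrite /c1 t0 [(_, _).2]/= [(_, _).1]/=; ring.
  apply: (local_A (isT : (0 < 2)%N) (isT : (2 <= 1.*2)%N) (@sdiff_fst R) (@sdiff_snd R) D1 (erefl _) (erefl _)
   sa sb sc (sd_cst 1) _ (oner_neq0 _) E); first by rewrite b10.
  by rewrite eqxx a10 b10 c10.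
 exists 3%N => //.
 pose a1 q := k1 + k0*t q.
 pose b1 q := a + k3*q.2 + k2*(q.1 + p q) + k1*(q.1*t q + q.2*t q^+2) + k0*(q.1*t q^+2 + q.2*t q^+3).
 have E q : 1*G q = b1 q*q.2^+2 + q.1^+2*a1 q*q.2 + q.1^+3*k0.
  by rewrite /G /p /a1 /b1 /p b0 c0; ring.
 have [sa sb] : [/\ sd a1 & sd b1] by rewrite /a1 /b1; split; sdauto.
 have b10 : b1 (0, 0) = a by rewrite /b1 /p t0 [(_, _).2]/= [(_, _).1]/=; ring.
 apply: (local_A (isT : (0 < 3)%N) (isT : (3 <= 2.*2)%N) (@sdiff_fst R) (@sdiff_snd R) D1 (erefl _) (erefl _)
   sa sb (sd_cst k0) (sd_cst 1) _ (oner_neq0 _) E); first by rewrite b10.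
 by [].
have [k k1' tGk] := tG.
pose r := Num.min (Num.min d d1) (Num.min d2 d4).
have r0 : 0 < r by rewrite !lt_min d0 d10 d20.
have rd : r <= d by rewrite /r !ge_min lexx. have rd1 : r <= d1 by rewrite /r !ge_min lexx orbT.
have rd2 : r <= d2 by rewrite /r !ge_min lexx !orbT. have rd4 : r <= d4 by rewrite /r !ge_min lexx !orbT.
pose r' := Num.min r d3; have r'0 : 0 < r' by rewrite lt_min r0.
have rr : r' <= r by minle. have rd3 : r' <= d3 by minle.
have cF' q : B0 r' q -> ctn (B0 r') F q.
 move=> b1; apply: ctnW (cF q (cballW (le_trans rr rd1) b1)) => w; exact: cballW (le_trans rr rd1).
have cG' q : B0 r' q -> ctn (B0 r') G q.
 move=> b1; apply: ctnW (cG q (cballW (le_trans rr rd2) b1)) => w; exact: cballW (le_trans rr rd2).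
have hX' q : B0 r' q -> (X q <-> F q*G q = 0).
 move=> b1; have bd : B0 d q by apply: cballW b1; lra.
 rewrite hX; have e := ht q bd.
 suff -> : q.1*(a*q.2^+2 + b*q.1*q.2 + c*q.1^+2) + quartic_form k0 k1 k2 k3 k4 q.1 q.2 =
  F q*G q + q.2^+3*(t q*(a + b*t q + c*t q^+2) +
    q.2*(k4 + k3*t q + k2*t q^+2 + k1*t q^+3 + k0*t q^+4)) by rewrite e mulr0 addr0.
 by rewrite /F /G /p /quartic_form; ring.
have hFG q : B0 r' q -> F q = 0 -> G q = 0 -> q = (0, 0).
 move=> b1 /eqP; rewrite subr_eq0 => /eqP x1 g1.
 have : q.2^+2*W q = 0 by rewrite -g1 /G /p /W x1; ring.
 have b3 : B0 d3 q by apply: cballW b1.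
 have b4 : B0 d4 q by apply: cballW b1; lra.
 move/eqP; rewrite mulf_eq0 (negbTE (nW q b3 b4)) orbF expf_eq0 /= => /eqP y0.
 by move: x1 y0; case: (q) => x y /= -> ->; rewrite mul0r.
have aF : accum (fun q => F q = 0).
 move=> e e0; have [||| s s0 bs] := @small_ctn (fun q => (q.2*t (0, q.2), q.2)) e e0; try by rewrite /=; sdauto.
 - by rewrite /= mul0r.
 - by apply: sdM; [sdauto|apply: sd_ext st => q].
 exists (s*t (0, s), s); split => //; first by case=> _ z; rewrite z eqxx in s0.
 by rewrite /F (tE (s*t (0, s), s)) subrr.
have G0 : G (0, 0) = 0 by rewrite /G /p /= !(mulr0, mul0r, addr0, expr0n).
split=> [|m m0]; first exact: (split_not_E6 r'0 k1' cF' cG' hX' hFG aF tGk).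
exact: (split_not_even r'0 k1' cF' cG' hX' hFG aF G0 tGk m0).
Qed.

Lemma quartic_form_le (k0 k1 k2 k3 k4 x y : C) (r : R) : cnorm x <= r -> cnorm y <= r ->
 cnorm (quartic_form k0 k1 k2 k3 k4 x y) <= (cnorm k0 + cnorm k1 + cnorm k2 + cnorm k3 + cnorm k4)*r^+4.
Proof.
move=> hx hy; have r0 : 0 <= r := le_trans (cnorm_ge0 x) hx.
have x0 := cnorm_ge0 x; have y0 := cnorm_ge0 y.
have pw (i j : nat) : (i + j = 4)%N -> cnorm x^+i*cnorm y^+j <= r^+4.
 by move=> <-; rewrite exprD ler_pM ?exprn_ge0 // lerXn2r ?nnegrE.
have tri (u v : C) (A B : R) : cnorm u <= A -> cnorm v <= B -> cnorm (u + v) <= A + B.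
 by move=> h1 h2; apply: le_trans (cnormD _ _) _; exact: lerD.
have mon (k : C) (i j : nat) : (i + j = 4)%N -> cnorm (k*x^+i*y^+j) <= cnorm k*r^+4.
 by move=> ij; rewrite -mulrA !cnormM !cnormX ler_wpM2l ?cnorm_ge0 // pw.
rewrite /quartic_form !mulrDl.
apply: (tri _ _ _ _); first (apply: (tri _ _ _ _); first (apply: (tri _ _ _ _); first (apply: (tri _ _ _ _)))).
- by have := mon k0 4 0 erefl; rewrite expr0 mulr1.
- exact: (mon k1 3 1 erefl).
- exact: (mon k2 2 2 erefl).
- exact: (mon k3 1 3 erefl).
- by have := mon k4 0 4 erefl; rewrite expr0 mulr1.
Qed.

(** With [t = y/x] the equation becomes [x = - c t^3 / h t]: one branch, parametrised by [t]. *)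
Lemma cube_unibranch (c k0 k1 k2 k3 k4 : C) (X : P -> Prop) m : (0 < m)%N -> c != 0 -> k0 != 0 ->
 (forall q, X q <-> c*q.2^+3 + quartic_form k0 k1 k2 k3 k4 q.1 q.2 = 0) ->
 ~ top_equiv_germ X (0, 0) (fun q : P => nf m.*2 q = 0) (0, 0).
Proof.
move=> m0 c0 k00 hX te; pose h t := quartic_form k0 k1 k2 k3 k4 1 t.
have sh : sd (fun q => h q.1) by rewrite /h /quartic_form; sdauto.
have ctn_h q : ctn (fun=> True) (fun q => h q.1) q.
 rewrite /h /quartic_form; ctnauto.
have h0 : h 0 != 0 by rewrite /h /quartic_form !(expr0n, mulr0, addr0, expr1n, mulr1).
have [r1 r10 ch] := sdiff_ball sh; have [r2 r20 nh] := ctn_neq0 (ch _ (cball_refl _ r10)) h0.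
pose r := Num.min r1 r2; have r0 : 0 < r by rewrite lt_min r10.
have bt t (d : R) : cnorm t < d -> B0 d (t, 0).
 by move=> ht; split; rewrite ?subr0 // ?cnorm0; exact: le_lt_trans (cnorm_ge0 t) ht.
have hn t : cnorm t < r -> h t != 0.
 by rewrite lt_min => /andP[n1 n2]; exact: (nh (t, 0) (bt _ _ n1) (bt _ _ n2)).
pose x t := - c*t^+3/h t; pose k t : P := (x t, t*x t).
have kX t : cnorm t < r -> t != 0 -> X (k t) /\ k t <> (0, 0).
 move=> tr t0; have hh := hn t tr; split.
  apply/hX; rewrite /k /=; have -> : quartic_form k0 k1 k2 k3 k4 (x t) (t*x t) = x t^+4*h t.
   by rewrite /h /quartic_form; ring.
  by rewrite /x; field.
 by case=> /eqP; rewrite !mulf_eq0 invr_eq0 (negbTE hh) oppr_eq0 (negbTE c0) (negbTE t0).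
have pk : param X k r.
 split=> // [|t tr e e0]; first by rewrite /k /x expr0n !(mulr0, mul0r).
 pose D (q : P) := cnorm q.1 < r.
 have cx : ctn D (fun q => x q.1) (t, 0).
  apply: ctnM; first by ctnauto.
  apply: ctnV; first exact: hn.
  apply: ctnW (ctn_h (t, 0)) => //.
 have cy : ctn D (fun q => q.1*x q.1) (t, 0) by apply: ctnM => //; exact: ctn_fst.
 have [d1 d10 e1] := cx e e0; have [d2 d20 e2] := cy e e0.
 exmin d1 d2.
 move=> t' t'r; rewrite lt_min => /andP[n1 n2].
 have bb (d : R) : cnorm (t' - t) < d -> cball ((t, 0) : P) d (t', 0).
  by move=> hd; split => //; rewrite subrr cnorm0; exact: le_lt_trans (cnorm_ge0 _) hd.
 by split; [exact: (e1 (t', 0) t'r (bb _ n1))|exact: (e2 (t', 0) t'r (bb _ n2))].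
have sk : psurj X k.
 move=> e e0; pose M := cnorm k0 + cnorm k1 + cnorm k2 + cnorm k3 + cnorm k4 + 1.
 have M0 : 0 < M by rewrite ltr_wpDl // !addr_ge0 ?cnorm_ge0.
 have cp := cnorm_gt0 c0; pose e' := Num.min e r; have e'0 : 0 < e' by rewrite lt_min e0.
 have d1 : 0 < cnorm c/M by rewrite divr_gt0.
 have d2 : 0 < e'^+3*cnorm c/M by rewrite divr_gt0 // mulr_gt0 // exprn_gt0.
 exists (Num.min (cnorm c/M) (e'^+3*cnorm c/M)); first by rewrite lt_min d1.
 move=> q; rewrite /cball !subr0 !lt_min => -[/andP[b1 b2] /andP[b3 b4]] q0 /hX Xq.
 have E : cnorm c*cnorm q.2^+3 = cnorm (quartic_form k0 k1 k2 k3 k4 q.1 q.2).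
  by rewrite -cnormX -cnormM -cnormN; congr cnorm; apply/eqP; rewrite eq_sym -addr_eq0 addrC Xq.
 have M1 : M - 1 <= M by lra. have ME : M - 1 = cnorm k0 + cnorm k1 + cnorm k2 + cnorm k3 + cnorm k4 by rewrite /M addrK.
 (* If [|q.1| <= |q.2|], the quartic part would be of order [|q.2|^4] and could not balance
    [c q.2^3]. *)
 have xy : cnorm q.2 < cnorm q.1.
  rewrite ltNge; apply/negP => xy; have := quartic_form_le k0 k1 k2 k3 k4 xy (lexx _).
  rewrite -ME -E (exprS _ 3) mulrA; have [y0|y0] := eqVneq q.2 0.
   have x0 : q.1 = 0 by apply: cnorm_eq0; apply/eqP; rewrite eq_le cnorm_ge0 andbT -(cnorm0 R) -y0.
   by case: q0; rewrite [q]surjective_pairing x0 y0.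
  have y3 := exprn_gt0 3 (cnorm_gt0 y0); rewrite ler_pM2r // => le1.
  by move: b3; rewrite ltr_pdivlMr // => b3; have := cnorm_ge0 q.2; nra.
 have x0 : q.1 != 0 by apply: cnorm_neq0; exact: le_lt_trans (cnorm_ge0 _) xy.
 pose t := q.2/q.1; have yE : q.2 = t*q.1 by rewrite /t divfK.
 have Eh : c*t^+3 = - (q.1*h t).
  apply/eqP; rewrite -addr_eq0 -(mulrI_eq0 _ (mulfI (expf_neq0 3 x0))); apply/eqP; rewrite -Xq yE.
  by rewrite /h /quartic_form; ring.
 have ht : cnorm (h t) <= M.
  have t1 : cnorm t <= 1 by rewrite cnormM cnormV ler_pdivrMr ?mul1r ?ltW // cnorm_gt0.
  have := @quartic_form_le k0 k1 k2 k3 k4 1 t 1; rewrite cnorm1 expr1n mulr1 => /(_ (lexx _) t1).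
  by rewrite -ME -/(h t); lra.
 have te' : cnorm t < e'.
  rewrite -(ltr_pXn2r (isT : (0 < 3)%N)) ?nnegrE ?cnorm_ge0 ?(ltW e'0) //.
  have : cnorm c*cnorm t^+3 = cnorm q.1*cnorm (h t) by rewrite -cnormX -!cnormM Eh cnormN.
  move: b2; rewrite ltr_pdivlMr // => b2; have := cnorm_ge0 q.1; have := cnorm_ge0 (h t).
  move: (cnorm t^+3) (e'^+3) b2 => u v; nra.
 have tr : cnorm t < r by apply: lt_le_trans te' _; minle.
 have t0 : t != 0.
  apply/eqP => t0; move: Eh; rewrite t0 expr0n mulr0 => /eqP.
  by rewrite eq_sym oppr_eq0 mulf_eq0 (negbTE x0) (negbTE h0).
 have xE : q.1 = x t by rewrite /x mulNr Eh opprK mulfK ?hn.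
 exists t; split => //; first by apply: lt_le_trans te' _; minle.
 by rewrite [q]surjective_pairing /k -xE yE.
exact: (even_not_unibranch m0 pk sk (top_equiv_sym te)).
Qed.

Lemma quartic_form_lin (k0 k1 k2 k3 k4 a b c d : C) : exists k1' k2' k3', forall x y,
 quartic_form k0 k1 k2 k3 k4 (a*x + b*y) (c*x + d*y) =
 quartic_form (quartic_form k0 k1 k2 k3 k4 a c) k1' k2' k3' (quartic_form k0 k1 k2 k3 k4 b d) x y.
Proof.
exists (k0*4*a^+3*b + k1*(3*a^+2*b*c + a^+3*d) + k2*(2*a*b*c^+2 + 2*a^+2*c*d)
 + k3*(b*c^+3 + 3*a*c^+2*d) + k4*4*c^+3*d).
exists (k0*6*a^+2*b^+2 + k1*(3*a*b^+2*c + 3*a^+2*b*d) +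
 k2*(b^+2*c^+2 + 4*a*b*c*d + a^+2*d^+2) + k3*(3*b*c^+2*d + 3*a*c*d^+2) + k4*6*c^+2*d^+2).
exists (k0*4*a*b^+3 + k1*(b^+3*c + 3*a*b^+2*d) + k2*(2*b^+2*c*d + 2*a*b*d^+2)
 + k3*(3*b*c*d^+2 + a*d^+3) + k4*4*c*d^+3).
by move=> x y; rewrite /quartic_form; ring.
Qed.

Definition cubic_form (c0 c1 c2 c3 : C) (x y : C) :=
 c0*x^+3 + c1*x^+2*y + c2*x*y^+2 + c3*y^+3.

Lemma cubic_root (c0 c1 c2 c3 : C) : exists a b c d, [/\ a*d - b*c != 0 & cubic_form c0 c1 c2 c3 b d = 0].
Proof.
have [c00|c00] := eqVneq c0 0.
 exists 0, 1, 1, 0; split; first by rewrite mul0r mulr1 sub0r oppr_eq0 oner_neq0.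
 by rewrite /cubic_form c00; ring.
have [x hx] := @solve_monicpoly C 3 (nth 0 [:: - c3/c0; - c2/c0; - c1/c0]) isT.
exists 1, x, 0, 1; split; first by rewrite mulr0 subr0 mulr1 oner_neq0.
move: hx; rewrite !big_ord_recl big_ord0 /= /bump /= => hx.
by rewrite /cubic_form hx; field.
Qed.

(** Root patterns of a binary cubic: a simple root [x] with cofactor either squarefree or a multiple
    of [y^2], and otherwise a multiple [h y^3], where [h = 0] is allowed. *)
Lemma cubic_class (c0 c1 c2 c3 : C) : exists a b c d e f g h, a*d - b*c != 0 /\
 (forall x y, cubic_form c0 c1 c2 c3 (a*x + b*y) (c*x + d*y) = x*(e*y^+2 + f*x*y + g*x^+2) + h*y^+3) /\
 (h = 0 /\ e != 0 /\ (f^+2 - 4*e*g != 0 \/ f = 0 /\ g = 0) \/ [/\ e = 0, f = 0 & g = 0]).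
Proof.
have [a [b [c [d [D r0]]]]] := cubic_root c0 c1 c2 c3.
pose e := c0*3*a*b^+2 + c1*(b^+2*c + 2*a*b*d) + c2*(2*b*c*d + a*d^+2) + c3*3*c*d^+2.
pose f := c0*3*a^+2*b + c1*(2*a*b*c + a^+2*d) + c2*(b*c^+2 + 2*a*c*d) + c3*3*c^+2*d.
pose g := cubic_form c0 c1 c2 c3 a c.
have E x y : cubic_form c0 c1 c2 c3 (a*x + b*y) (c*x + d*y) = x*(e*y^+2 + f*x*y + g*x^+2).
 transitivity (x*(e*y^+2 + f*x*y + g*x^+2) + cubic_form c0 c1 c2 c3 b d*y^+3); last by rewrite r0; ring.
 by rewrite /e /f /g /cubic_form; ring.
have two0 : (2 : C) != 0 by rewrite pnatr_eq0.
have [e0|e0] := eqVneq e 0.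
 have [f0|f0] := eqVneq f 0.
  exists b, a, d, c, 0, 0, 0, g; split; [|split; last by right].
   by rewrite (_ : b*c - a*d = - (a*d - b*c)) ?oppr_eq0 //; ring.
  move=> x y; have -> : b*x + a*y = a*y + b*x by ring. have -> : d*x + c*y = c*y + d*x by ring.
  by rewrite E e0 f0; ring.
 (* the substitution [x = y'], [y = (x' - g y')/f] *)
 exists (b/f), (a - b*g/f), (d/f), (c - d*g/f), 1, 0, 0, 0; split; [|split].
 - have -> : b/f*(c - d*g/f) - (a - b*g/f)*(d/f) = - (a*d - b*c)/f by field.
  by rewrite mulf_eq0 invr_eq0 (negbTE f0) oppr_eq0 (negbTE D).
 - move=> x y; have -> : b/f*x + (a - b*g/f)*y = a*y + b*((x - g*y)/f) by field.
  have -> : d/f*x + (c - d*g/f)*y = c*y + d*((x - g*y)/f) by field.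
  by rewrite E e0; field.
 - by left; split=> //; split; [exact: oner_neq0|right].
have [de|de] := eqVneq (f^+2 - 4*e*g) 0; last first.
 by exists a, b, c, d, e, f, g, 0; split => //; split; [move=> x y; rewrite E; ring|left; split => //; split => //; left].
exists (a - b*(f/(2*e))), b, (c - d*(f/(2*e))), d, e, 0, 0, 0; split; [|split].
- by have -> : (a - b*(f/(2*e)))*d - b*(c - d*(f/(2*e))) = a*d - b*c by ring.
- move=> x y; have -> : (a - b*(f/(2*e)))*x + b*y = a*x + b*(y - f/(2*e)*x) by ring.
 have -> : (c - d*(f/(2*e)))*x + d*y = c*x + d*(y - f/(2*e)*x) by ring.
 have ge : g = f^+2/(4*e).
  have -> : f^+2 = 4*e*g by apply/eqP; rewrite -subr_eq0 de. 
  by field.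
 by rewrite E ge; field.
- by left; split=> //; split=> //; right.
Qed.

(** A common zero of the cubic and quartic parts would be a line through the point contained in the
    curve. In its absence every root pattern but the cube splits into two parts, and the cube has
    one branch. *)
Lemma triple_point (c0 c1 c2 c3 k0 k1 k2 k3 k4 : C) (X : P -> Prop) :
 (forall x y, cubic_form c0 c1 c2 c3 x y = 0 -> quartic_form k0 k1 k2 k3 k4 x y = 0 -> x = 0 /\ y = 0) ->
 (forall q, X q <-> cubic_form c0 c1 c2 c3 q.1 q.2 + quartic_form k0 k1 k2 k3 k4 q.1 q.2 = 0) ->
 (top_equiv_germ X (0, 0) (fun q : P => nfE q = 0) (0, 0) ->
   exists a b c d h, [/\ a*d - b*c != 0, h != 0 &
    forall x y, cubic_form c0 c1 c2 c3 (a*x + b*y) (c*x + d*y) = h*y^+3]) /\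
 forall m, (0 < m)%N -> ~ top_equiv_germ X (0, 0) (fun q : P => nf m.*2 q = 0) (0, 0).
Proof.
move=> nc hX; have [a [b [c [d [e [f [g [h [D [E cs]]]]]]]]]] := cubic_class c0 c1 c2 c3.
have [k1' [k2' [k3' EQ]]] := quartic_form_lin k0 k1 k2 k3 k4 a b c d.
have tX := lin_germ X D.
set K0 := quartic_form k0 k1 k2 k3 k4 a c in EQ.
have cz : cubic_form c0 c1 c2 c3 a c = 0 -> K0 != 0.
 move=> z; apply/eqP => z'; have [a0 c0'] := nc a c z z'.
 by move: D; rewrite a0 c0' mul0r mulr0 subrr eqxx.
have hX' q : X (a*q.1 + b*q.2, c*q.1 + d*q.2) <->
  (q.1*(e*q.2^+2 + f*q.1*q.2 + g*q.1^+2) + h*q.2^+3) +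
  quartic_form K0 k1' k2' k3' (quartic_form k0 k1 k2 k3 k4 b d) q.1 q.2 = 0 by rewrite hX /= E EQ.
have E10 : cubic_form c0 c1 c2 c3 a c = g by have := E 1 0; rewrite !(mulr1, mulr0, addr0) => ->; ring.
case: cs => [[h0 [e0 cs]]|[e0 f0 g0]].
 have [] := @simple_root_split e f g K0 k1' k2' k3' (quartic_form k0 k1 k2 k3 k4 b d)
   (fun q => X (a*q.1 + b*q.2, c*q.1 + d*q.2)) e0.
 - case: cs => [->//|[f0 g0]]; apply/orP; right; rewrite f0 g0 !eqxx /=; apply: cz; by rewrite E10.
 - by move=> q; rewrite hX' h0 mul0r addr0.
 move=> n1 n2; split=> [te|m m0 te]; first by case: n1; exact: top_equiv_trans tX te.
 by apply: (n2 m m0); exact: top_equiv_trans tX te.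
have K00 : K0 != 0 by apply: cz; rewrite E10.
(* If the cubic part vanished, any nontrivial zero of the quartic form would contradict [nc]. *)
have h0 : h != 0.
 apply/eqP => h0; have cub0 x y : cubic_form c0 c1 c2 c3 (a*x + b*y) (c*x + d*y) = 0.
  by rewrite E e0 f0 g0 h0; ring.
 have root (x y : C) : quartic_form k0 k1 k2 k3 k4 (a*x + b*y) (c*x + d*y) = 0 -> x = 0 /\ y = 0.
  move=> /(nc _ _ (cub0 x y))[z1 z2].
  have x0 : (a*d - b*c)*x = 0 by transitivity (d*(a*x + b*y) - b*(c*x + d*y)); [ring|rewrite z1 z2; ring].
  have y0 : (a*d - b*c)*y = 0 by transitivity (a*(c*x + d*y) - c*(a*x + b*y)); [ring|rewrite z1 z2; ring].
  by move/eqP: x0; move/eqP: y0; rewrite !mulf_eq0 (negbTE D) /= => /eqP-> /eqP->.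
 have [z hz] := @solve_monicpoly C 4 (nth 0 [:: - quartic_form k0 k1 k2 k3 k4 b d/K0; - k3'/K0; - k2'/K0; - k1'/K0]) isT.
 have [] := root z 1; last by move=> _ /eqP; rewrite oner_eq0.
 rewrite EQ /quartic_form; move: hz; rewrite !big_ord_recl big_ord0 /= /bump /= => ->.
 by rewrite /quartic_form; field.
split=> [te|m m0 te].
 exists a, b, c, d, h; split => // x y; by rewrite E e0 f0 g0; ring.
apply: (@cube_unibranch h K0 k1' k2' k3' (quartic_form k0 k1 k2 k3 k4 b d)
  (fun q => X (a*q.1 + b*q.2, c*q.1 + d*q.2)) m m0 h0 K00); last exact: top_equiv_trans tX te.
move=> q; rewrite hX' e0 f0 g0.
by have -> : q.1*(0*q.2^+2 + 0*q.1*q.2 + 0*q.1^+2) + h*q.2^+3 = h*q.2^+3 by ring.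
Qed.

End Triple.

Notation cub k := (cubic_form (k 6%N) (k 7%N) (k 8%N) (k 9%N)).
Notation qua k := (quartic_form (k 10%N) (k 11%N) (k 12%N) (k 13%N) (k 14%N)).

(** * Polynomials as functions, and forms by coefficient lists *)

Section MPoly.
Variable R : realType.
Local Notation C := (R[i]).

Lemma polyfun0 (p : {poly C}) : (forall x, p.[x] = 0) -> p = 0.
Proof.
move=> H; apply/eqP; apply/negPn/negP => p0.
have := max_poly_roots (rs := [seq (i%:R : C) | i <- iota 0 (size p)]) p0.
rewrite size_map size_iota ltnn => H'; suff : false by []. apply: H'.
 by apply/allP => x _; apply/rootP.
by rewrite map_inj_uniq ?iota_uniq // => i j /eqP; rewrite eqr_nat => /eqP.
Qed.

Lemma digits_inj n N (a b : 'I_n -> nat) : (forall i, a i < N)%N -> (forall i, b i < N)%N ->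
 (\sum_i a i*N ^ i = \sum_i b i*N ^ i)%N -> a =1 b.
Proof.
elim: n a b => [|n IH] a b ha hb; first by move=> _ [].
rewrite !big_ord_recl !expn0 !muln1.
have E (c : 'I_n.+1 -> nat) : (\sum_(i < n) c (lift ord0 i)*N ^ lift ord0 i = N * \sum_(i < n) c (lift ord0 i)*N ^ i)%N.
 by rewrite big_distrr; apply: eq_bigr => i _; rewrite /= /bump /= add1n expnS mulnCA.
rewrite !E => e; have N0 : (0 < N)%N by exact: leq_ltn_trans (leq0n _) (ha ord0).
have e0 : a ord0 = b ord0 by have := congr1 (modn^~ N) e; rewrite /= ![(_ + N*_)%N]addnC ![(N*_)%N]mulnC !modnMDl !modn_small.
have e1 : forall i, a (lift ord0 i) = b (lift ord0 i).
 apply: (IH (fun i => a (lift ord0 i)) (fun i => b (lift ord0 i))) => //; move: e; rewrite e0 => /addnI /eqP.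
 by rewrite eqn_pmul2l // => /eqP.
by move=> i; case: (unliftP ord0 i) => [j|] ->.
Qed.

(** Kronecker substitution [x_i = t^(N^i)]: with [N] above all exponents, distinct monomials go to
    distinct powers of [t]. *)
Lemma mpoly_fun0 n (p : {mpoly C[n]}) : (forall v, p.@[v] = 0) -> p = 0.
Proof.
move=> H; pose N := msize p; pose code (m : 'X_{1..n}) := (\sum_(i < n) m i*N ^ i)%N.
pose P := \sum_(m <- msupp p) p@_m *: 'X^(code m).
have P0 : P = 0.
 apply: polyfun0 => t; rewrite /P horner_sum; transitivity (p.@[fun i => t^+(N ^ i)]); last exact: H.
 rewrite mevalE.
 apply: eq_bigr => m _; rewrite hornerZ hornerXn /code; congr (_*_).
 by rewrite expr_sum; apply: eq_bigr => i _; rewrite -exprM mulnC.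
have dig m : m \in msupp p -> forall i, (m i < N)%N.
 by move=> ms i; apply: leq_ltn_trans (msize_mdeg_lt ms); rewrite mdegE (bigD1 i) //= leq_addr.
apply/mpolyP => m; rewrite mcoeff0; apply/eqP; apply/negPn/negP; rewrite -mcoeff_msupp => ms.
have := congr1 (fun q : {poly C} => q`_(code m)) P0; rewrite coef0 /P coef_sum (bigD1_seq m) ?msupp_uniq //=.
rewrite coefZ coefXn eqxx mulr1 big_seq_cond big1 ?addr0; first by apply/eqP; rewrite -mcoeff_msupp.
move=> m' /andP[ms' mm]; rewrite coefZ coefXn; case: eqP => [e|]; rewrite ?mulr0 //.
case/eqP: mm; apply/mnmP => i; exact: (digits_inj (dig _ ms') (dig _ ms) (esym e)).
Qed.

Lemma mpoly_fun_eq n (p q : {mpoly C[n]}) : (forall v, p.@[v] = q.@[v]) -> p = q.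
Proof. by move=> H; apply/subr0_eq/mpoly_fun0 => v; rewrite mevalB H subrr. Qed.

Lemma mp_ind n (Q : {mpoly C[n]} -> Prop) : (forall c, Q c%:MP) -> (forall i, Q 'X_i) ->
 (forall p q, Q p -> Q q -> Q (p + q)) -> (forall p q, Q p -> Q q -> Q (p*q)) -> forall p, Q p.
Proof.
move=> Qc QX QD QM p; rewrite [p]mpolyE; elim/big_ind: _ => //; first by rewrite -(mpolyC0 n).
move=> m _; rewrite -mul_mpolyC; apply: (QM _ _ (Qc _)); rewrite mpolyXE_id.
elim/big_ind: _ => //; first by rewrite -(mpolyC1 n).
move=> i _; elim: (m i) => [|k IH]; first by rewrite expr0 -(mpolyC1 n).
by rewrite exprS; exact: (QM _ _ (QX i)).
Qed.

(** Restriction to the line [v + t w], as a polynomial in [t]; its coefficient of degree one is the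
    directional derivative. *)
Definition tline n (p : {mpoly C[n]}) (v w : 'I_n -> C) : {poly C} :=
 (map_mpoly polyC p).@[fun j => (v j)%:P + (w j)%:P * 'X].

Lemma tlineP n (p : {mpoly C[n]}) v w : (forall t, (tline p v w).[t] = p.@[fun j => v j + t*w j]) /\
 (tline p v w)`_1 = \sum_j w j * p^`M(j).@[v].
Proof.
have tC c : tline (c%:MP : {mpoly C[n]}) v w = c%:P by rewrite /tline map_mpolyC ?mevalC //= raddf0.
have tX i : tline ('X_i : {mpoly C[n]}) v w = (v i)%:P + (w i)%:P * 'X by rewrite /tline map_mpolyX mevalXU.
have tD q1 q2 : tline q1 v w + tline q2 v w = tline (q1 + q2) v w by rewrite /tline raddfD mevalD.
have tM q1 q2 : tline q1 v w*tline q2 v w = tline (q1*q2) v w by rewrite /tline rmorphM mevalM.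
elim/mp_ind: p => [c|i|p q [p1 p2] [q1 q2]|p q [p1 p2] [q1 q2]].
- rewrite tC; split=> [t|]; first by rewrite hornerC mevalC.
 by rewrite coefC big1 // => j _; rewrite mderivC meval0 mulr0.
- rewrite tX; split=> [t|]; first by rewrite mevalXU !hornerE mulrC.
 rewrite coefD coefCM coefC coefX /= add0r mulr1 (bigD1 i) //= big1 => [|j ji].
  have -> : ('X_i : {mpoly C[n]})^`M(i) = 1.
   by rewrite mderivX mnmE eqxx scale1r -(mpolyX0 n C); congr 'X_[_]; apply/mnmP => k; rewrite mnmBE subnn mnm0E.
  by rewrite meval1 mulr1 addr0.
 by rewrite mderivX mnmE eq_sym (negbTE ji) scale0r meval0 mulr0.
- rewrite -tD; split=> [t|]; first by rewrite hornerD mevalD (p1 t) (q1 t).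
 move: (tline p v w) (tline q v w) p2 q2 {p1 q1 tC tX tD tM} => P Q p2 q2.
 by rewrite coefD p2 q2 -big_split; apply: eq_bigr => j _; rewrite mderivD mevalD mulrDr.
rewrite -tM; split=> [t|]; first by rewrite hornerM mevalM (p1 t) (q1 t).
have z0 (r : {mpoly C[n]}) : (forall t, (tline r v w).[t] = r.@[fun j => v j + t*w j]) -> (tline r v w)`_0 = r.@[v].
 by move=> h; rewrite -horner_coef0 h; apply: meval_eq => j; rewrite mul0r addr0.
have zp := z0 p p1; have zq := z0 q q1.
move: (tline p v w) (tline q v w) p2 q2 zp zq {p1 q1 z0 tC tX tD tM} => P Q p2 q2 zp zq.
have -> : (P*Q)`_1 = P`_0*Q`_1 + P`_1*Q`_0 by rewrite coefM big_ord_recr big_ord1.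
rewrite p2 q2 zp zq mulr_sumr mulr_suml -big_split; apply: eq_bigr => j _.
by rewrite mderivM mevalD !mevalM /=; ring.
Qed.

Lemma ord3 (Q : 'I_3 -> Prop) : Q i0 -> Q i1 -> Q i2 -> forall j, Q j.
Proof. by move=> h0 h1 h2 [[|[|[|j]]] h] //; [move: h0|move: h1|move: h2]; congr Q; apply: val_inj. Qed.
Lemma prod3 (f : 'I_3 -> C) : \prod_j f j = f i0*f i1*f i2.
Proof. by rewrite !big_ord_recl big_ord0 mulr1 !mulrA; congr (f _*f _*f _); apply: val_inj. Qed.
Lemma mdeg3 (m : 'X_{1..3}) : mdeg m = (m i0 + m i1 + m i2)%N.
Proof. by rewrite mdegE !big_ord_recl big_ord0 addn0 !addnA; congr (m _ + m _ + m _)%N; apply: val_inj. Qed.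
Lemma prod2 (f : 'I_2 -> C) : \prod_j f j = f i2_0*f i2_1.
Proof. by rewrite !big_ord_recl big_ord0 mulr1; congr (f _*f _); apply: val_inj. Qed.
Lemma mdeg2 (m : 'X_{1..2}) : mdeg m = (m i2_0 + m i2_1)%N.
Proof. by rewrite mdegE !big_ord_recl big_ord0 addn0; congr (m _ + m _)%N; apply: val_inj. Qed.

(** [tform d k] is the ternary form of degree [d <= 4] whose coefficients, listed by increasing
  degree in [(x, y)], are [k 0, k 1, ...]. *)
Definition tform (d : nat) (k : nat -> C) (x y z : C) : C :=
 let f1 := z*k 0%N + (k 1%N*x + k 2%N*y) in
 let f2 := z*f1 + (k 3%N*x^+2 + k 4%N*x*y + k 5%N*y^+2) in
 let f3 := z*f2 + cub k x y in
 match d with 0 => k 0%N | 1 => f1 | 2 => f2 | 3 => f3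
 | _ => z*f3 + qua k x y end.
Definition isf d (f : C -> C -> C -> C) := exists k, forall x y z, f x y z = tform d k x y z.

Lemma isf_mul1 d (a b c : C) f : (d < 4)%N -> isf d f -> isf d.+1 (fun x y z => (a*x + b*y + c*z)*f x y z).
Proof.
case: d => [|[|[|[|]]]] // _ [k E].
- exists (nth 0 [:: c*k 0%N; a*k 0%N; b*k 0%N]) => x y z; rewrite E /tform /=; ring.
- exists (nth 0 [:: c*k 0%N; c*k 1%N + a*k 0%N; c*k 2%N + b*k 0%N; a*k 1%N; a*k 2%N + b*k 1%N; b*k 2%N]) => x y z.
 by rewrite E /tform /=; ring.
- exists (nth 0 [:: c*k 0%N; c*k 1%N + a*k 0%N; c*k 2%N + b*k 0%N; c*k 3%N + a*k 1%N; c*k 4%N + a*k 2%N + b*k 1%N;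
  c*k 5%N + b*k 2%N; a*k 3%N; a*k 4%N + b*k 3%N; a*k 5%N + b*k 4%N; b*k 5%N]) => x y z.
 by rewrite E /tform /cubic_form /=; ring.
- exists (nth 0 [:: c*k 0%N; c*k 1%N + a*k 0%N; c*k 2%N + b*k 0%N; c*k 3%N + a*k 1%N; c*k 4%N + a*k 2%N + b*k 1%N;
  c*k 5%N + b*k 2%N; c*k 6%N + a*k 3%N; c*k 7%N + a*k 4%N + b*k 3%N; c*k 8%N + a*k 5%N + b*k 4%N; c*k 9%N + b*k 5%N;
  a*k 6%N; a*k 7%N + b*k 6%N; a*k 8%N + b*k 7%N; a*k 9%N + b*k 8%N; b*k 9%N]) => x y z.
 by rewrite E /tform /cubic_form /quartic_form /=; ring.
Qed.
Lemma isf_add d f g : isf d f -> isf d g -> isf d (fun x y z => f x y z + g x y z).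
Proof.
move=> [k E] [k' E']; exists (fun i => k i + k' i) => x y z; rewrite E E' /tform /cubic_form /quartic_form.
by case: d {E E'} => [|[|[|[|d]]]]; ring.
Qed.
Lemma isf_scale d c f : isf d f -> isf d (fun x y z => c*f x y z).
Proof.
move=> [k E]; exists (fun i => c*k i) => x y z; rewrite E /tform /cubic_form /quartic_form.
by case: d {E} => [|[|[|[|d]]]]; ring.
Qed.
Lemma isf_ext d f g : (forall x y z, f x y z = g x y z) -> isf d f -> isf d g.
Proof. by move=> e [k E]; exists k => x y z; rewrite -e E. Qed.
Lemma isf0 d : isf d (fun _ _ _ => 0).
Proof. by exists (fun=> 0) => x y z; rewrite /tform /cubic_form /quartic_form; case: d => [|[|[|[|d]]]]; ring. Qed.
Lemma isf_sum d (I : Type) (s : seq I) (Q : pred I) (f : I -> C -> C -> C -> C) : (forall i, Q i -> isf d (f i)) ->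
 isf d (fun x y z => \sum_(i <- s | Q i) f i x y z).
Proof.
move=> H; elim: s => [|i s IH]; first by apply: isf_ext (isf0 d) => x y z; rewrite big_nil.
case Qi: (Q i); last by apply: isf_ext IH => x y z; rewrite big_cons Qi.
by apply: isf_ext (isf_add (H i Qi) IH) => x y z; rewrite big_cons Qi.
Qed.

Definition linf (l : C -> C -> C -> C) := exists a b c, forall x y z, l x y z = a*x + b*y + c*z.
Lemma isf_pow d n l f : linf l -> (d + n <= 4)%N -> isf d f -> isf (n + d) (fun x y z => l x y z^+n*f x y z).
Proof.
move=> [a [b [c E]]]; elim: n => [|n IH] dn Hf; first by apply: isf_ext Hf => x y z; rewrite expr0 mul1r.
have dn' : (d + n < 4)%N by rewrite addnS in dn.
have dn2 : (n + d < 4)%N by rewrite addnC.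
by apply: isf_ext (isf_mul1 a b c dn2 (IH (ltnW dn') Hf)) => x y z; rewrite exprS E mulrA.
Qed.

Lemma homog_form (F : {mpoly C[3]}) (L : 'I_3 -> C -> C -> C -> C) : F \is 4.-homog -> (forall j, linf (L j)) ->
 isf 4 (fun x y z => F.@[fun j => L j x y z]).
Proof.
move=> /dhomogP hF hL.
have E x y z : \sum_(m <- msupp F | mdeg m == 4%N) F@_m * \prod_i L i x y z^+m i = F.@[fun j => L j x y z].
 rewrite mevalE big_seq_cond [RHS]big_seq_cond; apply: eq_bigl => m; case ms: (m \in msupp F) => //=.
 by rewrite (hF m ms) eqxx.
apply: isf_ext E _; apply: isf_sum => m /eqP; rewrite mdeg3 => m4.
apply: isf_scale; have one : isf 0 (fun _ _ _ => 1) by exists (fun=> 1).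
have le a b c : (a + b + c = 4)%N -> (0 + a <= 4)%N /\ (a + 0 + b <= 4)%N /\ (b + (a + 0) + c <= 4)%N.
 lia.
have [l1 [l2 l3]] := le _ _ _ m4.
have e4 : (m i2 + (m i1 + (m i0 + 0)))%N = 4%N by rewrite addn0 (addnC (m i1)) (addnC (m i2)).
have H := isf_pow (hL i2) l3 (isf_pow (hL i1) l2 (isf_pow (hL i0) l1 one)); rewrite e4 in H.
by apply: isf_ext H => x y z; rewrite prod3; ring.
Qed.

Lemma affine_form (f : {mpoly C[2]}) (L0 L1 : C -> C -> C -> C) d : (d <= 4)%N -> (msize f <= d.+1)%N -> linf L0 -> linf L1 ->
 exists A, isf d A /\ forall x y, A x y 1 = f.@[fun j => nth 0 [:: L0 x y 1; L1 x y 1] j].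
Proof.
move=> d4 sf h0 h1.
exists (fun x y z => \sum_(m <- msupp f | (mdeg m <= d)%N) f@_m*(z^+(d - mdeg m)*(L1 x y z^+m i2_1*(L0 x y z^+m i2_0*1)))).
have lz : linf (fun x y z => z) by exists 0, 0, 1 => x y z; ring.
split.
 apply: isf_sum => m; rewrite mdeg2 => md; apply: isf_scale; have one : isf 0 (fun _ _ _ => 1) by exists (fun=> 1).
 have l1 : (0 + m i2_0 <= 4)%N by apply: leq_trans d4; apply: leq_trans md; rewrite leq_addr.
 have l2 : (m i2_0 + 0 + m i2_1 <= 4)%N by rewrite addn0; exact: leq_trans d4.
 have l3 : (m i2_1 + (m i2_0 + 0) + (d - (m i2_0 + m i2_1)) <= 4)%N by rewrite addn0 addnC (addnC (m i2_1)) subnK.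
 have ed : (d - (m i2_0 + m i2_1) + (m i2_1 + (m i2_0 + 0)))%N = d by rewrite addn0 (addnC (m i2_1)) subnK.
 by have H := isf_pow lz l3 (isf_pow h1 l2 (isf_pow h0 l1 one)); rewrite ed in H.
move=> x y; rewrite mevalE big_seq_cond [RHS]big_seq; apply: eq_big => [m|m _].
 case ms: (m \in msupp f) => //=; by rewrite -ltnS (leq_trans (msize_mdeg_lt ms) sf).
by rewrite prod2 /= expr1n mulr1 mul1r [X in _*X]mulrC.
Qed.

End MPoly.

(** * Projective frames and the germ of the curve at a point *)

Definition cmb (R : realType) (e0 e1 e2 : 'I_3 -> R[i]) (x y z : R[i]) : 'I_3 -> R[i] := fun j => x*e0 j + y*e1 j + z*e2 j.
Ltac cmbring := apply/funext => ?; rewrite /cmb; ring.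

Section Frames.
Variable R : realType.
Local Notation C := (R[i]).
Local Notation P := (C*C)%type.
Local Notation vec := ('I_3 -> C).
Implicit Types (u v w e : vec).

Lemma translation_germ (Y : P -> Prop) (b : P) :
 top_equiv_germ (fun p => Y (p.1 + b.1, p.2 + b.2)) (0, 0) Y b.
Proof.
apply/top_equivP; exists (fun=> True), (fun=> True), (fun p => (p.1 + b.1, p.2 + b.2)), (fun p => (p.1 - b.1, p.2 - b.2)).
have op : copen (fun _ : P => True) by move=> q _; exists 1.
split; last by split=> [|q _]; [rewrite [(0,0).1]/= [(0,0).2]/= !add0r; case: (b)|].
split=> //; split=> // [[x y] _|[x y] _|]; rewrite ?addrK ?subrK //.
by split; apply/ccont_ctn => q _; split; rewrite /=; ctnauto.
Qed.

Definition det3 u v w : C :=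
 u i0*(v i1*w i2 - v i2*w i1) - u i1*(v i0*w i2 - v i2*w i0) + u i2*(v i0*w i1 - v i1*w i0).

Lemma veqP v w : v i0 = w i0 -> v i1 = w i1 -> v i2 = w i2 -> v = w.
Proof. by move=> h0 h1 h2; apply/funext; apply: ord3. Qed.

Lemma cramer e0 e1 e2 v : det3 e0 e1 e2 != 0 ->
 v = cmb e0 e1 e2 (det3 v e1 e2/det3 e0 e1 e2) (det3 e0 v e2/det3 e0 e1 e2) (det3 e0 e1 v/det3 e0 e1 e2).
Proof. by move=> D; apply: veqP; rewrite /cmb; move: D; rewrite /det3 => D; field. Qed.

Lemma cmb_inj e0 e1 e2 x y z x' y' z' : det3 e0 e1 e2 != 0 ->
 cmb e0 e1 e2 x y z = cmb e0 e1 e2 x' y' z' -> [/\ x = x', y = y' & z = z'].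
Proof.
move=> D E.
have c (a b c : C) : [/\ det3 (cmb e0 e1 e2 a b c) e1 e2 = a*det3 e0 e1 e2, det3 e0 (cmb e0 e1 e2 a b c) e2 = b*det3 e0 e1 e2 &
  det3 e0 e1 (cmb e0 e1 e2 a b c) = c*det3 e0 e1 e2] by rewrite /cmb /det3; split; ring.
have [a1 a2 a3] := c x y z; have [b1 b2 b3] := c x' y' z'.
by split; apply: (mulIf D); rewrite -?a1 -?a2 -?a3 E ?b1 ?b2 ?b3.
Qed.

Section Curve.
Variable F : {mpoly C[3]}.
Hypothesis Fh : F \is 4.-homog.
Local Notation ev v := (F.@[v]).

Lemma evZ (l : C) v : ev (fun j => l*v j) = l^+4*ev v.
Proof.
rewrite !mevalE mulr_sumr !big_seq; apply: eq_bigr => m ms.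
have m4 : mdeg m = 4%N := dhomog_mf Fh ms; rewrite -m4 mdeg3 !prod3 !exprMn !exprD; ring.
Qed.

Definition fform e0 e1 e2 k := forall x y z, ev (cmb e0 e1 e2 x y z) = tform 4 k x y z.

Lemma frame_form e0 e1 e2 : exists k, fform e0 e1 e2 k.
Proof.
apply: (homog_form (L := fun j x y z => cmb e0 e1 e2 x y z j) Fh) => j.
by exists (e0 j), (e1 j), (e2 j) => x y z; rewrite /cmb; ring.
Qed.

(** By homogeneity the equation in a frame and in a standard chart differ by the fourth power of a
    unit. The change of coordinates is a quotient of linear functions, recentred by a translation,
    with Jacobian a multiple of the determinant in the hypothesis. *)
Lemma chart_transfer i a b v u0 u1 u2 (l : C) (Y : P -> Prop) : v i != 0 -> l != 0 -> (forall j, u0 j = l*v j) ->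
 (forall p : P, [/\ chart_emb i p a = p.1, chart_emb i p b = p.2 & chart_emb i p i = 1]) ->
 chart_coord i v = (v a/v i, v b/v i) ->
 (forall j, [\/ j = a, j = b | j = i]) ->
 ((u1 a*u0 i - u0 a*u1 i)*(u2 b*u0 i - u0 b*u2 i) - (u2 a*u0 i - u0 a*u2 i)*(u1 b*u0 i - u0 b*u1 i) != 0) ->
 top_equiv_germ (fun q => ev (chart_emb i q) = 0) (chart_coord i v) Y (0, 0) ->
 top_equiv_germ (fun q => ev (cmb u0 u1 u2 1 q.1 q.2) = 0) (0, 0) Y (0, 0).
Proof.
move=> vi l0 hu hc cc hj D te.
have u0i : u0 i != 0 by rewrite hu mulf_neq0.
pose w q := cmb u0 u1 u2 1 q.1 q.2.
have sw : sd (fun q => u0 i*w q i) by rewrite /w /cmb; sdauto.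
have w0 : w (0, 0) i = u0 i by rewrite /w /cmb [(_, _).1]/= [(_, _).2]/=; ring.
have sg := sdV sw; rewrite w0 in sg; have {}sg := sg (mulf_neq0 u0i u0i).
(* The common denominator in [w_c/w_i - u0_c/u0_i = N c * g]. *)
pose g q := (u0 i*w q i)^-1; have g0 : g (0, 0) = (u0 i*u0 i)^-1 by rewrite /g w0.
have [al [be sg']] := sg; rewrite -/g in sg'.
pose N c q := (u1 c*u0 i - u0 c*u1 i)*q.1 + (u2 c*u0 i - u0 c*u2 i)*q.2.
have N0 c : N c (0, 0) = 0 by rewrite /N !mulr0 addr0.
have sN c : sdiff (N c) (u1 c*u0 i - u0 c*u1 i) (u2 c*u0 i - u0 c*u2 i).
 have := sdiffD (sdiffM (sdiff_cst (u1 c*u0 i - u0 c*u1 i)) (@sdiff_fst R)) (sdiffM (sdiff_cst (u2 c*u0 i - u0 c*u2 i)) (@sdiff_snd R)).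
 by rewrite !(mulr0, mulr1, addr0, add0r).
have s1 := sdiffM (sN a) sg'; have s2 := sdiffM (sN b) sg'.
rewrite !N0 !mul0r !add0r g0 in s1 s2.
apply: top_equiv_trans (top_equiv_trans (translation_germ _ _) te).
apply: (sdiff_germ s1 s2).
- set h := (u0 i*u0 i)^-1; have h0 : h != 0 by rewrite invr_eq0 mulf_neq0.
 set A := u1 a*_ - _ in D *; set B := u2 b*_ - _ in D *; set A' := u2 a*_ - _ in D *; set B' := u1 b*_ - _ in D *.
 have -> : h*A*(h*B) - h*A'*(h*B') = h^+2*(A*B - A'*B') by ring.
 by rewrite mulf_neq0 // expf_neq0.
- by rewrite N0 mul0r.
- by rewrite N0 mul0r.
have [d d0 cw] := sdiff_ball sw; have wn : u0 i*w (0, 0) i != 0 by rewrite w0 mulf_neq0.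
have [d' d'0 nw] := ctn_neq0 (cw _ (cball_refl _ d0)) wn.
exmin d d'.
move=> q bq; have nz : u0 i*w q i != 0.
 by apply: nw; cmin bq.
have wi : w q i != 0 by apply: contraNneq nz => ->; rewrite mulr0.
rewrite -/(w q) cc [(_, _).1]/= [(_, _).2]/=.
suff -> : chart_emb i (N a q*g q + v a/v i, N b q*g q + v b/v i) = (fun j => (w q i)^-1*w q j).
 rewrite evZ; split=> [->|/eqP]; first by rewrite mulr0.
 by rewrite mulf_eq0 expf_eq0 invr_eq0 (negbTE wi) => /eqP.
have [h1 h2 h3] := hc (N a q*g q + v a/v i, N b q*g q + v b/v i).
have va c : v c/v i = u0 c/u0 i by rewrite !hu -mulf_div divff ?mul1r.
have wE c : N c q*g q + v c/v i = (w q i)^-1*w q c.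
 rewrite va /g; apply: (mulIf nz); rewrite mulrDl divfK //.
 have -> : (w q i)^-1*w q c*(u0 i*w q i) = w q c*u0 i by field.
 have -> : u0 c/u0 i*(u0 i*w q i) = u0 c*w q i by field.
 by rewrite /N /w /cmb; ring.
apply/funext => j; case: (hj j) => ->; rewrite ?h1 ?h2 ?h3 ?[(_, _).1]/= ?[(_, _).2]/= ?wE //.
by rewrite mulVf.
Qed.

Lemma germ_at v s u0 u1 u2 (l : C) : has_type F v s -> l != 0 -> (forall j, u0 j = l*v j) -> det3 u0 u1 u2 != 0 ->
 top_equiv_germ (fun q => ev (cmb u0 u1 u2 1 q.1 q.2) = 0) (0, 0) (fun q => normal_form s q = 0) (0, 0).
Proof.
move=> [i vi te] l0 hu D.
have u0i : u0 i != 0 by rewrite hu mulf_neq0.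
have fin a b (e : C) : e != 0 -> (u1 a*u0 i - u0 a*u1 i)*(u2 b*u0 i - u0 b*u2 i) -
  (u2 a*u0 i - u0 a*u2 i)*(u1 b*u0 i - u0 b*u1 i) = e*(u0 i*det3 u0 u1 u2) ->
  (u1 a*u0 i - u0 a*u1 i)*(u2 b*u0 i - u0 b*u2 i) -
  (u2 a*u0 i - u0 a*u2 i)*(u1 b*u0 i - u0 b*u1 i) != 0.
 by move=> e0 ->; rewrite !mulf_neq0.
have c3 : forall j : 'I_3, [\/ j = i0, j = i1 | j = i2].
 by apply: ord3; [constructor 1|constructor 2|constructor 3].
move: vi te u0i fin; elim/ord3: i => vi te u0i fin.
- apply: (@chart_transfer i0 i1 i2 v u0 u1 u2 l _ vi l0 hu _ _ _ _ te) => //.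
  by move=> j; case: (c3 j) => ->; [constructor 3|constructor 1|constructor 2].
 by apply: (fin _ _ 1); rewrite ?oner_neq0 // /det3; ring.
- apply: (@chart_transfer i1 i0 i2 v u0 u1 u2 l _ vi l0 hu _ _ _ _ te) => //.
  by move=> j; case: (c3 j) => ->; [constructor 1|constructor 3|constructor 2].
 by apply: (fin _ _ (-1)); rewrite ?oppr_eq0 ?oner_neq0 // /det3; ring.
- apply: (@chart_transfer i2 i0 i1 v u0 u1 u2 l _ vi l0 hu _ _ _ _ te) => //.
 by apply: (fin _ _ 1); rewrite ?oner_neq0 // /det3; ring.
Qed.

End Curve.
End Frames.

(** * Polynomial functions of three coordinates *)

Section PFun.
Variable R : realType.
Local Notation C := (R[i]).
Local Notation P := (C*C)%type.
Local Notation vec := ('I_3 -> C).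
Implicit Types (u v w e : vec) (g h : C -> C -> C -> C).

Definition pt (x y z : C) : vec := fun j => nth 0 [:: x; y; z] j.
Definition pfun g := exists p : {mpoly C[3]}, forall x y z, g x y z = p.@[pt x y z].

Lemma pfun_cst c : pfun (fun _ _ _ => c). Proof. by exists c%:MP => x y z; rewrite mevalC. Qed.
Lemma pfun_x : pfun (fun x _ _ => x). Proof. by exists 'X_i0 => x y z; rewrite mevalXU. Qed.
Lemma pfun_y : pfun (fun _ y _ => y). Proof. by exists 'X_i1 => x y z; rewrite mevalXU. Qed.
Lemma pfun_z : pfun (fun _ _ z => z). Proof. by exists 'X_i2 => x y z; rewrite mevalXU. Qed.
Lemma pfunD g h : pfun g -> pfun h -> pfun (fun x y z => g x y z + h x y z).
Proof. by move=> [p hp] [q hq]; exists (p + q) => x y z; rewrite mevalD hp hq. Qed.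
Lemma pfunN g : pfun g -> pfun (fun x y z => - g x y z).
Proof. by move=> [p hp]; exists (- p) => x y z; rewrite mevalN hp. Qed.
Lemma pfunM g h : pfun g -> pfun h -> pfun (fun x y z => g x y z*h x y z).
Proof. by move=> [p hp] [q hq]; exists (p*q) => x y z; rewrite mevalM hp hq. Qed.
Lemma pfunX g n : pfun g -> pfun (fun x y z => g x y z^+n).
Proof.
move=> hg; elim: n => [|n IH]; first by exists 1 => x y z; rewrite expr0 meval1.
by have [p hp] := pfunM hg IH; exists p => x y z; rewrite exprS hp.
Qed.
Lemma pfun_ext g h : (forall x y z, g x y z = h x y z) -> pfun g -> pfun h.
Proof. by move=> e [p hp]; exists p => x y z; rewrite -e. Qed.
End PFun.

Ltac pfauto := repeat match goal with
 | |- pfun (fun _ _ _ => ?c) => exact: pfun_cst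
 | |- pfun (fun x _ _ => x) => exact: pfun_x
 | |- pfun (fun _ y _ => y) => exact: pfun_y
 | |- pfun (fun _ _ z => z) => exact: pfun_z
 | H : pfun ?g |- pfun ?g => exact H
 | H : pfun ?g |- pfun (fun x y z => ?g x y z) => exact H
 | |- pfun (fun x y z => (@?f x y z + @?g x y z)%R) => refine (@pfunD _ f g _ _)
 | |- pfun (fun x y z => (- @?f x y z)%R) => refine (@pfunN _ f _)
 | |- pfun (fun x y z => (@?f x y z * @?g x y z)%R) => refine (@pfunM _ f g _ _)
 | |- pfun (fun x y z => (@?f x y z^+?n)%R) => refine (@pfunX _ f n _)
 end.

(** * Irreducibility and singular points in frames *)

Section Quartic.
Variable R : realType.
Local Notation C := (R[i]).
Local Notation P := (C*C)%type.
Local Notation vec := ('I_3 -> C).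
Implicit Types (u v w e : vec) (g h : C -> C -> C -> C).

Lemma pfun_tform d (k : nat -> C) : pfun (tform d k).
Proof. by rewrite /tform /cubic_form /quartic_form; case: d => [|[|[|[|d]]]]; pfauto. Qed.

(** Polynomials form a domain. This legitimates cancelling a coordinate in an identity, including at
    the points where it vanishes. *)
Lemma pfun_vanish g h : pfun g -> pfun h -> (exists x y z, h x y z != 0) -> (forall x y z, h x y z != 0 -> g x y z = 0) ->
 forall x y z, g x y z = 0.
Proof.
move=> [p hp] [q hq] [x0 [y0 [z0 hz]]] H.
have q0 : q != 0 by apply: contraNneq hz => qz; rewrite hq qz meval0.
have : p*q = 0.
 apply: mpoly_fun0 => v; have -> : v = pt (v i0) (v i1) (v i2) by apply: veqP.
 rewrite mevalM -hp -hq; case: (eqVneq (h (v i0) (v i1) (v i2)) 0) => [->|/H ->]; by rewrite ?mulr0 ?mul0r.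
by move/eqP; rewrite mulf_eq0 (negbTE q0) orbF => /eqP p0 x y z; rewrite hp p0 meval0.
Qed.

Lemma pfun_mul0 g h : pfun g -> pfun h -> (forall x y z, g x y z*h x y z = 0) ->
 (forall x y z, g x y z = 0) \/ (forall x y z, h x y z = 0).
Proof.
move=> pg ph H; case: (pselect (exists x y z, h x y z != 0)) => [ex|nex].
 by left; apply: (pfun_vanish pg ph ex) => x y z hz; have /eqP := H x y z; rewrite mulf_eq0 (negbTE hz) orbF => /eqP.
by right=> x y z; apply/eqP/negPn/negP => hz; apply: nex; exists x, y, z.
Qed.

Lemma pfun_offz g : pfun g -> (forall x y z, z != 0 -> g x y z = 0) -> forall x y z, g x y z = 0.
Proof.
move=> pg H; apply: (pfun_vanish pg (@pfun_z R)) => //; by exists 0, 0, 1; rewrite oner_neq0.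
Qed.

Lemma quartic0 (a b c d e : C) : (forall x y, quartic_form a b c d e x y = 0) -> [/\ a = 0, b = 0, c = 0, d = 0 & e = 0].
Proof.
move=> H; have : Poly [:: e; d; c; b; a] = 0.
 by apply: polyfun0 => x; rewrite horner_Poly /= -[RHS](H x 1) /quartic_form; ring.
by move=> E; have co i := congr1 (fun p : {poly C} => p`_i) E; split;
 [have := co 4%N|have := co 3%N|have := co 2%N|have := co 1%N|have := co 0%N]; rewrite coef_Poly coef0.
Qed.
Lemma cubic0 (a b c d : C) : (forall x y, cubic_form a b c d x y = 0) -> [/\ a = 0, b = 0, c = 0 & d = 0].
Proof.
move=> H; have [-> -> -> -> _] : [/\ a = 0, b = 0, c = 0, d = 0 & 0 = 0 :> C] => //.
apply: quartic0 => x y; transitivity (x*cubic_form a b c d x y); last by rewrite H mulr0.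
by rewrite /quartic_form /cubic_form; ring.
Qed.

Section Curve.
Variable F : {mpoly C[3]}.
Hypothesis irr : irreducible_quartic F.
Local Notation ev v := (F.@[v]).

Lemma irr_vec (G H : vec -> C) : (exists p : {mpoly C[3]}, forall v, G v = p.@[v]) -> (exists p : {mpoly C[3]}, forall v, H v = p.@[v]) ->
 (forall v, ev v = G v*H v) -> G (fun=> 0) = 0 -> H (fun=> 0) = 0 -> False.
Proof.
case: irr => F0 _ ir [p hp] [q hq] E G0 H0.
have EF : F = p*q by apply: mpoly_fun_eq => v; rewrite mevalM -hp -hq.
have cst (r : {mpoly C[3]}) : (msize r <= 1)%N -> r.@[fun=> 0] = 0 -> r = 0.
 by move=> /msize1_polyC e; rewrite {1}e mevalC => z; rewrite e z mpolyC0.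
by case: (ir _ _ EF) => /cst z; move: F0; rewrite EF z ?mul0r ?mulr0 ?eqxx // -?hp -?hq.
Qed.

Lemma comp_frame e0 e1 e2 g : det3 e0 e1 e2 != 0 -> pfun g ->
 exists2 G : vec -> C, (exists p : {mpoly C[3]}, forall v, G v = p.@[v]) & forall x y z, G (cmb e0 e1 e2 x y z) = g x y z.
Proof.
move=> D [p hp]; pose lam (a b c : C) : {mpoly C[3]} := a *: 'X_i0 + b *: 'X_i1 + c *: 'X_i2.
have lamE a b c v : (lam a b c).@[v] = a*v i0 + b*v i1 + c*v i2 by rewrite !mevalD !mevalZ !mevalXU.
pose Di := (det3 e0 e1 e2)^-1.
pose l0 := lam (Di*(e1 i1*e2 i2 - e1 i2*e2 i1)) (- Di*(e1 i0*e2 i2 - e1 i2*e2 i0)) (Di*(e1 i0*e2 i1 - e1 i1*e2 i0)).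
pose l1 := lam (- Di*(e0 i1*e2 i2 - e0 i2*e2 i1)) (Di*(e0 i0*e2 i2 - e0 i2*e2 i0)) (- Di*(e0 i0*e2 i1 - e0 i1*e2 i0)).
pose l2 := lam (Di*(e0 i1*e1 i2 - e0 i2*e1 i1)) (- Di*(e0 i0*e1 i2 - e0 i2*e1 i0)) (Di*(e0 i0*e1 i1 - e0 i1*e1 i0)).
exists (fun v => g (l0.@[v]) (l1.@[v]) (l2.@[v])).
 exists (p \mPo [tuple l0; l1; l2]) => v; rewrite comp_mpoly_meval hp; apply: meval_eq; by apply: ord3.
have DD : Di*det3 e0 e1 e2 = 1 by rewrite mulVf.
move=> x y z; congr g; rewrite lamE /cmb -[RHS]mul1r -DD /det3; ring.
Qed.

(** Vanishing at the origin makes both factors nonunits. Degenerate configurations are rejected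
    below by exhibiting a factorisation in a frame. *)
Lemma irr_frame e0 e1 e2 g h : det3 e0 e1 e2 != 0 -> pfun g -> pfun h -> g 0 0 0 = 0 -> h 0 0 0 = 0 ->
 (forall x y z, ev (cmb e0 e1 e2 x y z) = g x y z*h x y z) -> False.
Proof.
move=> D pg ph g0 h0 E; have [G pG EG] := comp_frame D pg; have [H pH EH] := comp_frame D ph.
have z0 : (fun=> 0) = cmb e0 e1 e2 0 0 0 by cmbring.
apply: (irr_vec pG pH); rewrite ?z0 ?EG ?EH // => v.
by rewrite (cramer v D) E -EG -EH.
Qed.

Lemma irr_frameZ e0 e1 e2 c g h : det3 e0 e1 e2 != 0 -> c != 0 -> pfun g -> pfun h -> g 0 0 0 = 0 -> h 0 0 0 = 0 ->
 (forall x y z, c*ev (cmb e0 e1 e2 x y z) = g x y z*h x y z) -> False.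
Proof.
move=> D c0 pg ph g0 h0 E; apply: (@irr_frame e0 e1 e2 (fun x y z => c^-1*g x y z) h D) => //.
- by pfauto.
- by rewrite g0 mulr0.
- by move=> x y z; rewrite -mulrA -E mulKf.
Qed.

(** The coefficients of [z^4], [x z^3], [y z^3] are the value and the transverse derivatives at
    [e2]; the derivative along [e2] itself is [4 k 0]. *)
Lemma singular_frame e0 e1 e2 k : det3 e0 e1 e2 != 0 ->
 fform F e0 e1 e2 k ->
 singular_pt F e2 <-> [/\ k 0%N = 0, k 1%N = 0 & k 2%N = 0].
Proof.
move=> D E.
have ext v : (fun j => e2 j + v j) =1 (fun j => e2 j + 1*v j) by move=> j; rewrite mul1r.
have tl w (a b c : C) : w = cmb e0 e1 e2 a b c -> (tline F e2 w)`_1 = 4*c*k 0%N + a*k 1%N + b*k 2%N.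
 move=> wE; pose Z : {poly C} := 1 + c%:P * 'X.
 pose m := a*k 1%N + b*k 2%N.
 pose q : {poly C} := (k 0%N)%:P*((6*c^+2)%:P + (4*c^+3)%:P * 'X + (c^+4)%:P * 'X^2) +
  m%:P*((3*c)%:P + (3*c^+2)%:P * 'X + (c^+3)%:P * 'X^2) +
  ((k 3%N*a^+2 + k 4%N*a*b + k 5%N*b^+2)%:P*Z^+2 +
   'X*Z*(cub k a b)%:P +
   'X^2*(qua k a b)%:P).
 have -> : tline F e2 w = (k 0%N)%:P + (4*c*k 0%N + m)%:P * 'X + 'X^2*q.
  apply/subr0_eq/polyfun0 => t; rewrite hornerD hornerN (tlineP F e2 w).1.
  have -> : (fun j => e2 j + t*w j) = cmb e0 e1 e2 (t*a) (t*b) (1 + t*c).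
   by apply/funext => j; rewrite wE /cmb; ring.
  by rewrite E /q /Z !(hornerD, hornerM, hornerC, hornerX, hornerXn, horner_exp) /m /tform /cubic_form /quartic_form; ring.
 by rewrite !coefD coefC coefCM coefX coefXnM /= mulr1 add0r addr0 /m addrA.
split=> [[_ [z0 zd]]|[k0 k1 k2]].
 have S w : (tline F e2 w)`_1 = 0 by rewrite (tlineP F e2 w).2 big1 // => j _; rewrite zd mulr0.
 have e2E : e2 = cmb e0 e1 e2 0 0 1 by cmbring.
 have k0 : k 0%N = 0.
  by have := E 0 0 1; rewrite -e2E (z0 : ev e2 = 0) => ->; rewrite /tform /cubic_form /quartic_form; ring.
 split=> //; first have := S e0; last have := S e1.
  rewrite (tl e0 1 0 0) ?k0; last by cmbring.
  by rewrite !(mul0r, mulr0, mul1r, add0r, addr0).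
 rewrite (tl e1 0 1 0) ?k0; last by cmbring.
 by rewrite !(mul0r, mulr0, mul1r, add0r, addr0).
split; [|split].
- case: (pselect (nonzero e2)) => // n; case/eqP: D.
 have z j : e2 j = 0 by apply/eqP/negPn/negP => h; apply: n; exists j.
 by rewrite /det3 !z; ring.
- have e2E : e2 = cmb e0 e1 e2 0 0 1 by cmbring.
 by rewrite /on_curve; have := E 0 0 1; rewrite -e2E => ->; rewrite /tform /cubic_form /quartic_form k0; ring.
move=> j; pose w : vec := fun i => (i == j)%:R.
have := (tlineP F e2 w).2; rewrite (tl w _ _ _ (cramer w D)) k0 k1 k2 !mulr0 !addr0 (bigD1 j) //= big1 => [|i ij].
 by rewrite /w eqxx mul1r addr0.
by rewrite /w (negbTE ij) mul0r.
Qed.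
End Curve.
End Quartic.

(** * Torus decompositions as identities between forms *)

Section Decs.
Variable R : realType.
Local Notation C := (R[i]).
Local Notation vec := ('I_3 -> C).
Implicit Types (u v w e : vec).

Definition vform n (G : vec -> C) := exists k, forall v, G v = tform n k (v i0) (v i1) (v i2).
Definition af v : 'I_2 -> C := fun j => nth 0 [:: v i0; v i1] j.

Lemma tformZ d (k : nat -> C) (l x y z : C) : (d <= 4)%N -> tform d k (l*x) (l*y) (l*z) = l^+d*tform d k x y z.
Proof. by case: d => [|[|[|[|[|]]]]] // _; rewrite /tform /cubic_form /quartic_form; ring. Qed.
Lemma tform00 d (k : nat -> C) : (0 < d)%N -> tform d k 0 0 0 = 0.
Proof. by case: d => [|[|[|[|d]]]] // _; rewrite /tform /cubic_form /quartic_form; ring. Qed.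

Lemma isf_mono n a b c (co : C) (l0 l1 l2 : C -> C -> C -> C) : (a + b + c = n)%N -> (n <= 4)%N -> linf l0 -> linf l1 -> linf l2 ->
 isf n (fun x y z => co*(l2 x y z^+c*(l1 x y z^+b*(l0 x y z^+a*1)))).
Proof.
move=> e n4 h0 h1 h2; apply: isf_scale; have one : isf 0 (fun _ _ _ => 1 : C) by exists (fun=> 1).
have b1 : (0 + a <= 4)%N by lia. have b2 : (a + 0 + b <= 4)%N by lia. have b3 : (b + (a + 0) + c <= 4)%N by lia.
have H := isf_pow h2 b3 (isf_pow h1 b2 (isf_pow h0 b1 one)).
have e' : (c + (b + (a + 0)) = n)%N by lia.
by rewrite e' in H.
Qed.

Lemma isf_lin n (k : nat -> C) l0 l1 l2 : (n <= 3)%N -> linf l0 -> linf l1 -> linf l2 ->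
 isf n (fun x y z => tform n k (l0 x y z) (l1 x y z) (l2 x y z)).
Proof.
move=> n3 h0 h1 h2.
pose mo (m a b c i : nat) := fun x y z => k i*(l2 x y z^+c*(l1 x y z^+b*(l0 x y z^+a*1))).
have M m a b c i : (a + b + c = m)%N -> (m <= 4)%N -> isf m (mo m a b c i) by move=> e m4; exact: isf_mono.
case: n n3 => [|[|[|[|]]]] // _.
- by exists (fun=> k 0%N).
- apply: isf_ext (isf_add (M 1 0 0 1 0 erefl isT) (isf_add (M 1 1 0 0 1 erefl isT) (M 1 0 1 0 2 erefl isT)))%N => x y z.
 by rewrite /mo /tform; ring.
- apply: isf_ext (isf_add (M 2 0 0 2 0 erefl isT) (isf_add (M 2 1 0 1 1 erefl isT) (isf_add (M 2 0 1 1 2 erefl isT)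
  (isf_add (M 2 2 0 0 3 erefl isT) (isf_add (M 2 1 1 0 4 erefl isT) (M 2 0 2 0 5 erefl isT))))))%N => x y z.
 by rewrite /mo /tform; ring.
- apply: isf_ext (isf_add (M 3 0 0 3 0 erefl isT) (isf_add (M 3 1 0 2 1 erefl isT) (isf_add (M 3 0 1 2 2 erefl isT)
  (isf_add (M 3 2 0 1 3 erefl isT) (isf_add (M 3 1 1 1 4 erefl isT) (isf_add (M 3 0 2 1 5 erefl isT)
  (isf_add (M 3 3 0 0 6 erefl isT) (isf_add (M 3 2 1 0 7 erefl isT) (isf_add (M 3 1 2 0 8 erefl isT) (M 3 0 3 0 9 erefl isT))))))))))%N => x y z.
 by rewrite /mo /tform /cubic_form; ring.
Qed.

Lemma vform_frame n G e0 e1 e2 : (n <= 3)%N -> vform n G -> exists k, forall x y z, G (cmb e0 e1 e2 x y z) = tform n k x y z.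
Proof.
move=> n3 [k E]; have L j : linf (fun x y z => cmb e0 e1 e2 x y z j).
 by exists (e0 j), (e1 j), (e2 j) => x y z; rewrite /cmb; ring.
have [k' E'] := isf_lin k n3 (L i0) (L i1) (L i2); by exists k' => x y z; rewrite E E'.
Qed.

Definition pdeg n (g : C -> C -> C) := exists2 f : {mpoly C[2]}, (msize f <= n.+1)%N & forall v : 'I_2 -> C, f.@[v] = g (v i2_0) (v i2_1).
Lemma pdeg_cst n c : pdeg n (fun _ _ => c).
Proof. by exists c%:MP; [rewrite msizeC; case: eqP|move=> v; rewrite mevalC]. Qed.
Lemma pdegD n g h : pdeg n g -> pdeg n h -> pdeg n (fun x y => g x y + h x y).
Proof.
move=> [f sf hf] [f' sf' hf']; exists (f + f'); last by move=> v; rewrite mevalD hf hf'.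
by apply: leq_trans (msizeD_le _ _) _; rewrite geq_max sf.
Qed.
Lemma pdeg_ext n g h : (forall x y, g x y = h x y) -> pdeg n g -> pdeg n h.
Proof. by move=> e [f sf hf]; exists f => // v; rewrite hf e. Qed.
Lemma pdeg_mono a b c n : (a + b <= n)%N -> pdeg n (fun x y => c*x^+a*y^+b).
Proof.
move=> abn; exists (c *: ('X_i2_0^+a * 'X_i2_1^+b)).
 rewrite !mpolyXn -mpolyXD; apply: leq_trans (msizeZ_le _ _) _; rewrite msizeX mdegD !mdegMn !mdeg1 !mul1n; lia.
by move=> v; rewrite mevalZ mevalM !rmorphXn /= !mevalXU mulrA.
Qed.
Lemma pdeg_tform n (k : nat -> C) : (n <= 4)%N -> pdeg n (fun x y => tform n k x y 1).
Proof.
pose mo a b i := fun x y : C => k i*x^+a*y^+b.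
have M m a b i : (a + b <= m)%N -> pdeg m (mo a b i) by exact: pdeg_mono.
have T1 m : (1 <= m)%N -> pdeg m (fun x y => tform 1 k x y 1).
 move=> m1; apply: pdeg_ext (pdegD (M m 0 0 0 _)%N (pdegD (M m 1 0 1 _)%N (M m 0 1 2 _)%N)); try lia.
 by move=> x y; rewrite /mo /tform; ring.
have T2 m : (2 <= m)%N -> pdeg m (fun x y => tform 2 k x y 1).
 move=> m1; apply: pdeg_ext (pdegD (T1 m _) (pdegD (M m 2 0 3 _)%N (pdegD (M m 1 1 4 _)%N (M m 0 2 5 _)%N))); try lia.
 by move=> x y; rewrite /mo /tform; ring.
have T3 m : (3 <= m)%N -> pdeg m (fun x y => tform 3 k x y 1).
 move=> m1; apply: pdeg_ext (pdegD (T2 m _) (pdegD (M m 3 0 6 _)%N (pdegD (M m 2 1 7 _)%N (pdegD (M m 1 2 8 _)%N (M m 0 3 9 _)%N)))); try lia.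
 by move=> x y; rewrite /mo /tform /cubic_form; ring.
case: n => [|[|[|[|[|]]]]] // _; [exact: pdeg_cst|exact: T1|exact: T2|exact: T3|].
apply: pdeg_ext (pdegD (T3 4%N _) (pdegD (M 4 4 0 10 _)%N (pdegD (M 4 3 1 11 _)%N (pdegD (M 4 2 2 12 _)%N
 (pdegD (M 4 1 3 13 _)%N (M 4 0 4 14 _)%N))))); try lia.
by move=> x y; rewrite /mo /tform /cubic_form /quartic_form; ring.
Qed.

Lemma af_eq (v : 'I_2 -> C) : v =1 af (pt (v i2_0) (v i2_1) 1).
Proof. by case=> [[|[|]] h] //; rewrite /af /=; congr v; apply: val_inj. Qed.

Lemma proportional (f f' : {mpoly C[2]}) a : (forall v, v i2 = 1 -> f'.@[af v] = a*f.@[af v]) -> f' = a *: f.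
Proof.
by move=> H; apply: mpoly_fun_eq => v; rewrite mevalZ (meval_eq _ (af_eq v)) H // -(meval_eq _ (af_eq v)).
Qed.

Section Curve.
Variable F : {mpoly C[3]}.
Hypothesis irr : irreducible_quartic F.
Local Notation ev v := (F.@[v]).
Let Fh : F \is 4.-homog. Proof. by case: irr. Qed.
Let E0 := pt (1 : C) 0 0. Let E1 := pt 0 (1 : C) 0. Let E2 := pt 0 0 (1 : C).
Let std x y z : cmb E0 E1 E2 x y z = pt x y z.
Proof. by apply: veqP; rewrite /cmb /E0 /E1 /E2 /pt /=; ring. Qed.
Let stdD : det3 E0 E1 E2 != 0.
Proof. by rewrite /det3 /E0 /E1 /E2 /pt /= !(mulr0, mul0r, subr0, addr0, mulr1) oner_neq0. Qed.

Lemma dehom_ev v : v i2 = 1 -> (dehom F).@[af v] = ev v.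
Proof.
move=> v2; rewrite /dehom comp_mpoly_meval; apply: meval_eq; apply: ord3.
- by rewrite (tnth_nth 0) /= mevalXU.
- by rewrite (tnth_nth 0) /= mevalXU.
- by rewrite (tnth_nth 0) /= meval1 v2.
Qed.

Lemma dehom_size : (msize (dehom F) <= 5)%N.
Proof.
have [k E] := frame_form Fh E0 E1 E2.
have [f sf hf] := pdeg_tform k (isT : (4 <= 4)%N); suff -> : dehom F = f by [].
apply: mpoly_fun_eq => v; rewrite (meval_eq _ (af_eq v)) dehom_ev // -std E hf; congr (tform _ _ _ _ _).
Qed.

Lemma homogenize (f : {mpoly C[2]}) n : (n <= 4)%N -> (msize f <= n.+1)%N ->
 exists G, vform n G /\ forall v, v i2 = 1 -> f.@[af v] = G v.
Proof.
move=> n4 sf; have lx : linf (fun x y z : C => x) by exists 1, 0, 0 => x y z; ring.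
have ly : linf (fun x y z : C => y) by exists 0, 1, 0 => x y z; ring.
have [A [[k E] EA]] := affine_form n4 sf lx ly.
exists (fun v => A (v i0) (v i1) (v i2)); split; first by exists k => v.
by move=> v v2; rewrite v2 EA.
Qed.

Lemma vformZ n G l v : (n <= 4)%N -> vform n G -> G (fun j => l*v j) = l^+n*G v.
Proof. by move=> n4 [k E]; rewrite !E tformZ. Qed.

Lemma pfun_vform n G : vform n G -> pfun (fun x y z => G (pt x y z)).
Proof. by case=> k E; apply: pfun_ext (pfun_tform n k) => x y z; rewrite E. Qed.

Lemma affine_ext n G H : (n <= 4)%N -> vform n G -> vform n H -> (forall v, v i2 = 1 -> G v = H v) -> forall v, G v = H v.
Proof.
move=> n4 vG vH E v; apply: subr0_eq.
have -> : v = pt (v i0) (v i1) (v i2) by apply: veqP.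
apply: (pfun_offz (g := fun x y z => G (pt x y z) - H (pt x y z))) => [|x y z z0].
 by apply: pfunD; [|apply: pfunN]; apply: (@pfun_vform n).
have -> : pt x y z = fun j => z * pt (x/z) (y/z) 1 j.
 by apply: veqP; rewrite /pt /= ?mulr1 // mulrC divfK.
by rewrite !(@vformZ n) // E ?subrr.
Qed.

(** Coprimality is automatic for an irreducible quartic: a nonconstant common factor [g] divides
    [f_2^3 + f_3^2] with a cofactor still divisible by [g], and homogenising both factors splits
    [F]. *)
Lemma dec_coprime c (d : {mpoly C[2]} * {mpoly C[2]}) : c != 0 -> c *: dehom F = d.1^+3 + d.2^+2 -> mcoprime d.1 d.2.
Proof.
move=> c0 E g [h1 H1] [h2 H2]; rewrite leqNgt; apply/negP => sg.
pose k := g*(g*h1^+3 + h2^+2).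
have Ek : c *: dehom F = g*k by rewrite E H1 H2 /k; ring.
have dF0 : dehom F != 0.
 apply/eqP => z; case: irr => /eqP F0 _ _; apply: F0; apply: mpoly_fun0 => v.
 have vF : vform 4 (fun v => ev v) by have [q Eq] := frame_form Fh E0 E1 E2; exists q => w; rewrite -Eq std; congr meval; apply: veqP.
 apply: (affine_ext (H := fun=> 0) (isT : (4 <= 4)%N) vF).
  by exists (fun=> 0) => w; rewrite /tform /cubic_form /quartic_form; ring.
 by move=> w w2; rewrite -dehom_ev // z meval0.
have gk0 : g*k != 0 by rewrite -Ek scaler_eq0 negb_or c0.
have [g0 k0] : g != 0 /\ k != 0 by apply/andP; rewrite -negb_or -mulf_eq0.
have sk : (1 < msize k)%N.
 have r0 : g*h1^+3 + h2^+2 != 0 by move: k0; rewrite mulf_eq0 negb_or => /andP[].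
 rewrite /k msizeM //; have : (0 < msize (g*h1^+3 + h2^+2))%N by rewrite lt0n msize_poly_eq0.
 move: (msize (_ + _)) sg; move: (msize g) => a b; lia.
have sgk : (msize g + msize k <= 6)%N.
 have : (msize (g*k) <= 5)%N by rewrite -Ek (leq_trans (msizeZ_le _ _)) // dehom_size.
 by rewrite msizeM //; move: sg; move: (msize g) (msize k) => [|a] b //; rewrite addSn.
pose a := (msize g).-1; pose b := (msize k).-1.
have [ab a1 b1 a4 b4] : [/\ (a + b <= 4)%N, (0 < a)%N, (0 < b)%N, (a <= 4)%N & (b <= 4)%N].
 by move: sg sk sgk; rewrite /a /b; move: (msize g) (msize k) => x y *; split; lia.
have [sa sb] : (msize g <= a.+1)%N /\ (msize k <= b.+1)%N.
 by move: sg sk sgk; rewrite /a /b; move: (msize g) (msize k) => x y *; split; lia.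
have [G [vG EG]] := homogenize a4 sa; have [K [vK EK]] := homogenize b4 sb.
apply: (irr_frameZ irr stdD c0 (g := fun x y z => G (pt x y z)) (h := fun x y z => K (pt x y z)*z^+(4 - (a + b)))).
- exact: pfun_vform vG.
- by have := pfun_vform vK => pk; pfauto.
- by have [q ->] := vG; exact: tform00.
- by have [q ->] := vK; rewrite tform00 ?mul0r.
move=> x y z; rewrite std; apply: subr0_eq; move: x y z.
apply: (@pfun_offz R).
 have pF : pfun (fun x y z => ev (pt x y z)) by exists F.
 by have := (pfun_vform vK, pfun_vform vG) => -[pk pg]; pfauto.
move=> x y z z0; have -> : pt x y z = fun j => z * pt (x/z) (y/z) 1 j.
 by apply: veqP; rewrite /pt /= ?mulr1 // mulrC divfK.
rewrite evZ // !(@vformZ _ _ _ _ _ vG) // !(@vformZ _ _ _ _ _ vK) //.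
have := congr1 (fun p : {mpoly C[2]} => p.@[af (pt (x/z) (y/z) 1)]) Ek.
rewrite mevalZ mevalM dehom_ev // EG // EK // => e.
have z4 : z^+4 = z^+a*z^+b*z^+(4 - (a + b)).
 by rewrite -!exprD; congr (_^+_); clear -ab; clearbody a b; lia.
rewrite z4 mulrCA e; move: (z^+a) (z^+b) (z^+(4 - (a + b))) (G _) (K _) => A B D g' k'.
by apply/eqP; rewrite subr_eq0; apply/eqP; ring.
Qed.

Lemma mk_dec c n2 n3 (G2 G3 : vec -> C) : c != 0 -> (n2 <= 2)%N -> (n3 <= 3)%N -> vform n2 G2 -> vform n3 G3 ->
 (forall v, v i2 = 1 -> c*ev v = G2 v^+3 + G3 v^+2) ->
 (exists v v', [/\ v i2 = 1, v' i2 = 1 & G2 v != G2 v']) -> (exists v v', [/\ v i2 = 1, v' i2 = 1 & G3 v != G3 v']) ->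
 exists d, [/\ torus_dec (dehom F) d, (msize d.1 <= n2.+1)%N &
  forall v, v i2 = 1 -> d.1.@[af v] = G2 v /\ d.2.@[af v] = G3 v].
Proof.
move=> c0 n22 n33 [k2 E2'] [k3 E3'] E nc2 nc3.
have [f2 s2 h2] := pdeg_tform k2 (leq_trans n22 (isT : (2 <= 4)%N)).
have [f3 s3 h3] := pdeg_tform k3 (leq_trans n33 (isT : (3 <= 4)%N)).
have e2 v : v i2 = 1 -> f2.@[af v] = G2 v by move=> v2; rewrite h2 E2' v2.
have e3 v : v i2 = 1 -> f3.@[af v] = G3 v by move=> v2; rewrite h3 E3' v2.
have EE : c *: dehom F = f2^+3 + f3^+2.
 apply: mpoly_fun_eq => v; rewrite !(meval_eq _ (af_eq v)) mevalZ mevalD !rmorphXn /= dehom_ev // e2 // e3 //.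
 exact: E.
have nc (f : {mpoly C[2]}) (G : vec -> C) : (forall v, v i2 = 1 -> f.@[af v] = G v) ->
  (exists v v', [/\ v i2 = 1, v' i2 = 1 & G v != G v']) -> (1 < msize f)%N.
 move=> H [v [v' [v2 v2' /eqP n]]]; rewrite ltnNge; apply/negP => /msize1_polyC e.
 by apply: n; rewrite -!H // e !mevalC.
exists (f2, f3); split => //=; last by move=> v v2; rewrite e2 // e3.
split => /=; first exact: (@dec_coprime c (f2, f3) c0 EE).
- by rewrite (nc f2 G2) //= (leq_trans s2).
- by rewrite (nc f3 G3) //= (leq_trans s3).
by exists c.
Qed.

(** The condition on [u] says that [l] is not a multiple of [Z], which makes [f_2] nonconstant. *)
Definition vis c (l C' : vec -> C) := [/\ c != 0, vform 1 l, vform 2 C', (exists2 u, u i2 = 0 & l u != 0) &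
 forall v, c*ev v = C' v^+2 + v i2 * l v^+3].

Lemma dec_forms d : torus_dec (dehom F) d -> exists c G2 G3, [/\ c != 0, vform 2 G2, vform 3 G3,
 forall v, c*v i2^+2*ev v = G2 v^+3 + G3 v^+2 & forall v, v i2 = 1 -> d.1.@[af v] = G2 v /\ d.2.@[af v] = G3 v].
Proof.
move=> [_ /andP[_ s2] /andP[_ s3] [c c0 E]].
have [G2 [v2 e2]] := homogenize (isT : (2 <= 4)%N) s2; have [G3 [v3 e3]] := homogenize (isT : (3 <= 4)%N) s3.
exists c, G2, G3; split => //; last by move=> v vz; rewrite e2 // e3.
move=> v; apply: subr0_eq.
have -> : v = pt (v i0) (v i1) (v i2) by apply: veqP.
pose H x y z := c*z^+2*ev (pt x y z) - (G2 (pt x y z)^+3 + G3 (pt x y z)^+2).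
have pH : pfun H.
 have pF : pfun (fun x y z => ev (pt x y z)) by exists F.
 by have := (pfun_vform v2, pfun_vform v3) => -[p2 p3]; rewrite /H; pfauto.
apply: (pfun_offz pH) => x y z z0; rewrite /H.
have -> : pt x y z = fun j => z * pt (x/z) (y/z) 1 j.
 by apply: veqP; rewrite /pt /= ?mulr1 // mulrC divfK.
rewrite evZ // (vformZ _ _ (isT : (2 <= 4)%N) v2) (vformZ _ _ (isT : (3 <= 4)%N) v3).
have := congr1 (fun p : {mpoly C[2]} => p.@[af (pt (x/z) (y/z) 1)]) E.
rewrite mevalZ mevalD !rmorphXn /= dehom_ev // e2 // e3 // => e.
have -> : c*z^+2*(z^+4*ev (pt (x/z) (y/z) 1)) = z^+6*(c*ev (pt (x/z) (y/z) 1)) by ring.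
by rewrite e; ring.
Qed.

(** If [Z] divides [G2], then [G3^2] vanishes on [Z = 0], so [Z] divides [G3] too, and the identity
    can be divided by [Z^2]. *)
Lemma visible_forms d c G2 G3 : torus_dec (dehom F) d -> c != 0 -> vform 2 G2 -> vform 3 G3 ->
 (forall v, c*v i2^+2*ev v = G2 v^+3 + G3 v^+2) -> (forall v, v i2 = 1 -> d.1.@[af v] = G2 v /\ d.2.@[af v] = G3 v) ->
 (forall v, v i2 = 0 -> G2 v = 0) ->
 exists l C', vis c l C' /\ forall v, v i2 = 1 -> d.1.@[af v] = l v /\ d.2.@[af v] = C' v.
Proof.
move=> [_ /andP[s2 _] _ _] c0 [k2 E2'] [k3 E3'] E De G20.
have [a3 a4 a5] : [/\ k2 3%N = 0, k2 4%N = 0 & k2 5%N = 0].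
 have [|_ _ a b c'] := @quartic0 R 0 0 (k2 3%N) (k2 4%N) (k2 5%N); last by [].
 move=> x y; transitivity (y^+2*G2 (pt x y 0)); last by rewrite G20 ?mulr0.
 by rewrite E2' /pt /= /quartic_form; ring.
have [b6 b7 b8 b9] : [/\ k3 6%N = 0, k3 7%N = 0, k3 8%N = 0 & k3 9%N = 0].
 apply: cubic0 => x y; apply/eqP; rewrite -sqrf_eq0; apply/eqP.
 have := E (pt x y 0); rewrite (G20 (pt x y 0) erefl) E3' [pt x y 0 i2]/= [pt x y 0 i0]/= [pt x y 0 i1]/= => e.
 transitivity (c*0^+2*ev (pt x y 0)); last by ring.
 by rewrite e /tform; ring.
pose l v := tform 1 k2 (v i0) (v i1) (v i2); pose C' v := tform 2 k3 (v i0) (v i1) (v i2).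
have Gl v : G2 v = v i2 * l v by rewrite E2' /l /tform a3 a4 a5; ring.
have GC v : G3 v = v i2*C' v by rewrite E3' /C' /tform /cubic_form b6 b7 b8 b9; ring.
have dl v : v i2 = 1 -> d.1.@[af v] = l v /\ d.2.@[af v] = C' v.
 by move=> v2; have [-> ->] := De v v2; rewrite Gl GC v2 !mul1r.
exists l, C'; split=> //; split => //; [by exists k2|by exists k3| |].
 case: (pselect (exists2 u, u i2 = 0 & l u != 0)) => // nex.
 have lz u : u i2 = 0 -> l u = 0 by move=> u2; apply/eqP/negPn/negP => h; apply: nex; exists u.
 have lc v : v i2 = 1 -> l v = k2 0%N.
  move=> v2; transitivity (k2 0%N + l (pt (v i0) (v i1) 0)); last by rewrite lz // addr0.
  by rewrite /l /tform v2 /pt /=; ring.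
 move: s2; suff -> : d.1 = (k2 0%N)%:MP by rewrite msizeC; case: eqP.
 by apply: mpoly_fun_eq => v; rewrite (meval_eq _ (af_eq v)) (dl _ _).1 // lc // mevalC.
move=> v; apply: subr0_eq.
have -> : v = pt (v i0) (v i1) (v i2) by apply: veqP.
pose H x y z := c*ev (pt x y z) - (C' (pt x y z)^+2 + z * l (pt x y z)^+3).
have pH : pfun H.
 have pF : pfun (fun x y z => ev (pt x y z)) by exists F.
 have pl : pfun (fun x y z => l (pt x y z)) by apply: (@pfun_vform 1); exists k2.
 have pC : pfun (fun x y z => C' (pt x y z)) by apply: (@pfun_vform 2); exists k3.
 by rewrite /H; pfauto.
apply: (pfun_offz pH) => x y z z0; apply: (mulfI (expf_neq0 2 z0)); rewrite mulr0 /H.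
have := E (pt x y z); rewrite Gl GC [pt x y z i2]/= => e.
have -> : z^+2*(c*ev (pt x y z) - (C' (pt x y z)^+2 + z * l (pt x y z)^+3)) =
 c*z^+2*ev (pt x y z) - ((z * l (pt x y z))^+3 + (z*C' (pt x y z))^+2) by ring.
by rewrite e subrr.
Qed.

End Curve.
End Decs.

(** * The quartic along the line at infinity *)

Section Geometry.
Variable R : realType.
Local Notation C := (R[i]).
Local Notation P := (C*C)%type.
Local Notation vec := ('I_3 -> C).
Implicit Types (u v w e : vec).

Lemma cmb_cmb e0 e1 e2 a0 a1 a2 b0 b1 b2 c0 c1 c2 x y z :
 cmb (cmb e0 e1 e2 a0 a1 a2) (cmb e0 e1 e2 b0 b1 b2) (cmb e0 e1 e2 c0 c1 c2) x y z =
 cmb e0 e1 e2 (x*a0 + y*b0 + z*c0) (x*a1 + y*b1 + z*c1) (x*a2 + y*b2 + z*c2).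
Proof. by cmbring. Qed.
Lemma det3_cmb e0 e1 e2 a0 a1 a2 b0 b1 b2 c0 c1 c2 :
 det3 (cmb e0 e1 e2 a0 a1 a2) (cmb e0 e1 e2 b0 b1 b2) (cmb e0 e1 e2 c0 c1 c2) =
 (a0*(b1*c2 - b2*c1) - a1*(b0*c2 - b2*c0) + a2*(b0*c1 - b1*c0))*det3 e0 e1 e2.
Proof. by rewrite /det3 /cmb; ring. Qed.

(** Projective frames adapted to the line at infinity, which is spanned by [e0] and [e1]. *)
Definition afr e0 e1 e2 := [/\ e0 i2 = 0, e1 i2 = 0, e2 i2 = 1 & det3 e0 e1 e2 != 0].

Lemma afr_change e0 e1 e2 a0 a1 b0 b1 c0 c1 : afr e0 e1 e2 -> a0*b1 - a1*b0 != 0 ->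
 afr (cmb e0 e1 e2 a0 a1 0) (cmb e0 e1 e2 b0 b1 0) (cmb e0 e1 e2 c0 c1 1).
Proof.
move=> [h0 h1 h2 D] d; split; rewrite ?det3_cmb /cmb ?h0 ?h1 ?h2; try ring.
by rewrite mulf_neq0 // (_ : _ + _ = a0*b1 - a1*b0) //; ring.
Qed.

Lemma afr_perm e0 e1 e2 : afr e0 e1 e2 -> det3 e2 e0 e1 != 0 /\ det3 e0 e1 e2 != 0 /\ det3 e1 e2 e0 != 0.
Proof.
move=> [_ _ _ D]; split; [|split => //].
 by rewrite (_ : det3 _ _ _ = det3 e0 e1 e2) // /det3; ring.
by rewrite (_ : det3 _ _ _ = det3 e0 e1 e2) // /det3; ring.
Qed.

Lemma afr_span e0 e1 e2 v z : afr e0 e1 e2 -> v i2 = z -> exists x y, v = cmb e0 e1 e2 x y z.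
Proof.
move=> [h0 h1 h2 D] <-; have E := cramer v D; do 2 eexists; rewrite {1}E; congr cmb.
by apply: (mulIf D); rewrite divfK // /det3 h0 h1 h2; ring.
Qed.

Lemma Linf_pair u w : u i2 = 0 -> w i2 = 0 -> nonzero u -> nonzero w -> ~ proj_eq u w -> u i0*w i1 - u i1*w i0 != 0.
Proof.
move=> u2 w2 nu nw np; apply/eqP => d.
have nz v : v i2 = 0 -> nonzero v -> v i0 != 0 \/ v i1 != 0.
 by move=> v2 [j]; elim/ord3: j => [|| /negP[]]; [left|right|rewrite v2].
apply: np; have [w0|w0] := nz w w2 nw.
 have u0 : u i0 != 0.
  have [//|u1] := nz u u2 nu; apply: contraTneq isT => z; move/eqP: d.
  by rewrite z mul0r sub0r oppr_eq0 mulf_eq0 (negbTE u1) (negbTE w0).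
 exists (u i0/w i0); first by rewrite mulf_neq0 // invr_eq0.
 apply: ord3; rewrite ?u2 ?w2 ?mulr0 ?divfK //.
 by apply: (mulIf w0); rewrite mulrAC divfK // ; apply/esym/eqP; rewrite -subr_eq0 d.
have u1 : u i1 != 0.
 have [u0|//] := nz u u2 nu; apply: contraTneq isT => z; move/eqP: d.
 by rewrite z mul0r subr0 mulf_eq0 (negbTE u0) (negbTE w0).
exists (u i1/w i1); first by rewrite mulf_neq0 // invr_eq0.
apply: ord3; rewrite ?u2 ?w2 ?mulr0 ?divfK //.
by apply: (mulIf w0); rewrite mulrAC divfK //; apply/eqP; rewrite -subr_eq0 d.
Qed.

Lemma afr_Linf u w e : u i2 = 0 -> w i2 = 0 -> e i2 = 1 -> u i0*w i1 - u i1*w i0 != 0 -> afr u w e.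
Proof.
move=> u2 w2 e2 d; split => //; rewrite (_ : det3 _ _ _ = u i0*w i1 - u i1*w i0) //.
by rewrite /det3 u2 w2 e2; ring.
Qed.

Lemma csqrt (a : C) : exists s, s^+2 = a.
Proof. by exists (sqrtC a); rewrite sqrtCK. Qed.

Section Curve.
Variable F : {mpoly C[3]}.
Hypothesis irr : irreducible_quartic F.
Local Notation ev v := (F.@[v]).
Let Fh : F \is 4.-homog. Proof. by case: irr. Qed.
Let E2 := pt 0 0 (1 : C).

Definition Dv v w := \sum_j w j*F^`M(j).@[v].
Lemma Dv_lin v u w a b t : (forall j, t j = a*u j + b*w j) -> Dv v t = a*Dv v u + b*Dv v w.
Proof.
move=> E; rewrite /Dv !mulr_sumr -big_split; apply: eq_bigr => j _.
by rewrite E mulrDl !mulrA.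
Qed.
Lemma Dv_self v : ev v = 0 -> Dv v v = 0.
Proof.
move=> z; rewrite /Dv -(tlineP F v v).2 (_ : tline F v v = 0) ?coef0 //.
apply: polyfun0 => t; rewrite (tlineP F v v).1.
have -> : (fun j => v j + t*v j) = (fun j => (1 + t)*v j) by apply/funext => j; ring.
by rewrite evZ // z mulr0.
Qed.

Lemma line_coefs u w e k : (forall x y, ev (cmb u w e x y 0) = qua k x y) ->
 tline F u w = Poly [:: k 10%N; k 11%N; k 12%N; k 13%N; k 14%N].
Proof.
move=> E; apply/subr0_eq/polyfun0 => t; rewrite hornerD hornerN (tlineP F u w).1 horner_Poly /=.
have -> : (fun j => u j + t*w j) = cmb u w e 1 t 0 by cmbring.
by rewrite E /quartic_form; ring.
Qed.

Lemma frame_line u w : exists k : nat -> C, forall e x y,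
 ev (cmb u w e x y 0) = qua k x y.
Proof.
have [k E] := frame_form Fh u w E2; exists k => e x y.
have -> : cmb u w e x y 0 = cmb u w E2 x y 0 by cmbring.
by rewrite E /tform; ring.
Qed.

Lemma not_Linf : ~ forall v, v i2 = 0 -> ev v = 0.
Proof.
move=> H; have fr : afr (pt 1 0 0) (pt 0 1 0) E2.
 by apply: afr_Linf => //; rewrite /pt /= mulr1 mulr0 subr0 oner_neq0.
have [k E] := frame_form Fh (pt 1 0 0) (pt 0 1 0) E2; have [_ [D _]] := afr_perm fr.
apply: (irr_frame irr D (g := fun x y z => z) (h := tform 3 k)).
- exact: pfun_z.
- exact: pfun_tform.
- by [].
- exact: tform00.
move=> x y z; rewrite E; have : tform 4 k x y 0 = 0 by rewrite -E; apply: H; rewrite /cmb /pt /=; ring.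
by rewrite /tform /= mul0r add0r => ->; rewrite addr0.
Qed.

Lemma mup00 : mup 0 (0 : {poly C}) = 0%N.
Proof. by rewrite /mup; case: arg_maxnP => [|[i hi] _ _]; [rewrite dvdp0|move: (hi); rewrite /= size_poly0 ltnS leqn0 => /eqP]. Qed.

Lemma imult2 v : (2 <= imult_Linf F v)%N -> ev v = 0 /\ Dv v (other_Linf v) = 0.
Proof.
rewrite /imult_Linf -/(tline F v (other_Linf v)) => m.
set p := tline F v (other_Linf v) in m.
have p0 : p != 0.
 by apply: contraTneq m => ->; rewrite mup00.
have := mup_geq 0 2 p0; rewrite m subr0 => /esym/dvdpP[r Er].
split.
 have := (tlineP F v (other_Linf v)).1 0; rewrite -/p Er hornerM hornerXn expr0n mulr0 => h.
 by rewrite h; apply: meval_eq => j; rewrite mul0r addr0.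
by rewrite /Dv -(tlineP F v (other_Linf v)).2 -/p Er coefMXn.
Qed.

Lemma imult4 v : imult_Linf F v = 4%N -> exists r, tline F v (other_Linf v) = r * 'X^4.
Proof.
rewrite /imult_Linf -/(tline F v (other_Linf v)) => m; set p := tline F v (other_Linf v) in m *.
have p0 : p != 0.
 by apply/eqP => z; move: m; rewrite z mup00.
by have := mup_geq 0 4 p0; rewrite m leqnn subr0 => /esym/dvdpP.
Qed.

Lemma other_Linf_pair v : v i2 = 0 -> nonzero v ->
 other_Linf v i2 = 0 /\ v i0*other_Linf v i1 - v i1*other_Linf v i0 != 0.
Proof.
move=> v2 nv; rewrite /other_Linf; case: eqP => [v0|/eqP v0] /=; split=> //.
 rewrite v0 mul0r sub0r oppr_eq0 mulr1; case: nv => j; elim/ord3: j => //; first by rewrite v0 eqxx.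
 by rewrite v2 eqxx.
by rewrite mulr1 mulr0 subr0.
Qed.

Lemma aff_pair P0 P1 : P0 i2 = 1 -> P1 i2 = 1 -> P0 <> P1 -> let e0 : vec := fun j => P1 j - P0 j in
 exists e1, afr e0 e1 P0 /\ afr e0 e1 P1.
Proof.
move=> z0 z1 n01 e0; have e02 : e0 i2 = 0 by rewrite /e0 z0 z1 subrr.
have ne0 : nonzero e0.
 case: (pselect (nonzero e0)) => // n; case: n01; apply/funext => j; apply/esym/subr0_eq/eqP.
 by apply/negPn/negP => h; apply: n; exists j.
by have [o2 od] := other_Linf_pair e02 ne0; exists (other_Linf e0); split; apply: afr_Linf.
Qed.

(** A double zero at both ends leaves only the coefficient of [x^2 y^2], nonzero because the line is
    not a component. *)
Lemma pos_two (u w : vec) : QLpt F u -> QLpt F w -> ~ proj_eq u w -> ev u = 0 -> ev w = 0 ->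
 (forall t, t i2 = 0 -> Dv u t = 0) -> (forall t, t i2 = 0 -> Dv w t = 0) ->
 u i0*w i1 - u i1*w i0 != 0 /\ exists2 q, q != 0 & forall e x y, ev (cmb u w e x y 0) = (q*x*y)^+2.
Proof.
move=> [nu [u2 _]] [nw [w2 _]] np zu zw du dw; have d := Linf_pair u2 w2 nu nw np; split=> //.
have [k E] := frame_line u w.
have [k10 k11] : k 10%N = 0 /\ k 11%N = 0.
 have tl := line_coefs (E E2); split; [have := (tlineP F u w).1 0|have := (tlineP F u w).2]; rewrite tl.
  by rewrite horner_coef0 coef_Poly /= => ->; rewrite -[RHS]zu; apply: meval_eq => j; rewrite mul0r addr0.
 by rewrite coef_Poly /= -/(Dv u w) du.
have [k14 k13] : k 14%N = 0 /\ k 13%N = 0.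
 have E' x y : ev (cmb w u E2 x y 0) = quartic_form (k 14%N) (k 13%N) (k 12%N) (k 11%N) (k 10%N) x y.
  have -> : cmb w u E2 x y 0 = cmb u w E2 y x 0 by cmbring.
  by rewrite E /quartic_form; ring.
 have tl := @line_coefs w u E2 (fun i => k (24 - i)%N) E'.
 split; [have := (tlineP F w u).1 0|have := (tlineP F w u).2]; rewrite tl.
  by rewrite horner_coef0 coef_Poly /= => ->; rewrite -[RHS]zw; apply: meval_eq => j; rewrite mul0r addr0.
 by rewrite coef_Poly /= -/(Dv w u) dw.
have [q q2] := csqrt (k 12%N); exists q; last first.
 by move=> e x y; rewrite E k10 k11 k13 k14 -q2 /quartic_form; ring.
apply/eqP => q0; apply: not_Linf => v v2.
have fr : afr u w E2 by exact: afr_Linf.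
have [_ [D _]] := afr_perm fr; rewrite (cramer v D).
have -> : det3 u w v = 0 by rewrite /det3 u2 w2 v2; ring.
by rewrite mul0r E k10 k11 k13 k14 -q2 q0 /quartic_form; ring.
Qed.

Lemma Dv_imult v : v i2 = 0 -> nonzero v -> (2 <= imult_Linf F v)%N -> ev v = 0 /\ forall t, t i2 = 0 -> Dv v t = 0.
Proof.
move=> v2 nv m; have [z D] := imult2 m; split=> // t t2; have [o2 d] := other_Linf_pair v2 nv.
set o := other_Linf v in D d o2; set dd := v i0*o i1 - v i1*o i0 in d.
rewrite (@Dv_lin v v o ((t i0*o i1 - t i1*o i0)/dd) ((v i0*t i1 - v i1*t i0)/dd)) ?D ?Dv_self ?mulr0 ?addr0 //.
by apply: ord3; rewrite ?v2 ?o2 ?t2; [| |by rewrite !mulr0 addr0]; move: d; rewrite /dd => d; field.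
Qed.

Lemma Dv_sing v t : singular_pt F v -> Dv v t = 0.
Proof. by move=> [_ [_ h]]; rewrite /Dv big1 // => j _; rewrite h mulr0. Qed.

Definition two_pts (u w : vec) := [/\ u i2 = 0, w i2 = 0, u i0*w i1 - u i1*w i0 != 0 &
 exists2 q, q != 0 & forall e x y, ev (cmb u w e x y 0) = (q*x*y)^+2].
Definition one_pt (u w : vec) := [/\ u i2 = 0, w i2 = 0, u i0*w i1 - u i1*w i0 != 0 &
 exists2 q, q != 0 & forall e x y, ev (cmb u w e x y 0) = (q*y^+2)^+2].

Lemma pos_i_two : pos_i F -> exists u w, two_pts u w.
Proof.
move=> [p [q [hp hq np _ [_ _ mp mq]]]]; have [nu [u2 _]] := hp; have [nw [w2 _]] := hq.
have [zu du] := Dv_imult u2 nu mp; have [zw dw] := Dv_imult w2 nw mq.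
by have [d ex] := pos_two hp hq np zu zw du dw; exists p, q.
Qed.

Lemma pos_ii_two : pos_ii F -> exists u w, two_pts u w /\ singular_pt F u.
Proof.
move=> [q [p [hq hp np _ [_ mq sp]]]]; have [nu [u2 zu]] := hp; have [nw [w2 _]] := hq.
have [zw dw] := Dv_imult w2 nw mq.
have np' : ~ proj_eq p q.
 move=> [l l0 e]; apply: np; exists l^-1; first by rewrite invr_eq0.
 by move=> j; rewrite e mulKf.
by have [d ex] := pos_two hp hq np' zu zw (fun t _ => Dv_sing t sp) dw; exists p, q.
Qed.

Lemma pos_one v : QLpt F v -> imult_Linf F v = 4%N -> exists w, one_pt v w.
Proof.
move=> [nv [v2 _]] /imult4[r Er]; have [o2 d] := other_Linf_pair v2 nv; set o := other_Linf v in d o2 Er.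
exists o; split=> //; have [k E] := frame_line v o; have tl := line_coefs (E E2); rewrite Er in tl.
have co i : (i < 4)%N -> (Poly [:: k 10%N; k 11%N; k 12%N; k 13%N; k 14%N])`_i = 0 by move=> i4; rewrite -tl coefMXn i4.
have k10 : k 10%N = 0 by have := co 0%N isT; rewrite coef_Poly.
have k11 : k 11%N = 0 by have := co 1%N isT; rewrite coef_Poly.
have k12 : k 12%N = 0 by have := co 2%N isT; rewrite coef_Poly.
have k13 : k 13%N = 0 by have := co 3%N isT; rewrite coef_Poly.
have [q q2] := csqrt (k 14%N); exists q; last first.
 by move=> e x y; rewrite E k10 k11 k12 k13 -q2 /quartic_form; ring.
apply/eqP => q0; apply: not_Linf => t t2.
have fr : afr v o E2 by exact: afr_Linf.
have [_ [D _]] := afr_perm fr; rewrite (cramer t D).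
have -> : det3 v o t = 0 by rewrite /det3 v2 o2 t2; ring.
by rewrite mul0r E k10 k11 k12 k13 -q2 q0 /quartic_form; ring.
Qed.

(** The quartic restricts to the line at infinity as the square of a quadratic form. *)
Definition LS := forall u w, u i2 = 0 -> w i2 = 0 -> exists a b c, forall e x y,
 ev (cmb u w e x y 0) = (a*x^+2 + b*x*y + c*y^+2)^+2.

Lemma LS_gen u w a b c : u i2 = 0 -> w i2 = 0 -> u i0*w i1 - u i1*w i0 != 0 ->
 (forall e x y, ev (cmb u w e x y 0) = (a*x^+2 + b*x*y + c*y^+2)^+2) -> LS.
Proof.
move=> u2 w2 d E u' w' u2' w2'; have fr : afr u w E2 by exact: afr_Linf.
have [p [q eu]] := afr_span fr u2'; have [p' [q' ew]] := afr_span fr w2'.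
exists (a * p^+2 + b * p*q + c*q^+2), (2*a * p * p' + b*(p*q' + p'*q) + 2*c*q*q'),
 (a * p'^+2 + b * p'*q' + c*q'^+2) => e x y.
have -> : cmb u' w' e x y 0 = cmb u w E2 (x * p + y * p') (x*q + y*q') 0.
 by rewrite eu ew; cmbring.
by rewrite E; congr (_^+_); ring.
Qed.

Lemma two_pts_LS u w : two_pts u w -> LS.
Proof. by move=> [u2 w2 d [q _ E]]; apply: (@LS_gen u w 0 q 0) => // e x y; rewrite E; congr (_^+_); ring. Qed.
Lemma one_pt_LS u w : one_pt u w -> LS.
Proof. by move=> [u2 w2 d [q _ E]]; apply: (@LS_gen u w 0 0 q) => // e x y; rewrite E; congr (_^+_); ring. Qed.

(** A quartic in two of the three coordinates is a cone, and a root of the binary form splits off a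
    line. *)
Lemma binary_reducible e0 e1 e2 a b c d f : det3 e0 e1 e2 != 0 ->
 (forall x y z, ev (cmb e0 e1 e2 x y z) = quartic_form a b c d f x z) -> False.
Proof.
move=> D E; have [a0|a0] := eqVneq a 0.
 apply: (irr_frame irr D (g := fun x y z => z) (h := fun x y z => cubic_form b c d f x z)).
 - exact: pfun_z.
 - by rewrite /cubic_form; pfauto.
 - by [].
 - by rewrite /cubic_form; ring.
 by move=> x y z; rewrite E a0 /quartic_form /cubic_form; ring.
have [r hr] := @solve_monicpoly C 4 (nth 0 [:: - f/a; - d/a; - c/a; - b/a]) isT.
move: hr; rewrite !big_ord_recl big_ord0 /= /bump /= => hr.
have fE : f = - (a*r^+4 + b*r^+3 + c*r^+2 + d*r) by rewrite hr; field.
apply: (irr_frame irr D (g := fun x y z => x - r*z) (h := fun x y z => cubic_form a (b + a*r) (c + b*r + a*r^+2) (d + c*r + b*r^+2 + a*r^+3) x z)).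
- by pfauto.
- by rewrite /cubic_form; pfauto.
- by ring.
- by rewrite /cubic_form; ring.
by move=> x y z; rewrite E fE /quartic_form /cubic_form; ring.
Qed.

(** The germ at [v] is [x^2 + y^k], type [A_(k-1)]. One frame suffices because [germ_at] compares
    types in any frame. *)
Definition Apt k v := exists u1 u2, det3 v u1 u2 != 0 /\
 top_equiv_germ (fun q => ev (cmb v u1 u2 1 q.1 q.2) = 0) (0, 0) (fun q : P => nf k q = 0) (0, 0).

(** The type [E_6] is excluded for odd [k] by the quartic cover and for even [k] by counting
    branches; hence the bound on [k]. *)
Lemma Apt_type k v v' s (l : C) : (1 < k < 7)%N -> Apt k v -> has_type F v' s -> l != 0 -> (forall j, v j = l*v' j) -> s = A k.-1.
Proof.
move=> /andP[k1 k7] [u1 [u2 [D te]]] ht l0 hv; have te' := germ_at Fh ht l0 hv D.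
have te2 := top_equiv_trans (top_equiv_sym te) te'.
case: s ht te' te2 => [n|] ht te' te2.
 by have /= -> := @nf_equiv_eq R k n.+1 (ltnW k1) isT te2.
case: k k1 k7 te te2 => [|[|[|[|[|[|[|]]]]]]] // _ _ _ te2.
- by case: (@nfE_not_even R 1 isT te2).
- by case: (@nfE_not_nf R 3 isT te2).
- by case: (@nfE_not_even R 2 isT te2).
- by case: (@nfE_not_nf R 5 isT te2).
- by case: (@nfE_not_even R 3 isT te2).
Qed.

End Curve.
End Geometry.

(** * Local types read off coefficients, and the normal form of a visible decomposition *)

Section Local.
Variable R : realType.
Local Notation C := (R[i]).
Local Notation P := (C*C)%type.
Local Notation vec := ('I_3 -> C).
Implicit Types (u v w e : vec).

Lemma sdiff_lin0 (f g1 g2 : P -> C) al be : sd g1 -> sd g2 -> g1 (0, 0) = 0 -> g2 (0, 0) = 0 ->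
 (forall q, f q = al*q.1 + be*q.2 + q.1*g1 q + q.2*g2 q) -> sdiff f al be.
Proof.
move=> s1 s2 z1 z2 E.
have h1 := sdiff_prod0 (sd_fst R) s1 (erefl _) z1; have h2 := sdiff_prod0 (sd_snd R) s2 (erefl _) z2.
have := sdiffD (sdiffD (sdiffD (sdiffM (sdiff_cst al) (@sdiff_fst R)) (sdiffM (sdiff_cst be) (@sdiff_snd R))) h1) h2.
rewrite !(mulr0, mulr1, addr0, add0r) => H e e0; have [d d0 hd] := H e e0.
by exists d => // q q' b b'; rewrite !E; exact: hd.
Qed.

Section Curve.
Variable F : {mpoly C[3]}.
Hypothesis irr : irreducible_quartic F.
Local Notation ev v := (F.@[v]).

Lemma Apt_local v u1 u2 c0 (X Y a b c u : P -> C) x1 x2 y1 y2 j k : det3 v u1 u2 != 0 -> c0 != 0 ->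
 (0 < k)%N -> (k <= j.*2)%N ->
 sdiff X x1 x2 -> sdiff Y y1 y2 -> x1*y2 - x2*y1 != 0 -> X (0, 0) = 0 -> Y (0, 0) = 0 ->
 sd a -> sd b -> sd c -> sd u -> b (0, 0) != 0 -> u (0, 0) != 0 ->
 (forall q, u q*(c0*ev (cmb v u1 u2 1 q.1 q.2)) = b q*Y q^+2 + X q^+j*a q*Y q + X q^+k*c q) ->
 (if k == j.*2 then a (0, 0)^+2 - 4*b (0, 0)*c (0, 0) != 0 else c (0, 0) != 0) -> Apt F k v.
Proof.
move=> D c00 k0 kj sX sY xy X0 Y0 sa sb sc su b0 u0 E cd; exists u1, u2; split => //.
have := local_A k0 kj sX sY xy X0 Y0 sa sb sc su b0 u0 E cd; apply: top_equiv_ext => q.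
by split=> [/eqP|->]; rewrite ?mulr0 // mulf_eq0 (negbTE c00) => /eqP.
Qed.

Lemma cusp_vis v u1 u2 c0 (T : P -> C) t1 t2 (g1 g2 w : P -> C) : det3 v u1 u2 != 0 -> c0 != 0 ->
 sd g1 -> sd g2 -> g1 (0, 0) = 0 -> g2 (0, 0) = 0 -> sd w -> w (0, 0) != 0 ->
 (forall q, T q = t1*q.1 + t2*q.2 + q.1*g1 q + q.2*g2 q) -> t1 != 0 ->
 (forall q, c0*ev (cmb v u1 u2 1 q.1 q.2) = T q^+2 + q.2^+3*w q) -> Apt F 3 v.
Proof.
move=> D c00 s1 s2 z1 z2 sw w0 ET t10 E.
have sT := sdiff_lin0 s1 s2 z1 z2 ET.
have T0 : T (0, 0) = 0 by rewrite ET [(_, _).1]/= [(_, _).2]/= z1 z2; ring.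
apply: (Apt_local (j := 2) (k := 3) D c00 isT isT (@sdiff_snd R) sT _ (erefl _) T0 (sd_cst 0) (sd_cst 1) sw (sd_cst 1)).
- by rewrite mul0r mul1r sub0r oppr_eq0.
- exact: oner_neq0.
- exact: oner_neq0.
- by move=> q; rewrite E; ring.
- exact: w0.
Qed.

(** The criterion [local_A] needs a square with unit coefficient. If both squares are missing from
    the quadratic part, the shear [x - y] produces one. *)
Lemma node_local v u1 u2 (al be ga : C) (A B G : P -> C) : det3 v u1 u2 != 0 ->
 sd A -> sd B -> sd G -> A (0, 0) = 0 -> B (0, 0) = 0 -> G (0, 0) = 0 ->
 (forall q, ev (cmb v u1 u2 1 q.1 q.2) = q.1^+2*(al + A q) + q.1*q.2*(be + B q) + q.2^+2*(ga + G q)) ->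
 be^+2 - 4*al*ga != 0 -> Apt F 2 v.
Proof.
move=> D sA sB sG A0 B0 G0 E dd.
have D1 : (1 : C)*1 - 0*0 != 0 by rewrite mulr1 mulr0 subr0 oner_neq0.
have D2 : (0 : C)*0 - 1*1 != 0 by rewrite mulr1 mulr0 sub0r oppr_eq0 oner_neq0.
have [g0|g0] := eqVneq ga 0; last first.
 apply: (Apt_local (j := 1) (k := 2) (a := fun q => be + B q) (b := fun q => ga + G q) (c := fun q => al + A q) D (oner_neq0 _) isT isT
  (@sdiff_fst R) (@sdiff_snd R) D1 (erefl _) (erefl _) _ _ _ (sd_cst 1) _ (oner_neq0 _)); try by sdauto.
 - by rewrite G0 addr0.
 - by move=> q; rewrite E; ring.
 - by rewrite eqxx A0 B0 G0 !addr0 (_ : 4*ga*al = 4*al*ga) //; ring.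
have [a0|a0] := eqVneq al 0; last first.
 apply: (Apt_local (j := 1) (k := 2) (a := fun q => be + B q) (b := fun q => al + A q) (c := fun q => ga + G q) D (oner_neq0 _) isT isT
  (@sdiff_snd R) (@sdiff_fst R) D2 (erefl _) (erefl _) _ _ _ (sd_cst 1) _ (oner_neq0 _)); try by sdauto.
 - by rewrite A0 addr0.
 - by move=> q; rewrite E; ring.
 - by rewrite eqxx A0 B0 G0 !addr0.
have b0 : be != 0 by apply: contraNneq dd => ->; rewrite a0; apply/eqP; ring.
have sX : sdiff (fun q : P => q.1 - q.2) 1 (-1).
 apply: (@sdiff_lin0 _ (fun=> 0) (fun=> 0)); try exact: sd_cst; rewrite // => q; ring.
apply: (Apt_local (X := fun q => q.1 - q.2) (j := 1) (k := 2) (a := fun q => be + (A q + A q + B q)) (b := fun q => be + (A q + B q + G q)) (c := A) D (oner_neq0 _) isT isT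
  sX (@sdiff_snd R) _ _ (erefl _) _ _ _ (sd_cst 1) _ (oner_neq0 _)); try by sdauto.
- by rewrite mulr1 mulr0 subr0 oner_neq0.
- by rewrite subrr.
- by rewrite A0 B0 G0 !addr0.
- by move=> q; rewrite E a0 g0; ring.
- by rewrite eqxx A0 B0 G0 !addr0 mulr0 subr0 expf_neq0.
Qed.

Lemma cmb_e2 e0 e1 e2 x y : cmb e2 e0 e1 1 x y = cmb e0 e1 e2 x y 1.
Proof. by cmbring. Qed.

(** Coefficients of a quartic form after the cyclic permutation of its variables. *)
Definition rotf (k : nat -> C) := nth 0 [:: k 10; k 11; k 6; k 12; k 7; k 3; k 13; k 8; k 4; k 1; k 14; k 9; k 5; k 2; k 0]%N.

Lemma rotE e0 e1 e2 k : fform F e0 e1 e2 k ->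
 fform F e1 e2 e0 (rotf k).
Proof.
move=> E x y z; have -> : cmb e1 e2 e0 x y z = cmb e0 e1 e2 z x y by cmbring.
by rewrite E /rotf /tform /cubic_form /quartic_form /=; ring.
Qed.

(** The form in which singularities other than nodes are used: the quadratic part at the point has
    zero discriminant. *)
Lemma vertex e0 e1 e2 k : det3 e0 e1 e2 != 0 -> fform F e0 e1 e2 k ->
 singular_pt F e2 -> ~ Apt F 2 e2 -> [/\ k 0%N = 0, k 1%N = 0, k 2%N = 0 & k 4%N^+2 = 4*k 3%N*k 5%N].
Proof.
move=> D E s2 n2; have [k0 k1 k2] := (singular_frame D E).1 s2; split=> //; apply/eqP; rewrite -subr_eq0.
apply/negPn/negP => h; apply: n2; have {}D : det3 e2 e0 e1 != 0 by rewrite (_ : det3 e2 e0 e1 = det3 e0 e1 e2) // /det3; ring.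
apply: (node_local (A := fun q => k 6%N * q.1 + k 7%N * q.2 + k 10%N * q.1^+2 + k 11%N * q.1 * q.2 + k 12%N * q.2^+2)
 (B := fun q => 0) (G := fun q => k 8%N * q.1 + k 9%N * q.2 + k 13%N * q.1 * q.2 + k 14%N * q.2^+2) D _ _ _ _ _ _ _ h); try by sdauto.
- by pring.
- by pring.
by move=> q; rewrite cmb_e2 E /tform /cubic_form /quartic_form k0 k1 k2; ring.
Qed.

Lemma vertex0 e0 e1 e2 k : afr e0 e1 e2 -> fform F e0 e1 e2 k -> singular_pt F e0 -> ~ Apt F 2 e0 ->
 [/\ k 10%N = 0, k 11%N = 0, k 6%N = 0 & k 7%N^+2 = 4*k 12%N*k 3%N].
Proof. by move=> /afr_perm[_ [_ D]] E; exact: (vertex D (rotE E)). Qed.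

(** * Visible decompositions *)

Lemma vform1_lin l e0 e1 e2 x y z : vform 1 l -> l (cmb e0 e1 e2 x y z) = x * l e0 + y * l e1 + z * l e2.
Proof. by move=> [k E]; rewrite !E /tform /cmb; ring. Qed.

(** The line [l = 0] becomes [y = 0]: [e0] is its point at infinity and [e2] an affine point on it.
    [m] lists the coefficients of the conic. *)
Definition nform c (l C' : vec -> C) e0 e1 e2 m := [/\ afr e0 e1 e2, c != 0, l e0 = 0 /\ l e1 = 1 /\ l e2 = 0,
 forall x y z, C' (cmb e0 e1 e2 x y z) = tform 2 m x y z &
 forall x y z, c*ev (cmb e0 e1 e2 x y z) = tform 2 m x y z^+2 + z*y^+3].

Lemma vis_nform_of c l C' e0 e1 e2 : vis F c l C' -> afr e0 e1 e2 -> l e0 = 0 -> l e1 = 1 -> l e2 = 0 ->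
 exists m, nform c l C' e0 e1 e2 m.
Proof.
move=> [c0 v1 v2 _ E] fr l0 l1 l2; have [m Em] := vform_frame e0 e1 e2 (isT : (2 <= 3)%N) v2.
exists m; split => // x y z; rewrite E Em vform1_lin // l0 l1 l2; congr (_ + _*_^+_); last by ring.
by have [h0 h1 h2 _] := fr; rewrite /cmb h0 h1 h2; ring.
Qed.

Lemma vis_frame c l C' : vis F c l C' -> exists e0 e1 e2, [/\ afr e0 e1 e2, l e0 = 0, l e1 = 1 & l e2 = 0].
Proof.
move=> [c0 v1 v2 [u u2 lu] E].
pose E0 := pt (1 : C) 0 0; pose E1 := pt 0 (1 : C) 0; pose E2 := pt 0 0 (1 : C).
have le (v : vec) : l v = v i0 * l E0 + v i1 * l E1 + v i2 * l E2.
 rewrite -vform1_lin //; congr l; apply: veqP; rewrite /cmb /E0 /E1 /E2 /pt /=; ring.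
have lu' : u i0 * l E0 + u i1 * l E1 = l u by rewrite (le u) u2; ring.
pose e1 : vec := fun j => u j/l u; pose e0 := pt (l E1) (- l E0) 0; pose e2 : vec := fun j => E2 j - l E2*e1 j.
have l1 : l e1 = 1.
 transitivity ((u i0 * l E0 + u i1 * l E1)/l u); last by rewrite lu' divff.
 by rewrite (le e1) /e1 u2; ring.
exists e0, e1, e2; split.
- apply: afr_Linf; first by [].
 + by rewrite /e1 u2 mul0r.
 + by rewrite /e2 /e1 u2 mul0r mulr0 subr0.
 have -> : e0 i0*e1 i1 - e0 i1*e1 i0 = (u i0 * l E0 + u i1 * l E1)/l u.
  by change (l E1*(u i1/l u) - (- l E0)*(u i0/l u) = (u i0 * l E0 + u i1 * l E1)/l u); ring.
 by rewrite lu' divff // oner_neq0.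
- by rewrite le /e0 /pt /=; ring.
- exact: l1.
have := le e1; rewrite l1 => l1'; rewrite le /e2.
transitivity (E2 i0 * l E0 + E2 i1 * l E1 + E2 i2 * l E2 - l E2*(e1 i0 * l E0 + e1 i1 * l E1 + e1 i2 * l E2)); first by ring.
by rewrite -l1' /E2 /pt /=; ring.
Qed.

(** If [l] divided the conic, it would divide the quartic. *)
Lemma nform_not_div c l C' e0 e1 e2 m : nform c l C' e0 e1 e2 m -> ~ (forall x z, tform 2 m x 0 z = 0).
Proof.
move=> [fr c0 _ _ E] H; have [_ [D _]] := afr_perm fr.
have TE x y z : tform 2 m x y z = y*(m 2%N*z + m 4%N*x + m 5%N*y).
 by rewrite -[LHS]subr0 -[X in _ - X](H x z) /tform; ring.
pose h x y z := y*(m 2%N*z + m 4%N*x + m 5%N*y)^+2 + z*y^+2.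
apply: (irr_frameZ irr D c0 (g := fun x y z => y) (h := h)).
- exact: pfun_y.
- by rewrite /h; pfauto.
- by [].
- by rewrite /h; ring.
by move=> x y z; rewrite E TE /h; ring.
Qed.

Lemma quad0 (a b c : C) : (forall x y, a*x^+2 + b*x*y + c*y^+2 = 0) -> [/\ a = 0, b = 0 & c = 0].
Proof.
move=> H; have [|-> -> -> _ _] := @quartic0 R a b c 0 0; last by [].
move=> x y; transitivity (x^+2*(a*x^+2 + b*x*y + c*y^+2)); last by rewrite H mulr0.
by rewrite /quartic_form; ring.
Qed.

(** [c C2^2 - c' C1^2] is a multiple of [Z l^3]. On [l = 0] this makes [C2] a multiple [s C1]; since
    [l] does not divide [C1], cancelling [l] twice removes the rest [C2 - s C1]. *)
Lemma vis_unique c l C1 c' l' C2 lam : vis F c l C1 -> vis F c' l' C2 -> lam != 0 -> (forall v, l' v = lam * l v) ->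
 exists2 s, s != 0 & forall v, C2 v = s*C1 v.
Proof.
move=> V V' lam0 hl; have [e0 [e1 [e2 [fr l0 l1 l2]]]] := vis_frame V.
have [m N] := vis_nform_of V fr l0 l1 l2; have nd := nform_not_div N.
have [_ c0 _ CE E] := N; have [c'0 _ v2' _ E'] := V'.
have [m' CE'] := vform_frame e0 e1 e2 (isT : (2 <= 3)%N) v2'.
have {}E' x y z : c'*ev (cmb e0 e1 e2 x y z) = tform 2 m' x y z^+2 + lam^+3*(z*y^+3).
 rewrite E' CE' hl vform1_lin; last by case: V.
 by rewrite l0 l1 l2; have [h0 h1 h2 _] := fr; rewrite /cmb h0 h1 h2; ring.
have [s0 s02] := csqrt (c'/c).
have ID x y z : c*tform 2 m' x y z^+2 - c'*tform 2 m x y z^+2 = (c' - c * lam^+3)*(z*y^+3).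
 have -> : tform 2 m' x y z^+2 = c'*ev (cmb e0 e1 e2 x y z) - lam^+3*(z*y^+3) by rewrite E'; ring.
 have -> : tform 2 m x y z^+2 = c*ev (cmb e0 e1 e2 x y z) - z*y^+3 by rewrite E; ring.
 by ring.
have [s s2 Hs] : exists2 s, s^+2 = c'/c & forall x z, tform 2 m' x 0 z = s*tform 2 m x 0 z.
 have [||x y z|H|H] := @pfun_mul0 R (fun x y z => tform 2 m' x 0 z - s0*tform 2 m x 0 z) (fun x y z => tform 2 m' x 0 z + s0*tform 2 m x 0 z).
 - by rewrite /tform; pfauto.
 - by rewrite /tform; pfauto.
 - rewrite -subr_sqr exprMn s02; apply: (mulfI c0); rewrite mulr0.
  transitivity (c*tform 2 m' x 0 z^+2 - c'*tform 2 m x 0 z^+2); first by field.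
  by rewrite ID; ring.
 - by exists s0 => // x z; apply/eqP; rewrite -subr_eq0 (H x 0 z).
 - by exists (- s0); rewrite ?sqrrN // => x z; apply/eqP; rewrite mulNr -addr_eq0 (H x 0 z).
have s00 : s != 0 by apply: contraTneq (mulf_neq0 c'0 (invr_neq0 c0)) => z; rewrite -s2 z expr0n eqxx.
pose n x y z := (m' 2%N - s * m 2%N)*z + (m' 4%N - s * m 4%N)*x + (m' 5%N - s * m 5%N)*y.
have TE x y z : tform 2 m' x y z = s*tform 2 m x y z + y*n x y z.
 have := Hs x z; rewrite /n /tform => /eqP; rewrite -subr_eq0 => /eqP h.
 by apply: subr0_eq; rewrite -[RHS]h; ring.
have c'E : c' = c*s^+2 by rewrite s2; field.
pose kap := c' - c * lam^+3.
have I1 : forall x y z, c*(n x y z*(2*s*tform 2 m x y z + y*n x y z)) - kap*(z*y^+2) = 0.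
 apply: (pfun_vanish _ (@pfun_y R)); first by rewrite /n /tform; pfauto.
  by exists 0, 1, 0; exact: oner_neq0.
 move=> x y z y0; apply: (mulfI y0); rewrite mulr0.
 transitivity (c*tform 2 m' x y z^+2 - c'*tform 2 m x y z^+2 - kap*(z*y^+3)); last by rewrite ID subrr.
 by rewrite TE [in X in _ = X]c'E; ring.
have n0 x z : n x 0 z = 0.
 have [||x' y' z'|H|H] := @pfun_mul0 R (fun x y z => n x 0 z) (fun x y z => tform 2 m x 0 z).
 - by rewrite /n; pfauto.
 - by rewrite /tform; pfauto.
 - have := I1 x' 0 z'; rewrite mul0r addr0 expr0n mulr0 mulr0 subr0 => /eqP.
  by rewrite mulf_eq0 (negbTE c0) /= mulrCA mulf_eq0 !mulf_eq0 pnatr_eq0 (negbTE s00) /= => /orP[]/eqP->; rewrite ?mul0r ?mulr0.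
 - exact: (H x 0 z).
 by case: nd => x' z'; exact: (H x' 0 z').
pose n2 := m' 5%N - s * m 5%N.
have nE x y z : n x y z = n2*y by rewrite -[LHS]subr0 -(n0 x z) /n /n2; ring.
have I2 : forall x y z, c*(n2*(2*s*tform 2 m x y z + n2*y^+2)) - kap*(z*y) = 0.
 apply: (pfun_vanish _ (@pfun_y R)); first by rewrite /tform; pfauto.
  by exists 0, 1, 0; exact: oner_neq0.
 move=> x y z y0; apply: (mulfI y0); rewrite mulr0 -[RHS](I1 x y z) nE; ring.
have n20 : n2 = 0.
 apply/eqP/negPn/negP => n20; apply: nd => x z; have := I2 x 0 z; rewrite expr0n !mulr0 addr0 subr0 => /eqP.
 by rewrite !mulf_eq0 (negbTE c0) (negbTE n20) (negbTE s00) pnatr_eq0 /= => /eqP.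
exists s => // v; have [_ [D _]] := afr_perm fr; rewrite (cramer v D) CE CE' TE nE n20; ring.
Qed.

End Curve.
End Local.

(** * Invisible decompositions *)
Section Invisible.
Variable R : realType.
Local Notation C := (R[i]).
Local Notation P := (C*C)%type.
Local Notation vec := ('I_3 -> C).
Implicit Types (u v w e : vec).

Lemma quad_dir (al be ga : C) : exists p q p' q', p*q' - p'*q != 0 /\ al * p^+2 + be * p*q + ga*q^+2 = 0.
Proof.
have [a0|a0] := eqVneq al 0.
 by exists 1, 0, 0, 1; split; [rewrite mulr1 mulr0 subr0 oner_neq0|rewrite a0; ring].
have [x hx] := @solve_monicpoly C 2 (nth 0 [:: - ga/al; - be/al]) isT.
move: hx; rewrite !big_ord_recl big_ord0 /= /bump /= => hx.
exists x, 1, 1, 0; split; first by rewrite mulr0 mulr1 sub0r oppr_eq0 oner_neq0.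
by rewrite hx; field.
Qed.

Section Curve.
Variable F : {mpoly C[3]}.
Hypothesis irr : irreducible_quartic F.
Local Notation ev v := (F.@[v]).
Let Fh : F \is 4.-homog. Proof. by case: irr. Qed.

Definition inv_nf c (G2 G3 : vec -> C) e0 e1 e2 mu := forall x y z, [/\ G2 (cmb e0 e1 e2 x y z) = - x^+2 + y*z,
 G3 (cmb e0 e1 e2 x y z) = x^+3 - 3/2*x*y*z + mu*z^+3 &
 c*ev (cmb e0 e1 e2 x y z) = - (3/4)*x^+2*y^+2 + z*(2 * mu*x^+3 + y^+3 - 3 * mu*x*y*z + mu^+2*z^+3)].

Section Dec.
Variables (c : C) (G2 G3 : vec -> C).
Hypotheses (c0 : c != 0) (v2 : vform 2 G2) (v3 : vform 3 G3).
Hypothesis ID : forall v, c*v i2^+2*ev v = G2 v^+3 + G3 v^+2.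
Hypothesis ls : LS F.

Lemma std_afr : afr (pt (1 : C) 0 0) (pt 0 1 0) (pt 0 0 1).
Proof. by apply: afr_Linf => //; rewrite /pt /= mulr1 mulr0 subr0 oner_neq0. Qed.

Let IDf e0 e1 e2 x y z : afr e0 e1 e2 ->
 c*z^+2*ev (cmb e0 e1 e2 x y z) = G2 (cmb e0 e1 e2 x y z)^+3 + G3 (cmb e0 e1 e2 x y z)^+2.
Proof. by move=> [h0 h1 h2 _]; rewrite -ID; congr (_*_^+_*_); rewrite /cmb h0 h1 h2; ring. Qed.

(** On [Z = 0] the identity reads [G2^3 + G3^2 = 0], so there [G2] is minus the square of a linear
    form and [G3] its cube. The frame puts [e1] at the zero of that form and scales [e0]. *)
Lemma invis_frame1 : (exists2 u, u i2 = 0 & G2 u != 0) -> exists e0 e1 e2, afr e0 e1 e2 /\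
 exists a0 a1 a2 b0 b1 b2 b3 b4 b5, forall x y z, G2 (cmb e0 e1 e2 x y z) = - x^+2 + z*(a0*z + a1*x + a2*y) /\
 G3 (cmb e0 e1 e2 x y z) = x^+3 + z*(b0*z^+2 + b1*x*z + b2*y*z + b3*x^+2 + b4*x*y + b5*y^+2).
Proof.
move=> [u u2 Gu]; pose E0 := pt (1 : C) 0 0; pose E1 := pt 0 (1 : C) 0; pose E2 := pt 0 0 (1 : C).
have [k Ek] := vform_frame E0 E1 E2 (isT : (2 <= 3)%N) v2.
have [p [q [p' [q' [d rt]]]]] := quad_dir (k 3%N) (k 4%N) (k 5%N).
have d' : p'*q - q' * p != 0 by rewrite -oppr_eq0 (_ : - (p'*q - q' * p) = p*q' - p'*q) //; ring.
have fr := @afr_change R E0 E1 E2 p' q' p q 0 0 std_afr d'.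
set e0 := cmb E0 E1 E2 p' q' 0 in fr; set e1 := cmb E0 E1 E2 p q 0 in fr; set e2 := cmb E0 E1 E2 0 0 1 in fr.
have [a Ea] := vform_frame e0 e1 e2 (isT : (2 <= 3)%N) v2; have [b Eb] := vform_frame e0 e1 e2 (isT : (3 <= 3)%N) v3.
have a5 : a 5%N = 0.
 have := Ea 0 1 0; have -> : cmb e0 e1 e2 0 1 0 = cmb E0 E1 E2 p q 0 by rewrite cmb_cmb; congr cmb; ring.
 rewrite Ek => h; transitivity (tform 2 a 0 1 0); first by rewrite /tform; ring.
 by rewrite -h -[RHS]rt /tform; ring.
(* Coefficients of [G2^3 + G3^2] on [z = 0], [y = 1], by increasing powers of [x]. They kill
   everything except [a 3] and [b 6]. *)
have PI : Poly [:: b 9%N^+2; 2*b 8%N*b 9%N; b 8%N^+2 + 2*b 7%N*b 9%N; a 4%N^+3 + 2*b 6%N*b 9%N + 2*b 7%N*b 8%N;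
  3*a 3%N*a 4%N^+2 + b 7%N^+2 + 2*b 6%N*b 8%N; 3*a 3%N^+2*a 4%N + 2*b 6%N*b 7%N; a 3%N^+3 + b 6%N^+2] = 0.
 apply: polyfun0 => x; rewrite horner_Poly /=; transitivity (c*0^+2*ev (cmb e0 e1 e2 x 1 0)); last by ring.
 by rewrite IDf // Ea Eb /tform /cubic_form a5; ring.
have co i := congr1 (fun r : {poly C} => r`_i) PI.
have b9 : b 9%N = 0 by have := co 0%N; rewrite coef_Poly coef0 /= => /eqP; rewrite sqrf_eq0 => /eqP.
have b8 : b 8%N = 0 by have := co 2%N; rewrite coef_Poly coef0 /= b9 mulr0 addr0 => /eqP; rewrite sqrf_eq0 => /eqP.
have a4 : a 4%N = 0 by have := co 3%N; rewrite coef_Poly coef0 /= b9 b8 !mulr0 !addr0 => /eqP; rewrite expf_eq0 => /eqP.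
have b7 : b 7%N = 0.
 by have := co 4%N; rewrite coef_Poly coef0 /= b8 a4 expr0n !mulr0 addr0 add0r => /eqP; rewrite sqrf_eq0 => /eqP.
have b6 : b 6%N^+2 = - a 3%N^+3.
 by have := co 6%N; rewrite coef_Poly coef0 /= => /eqP; rewrite addrC addr_eq0 => /eqP.
have a30 : a 3%N != 0.
 apply: contraNneq Gu => a3; have [_ [D _]] := afr_perm fr; rewrite (cramer u D) Ea.
 have -> : det3 e0 e1 u = 0 by have [h0 h1 _ _] := fr; rewrite /det3 h0 h1 u2; ring.
 by rewrite /tform a3 a4 a5; apply/eqP; ring.
(* The parameter of the cuspidal cubic [b^2 = - a^3]: [s^2 = - a 3] and [s^3 = b 6]. *)
pose s := - b 6%N/a 3%N.
have b60 : b 6%N != 0 by rewrite -sqrf_eq0 b6 oppr_eq0 expf_neq0.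
have s0 : s != 0 by rewrite mulf_neq0 ?oppr_eq0 ?invr_eq0.
have s2 : s^+2 = - a 3%N by rewrite /s expr_div_n sqrrN b6; field.
have s3 : s^+3 = b 6%N by rewrite exprS s2 /s; field.
have fr' := @afr_change R e0 e1 e2 s^-1 0 0 1 0 0 fr.
exists (cmb e0 e1 e2 s^-1 0 0), (cmb e0 e1 e2 0 1 0), (cmb e0 e1 e2 0 0 1); split.
 by apply: fr'; rewrite mulr1 mul0r subr0 invr_eq0.
exists (a 0%N), (a 1%N/s), (a 2%N), (b 0%N), (b 1%N/s), (b 2%N), (b 3%N/s^+2), (b 4%N/s), (b 5%N) => x y z.
have a3' : a 3%N = - s^+2 by rewrite s2 opprK.
by rewrite cmb_cmb Ea Eb /tform /cubic_form b7 b8 b9 a4 a5 -s3 a3'; split; field.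
Qed.

(** With [G2 = - x^2 + z M] and [G3 = x^3 + z N], divisibility of [G2^3 + G3^2] by [z^2] forces
    [N = - (3/2) x M + z q] with [q] linear. Then [M] is taken as the coordinate [y]. *)
Lemma invis_frame2 : (exists2 u, u i2 = 0 & G2 u != 0) -> exists e0 e1 e2, afr e0 e1 e2 /\
 exists q0 q1 mu, forall x y z, [/\ G2 (cmb e0 e1 e2 x y z) = - x^+2 + y*z,
 G3 (cmb e0 e1 e2 x y z) = x^+3 - 3/2*x*y*z + z^+2*(q0*x + q1*y + mu*z) &
 c*ev (cmb e0 e1 e2 x y z) = let q := q0*x + q1*y + mu*z in
  x^+2*(2*x*q - 3/4*y^+2) + z*(y^+3 - 3*x*y*q) + z^+2*q^+2].
Proof.
move=> /invis_frame1[e0 [e1 [e2 [fr [a0 [a1 [a2 [b0 [b1 [b2 [b3 [b4 [b5 E]]]]]]]]]]]]].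
have pF : pfun (fun x y z => ev (cmb e0 e1 e2 x y z)).
 by have [k Ek] := frame_form Fh e0 e1 e2; apply: pfun_ext (pfun_tform 4 k) => x y z; rewrite Ek.
pose M x y z := a0*z + a1*x + a2*y.
pose N x y z := b0*z^+2 + b1*x*z + b2*y*z + b3*x^+2 + b4*x*y + b5*y^+2.
have I0 x y z : c*z^+2*ev (cmb e0 e1 e2 x y z) = (- x^+2 + z*M x y z)^+3 + (x^+3 + z*N x y z)^+2.
 by rewrite IDf //; have [-> ->] := E x y z.
have I1 : forall x y z, 3*x^+4*M x y z + 2*x^+3*N x y z - 3*x^+2*z*M x y z^+2 + z^+2*M x y z^+3
  + z*N x y z^+2 - c*z*ev (cmb e0 e1 e2 x y z) = 0.
 apply: pfun_offz; first by rewrite /M /N; pfauto.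
 move=> x y z z0; apply: (mulfI z0); rewrite mulr0 -[RHS](subrr (c*z^+2*ev (cmb e0 e1 e2 x y z))) {1}I0; ring.
have [b3E b4E b5E] : [/\ 3*a1 + 2*b3 = 0, 3*a2 + 2*b4 = 0 & 2*b5 = 0].
 apply: quad0 => x y.
 suff: forall x y z : C, (3*a1 + 2*b3)*x^+2 + (3*a2 + 2*b4)*x*y + 2*b5*y^+2 = 0 by move/(_ x y 0).
 move=> {x y}; apply: (pfun_vanish _ (@pfun_x R)); first by pfauto.
  by exists 1, 0, 0; exact: oner_neq0.
 move=> x y z x0; apply: (mulfI (expf_neq0 3 x0)); rewrite mulr0 -[RHS](I1 x y 0) /M /N; ring.
have two0 : (2 : C) != 0 by rewrite pnatr_eq0.
have {}b5E : b5 = 0 by apply: (mulfI two0); rewrite mulr0.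
have {}b3E : b3 = - (3/2)*a1.
 by apply: (mulfI two0); apply: subr0_eq; rewrite -[RHS]b3E; field.
have {}b4E : b4 = - (3/2)*a2.
 by apply: (mulfI two0); apply: subr0_eq; rewrite -[RHS]b4E; field.
pose q x y z := b0*z + (b1 + 3/2*a0)*x + b2*y.
have NE x y z : N x y z = - (3/2)*x*M x y z + z*q x y z by rewrite /N /M /q b5E b3E b4E; field.
have PH : forall x y z, c*ev (cmb e0 e1 e2 x y z) - (x^+2*(2*x*q x y z - 3/4*M x y z^+2) +
  z*(M x y z^+3 - 3*x*M x y z*q x y z) + z^+2*q x y z^+2) = 0.
 apply: pfun_offz; first by rewrite /M /q; pfauto.
 move=> x y z z0; apply: (mulfI (expf_neq0 2 z0)); rewrite mulr0 -[RHS](subrr (c*z^+2*ev (cmb e0 e1 e2 x y z))) {2}I0 NE.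
 by field.
have [f0 f1 f2 D] := fr.
have [al [be [de ES]]] := ls f0 f1.
have ES' x y : c*(al*x^+2 + be*x*y + de*y^+2)^+2 = x^+2*(2*x*q x y 0 - 3/4*M x y 0^+2).
 by apply/eqP; rewrite -(ES e2) -subr_eq0 -[X in _ == X](PH x y 0); apply/eqP; ring.
(* If [M] did not involve [y], the square at infinity would force [b2 = 0], and the quartic would be
   a binary form in [x] and [z]. *)
have a20 : a2 != 0.
 apply/eqP => a2z.
 have [_ k2 k3 k4 k5] : [/\ c*al^+2 - (2*(b1 + 3/2*a0) - 3/4*a1^+2) = 0, c*2*al*be - 2*b2 = 0,
   c*(be^+2 + 2*al*de) = 0, c*2*be*de = 0 & c*de^+2 = 0].
  apply: quartic0 => x y.
  transitivity (c*(al*x^+2 + be*x*y + de*y^+2)^+2 - x^+2*(2*x*q x y 0 - 3/4*M x y 0^+2)); last by rewrite ES' subrr.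
  by rewrite /quartic_form /q /M a2z; ring.
 have de0 : de = 0 by move/eqP: k5; rewrite mulf_eq0 (negbTE c0) sqrf_eq0 => /eqP.
 have be0 : be = 0 by move/eqP: k3; rewrite de0 mulr0 addr0 mulf_eq0 (negbTE c0) sqrf_eq0 => /eqP.
 have b20 : b2 = 0 by move: k2; rewrite be0 mulr0 sub0r => /eqP; rewrite oppr_eq0 mulf_eq0 (negbTE two0) => /eqP.
 pose b1' := b1 + 3/2*a0.
 apply: (@binary_reducible _ _ irr e0 e1 e2 (c^-1*(2*b1' - 3/4*a1^+2))
   (c^-1*(2*b0 - 3/4*(2*a0*a1) + a1^+3 - 3*a1*b1'))
   (c^-1*(- (3/4)*a0^+2 + 3*a0*a1^+2 - 3*(a0*b1' + a1*b0) + b1'^+2))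
   (c^-1*(3*a0^+2*a1 - 3*a0*b0 + 2*b0*b1')) (c^-1*(a0^+3 + b0^+2)) D) => x y z.
 apply: (mulfI c0); have /eqP := PH x y z; rewrite subr_eq0 => /eqP ->.
 by rewrite /M /q /quartic_form a2z b20 -/b1'; field.
have fr' := @afr_change R e0 e1 e2 1 (- a1/a2) 0 a2^-1 0 (- a0/a2) fr.
exists (cmb e0 e1 e2 1 (- a1/a2) 0), (cmb e0 e1 e2 0 a2^-1 0), (cmb e0 e1 e2 0 (- a0/a2) 1); split.
 by apply: fr'; rewrite mulr0 subr0 mul1r invr_eq0.
exists (b1 + 3/2*a0 - b2*a1/a2), (b2/a2), (b0 - b2*a0/a2) => x y z.
rewrite cmb_cmb !mulr1 !mulr0 !addr0 !add0r.
set Y := _ + y*_ + _.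
have ME : M x Y z = y by rewrite /M /Y; field.
have qE : q x Y z = (b1 + 3/2*a0 - b2*a1/a2)*x + b2/a2*y + (b0 - b2*a0/a2)*z by rewrite /q /Y; field.
have [g2 g3] := E x Y z; rewrite g2 g3 -/(M x Y z) -/(N x Y z) NE ME -qE.
split; [by ring|by field|].
by have /eqP := PH x Y z; rewrite subr_eq0 ME => /eqP ->.
Qed.

(** At infinity [c F] is [x^2 (2 x q - (3/4) y^2)]. That it is a multiple of a square gives
    [q0 = - (2/3) q1^2], exactly what a translation along the parabola removes. If [mu] vanished,
    [y] would divide the quartic. *)
Lemma invisible_nf : (exists2 u, u i2 = 0 & G2 u != 0) -> exists e0 e1 e2 mu, [/\ afr e0 e1 e2, mu != 0 &
 inv_nf c G2 G3 e0 e1 e2 mu].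
Proof.
move=> /invis_frame2[e0 [e1 [e2 [fr [q0 [q1 [mu E]]]]]]].
have two0 : (2 : C) != 0 by rewrite pnatr_eq0.
have [f0 f1 f2 _] := fr; have [al [be [de ES]]] := ls f0 f1.
have q0E : q0 = - (2/3)*q1^+2.
 have [k1 k2 k3 k4 k5] : [/\ c*al^+2 - 2*q0 = 0, c*2*al*be - 2*q1 = 0,
   c*(be^+2 + 2*al*de) + 3/4 = 0, c*2*be*de = 0 & c*de^+2 = 0].
  apply: quartic0 => x y; have [_ _] := E x y 0; rewrite ES /= => h.
  transitivity (c*(al*x^+2 + be*x*y + de*y^+2)^+2 - c*(al*x^+2 + be*x*y + de*y^+2)^+2); last by rewrite subrr.
  by rewrite {2}h /quartic_form; ring.
 have de0 : de = 0 by move/eqP: k5; rewrite mulf_eq0 (negbTE c0) sqrf_eq0 => /eqP.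
 have be2 : c*be^+2 = - (3/4).
  by apply: subr0_eq; rewrite -[RHS]k3 de0; ring.
 have q1E : q1 = c*al*be.
  by apply: (mulfI two0); apply/esym/subr0_eq; rewrite -[RHS]k2; ring.
 have -> : q0 = c*al^+2/2.
  by apply: (mulfI two0); apply/esym/subr0_eq; rewrite -[RHS]k1; field.
 have -> : q1^+2 = (c*al^+2)*(c*be^+2) by rewrite q1E; ring.
 by rewrite be2; field.
(* The substitution [x + s z], [y + 2 s x + s^2 z] preserves [y z - x^2]; this [s] cancels both [q0]
   and [q1]. *)
pose s := 2/3*q1.
have fr' := @afr_change R e0 e1 e2 1 (2*s) 0 1 s (s^+2) fr.
pose mu' := mu - 1/2*s^+3 + q0*s + q1*s^+2.
set h0 := cmb e0 e1 e2 1 (2*s) 0 in fr'; set h1 := cmb e0 e1 e2 0 1 0 in fr'; set h2 := cmb e0 e1 e2 s (s^+2) 1 in fr'.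
have {}fr' : afr h0 h1 h2 by apply: fr'; rewrite mulr0 subr0 mul1r oner_neq0.
have E' : inv_nf c G2 G3 h0 h1 h2 mu'.
 move=> x y z; rewrite cmb_cmb; have [-> -> ->] := E (x*1 + y*0 + z*s) (x*(2*s) + y*1 + z*s^+2) (x*0 + y*0 + z*1).
 have q1E : q1 = 3/2*s by rewrite /s; field.
 by rewrite /= /mu' q0E q1E; split; field.
exists h0, h1, h2, mu'; split => //.
apply/eqP => m0; have [_ [D _]] := afr_perm fr'.
apply: (irr_frameZ irr D c0 (g := fun x y z => y) (h := fun x y z => y*(- (3/4)*x^+2 + y*z))).
- exact: pfun_y.
- by pfauto.
- by [].
- by ring.
by move=> x y z; have [_ _ ->] := E' x y z; rewrite m0; ring.
Qed.

End Dec.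

(** At such a point [G2] and [G3] vanish with independent differentials, so they serve as local
    coordinates in which the quartic is [G2^3 + G3^2]. *)
Lemma invisible_cusp c (G2 G3 : vec -> C) e0 e1 e2 mu xi : c != 0 -> afr e0 e1 e2 -> mu != 0 -> inv_nf c G2 G3 e0 e1 e2 mu ->
 xi^+3 = 2 * mu -> singular_pt F (cmb e0 e1 e2 xi (xi^+2) 1) /\ Apt F 3 (cmb e0 e1 e2 xi (xi^+2) 1).
Proof.
move=> c0 fr mu0 E x3.
have xi0 : xi != 0 by apply: contraTneq mu0 => z; move: x3; rewrite z expr0n => /esym/eqP; rewrite mulf_eq0 pnatr_eq0 => /eqP->; rewrite eqxx.
have muE : mu = xi^+3/2 by rewrite x3; field.
pose v := cmb e0 e1 e2 xi (xi^+2) 1.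
have fr' := @afr_change R e0 e1 e2 1 0 0 1 xi (xi^+2) fr.
set h0 := cmb e0 e1 e2 1 0 0 in fr'; set h1 := cmb e0 e1 e2 0 1 0 in fr'; rewrite -/v in fr' *.
have {}fr' : afr h0 h1 v by apply: fr'; rewrite mulr0 subr0 mul1r oner_neq0.
have [D [D' _]] := afr_perm fr'.
have EF : fform F h0 h1 v (fun i => c^-1*nth 0 [:: 0; 0; 0; 9/4*xi^+4; - (9/2)*xi^+3; 9/4*xi^+2; xi^+3; - (3/2)*xi^+2; - (3/2)*xi; 1; 0; 0; - (3/4)] i).
 move=> x y z; rewrite cmb_cmb; apply: (mulfI c0).
 have [_ _ ->] := E (x*1 + y*0 + z*xi) (x*0 + y*1 + z*xi^+2) (x*0 + y*0 + z*1).
 by rewrite muE /tform /cubic_form /quartic_form /=; field.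
split; first by apply/(singular_frame D' EF); rewrite /= mulr0.
(* [X1] and [Y1] are [G2] and [G3] at [z = 1], recentred at [v]. *)
pose X1 (q : P) := - 2*xi*q.1 + q.2 - q.1^+2.
pose Y1 (q : P) := 3/2*xi^+2*q.1 - 3/2*xi*q.2 + 3*xi*q.1^+2 - 3/2*q.1*q.2 + q.1^+3.
have sX : sdiff X1 (- 2*xi) 1.
 apply: (@sdiff_lin0 _ _ (fun q => - q.1) (fun=> 0)); try by sdauto.
  by rewrite [(_, _).1]/= oppr0.
 by move=> q; rewrite /X1; ring.
have sY : sdiff Y1 (3/2*xi^+2) (- (3/2)*xi).
 apply: (@sdiff_lin0 _ _ (fun q => 3*xi*q.1 - 3/2*q.2 + q.1^+2) (fun=> 0)); try by sdauto.
  by pring.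
 by move=> q; rewrite /Y1; ring.
apply: (Apt_local (j := 2) (k := 3) D c0 isT isT sX sY _ _ _ (sd_cst 0) (sd_cst 1) (sd_cst 1) (sd_cst 1)).
- have -> : - 2*xi*(- (3/2)*xi) - 1*(3/2*xi^+2) = 3/2*xi^+2 by field.
 by rewrite mulf_neq0 ?expf_neq0 // mulf_neq0 ?invr_eq0 ?pnatr_eq0.
- by rewrite /X1 [(_, _).1]/= [(_, _).2]/=; ring.
- by rewrite /Y1 [(_, _).1]/= [(_, _).2]/=; ring.
- exact: oner_neq0.
- exact: oner_neq0.
- by move=> q; rewrite cmb_e2 EF /X1 /Y1 /tform /cubic_form /quartic_form /=; field.
- exact: oner_neq0.
Qed.

End Curve.
End Invisible.

(** * From identities in a frame to decompositions *)

Section Assembly.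
Variable R : realType.
Local Notation C := (R[i]).
Local Notation vec := ('I_3 -> C).
Implicit Types (u v w e : vec).

Lemma vform_coords n (k : nat -> C) e0 e1 e2 : (n <= 3)%N -> det3 e0 e1 e2 != 0 ->
 exists G, vform n G /\ forall x y z, G (cmb e0 e1 e2 x y z) = tform n k x y z.
Proof.
move=> n3 D; pose DD := det3 e0 e1 e2.
pose l0 (x y z : C) := det3 (pt x y z) e1 e2/DD; pose l1 (x y z : C) := det3 e0 (pt x y z) e2/DD; pose l2 (x y z : C) := det3 e0 e1 (pt x y z)/DD.
have L0 : linf l0 by exists (l0 1 0 0), (l0 0 1 0), (l0 0 0 1) => x y z; rewrite /l0 /det3 /pt /=; ring.
have L1 : linf l1 by exists (l1 1 0 0), (l1 0 1 0), (l1 0 0 1) => x y z; rewrite /l1 /det3 /pt /=; ring.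
have L2 : linf l2 by exists (l2 1 0 0), (l2 0 1 0), (l2 0 0 1) => x y z; rewrite /l2 /det3 /pt /=; ring.
have [k' E] := isf_lin k n3 L0 L1 L2.
exists (fun v => tform n k (l0 (v i0) (v i1) (v i2)) (l1 (v i0) (v i1) (v i2)) (l2 (v i0) (v i1) (v i2))).
split; first by exists k' => v; rewrite E.
move=> x y z; congr tform; rewrite /l0 /l1 /l2; apply: (mulIf D); rewrite divfK // /DD /det3 /cmb /pt /=; ring.
Qed.

Lemma cube_root (a : C) : exists x, x^+3 = a.
Proof.
have [x hx] := @solve_monicpoly C 3 (nth 0 [:: a; 0; 0]) isT; exists x.
by rewrite hx !big_ord_recl big_ord0 /= /bump /=; ring.
Qed.
Lemma omega_ex : exists w : C, [/\ w^+2 + w + 1 = 0, w^+3 = 1, w != 1 & w^+2 != w /\ w^+2 != 1].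
Proof.
have [s s2] := csqrt (-3 : C); pose w := (- 1 + s)/2.
have w2 : w^+2 + w + 1 = 0.
 have -> : w^+2 + w + 1 = (s^+2 + 3)/4 by rewrite /w; field.
 by rewrite s2; field.
have w3 : w^+3 = 1.
 have e3 : w^+3 - 1 = (w - 1)*(w^+2 + w + 1) by ring.
 by apply/eqP; rewrite -subr_eq0 e3 w2 mulr0.
have w1 : w != 1.
 apply/eqP => z; move: w2; rewrite z (_ : 1^+2 + 1 + 1 = 3 :> C); last by ring.
 by move/eqP; rewrite pnatr_eq0.
have w0 : w != 0 by apply/eqP => z; move/eqP: w3; rewrite z expr0n eq_sym oner_eq0.
have w22 : w^+2 != w by rewrite expr2 -[X in _ != X]mulr1 (inj_eq (mulfI w0)).
exists w; split => //; split => //; apply: contraNneq w1 => w21.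
by rewrite -w3 exprS w21 mulr1.
Qed.

Section Curve.
Variable F : {mpoly C[3]}.
Hypothesis irr : irreducible_quartic F.
Local Notation ev v := (F.@[v]).

(** Coefficient list of the square of a quadratic form, in the ordering of [tform]. *)
Definition sq2 (a : nat -> C) : nat -> C := nth 0 [:: a 0%N^+2; 2*a 0%N*a 1%N; 2*a 0%N*a 2%N;
 a 1%N^+2 + 2*a 0%N*a 3%N; 2*a 1%N*a 2%N + 2*a 0%N*a 4%N; a 2%N^+2 + 2*a 0%N*a 5%N;
 2*a 1%N*a 3%N; 2*a 1%N*a 4%N + 2*a 2%N*a 3%N; 2*a 1%N*a 5%N + 2*a 2%N*a 4%N; 2*a 2%N*a 5%N;
 a 3%N^+2; 2*a 3%N*a 4%N; a 4%N^+2 + 2*a 3%N*a 5%N; 2*a 4%N*a 5%N; a 5%N^+2].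

Lemma sing_nform c l C' e0 e1 e2 m x0 y0 : nform F c l C' e0 e1 e2 m ->
 singular_pt F (cmb e0 e1 e2 x0 y0 1) <->
 [/\ tform 2 m x0 y0 1^+2 + y0^+3 = 0, 2*tform 2 m x0 y0 1*(m 1%N + 2 * m 3%N*x0 + m 4%N*y0) = 0 &
  2*tform 2 m x0 y0 1*(m 2%N + m 4%N*x0 + 2 * m 5%N*y0) + 3*y0^+2 = 0].
Proof.
move=> [fr c0 _ _ E]; have fr' := @afr_change R e0 e1 e2 1 0 0 1 x0 y0 fr.
have D1 : (1 : C)*1 - 0*0 != 0 by rewrite mulr1 mulr0 subr0 oner_neq0.
have [_ [D _]] := afr_perm (fr' D1).
pose a := nth 0 [:: tform 2 m x0 y0 1; m 1%N + 2 * m 3%N*x0 + m 4%N*y0; m 2%N + m 4%N*x0 + 2 * m 5%N*y0; m 3%N; m 4%N; m 5%N].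
pose k i := c^-1*(sq2 a i + nth 0 [:: y0^+3; 0; 3*y0^+2; 0; 0; 3*y0; 0; 0; 0; 1] i).
have Ek x y z : ev (cmb (cmb e0 e1 e2 1 0 0) (cmb e0 e1 e2 0 1 0) (cmb e0 e1 e2 x0 y0 1) x y z) = tform 4 k x y z.
 rewrite cmb_cmb; apply: (mulfI c0); rewrite E /tform /cubic_form /quartic_form /k /sq2 /a /= /tform.
 by field.
apply: iff_trans (singular_frame D Ek) _.
have cv x : c^-1*x = 0 <-> x = 0.
 by split=> [/eqP|->]; rewrite ?mulr0 // mulf_eq0 invr_eq0 (negbTE c0) => /eqP.
rewrite /k /sq2 /a /=; split=> [[/cv h0 /cv h1 /cv h2]|[h0 h1 h2]].
 by split; [rewrite -[RHS]h0|rewrite -[RHS]h1|rewrite -[RHS]h2]; ring.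
by split; apply/cv; [rewrite -[RHS]h0|rewrite -[RHS]h1|rewrite -[RHS]h2]; ring.
Qed.

(** A cube root of [ga] goes into the linear form; [ga = 0] would make the quartic a multiple of a
    square. *)
Lemma mkvis e0 e1 e2 c (m : nat -> C) ga : afr e0 e1 e2 -> c != 0 ->
 (forall x y z, c*ev (cmb e0 e1 e2 x y z) = tform 2 m x y z^+2 + ga*(z*y^+3)) ->
 exists l C', vis F c l C' /\ forall x z, l (cmb e0 e1 e2 x 0 z) = 0.
Proof.
move=> fr c0 E; have [_ [D _]] := afr_perm fr.
have g0 : ga != 0.
 apply/eqP => g0; apply: (irr_frameZ irr D c0 (g := tform 2 m) (h := tform 2 m)); rewrite ?tform00 //; try exact: pfun_tform.
 by move=> x y z; rewrite E g0; ring.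
have [s s3] := cube_root ga; have s0 : s != 0 by apply: contraNneq g0 => z; rewrite -s3 z expr0n.
have [l [vl El]] := vform_coords (nth 0 [:: 0; 0; s]) (isT : (1 <= 3)%N) D.
have [C' [vC EC]] := vform_coords m (isT : (2 <= 3)%N) D.
have [h0 h1 h2 _] := fr.
exists l, C'; split; last by move=> x z; rewrite El /tform /=; ring.
split=> //.
 exists (cmb e0 e1 e2 0 1 0); first by rewrite /cmb h0 h1; ring.
 by rewrite El /tform /= (_ : _ + _ = s) //; ring.
move=> v; rewrite (cramer v D); set x := _/_; set y := _/_; set z := _/_.
rewrite E El EC -s3 /tform /=; congr (_ + _); rewrite {1}/cmb h0 h1 h2; ring.
Qed.

(** The point to check is that [f_3] is nonconstant: a conic constant on the affine plane is a
    multiple of [Z^2], and [Z] would divide the quartic. *)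
Lemma vis_dec c l C' : vis F c l C' -> exists d, [/\ torus_dec (dehom F) d, (msize d.1 <= 2)%N &
 forall v, v i2 = 1 -> d.1.@[af v] = l v /\ d.2.@[af v] = C' v].
Proof.
move=> V; have [c0 vl vC [u u2 lu] E] := V.
apply: (mk_dec irr (n2 := 1) (n3 := 2) c0) => //.
- by move=> v v2; rewrite E v2; ring.
- exists (pt 0 0 1), (cmb u u (pt 0 0 1) 1 0 1); split=> //; first by rewrite /cmb u2 /pt /=; ring.
 by rewrite vform1_lin // mul1r mul0r mul1r addr0 -subr_eq0 opprD addrCA subrr addr0 oppr_eq0.
have [e0 [e1 [e2 [fr l0 l1 l2]]]] := vis_frame V; have [m N] := vis_nform_of V fr l0 l1 l2.
have [_ [D _]] := afr_perm fr; have [_ _ _ EC En] := N; have [h0 h1 h2 _] := fr.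
case: (pselect (exists v v', [/\ v i2 = 1, v' i2 = 1 & C' v != C' v'])) => // nex.
have cst x y : tform 2 m x y 1 = m 0%N.
 transitivity (tform 2 m 0 0 1); last by rewrite /tform; ring.
 apply/eqP/negPn/negP => h; apply: nex; exists (cmb e0 e1 e2 x y 1), (cmb e0 e1 e2 0 0 1).
 by split; rewrite ?EC // /cmb h0 h1 h2; ring.
have TZ x y z : tform 2 m x y z = m 0%N*z^+2.
 apply: subr0_eq; move: x y z; apply: (@pfun_offz R (fun x y z => tform 2 m x y z - m 0%N*z^+2)).
  by rewrite /tform; pfauto.
 move=> x y z z0; have -> : tform 2 m x y z = z^+2*tform 2 m (x/z) (y/z) 1.
  by rewrite -tformZ // mulr1; congr tform; rewrite mulrC divfK.
 by rewrite cst; ring.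
case: (irr_frameZ irr D c0 (g := fun x y z => z) (h := fun x y z => m 0%N^+2*z^+3 + y^+3)).
- exact: pfun_z.
- by pfauto.
- by [].
- by ring.
by move=> x y z; rewrite En TZ; ring.
Qed.

Lemma one_dec : (exists c l C', vis F c l C') ->
 (forall c G2 G3, c != 0 -> vform 2 G2 -> vform 3 G3 -> (forall v, c*v i2^+2*ev v = G2 v^+3 + G3 v^+2) ->
   forall v, v i2 = 0 -> G2 v = 0) ->
 (forall c l C' c' l' C1, vis F c l C' -> vis F c' l' C1 -> exists2 lam, lam != 0 & forall v, l' v = lam * l v) ->
 exists ds, dec_reps (dehom F) 1 ds.
Proof.
move=> [c [l [C' V]]] nv un; have [d [td _ dE]] := vis_dec V.
exists (fun=> d); split => // [[] // [] //|d' td']; exists 0%N => //.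
have [c' [G2 [G3 [c'0 v2 v3 ID De]]]] := dec_forms irr td'.
have [l' [C1 [V' dE']]] := visible_forms td' c'0 v2 v3 ID De (nv _ _ _ c'0 v2 v3 ID).
have [lam lam0 El] := un _ _ _ _ _ _ V' V; have [s s0 EC] := vis_unique irr V' V lam0 El.
exists lam, s; split => //; apply: proportional => v hv; have [a b] := dE v hv; have [a' b'] := dE' v hv.
 by rewrite a a' El.
by rewrite b b' EC.
Qed.

End Curve.
End Assembly.

(** * The line of a visible decomposition *)
Section Lines.
Variable R : realType.
Local Notation C := (R[i]).
Local Notation P := (C*C)%type.
Local Notation vec := ('I_3 -> C).
Implicit Types (u v w e : vec).

Section Curve.
Variable F : {mpoly C[3]}.
Hypothesis irr : irreducible_quartic F.
Local Notation ev v := (F.@[v]).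
Let Fh : F \is 4.-homog. Proof. by case: irr. Qed.

Lemma singularZ v (l : C) : l != 0 -> singular_pt F v -> singular_pt F (fun j => l*v j).
Proof.
move=> l0 [[j0 vj] [z d]]; split; first by exists j0; rewrite mulf_neq0.
split; first by rewrite /on_curve evZ // (z : ev v = 0) mulr0.
move=> j; pose w : vec := fun i => (i == j)%:R.
have E : tline F (fun j => l*v j) (fun j => l*w j) = (l^+4)%:P*tline F v w.
 apply/subr0_eq/polyfun0 => t; rewrite hornerD hornerN hornerM hornerC !(tlineP F _ _).1.
 have -> : (fun j => l*v j + t*(l*w j)) = (fun j => l*(v j + t*w j)) by apply/funext => i; ring.
 by rewrite evZ // subrr.
have := congr1 (fun p : {poly C} => p`_1) E; rewrite coefCM !(tlineP F _ _).2.
have -> : \sum_j0 w j0*F^`M(j0).@[v] = 0 by apply: big1 => i _; rewrite d mulr0.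
rewrite mulr0 (bigD1 j) //= big1 => [|i ij]; last by rewrite /w (negbTE ij) mulr0 mul0r.
by rewrite /w eqxx mulr1 addr0 => /eqP; rewrite mulf_eq0 (negbTE l0) => /eqP.
Qed.

Lemma l_prop l l' a b w : vform 1 l -> vform 1 l' -> (exists2 u, u i2 = 0 & l u != 0) -> (exists2 u, u i2 = 0 & l' u != 0) ->
 det3 a b w != 0 -> l a = 0 -> l b = 0 -> l' a = 0 -> l' b = 0 -> exists2 lam, lam != 0 & forall v, l' v = lam * l v.
Proof.
move=> vl vl' [u _ lu] [u' _ lu'] D la lb la' lb'.
have E (f : vec -> C) v : vform 1 f -> f a = 0 -> f b = 0 -> f v = det3 a b v/det3 a b w*f w.
 by move=> vf fa fb; rewrite {1}(cramer v D) vform1_lin // fa fb; ring.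
have lw : l w != 0 by apply: contraNneq lu => z; rewrite (E l u vl la lb) z mulr0.
have lw' : l' w != 0 by apply: contraNneq lu' => z; rewrite (E l' u' vl' la' lb') z mulr0.
exists (l' w/l w); first by rewrite mulf_neq0 // invr_eq0.
by move=> v; rewrite (E l v vl la lb) (E l' v vl' la' lb'); move: (_/det3 a b w) => d; field.
Qed.

(** The remaining freedom in the frame: [e2] slides along the line [l = 0], and [e1] moves by a
    multiple of [e0]. *)
Lemma nform_change c l C' e0 e1 e2 m x0 t : vis F c l C' -> nform F c l C' e0 e1 e2 m ->
 nform F c l C' e0 (cmb e0 e1 e2 t 1 0) (cmb e0 e1 e2 x0 0 1)
  (nth 0 [:: m 0%N + m 1%N*x0 + m 3%N*x0^+2; m 1%N + 2 * m 3%N*x0; m 2%N + m 4%N*x0 + t*(m 1%N + 2 * m 3%N*x0);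
   m 3%N; m 4%N + 2*t * m 3%N; m 5%N + t * m 4%N + t^+2 * m 3%N]).
Proof.
move=> [_ vl _ _ _] [fr c0 [l0 [l1 l2]] EC E].
have e0E : e0 = cmb e0 e1 e2 1 0 0 by cmbring.
have ch x y z : cmb e0 (cmb e0 e1 e2 t 1 0) (cmb e0 e1 e2 x0 0 1) x y z = cmb e0 e1 e2 (x + y*t + z*x0) y z.
 by cmbring.
split=> //.
- rewrite {1}e0E; apply: afr_change => //; by rewrite mulr1 mul0r subr0 oner_neq0.
- by rewrite !vform1_lin // l0 l1 l2; split=> //; split; ring.
- by move=> x y z; rewrite ch EC /tform /=; ring.
- by move=> x y z; rewrite ch E /tform /=; ring.
Qed.

Lemma sing_e0 c l C' e0 e1 e2 m : nform F c l C' e0 e1 e2 m -> singular_pt F e0 <-> m 3%N = 0.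
Proof.
move=> [fr c0 _ _ E]; have [_ [_ D]] := afr_perm fr.
pose a := nth 0 [:: m 3%N; m 4%N; m 1%N; m 5%N; m 2%N; m 0%N].
pose k i := c^-1*(sq2 a i + (i == 11%N)%:R).
have Ek x y z : ev (cmb e1 e2 e0 x y z) = tform 4 k x y z.
 have -> : cmb e1 e2 e0 x y z = cmb e0 e1 e2 z x y by cmbring.
 apply: (mulfI c0); rewrite E /tform /cubic_form /quartic_form /k /sq2 /a /=; by field.
apply: iff_trans (singular_frame D Ek) _; rewrite /k /sq2 /a /=; split=> [[/eqP h _ _]|->].
 by move: h; rewrite addr0 mulf_eq0 invr_eq0 (negbTE c0) sqrf_eq0 => /eqP.
by split; ring.
Qed.

(** A zero of the conic on the line [l = 0] is a singular point of the quartic. With none of them at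
    infinity the conic has two affine zeros there, which are transversal and give cusps, or one
    double zero. *)
Lemma vis_cases c l C' : (forall v, singular_pt F v -> v i2 != 0) -> vis F c l C' ->
 (exists R1 R2, [/\ R1 i2 = 1, R2 i2 = 1, R1 <> R2, l R1 = 0 /\ l R2 = 0 &
   [/\ singular_pt F R1, singular_pt F R2, Apt F 3 R1 & Apt F 3 R2]]) \/
 (exists e0 e1 e2 m, [/\ nform F c l C' e0 e1 e2 m, singular_pt F e2, m 0%N = 0, m 1%N = 0 & m 4%N = 0 /\ m 3%N != 0]).
Proof.
move=> NS V; have [e0 [e1 [e2 [fr l0 l1 l2]]]] := vis_frame V; have [m N] := vis_nform_of V fr l0 l1 l2.
have [h0 h1 h2 D] := fr; have [c0 vl _ _ _] := V.
have m3 : m 3%N != 0.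
 by apply/eqP => z; have := NS e0 (proj2 (sing_e0 N) z); rewrite h0 eqxx.
have two0 : (2 : C) != 0 by rewrite pnatr_eq0.
have [s s2] := csqrt (m 1%N^+2 - 4 * m 0%N * m 3%N).
have rt x : (2 * m 3%N*x + m 1%N)^+2 = s^+2 -> tform 2 m x 0 1 = 0.
 rewrite s2 => /eqP; rewrite -subr_eq0 => /eqP h; have m4 : 4 * m 3%N != 0 by rewrite mulf_neq0 ?pnatr_eq0.
 by apply: (mulfI m4); rewrite mulr0 -[RHS]h /tform; ring.
have sg x : tform 2 m x 0 1 = 0 -> singular_pt F (cmb e0 e1 e2 x 0 1).
 by move=> z; apply/(sing_nform x 0 N); rewrite z; split; ring.
have [s0|s0] := eqVneq s 0.
 (* [x0] centres the frame at the double zero, and [t] removes the mixed coefficient [m 4]. *)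
 right; pose x0 := - m 1%N/(2 * m 3%N); pose t := - m 4%N/(2 * m 3%N).
 have z : tform 2 m x0 0 1 = 0 by apply: rt; rewrite s0 /x0; field.
 do 4 eexists; split; first exact: (nform_change x0 t V N).
 - exact: sg.
 - by rewrite -[RHS]z /tform /=; ring.
 - by rewrite /= /x0; field.
 - by split => //; rewrite /= /t; field.
left.
have cu x : (2 * m 3%N*x + m 1%N)^+2 = s^+2 -> Apt F 3 (cmb e0 e1 e2 x 0 1).
 move=> h; have z := rt x h; have N' := nform_change x 0 V N; set e2' := cmb e0 e1 e2 x 0 1 in N' *.
 set e1' := cmb e0 e1 e2 0 1 0 in N'; set m' := nth 0 _ in N'; have [fr' _ _ _ E'] := N'; have [D' _] := afr_perm fr'.
 have m'1 : m' 1%N = 2 * m 3%N*x + m 1%N by rewrite /m' /=; ring.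
 have m'0 : m' 0%N = 0 by rewrite -[RHS]z /m' /tform /=; ring.
 apply: (cusp_vis (c0 := c) (T := fun q => tform 2 m' q.1 q.2 1) (t1 := m' 1%N) (t2 := m' 2%N)
  (g1 := fun q => m' 3%N*q.1 + m' 4%N*q.2) (g2 := fun q => m' 5%N*q.2) (w := fun=> 1) D' c0); try by sdauto.
 - by pring.
 - by pring.
 - exact: oner_neq0.
 - by move=> q; rewrite /tform m'0; ring.
 - by rewrite m'1 -sqrf_eq0 h sqrf_eq0.
 - by move=> q; rewrite cmb_e2 E'; ring.
pose x1 := (- m 1%N + s)/(2 * m 3%N); pose x2 := (- m 1%N - s)/(2 * m 3%N).
have r1 : (2 * m 3%N*x1 + m 1%N)^+2 = s^+2 by rewrite /x1; field.
have r2 : (2 * m 3%N*x2 + m 1%N)^+2 = s^+2 by rewrite /x2; field.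
exists (cmb e0 e1 e2 x1 0 1), (cmb e0 e1 e2 x2 0 1); split.
- by rewrite /cmb h0 h1 h2; ring.
- by rewrite /cmb h0 h1 h2; ring.
- case/(cmb_inj D) => xx _ _; move/eqP: xx; rewrite -subr_eq0 (_ : x1 - x2 = s/m 3%N); last by rewrite /x1 /x2; field.
 by rewrite mulf_eq0 (negbTE s0) invr_eq0 (negbTE m3).
- by rewrite !vform1_lin // l0 l1 l2; split; ring.
- by split; [exact: sg (rt _ r1)|exact: sg (rt _ r2)|exact: cu|exact: cu].
Qed.

(** The equations for a second affine singular point force [4 m2 m5 = -1], and then the quartic is
    reducible. *)
Lemma double_alone c l C' e0 e1 e2 m v : nform F c l C' e0 e1 e2 m -> m 0%N = 0 -> m 1%N = 0 -> m 4%N = 0 -> m 3%N != 0 ->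
 singular_pt F v -> v i2 = 1 -> v = e2.
Proof.
move=> N m0 m1 m4 m3 sv v2; have [fr c0 _ _ E] := N; have [h0 h1 h2 D] := fr.
have [x [y vE]] := afr_span fr v2; rewrite vE in sv *.
have [q1 q2 q3] := (sing_nform x y N).1 sv.
have TE : tform 2 m x y 1 = m 2%N*y + m 3%N*x^+2 + m 5%N*y^+2 by rewrite /tform m0 m1 m4; ring.
have two0 : (2 : C) != 0 by rewrite pnatr_eq0.
have [T0|T0] := eqVneq (tform 2 m x y 1) 0.
 have y0 : y = 0 by move/eqP: q1; rewrite T0 expr0n add0r expf_eq0 => /eqP.
 move/eqP: T0; rewrite TE y0 !(mulr0, expr0n, addr0, add0r) mulf_eq0 (negbTE m3) sqrf_eq0 => /eqP x0.
 by rewrite x0; cmbring.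
have x0 : x = 0.
 by move/eqP: q2; rewrite m1 m4 add0r mul0r addr0 !mulf_eq0 (negbTE two0) (negbTE T0) (negbTE m3) /= => /eqP.
have y0 : y != 0 by apply: contraNneq T0 => y0; rewrite TE x0 y0; apply/eqP; ring.
pose u := m 2%N + m 5%N*y; have TE' : tform 2 m x y 1 = y*u by rewrite TE x0 /u; ring.
have u0 : u != 0 by apply: contraNneq T0 => z; rewrite TE' z mulr0.
have u2 : u^+2 = - y.
 by apply: (mulfI (expf_neq0 2 y0)); apply: subr0_eq; rewrite -[RHS]q1 TE'; ring.
have u5 : u = 2 * m 5%N*y.
 apply: (mulfI u0); apply: (mulfI y0); apply/eqP; rewrite eq_sym -subr_eq0 -[X in _ == X]q3 TE' m4; apply/eqP.
 have -> : 3*y^+2 = - 3*y*(u^+2) by rewrite u2; ring.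
 by rewrite /u; ring.
have m2E : m 2%N = m 5%N*y by move: u5; rewrite /u => /eqP; rewrite -subr_eq0 => /eqP h; apply: subr0_eq; rewrite -[RHS]h; ring.
have m25 : 4 * m 2%N * m 5%N = -1.
 apply: (mulfI y0); rewrite mulrN1 -u2 u5 m2E; ring.
(* Changing the sign of [m5] in the conic absorbs [z y^3] and leaves [4 m3 m5 x^2 y^2]: a difference
   of two squares. *)
have [a a2] := csqrt (- 4 * m 3%N * m 5%N).
exfalso; apply: (irr_frameZ irr D c0 (g := fun x y z => m 3%N*x^+2 + m 2%N*y*z - m 5%N*y^+2 + a*x*y)
  (h := fun x y z => m 3%N*x^+2 + m 2%N*y*z - m 5%N*y^+2 - a*x*y)); try (by pfauto); try ring.
move=> X Y Z; rewrite E /tform m0 m1 m4.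
have -> : Z*Y^+3 = - (4 * m 2%N * m 5%N)*(Z*Y^+3) by rewrite m25 opprK mul1r.
have -> : (m 3%N*X^+2 + m 2%N*Y*Z - m 5%N*Y^+2 + a*X*Y)*(m 3%N*X^+2 + m 2%N*Y*Z - m 5%N*Y^+2 - a*X*Y) =
 (m 3%N*X^+2 + m 2%N*Y*Z - m 5%N*Y^+2)^+2 - a^+2*X^+2*Y^+2 by ring.
by rewrite a2; ring.
Qed.

(* The tangent direction [e0] meets the curve at [e2] with multiplicity four, which forces any other line [l'] through it. *)
Lemma double_unique c l C' e0 e1 e2 m c' l' C1 e0' e1' m' : vis F c l C' -> vis F c' l' C1 ->
 nform F c l C' e0 e1 e2 m -> m 0%N = 0 -> m 1%N = 0 -> m 4%N = 0 ->
 nform F c' l' C1 e0' e1' e2 m' -> m' 0%N = 0 -> m' 1%N = 0 -> m' 4%N = 0 ->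
 exists2 lam, lam != 0 & forall v, l' v = lam * l v.
Proof.
move=> V V' N m0 m1 m4 N' m0' m1' m4'.
have [fr c0 [l0 [l1 l2]] _ E] := N; have [fr' c0' [l0' [l1' l2']] _ E'] := N'.
have [_ vl _ nl _] := V; have [_ vl' _ nl' _] := V'.
have [h0 h1 h2 D] := fr; have [h0' h1' h2' D'] := fr'.
have [x [y e0E]] := afr_span fr' h0.
have ly : l' e0 = y by rewrite e0E vform1_lin // l0' l1' l2'; ring.
have PE : Poly [:: 0; 0; m' 2%N^+2*y^+2; 2 * m' 2%N*y*(m' 3%N*x^+2 + m' 5%N*y^+2) + y^+3;
  (m' 3%N*x^+2 + m' 5%N*y^+2)^+2 - c'/c * m 3%N^+2] = 0.
 apply: polyfun0 => s; rewrite horner_Poly /=.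
 have ea : c*ev (cmb e0 e1 e2 s 0 1) = (m 3%N*s^+2)^+2 by rewrite E /tform m0 m1 m4; ring.
 have eb : c'*ev (cmb e0' e1' e2 (s*x) (s*y) 1) = (s * m' 2%N*y + s^+2*(m' 3%N*x^+2 + m' 5%N*y^+2))^+2 + s^+3*y^+3.
  by rewrite E' /tform m0' m1' m4'; ring.
 have ee : cmb e0 e1 e2 s 0 1 = cmb e0' e1' e2 (s*x) (s*y) 1 by rewrite e0E; cmbring.
 rewrite ee in ea; transitivity (c'*ev (cmb e0' e1' e2 (s*x) (s*y) 1) - c'/c*(c*ev (cmb e0' e1' e2 (s*x) (s*y) 1))); last by field.
 by rewrite ea eb; ring.
have co i := congr1 (fun r : {poly C} => r`_i) PE.
have y0 : y = 0.
 have := co 2%N; rewrite coef_Poly coef0 /= -exprMn => /eqP; rewrite sqrf_eq0 => /eqP z.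
 have := co 3%N; rewrite coef_Poly coef0 /= -(mulrA 2) z mulr0 mul0r add0r => /eqP; rewrite expf_eq0 => /eqP //.
rewrite y0 in ly; have [_ [_ D2]] := afr_perm fr.
have D3 : det3 e2 e0 e1 != 0 by have [] := afr_perm fr.
exact: (@l_prop l l' e2 e0 e1).
Qed.

(** If [l p] were nonzero, [Z l^3] would vanish at [p] to first order only, whereas [C'^2] vanishes
    to second order; the sum would be smooth there. *)
Lemma vis_Linf c l C' p : vis F c l C' -> singular_pt F p -> p i2 = 0 -> l p = 0 /\
 exists e1 e2 m, nform F c l C' p e1 e2 m /\ m 3%N = 0.
Proof.
move=> V sp p2; have [e0 [e1 [e2 [fr l0 l1 l2]]]] := vis_frame V.
have [c0 vl _ _ _] := V; have [h0 h1 h2 D] := fr; have [s [t pE]] := afr_span fr p2.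
have lt : l p = t by rewrite pE vform1_lin // l0 l1 l2; ring.
have lp : l p = 0.
 rewrite lt; apply/eqP/negPn/negP => t0; pose e1' := cmb e0 e1 e2 (s/t) 1 0.
 have e1E : (fun j => t^-1 * p j) = e1' by rewrite pE; apply/funext => j; rewrite /e1' /cmb; field.
 have fr' : afr e0 e1' e2.
  split=> //; first by rewrite /e1' /cmb h0 h1; ring.
  by rewrite (_ : det3 _ _ _ = det3 e0 e1 e2) // /det3 /e1' /cmb; ring.
 have l1' : l e1' = 1 by rewrite /e1' vform1_lin // l0 l1 l2; ring.
 have [m [_ _ _ _ E]] := vis_nform_of V fr' l0 l1' l2; have [D1 _] := afr_perm fr'.
 pose a := nth 0 [:: m 5%N; m 2%N; m 4%N; m 0%N; m 1%N; m 3%N].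
 pose k i := c^-1*(sq2 a i + (i == 1%N)%:R).
 have Ek x y z : ev (cmb e2 e0 e1' x y z) = tform 4 k x y z.
  have -> : cmb e2 e0 e1' x y z = cmb e0 e1' e2 y z x by cmbring.
  by apply: (mulfI c0); rewrite E /tform /cubic_form /quartic_form /k /sq2 /a /=; field.
 have sg : singular_pt F e1' by rewrite -e1E; apply: singularZ; rewrite ?invr_eq0.
 have [/eqP q0 q1 _] := (singular_frame D1 Ek).1 sg; move: q0 q1; rewrite /k /sq2 /a /= addr0 mulf_eq0 invr_eq0 (negbTE c0) sqrf_eq0 => /eqP m5 q1.
 have : c^-1 = 0 by rewrite -[RHS]q1 m5; ring.
 by apply/eqP; rewrite invr_eq0.
split=> //; rewrite -lt lp in pE.
have s0 : s != 0.
 apply/eqP => z; case: sp => -[j] /negP[]; apply/eqP; rewrite pE z /cmb; ring.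
have fr' : afr p e1 e2.
 by split=> //; rewrite pE (_ : det3 _ _ _ = s*det3 e0 e1 e2) ?mulf_neq0 // /det3 /cmb; ring.
have [m N] := vis_nform_of V fr' lp l1 l2; exists e1, e2, m; split=> //.
exact/(sing_e0 N).
Qed.

Lemma vis_inf_root c l C' p e1 e2 m : nform F c l C' p e1 e2 m -> m 3%N = 0 -> m 1%N != 0 ->
 singular_pt F (cmb p e1 e2 (- m 0%N/m 1%N) 0 1).
Proof.
move=> N m3 m1; apply/(sing_nform _ _ N).
have -> : tform 2 m (- m 0%N/m 1%N) 0 1 = 0 by rewrite /tform m3; field.
by split; ring.
Qed.

(** At an affine singular point the [x]-derivative gives [y C' = 0]. Either factor forces the other
    to vanish, so [m 0 = 0] and [l] divides the conic. *)
Lemma vis_inf_none c l C' p e1 e2 m v : nform F c l C' p e1 e2 m -> m 3%N = 0 -> m 1%N = 0 -> m 4%N != 0 ->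
 singular_pt F v -> v i2 != 0 -> False.
Proof.
move=> N m3 m1 m4 sv v2; have [fr c0 _ _ E] := N; have [h0 h1 h2 D] := fr.
have m0 : m 0%N != 0.
 by apply/eqP => m0; apply: (nform_not_div irr N) => x z; rewrite /tform m0 m1 m3; ring.
have [x [y wE]] := afr_span (v := fun j => (v i2)^-1*v j) fr (mulVf v2).
have sw : singular_pt F (fun j => (v i2)^-1*v j) by apply: singularZ; rewrite ?invr_eq0.
rewrite wE in sw; have [t1 t2 t3] := (sing_nform x y N).1 sw.
have TE : tform 2 m x y 1 = m 0%N + y*(m 2%N + m 4%N*x + m 5%N*y) by rewrite /tform m1 m3; ring.
have Tz : y*tform 2 m x y 1 = 0.
 move/eqP: t2; rewrite m1 m3 add0r !mulr0 mul0r add0r !mulf_eq0 pnatr_eq0 (negbTE m4) /=.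
 by case/orP => /eqP ->; rewrite ?mulr0 ?mul0r.
move/eqP: Tz; rewrite mulf_eq0 => /orP[/eqP y0|/eqP T0].
 move/eqP: t1; rewrite TE y0 mul0r addr0 expr0n addr0 sqrf_eq0; exact/negP.
have y0 : y = 0 by move/eqP: t1; rewrite T0 expr0n add0r expf_eq0 => /eqP.
by move: T0; rewrite TE y0 mul0r addr0; exact/eqP.
Qed.

(** On the line [l = 0] the conic is constant, so the quartic has no affine zero there. Along
    another line through [p], with [l'] nonzero on it, the second decomposition has a nonzero term
    of degree two. *)
Lemma vis_inf_unique c l C' c' l' C1 p e1 e2 m e1' e2' m' : vis F c l C' -> vis F c' l' C1 ->
 nform F c l C' p e1 e2 m -> m 3%N = 0 -> m 1%N = 0 ->
 nform F c' l' C1 p e1' e2' m' -> m' 3%N = 0 -> m' 1%N = 0 -> m' 4%N != 0 ->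
 exists2 lam, lam != 0 & forall v, l' v = lam * l v.
Proof.
move=> V V' N m3 m1 N' m3' m1' m4'.
have [fr c0 [l0 [l1 l2]] _ E] := N; have [fr' c0' [l0' [l1' l2']] _ E'] := N'.
have [_ vl _ nl _] := V; have [_ vl' _ nl' _] := V'.
have [h0 h1 h2 D] := fr; have [_ h1' h2' D'] := fr'.
have [x [y e2E]] := afr_span fr' h2.
have ly : l' e2 = y by rewrite e2E vform1_lin // l0' l1' l2'; ring.
pose B := m' 0%N + m' 2%N*y + m' 4%N*x*y + m' 5%N*y^+2.
have PE : Poly [:: B^+2 + y^+3 - c'/c * m 0%N^+2; 2*B * m' 4%N*y; m' 4%N^+2*y^+2] = 0.
 apply: polyfun0 => s; rewrite horner_Poly /=.
 have ea : c*ev (cmb p e1 e2 s 0 1) = m 0%N^+2 by rewrite E /tform m3 m1; ring.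
 have eb : c'*ev (cmb p e1' e2' (s + x) y 1) = (B + m' 4%N*s*y)^+2 + y^+3.
  by rewrite E' /B /tform m3' m1'; ring.
 have ee : cmb p e1 e2 s 0 1 = cmb p e1' e2' (s + x) y 1 by rewrite e2E; cmbring.
 rewrite ee in ea; transitivity (c'*ev (cmb p e1' e2' (s + x) y 1) - c'/c*(c*ev (cmb p e1' e2' (s + x) y 1))); last by field.
 by rewrite ea eb; ring.
have y0 : y = 0.
 have := congr1 (fun r : {poly C} => r`_2) PE; rewrite coef_Poly coef0 /= -exprMn => /eqP.
 by rewrite sqrf_eq0 mulf_eq0 (negbTE m4') => /eqP.
rewrite y0 in ly; have [D1 _] := afr_perm fr.
exact: (@l_prop l l' e2 p e1).
Qed.

End Curve.
End Lines.

(** * Existence of visible decompositions *)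
Section Existence.
Variable R : realType.
Local Notation C := (R[i]).
Local Notation P := (C*C)%type.
Local Notation vec := ('I_3 -> C).
Implicit Types (u v w e : vec).

Lemma four_neq0 : (4 : C) != 0. Proof. by rewrite pnatr_eq0. Qed.
Lemma sqr_signed (a b : C) : a^+2 = b^+2 -> exists2 s : C, s^+2 = 1 & a = s*b.
Proof.
move/eqP; rewrite eqf_sqr => /orP[/eqP ->|/eqP ->].
 by exists 1; rewrite ?expr1n ?mul1r.
by exists (-1); rewrite ?sqrrN ?expr1n ?mulN1r.
Qed.
Lemma rank_one (a b c s : C) : s != 0 -> a = s^+2 -> b^+2 = 4*a*c -> exists2 t, b = 2*s*t & c = t^+2.
Proof.
move=> s0 aE h; exists (b/(2*s)); first by field.
have -> : c = b^+2/(4*s^+2) by rewrite h aE; field.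
by field.
Qed.

Section Curve.
Variable F : {mpoly C[3]}.
Hypothesis irr : irreducible_quartic F.
Local Notation ev v := (F.@[v]).
Let Fh : F \is 4.-homog. Proof. by case: irr. Qed.

Lemma div_y_false e0 e1 e2 k : afr e0 e1 e2 -> fform F e0 e1 e2 k ->
 [/\ k 0%N = 0, k 1%N = 0, k 3%N = 0, k 6%N = 0 & k 10%N = 0] -> False.
Proof.
move=> fr E [k0 k1 k3 k6 k10]; have [_ [D _]] := afr_perm fr.
apply: (irr_frame irr D (g := fun x y z => y) (h := tform 3 (nth 0 [:: k 2%N; k 4%N; k 5%N; k 7%N; k 8%N; k 9%N; k 11%N; k 12%N; k 13%N; k 14%N]))).
- exact: pfun_y.
- exact: pfun_tform.
- by [].
- exact: tform00.
by move=> x y z; rewrite E /tform /cubic_form /quartic_form k0 k1 k3 k6 k10 /=; ring.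
Qed.

Lemma LS_coefs e0 e1 e2 k : LS F -> afr e0 e1 e2 -> fform F e0 e1 e2 k ->
 exists a b d, [/\ k 10%N = a^+2, k 11%N = 2*a*b, k 12%N = b^+2 + 2*a*d, k 13%N = 2*b*d & k 14%N = d^+2].
Proof.
move=> ls [h0 h1 h2 D] E; have [a [b [d Eg]]] := ls e0 e1 h0 h1; exists a, b, d.
have [|q1 q2 q3 q4 q5] := @quartic0 R (k 10%N - a^+2) (k 11%N - 2*a*b) (k 12%N - (b^+2 + 2*a*d)) (k 13%N - 2*b*d) (k 14%N - d^+2).
 move=> x y; transitivity (tform 4 k x y 0 - (a*x^+2 + b*x*y + d*y^+2)^+2); last by rewrite -E Eg subrr.
 by rewrite /tform /quartic_form; ring.
by split; apply/eqP; rewrite -subr_eq0 ?q1 ?q2 ?q3 ?q4 ?q5.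
Qed.

(** Since [e0 = P1 - P0], the points are [(0, 0, 1)] and [(1, 0, 1)]. The zero discriminants at both
    and the square at infinity determine every coefficient of the quartic modulo [z y^3]. *)
Lemma exist_two P0 P1 : LS F -> P0 i2 = 1 -> P1 i2 = 1 -> P0 <> P1 -> singular_pt F P0 -> singular_pt F P1 ->
 ~ Apt F 2 P0 -> ~ Apt F 2 P1 -> exists c l C', vis F c l C' /\ l P0 = 0 /\ l P1 = 0.
Proof.
move=> ls z0 z1 n01 s0 s1 na0 na1.
have [e1 [fr fr1]] := aff_pair z0 z1 n01; set e0 : vec := fun j => P1 j - P0 j in fr fr1.
have [_ [D _]] := afr_perm fr; have [k E] := frame_form Fh e0 e1 P0.
have [k0 k1 k2 dd0] := vertex D E s0 na0.
have [a [b [d [k10 k11 k12 k13 k14]]]] := LS_coefs ls fr E.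
have [_ [D1 _]] := afr_perm fr1.
pose k' := nth 0 [:: k 3%N + k 6%N + k 10%N; 2*k 3%N + 3*k 6%N + 4*k 10%N; k 4%N + k 7%N + k 11%N;
  k 3%N + 3*k 6%N + 6*k 10%N; k 4%N + 2*k 7%N + 3*k 11%N; k 5%N + k 8%N + k 12%N;
  k 6%N + 4*k 10%N; k 7%N + 3*k 11%N; k 8%N + 2*k 12%N; k 9%N + k 13%N; k 10%N; k 11%N; k 12%N; k 13%N; k 14%N].
have E1 x y z : ev (cmb e0 e1 P1 x y z) = tform 4 k' x y z.
 have -> : cmb e0 e1 P1 x y z = cmb e0 e1 P0 (x + z) y z by apply/funext => j; rewrite /cmb /e0; ring.
 by rewrite E /tform /cubic_form /quartic_form /k' /= k0 k1 k2; ring.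
have [q0 q1 q2 dd1] := vertex D1 E1 s1 na1.
have k3 : k 3%N = a^+2.
 apply: subr0_eq; transitivity (3*k' 0%N - k' 1%N); last by rewrite q0 q1; ring.
 by rewrite /k' /= k10; ring.
have k6 : k 6%N = - 2*a^+2.
 apply: subr0_eq; transitivity (k' 1%N - 2*k' 0%N); last by rewrite q0 q1; ring.
 by rewrite /k' /= k10; ring.
have a0 : a != 0.
 by apply/eqP => a0; apply: (div_y_false fr E); rewrite k0 k1 k3 k6 k10 a0; split; ring.
have [s k4 k5] := rank_one a0 k3 dd0.
have k7 : k 7%N = - 2*a*s - 2*a*b.
 by apply: subr0_eq; rewrite -[RHS]q2 /k' /= k4 k11; ring.
have k8 : k 8%N = - 2*b*s - 2*a*d.
 move: dd1; rewrite /k' /= k3 k6 k10 k4 k7 k11 k5 k12 => h.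
 have a4 : 4*a^+2 != 0 by rewrite mulf_neq0 ?four_neq0 ?expf_neq0.
 apply: (mulfI a4); apply: subr0_eq.
 transitivity (4*(a^+2 + 3*(- 2*a^+2) + 6*a^+2)*(s^+2 + k 8%N + (b^+2 + 2*a*d)) -
   (2*a*s + 2*(- 2*a*s - 2*a*b) + 3*(2*a*b))^+2); first by ring.
 by rewrite h subrr.
(* The conic whose square is the quartic modulo [z y^3]; it vanishes at both points. *)
pose m := nth 0 [:: 0; - a; - s; a; b; d].
have EV x y z : 1*ev (cmb e0 e1 P0 x y z) = tform 2 m x y z^+2 + (k 9%N + 2*d*s)*(z*y^+3).
 by rewrite E /tform /cubic_form /quartic_form /m /= k0 k1 k2 k3 k4 k5 k6 k7 k8 k10 k11 k12 k13 k14; ring.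
have [l [C' [V l0]]] := mkvis irr fr (oner_neq0 C) EV; exists 1, l, C'; split=> //; split.
 by have -> : P0 = cmb e0 e1 P0 0 0 1 by cmbring.
by have -> : P1 = cmb e0 e1 P0 1 0 1 by apply/funext => j; rewrite /cmb /e0; ring.
Qed.

(** The first obstruction to the form conic squared plus a multiple of [z y^3] decides the type: a
    term [x^3] gives [A_2], a nondegenerate quadratic in [y] and [x^2] gives [A_3], a term [x y^2]
    gives [A_4]. Without obstruction the point is [A_5]. *)
Lemma exist_double e0 e1 e2 k : LS F -> afr e0 e1 e2 -> fform F e0 e1 e2 k ->
 k 0%N = 0 -> k 1%N = 0 -> k 2%N = 0 -> k 3%N = 0 -> k 4%N = 0 -> k 5%N != 0 ->
 [\/ Apt F 3 e2, Apt F 4 e2, Apt F 5 e2 | Apt F 6 e2 /\ exists c l C', vis F c l C'].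
Proof.
move=> ls fr E k0 k1 k2 k3 k4 k5.
have [D [D' _]] := afr_perm fr; have [r r2] := csqrt (k 5%N)^-1.
have r0 : r != 0 by rewrite -sqrf_eq0 r2 invr_eq0.
have [a [b [d [k10 k11 k12 k13 k14]]]] := LS_coefs ls fr E.
pose c := (k 5%N)^-1; have c0 : c != 0 by rewrite invr_eq0.
have D1 : (1 : C)*1 - 0*0 != 0 by rewrite mulr1 mulr0 subr0 oner_neq0.
pose p0 := c*k 6%N; pose p1 := c*k 7%N; pose p2 := c*k 8%N; pose p3 := c*k 9%N.
have E1 g0 g1 g2 x y z : g0^+2 = c*a^+2 -> g0*g1 = c*a*b -> g1^+2 + 2*g0*g2 = c*(b^+2 + 2*a*d) ->
  g1*g2 = c*b*d -> g2^+2 = c*d^+2 ->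
  c*ev (cmb e0 e1 e2 x y z) = z^+2*y^+2 + z*cubic_form p0 p1 p2 p3 x y + (g0*x^+2 + g1*x*y + g2*y^+2)^+2.
 move=> G1 G2 G3 G4 G5.
 have -> : (g0*x^+2 + g1*x*y + g2*y^+2)^+2 = g0^+2*x^+4 + 2*(g0*g1)*x^+3*y + (g1^+2 + 2*g0*g2)*x^+2*y^+2
  + 2*(g1*g2)*x*y^+3 + g2^+2*y^+4 by ring.
 rewrite G1 G2 G3 G4 G5 E /tform /cubic_form /quartic_form k0 k1 k2 k3 k4 k10 k11 k12 k13 k14 /p0 /p1 /p2 /p3 /c; by field.
have G sg : sg^+2 = 1 -> [/\ (sg*r*a)^+2 = c*a^+2, (sg*r*a)*(sg*r*b) = c*a*b,
  (sg*r*b)^+2 + 2*(sg*r*a)*(sg*r*d) = c*(b^+2 + 2*a*d), (sg*r*b)*(sg*r*d) = c*b*d & (sg*r*d)^+2 = c*d^+2].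
 by move=> s1; rewrite /c -r2; split; rewrite -[in RHS](mul1r (r^+2)) -s1; ring.
have [p00|p00] := eqVneq p0 0; last first.
 constructor 1; have [G1 G2 G3 G4 G5] := G 1 (expr1n _ 2); move: G1 G2 G3 G4 G5.
 set g0 := 1*r*a; set g1 := 1*r*b; set g2 := 1*r*d => G1 G2 G3 G4 G5.
 apply: (Apt_local (c0 := c) (X := fst) (Y := snd) (j := 2) (k := 3) (a := fun q => p1 + 2*g0*g1*q.1 + (g1^+2 + 2*g0*g2)*q.2)
  (b := fun q => 1 + p2*q.1 + p3*q.2 + 2*g1*g2*q.1*q.2 + g2^+2*q.2^+2) (c := fun q => p0 + g0^+2*q.1) (u := fun=> 1)
  D c0 isT isT (@sdiff_fst R) (@sdiff_snd R) D1 (erefl _) (erefl _)); try by sdauto.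
 - by rewrite [(_, _).1]/= [(_, _).2]/= (_ : _ + _ = 1) ?oner_neq0 //; ring.
 - exact: oner_neq0.
 - by move=> q; rewrite cmb_e2 (E1 g0 g1 g2) // /cubic_form; ring.
 - by change (p0 + g0^+2*(0 : C) != 0); rewrite mulr0 addr0.
have [dd|dd] := eqVneq (p1^+2) (4*(c*a^+2)); last first.
 constructor 2; have [G1 G2 G3 G4 G5] := G 1 (expr1n _ 2); move: G1 G2 G3 G4 G5.
 set g0 := 1*r*a; set g1 := 1*r*b; set g2 := 1*r*d => G1 G2 G3 G4 G5.
 apply: (Apt_local (c0 := c) (X := fst) (Y := snd) (j := 2) (k := 4) (a := fun q => p1 + 2*g0*g1*q.1 + (g1^+2 + 2*g0*g2)*q.2)
  (b := fun q => 1 + p2*q.1 + p3*q.2 + 2*g1*g2*q.1*q.2 + g2^+2*q.2^+2) (c := fun q => g0^+2) (u := fun=> 1)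
  D c0 isT isT (@sdiff_fst R) (@sdiff_snd R) D1 (erefl _) (erefl _)); try by sdauto.
 - by rewrite [(_, _).1]/= [(_, _).2]/= (_ : _ + _ = 1) ?oner_neq0 //; ring.
 - exact: oner_neq0.
 - by move=> q; rewrite cmb_e2 (E1 g0 g1 g2) // /cubic_form p00; ring.
 - rewrite eqxx [(_, _).1]/= [(_, _).2]/= G1; apply: contraNneq dd => z; rewrite -subr_eq0 -[X in _ == X]z; apply/eqP; ring.
(* The discriminant fixes [p1] up to sign. The sign moves into the coefficients [g], whose square at
   infinity is unaffected. *)
have [sg s1 pE] : exists2 sg : C, sg^+2 = 1 & p1 = sg*(2*(r*a)).
 by apply: sqr_signed; rewrite dd /c -r2; ring.
have [G1 G2 G3 G4 G5] := G sg s1; move: G1 G2 G3 G4 G5.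
set g0 := sg*r*a; set g1 := sg*r*b; set g2 := sg*r*d => G1 G2 G3 G4 G5.
have {}pE : p1 = 2*g0 by rewrite pE /g0; ring.
pose n0 := p2 - 2*g1; pose n1 := p3 - 2*g2.
have E2 x y z : c*ev (cmb e0 e1 e2 x y z) = (y*z + (g0*x^+2 + g1*x*y + g2*y^+2))^+2 + z*y^+2*(n0*x + n1*y).
 by rewrite (E1 g0 g1 g2) // /cubic_form p00 pE /n0 /n1; ring.
clearbody g0 g1 g2 n0 n1.
have g00 : g0 != 0.
 apply/eqP => g00; apply: (irr_frameZ irr D' c0 (g := fun x y z => y) (h := fun x y z => y*((z + g1*x + g2*y)^+2 + z*(n0*x + n1*y)))).
 - exact: pfun_y.
 - by pfauto.
 - by [].
 - by ring.
 by move=> x y z; rewrite E2 g00; ring.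
(* [Y = y Be + g0 x^2]. Multiplying by the unit [Be^3] allows [y] to be eliminated in favour of
   [Y]. *)
pose Be (q : P) := 1 + g1*q.1 + g2*q.2; pose Y (q : P) := q.2 + (g0*q.1^+2 + g1*q.1*q.2 + g2*q.2^+2).
have sB : sd Be by rewrite /Be; sdauto. have B0 : Be (0, 0) = 1 by rewrite /Be [(_, _).1]/= [(_, _).2]/=; ring.
have sY0 : sd Y by rewrite /Y; sdauto.
have sY : sdiff Y 0 1.
 apply: (@sdiff_lin0 R _ (fun q => g0*q.1 + g1*q.2) (fun q => g2*q.2)); try by sdauto.
 - by pring.
 - by pring.
 by move=> q; rewrite /Y; ring.
have Y0 : Y (0, 0) = 0 by rewrite /Y [(_, _).1]/= [(_, _).2]/=; ring.
have [n00|n00] := eqVneq n0 0; last first.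
 constructor 3; pose M (q : P) := n0*Be q - n1*g0*q.1; have sM : sd M by rewrite /M; sdauto.
 apply: (Apt_local (c0 := c) (X := fst) (Y := Y) (j := 3) (k := 5) (a := fun q => - 2*g0*M q + g0^+2*n1*q.1)
  (b := fun q => Be q^+3 + q.1*M q + n1*Y q - 2*g0*n1*q.1^+2) (c := fun q => g0^+2*M q) (u := fun q => Be q^+3)
  D c0 isT isT (@sdiff_fst R) sY D1 (erefl _) Y0); try by sdauto.
 - by rewrite B0 Y0 [(_, _).1]/= (_ : _ - _ = 1) ?oner_neq0 //; ring.
 - by rewrite B0 expr1n oner_neq0.
 - by move=> q; rewrite cmb_e2 E2 /M /Y /Be; ring.
 - by change (g0^+2*M (0, 0) != 0); rewrite /M B0 [(_, _).1]/= mulr0 subr0 mulr1 mulf_neq0 ?expf_neq0.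
have n10 : n1 != 0.
 apply/eqP => n10; pose g := fun x y z : C => y*z + (g0*x^+2 + g1*x*y + g2*y^+2).
 apply: (irr_frameZ irr D' c0 (g := g) (h := g)); rewrite /g; try (by pfauto); try ring.
 by move=> x y z; rewrite E2 n00 n10; ring.
constructor 4; split.
 apply: (Apt_local (c0 := c) (X := fst) (Y := Y) (j := 3) (k := 6) (a := fun q => 3*n1*g0^+2*q.1)
  (b := fun q => Be q^+3 + n1*(Y q - 3*g0*q.1^+2)) (c := fun q => - n1*g0^+3) (u := fun q => Be q^+3)
  D c0 isT isT (@sdiff_fst R) sY D1 (erefl _) Y0); try by sdauto.
 - by rewrite B0 Y0 [(_, _).1]/= (_ : _ + _ = 1) ?oner_neq0 //; ring.
 - by rewrite B0 expr1n oner_neq0.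
 - by move=> q; rewrite cmb_e2 E2 n00 /Y /Be; ring.
 - rewrite eqxx B0 Y0 [(_, _).1]/= (_ : _ - _ = 4*(n1*g0^+3)); last by ring.
  by rewrite !mulf_neq0 ?expf_neq0 ?four_neq0.
have [|l [C' [V _]]] := @mkvis R F irr e0 e1 e2 c (nth 0 [:: 0; 0; 1; g0; g1; g2]) n1 fr c0; last by exists c, l, C'.
by move=> x y z; rewrite E2 n00 /tform /=; ring.
Qed.

Lemma mkvis1 e0 e1 e2 (m : nat -> C) ga : afr e0 e1 e2 ->
 (forall x y z, ev (cmb e0 e1 e2 x y z) = tform 2 m x y z^+2 + ga*(z*y^+3)) -> exists c l C', vis F c l C'.
Proof.
move=> fr E; have [|l [C' [V _]]] := @mkvis R F irr e0 e1 e2 1 m ga fr (oner_neq0 _); last by exists 1, l, C'.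
by move=> x y z; rewrite mul1r E.
Qed.

(** The frame directs [e0] along a zero of the quadratic part, which then reduces to [k5 y^2]. If
    [k5 = 0], type [A_5] is impossible, and type [E_6] makes the cubic part [h y^3] in a suitable
    frame; the rest is a square by the condition at infinity. *)
Lemma exist_single s P0 : LS F -> P0 i2 = 1 -> singular_pt F P0 -> has_type F P0 s ->
 s <> A 1 -> s <> A 2 -> s <> A 3 -> s <> A 4 -> (s = E6 \/ s = A 5) -> exists c l C', vis F c l C'.
Proof.
move=> ls z0 s0 ht n1 n2 n3 n4 sE.
have na k : (1 < k < 7)%N -> Apt F k P0 -> s = A k.-1.
 by move=> kk ap; apply: (Apt_type irr kk ap ht (oner_neq0 C)) => j; rewrite mul1r.
pose E0 := pt (1 : C) 0 0; pose E1 := pt 0 (1 : C) 0.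
have fr0 : afr E0 E1 P0 by apply: afr_Linf => //; rewrite /E0 /E1 /pt /= mulr1 mulr0 subr0 oner_neq0.
have [k' E'] := frame_form Fh E0 E1 P0.
have [p [q [p' [q' [d rt]]]]] := quad_dir (k' 3%N) (k' 4%N) (k' 5%N).
have fr := @afr_change R E0 E1 P0 p q p' q' 0 0 fr0; rewrite (mulrC q p') in fr; have {}fr := fr d.
have P0E : cmb E0 E1 P0 0 0 1 = P0 by cmbring.
rewrite P0E in fr; set e0 := cmb E0 E1 P0 p q 0 in fr; set e1 := cmb E0 E1 P0 p' q' 0 in fr.
have [_ [D _]] := afr_perm fr; have [k E] := frame_form Fh e0 e1 P0.
have [k0 k1 k2 d4] := vertex D E s0 (fun ap => n1 (na 2%N isT ap)).
have [_ [D0 _]] := afr_perm fr0; have [k0' k1' k2'] := (singular_frame D0 E').1 s0.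
have k3 : k 3%N = 0.
 have PE : Poly [:: 0; 0; k 3%N; k 6%N - cub k' p q;
   k 10%N - qua k' p q] = 0.
  apply: polyfun0 => t; rewrite horner_Poly /=; transitivity (tform 4 k t 0 1 - tform 4 k' (t * p) (t*q) 1).
   rewrite /tform k0 k1 k2 k0' k1' k2' /cubic_form /quartic_form.
   transitivity (k 3%N*t^+2 + k 6%N*t^+3 + k 10%N*t^+4 - t^+2*(k' 3%N * p^+2 + k' 4%N * p*q + k' 5%N*q^+2) -
    t^+3*cub k' p q - t^+4*qua k' p q).
    by rewrite rt /cubic_form /quartic_form; ring.
   by rewrite /cubic_form /quartic_form; ring.
  rewrite -E -E' (_ : cmb e0 e1 P0 t 0 1 = cmb E0 E1 P0 (t * p) (t*q) 1) ?subrr //.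
  by rewrite /e0; cmbring.
 by have := congr1 (fun r : {poly C} => r`_2) PE; rewrite coef_Poly coef0.
have k4 : k 4%N = 0 by apply/eqP; rewrite -sqrf_eq0 d4 k3 mulr0 mul0r.
have [k5|k5] := eqVneq (k 5%N) 0; last first.
 case: (exist_double ls fr E k0 k1 k2 k3 k4 k5) => [ap|ap|ap|[ap //]].
 - by case: n2; exact: (na 3%N).
 - by case: n3; exact: (na 4%N).
 - by case: n4; exact: (na 5%N).
(* the quadratic part vanishes: triple point *)
have [a [b [dd [k10 k11 k12 k13 k14]]]] := LS_coefs ls fr E.
have EF x y z : ev (cmb e0 e1 P0 x y z) = z*cub k x y +
  qua k x y by rewrite E /tform k0 k1 k2 k3 k4 k5; ring.
have te := germ_at Fh ht (oner_neq0 C) (fun j => esym (mul1r (P0 j))) (proj1 (afr_perm fr)).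
(* A common zero of the cubic and quartic parts gives a line through [P0] contained in the curve. *)
have nc x y : cub k x y = 0 -> qua k x y = 0 -> x = 0 /\ y = 0.
 move=> h3 h4; case: (pselect (x = 0 /\ y = 0)) => // nxy; exfalso.
 have [x' [y' dxy]] : exists x' y', x*y' - y*x' != 0.
  have [x0|x0] := eqVneq x 0; last by exists 0, 1; rewrite mulr1 mulr0 subr0.
  exists (-1), 0; rewrite mulr0 sub0r mulrN1 opprK; apply/eqP => y0; exact: nxy.
 have fr' := @afr_change R e0 e1 P0 x y x' y' 0 0 fr dxy.
 have [kk EE] := frame_form Fh (cmb e0 e1 P0 x y 0) (cmb e0 e1 P0 x' y' 0) (cmb e0 e1 P0 0 0 1).
 have PE (t z : C) : tform 4 kk t 0 z = 0.
  rewrite -EE cmb_cmb EF; transitivity (z*(t^+3*cub k x y) + t^+4*qua k x y).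
   by rewrite /cubic_form /quartic_form; ring.
  by rewrite h3 h4; ring.
 apply: (div_y_false fr' EE).
 have [|h10 h6 h3' h1 h0] := @quartic0 R (kk 10%N) (kk 6%N) (kk 3%N) (kk 1%N) (kk 0%N); last by [].
 by move=> t z; rewrite -[RHS](PE t z) /tform /cubic_form /quartic_form; ring.
have hX (w : P) : (ev (cmb P0 e0 e1 1 w.1 w.2) = 0) <-> cub k w.1 w.2 +
  qua k w.1 w.2 = 0 by rewrite cmb_e2 EF mul1r.
have [tE tA] := triple_point nc hX.
case: sE => sE; rewrite sE in te; last by case: (tA 3%N isT te).
have [a' [b' [c' [d' [h [dt h0 ch]]]]]] := tE te.
have fr' := @afr_change R e0 e1 P0 a' c' b' d' 0 0 fr; rewrite (mulrC c' b') in fr'; have {}fr' := fr' dt.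
pose m := nth 0 [:: 0; 0; 0; a*a'^+2 + b*a'*c' + dd*c'^+2; 2*a*a'*b' + b*(a'*d' + b'*c') + 2*dd*c'*d';
  a*b'^+2 + b*b'*d' + dd*d'^+2].
apply: (mkvis1 (m := m) (ga := h) fr') => x y z; rewrite cmb_cmb EF.
have -> : x*0 + y*0 + z*1 = z by ring.
have -> : x*a' + y*b' + z*0 = a'*x + b'*y by ring. have -> : x*c' + y*d' + z*0 = c'*x + d'*y by ring.
by rewrite ch k10 k11 k12 k13 k14 /tform /quartic_form /m /=; ring.
Qed.

(** The zero discriminants at [u] and [P1] make the quartic a square plus [z y^2 (n x + k9 y)]. A
    nonzero [n] would produce a cusp at [u]. *)
Lemma exist_6 u w P1 : two_pts F u w -> singular_pt F u -> P1 i2 = 1 -> singular_pt F P1 ->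
 ~ Apt F 2 u -> ~ Apt F 3 u -> ~ Apt F 2 P1 -> exists c l C', vis F c l C'.
Proof.
move=> [u2 w2 d [q0 q00 Eq]] su z1 s1 nu2 nu3 n1.
have fr : afr u w P1 by exact: afr_Linf.
have [_ [D _]] := afr_perm fr; have [k E] := frame_form Fh u w P1.
have [k0 k1 k2 d1] := vertex D E s1 n1; have [k10 k11 k6 du] := vertex0 fr E su nu2.
have [_ _ k12 k13 k14] : [/\ k 10%N - 0 = 0, k 11%N - 0 = 0, k 12%N - q0^+2 = 0, k 13%N = 0 & k 14%N = 0].
 apply: quartic0 => x y; transitivity (tform 4 k x y 0 - (q0*x*y)^+2); last by rewrite -E Eq subrr.
 by rewrite /tform /quartic_form; ring.
have {}k12 : k 12%N = q0^+2 by apply/eqP; rewrite -subr_eq0 k12.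
have [ka ka2] := csqrt (k 3%N).
have ka0 : ka != 0.
 apply/eqP => z; have k3 : k 3%N = 0 by rewrite -ka2 z expr0n.
 by apply: (div_y_false fr E).
have [s k4 k5] := rank_one ka0 (esym ka2) d1.
have [sg sg1 k7] : exists2 sg : C, sg^+2 = 1 & k 7%N = sg*(2*ka*q0).
 by apply: sqr_signed; rewrite du k12 -ka2; ring.
pose q := sg*q0; have q2 : k 12%N = q^+2 by rewrite /q exprMn sg1 mul1r.
have {}k7 : k 7%N = 2*ka*q by rewrite k7 /q; ring.
have qn : q != 0 by rewrite mulf_neq0 // -sqrf_eq0 sg1 oner_neq0.
clearbody q.
pose n := k 8%N - 2*q*s.
have EE x y z : ev (cmb u w P1 x y z) = (ka*x*z + q*x*y + s*y*z)^+2 + z*y^+2*(n*x + k 9%N*y).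
 by rewrite E /tform /cubic_form /quartic_form k0 k1 k2 k10 k11 k6 k13 k14 q2 k7 k4 k5 -ka2 /n; ring.
have [n0|n0] := eqVneq n 0; last first.
 case: nu3; pose W (p : P) := ka + s * p.1; have sW : sd W by rewrite /W; sdauto.
 pose T (p : P) := ka * p.2 + q * p.1 + s * p.1 * p.2.
 have sT : sdiff T q ka.
  apply: (@sdiff_lin0 R _ (fun p => s * p.2) (fun=> 0)); try by sdauto.
   by rewrite [(_, _).2]/= mulr0.
  by move=> p; rewrite /T; ring.
 apply: (Apt_local (c0 := 1) (X := fst) (Y := T) (j := 2) (k := 3) (a := fun p => n + k 9%N * p.1) (b := W)
  (c := fun p => - q*(n + k 9%N * p.1)) (u := W) D (oner_neq0 _) isT isT (@sdiff_fst R) sT); try by sdauto.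
 - by rewrite mul1r mul0r subr0.
 - by rewrite /T [(_, _).1]/= [(_, _).2]/=; ring.
 - by rewrite /W [(_, _).1]/= mulr0 addr0.
 - by rewrite /W [(_, _).1]/= mulr0 addr0.
 - by move=> p; rewrite EE /W /T; ring.
 - by change (- q*(n + k 9%N*(0 : C)) != 0); rewrite mulr0 addr0 mulf_neq0 ?oppr_eq0.
apply: (mkvis1 (m := nth 0 [:: 0; ka; s; 0; q; 0]) (ga := k 9%N) fr) => x y z.
by rewrite EE n0 /tform /=; ring.
Qed.

(** Here the only choice left is [k 8]. Unless it completes the square, [u] is a point of type
    [A_3]. *)
Lemma exist_10 u w P1 : one_pt F u w -> singular_pt F u -> P1 i2 = 1 -> singular_pt F P1 ->
 ~ Apt F 2 u -> ~ Apt F 4 u -> ~ Apt F 2 P1 -> exists c l C', vis F c l C'.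
Proof.
move=> [u2 w2 d [q0 q00 Eq]] su z1 s1 nu2 nu4 n1.
have fr : afr u w P1 by exact: afr_Linf.
have [_ [D _]] := afr_perm fr; have [k E] := frame_form Fh u w P1.
have [k0 k1 k2 d1] := vertex D E s1 n1; have [k10 k11 k6 du] := vertex0 fr E su nu2.
have [_ _ k12 k13 k14] : [/\ k 10%N - 0 = 0, k 11%N - 0 = 0, k 12%N = 0, k 13%N = 0 & k 14%N - q0^+2 = 0].
 apply: quartic0 => x y; transitivity (tform 4 k x y 0 - (q0*y^+2)^+2); last by rewrite -E Eq subrr.
 by rewrite /tform /quartic_form; ring.
have {}k14 : k 14%N = q0^+2 by apply/eqP; rewrite -subr_eq0 k14.
have k7 : k 7%N = 0 by apply/eqP; rewrite -sqrf_eq0 du k12 mulr0 mul0r.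
have [ka ka2] := csqrt (k 3%N).
have ka0 : ka != 0.
 apply/eqP => z; have k3 : k 3%N = 0 by rewrite -ka2 z expr0n.
 by apply: (div_y_false fr E).
have [s k4 k5] := rank_one ka0 (esym ka2) d1.
have dd : k 8%N^+2 = (2*ka*q0)^+2.
 apply/eqP; rewrite -subr_eq0; apply/negPn/negP => h; apply: nu4.
 apply: (Apt_local (c0 := 1) (X := fst) (Y := snd) (j := 2) (k := 4) (a := fun p => k 8%N + k 9%N * p.1) (b := fun p => (ka + s * p.1)^+2)
  (c := fun p => q0^+2) (u := fun=> 1) D (oner_neq0 _) isT isT (@sdiff_fst R) (@sdiff_snd R)); try by sdauto.
 - by rewrite mulr1 mulr0 subr0 oner_neq0.
 - by rewrite [(_, _).1]/= mulr0 addr0 expf_neq0.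
 - exact: oner_neq0.
 - by move=> p; rewrite E /tform /cubic_form /quartic_form k0 k1 k2 k10 k11 k6 k7 k12 k13 k14 k4 k5 -ka2; ring.
 - rewrite eqxx [(_, _).1]/=; apply: contraNneq h => z; rewrite -[X in _ == X]z; apply/eqP; ring.
have [sg sg1 k8] := sqr_signed dd.
pose q := sg*q0; have q2 : k 14%N = q^+2 by rewrite /q exprMn sg1 mul1r.
have {}k8 : k 8%N = 2*ka*q by rewrite k8 /q; ring.
apply: (mkvis1 (m := nth 0 [:: 0; ka; s; 0; 0; q]) (ga := k 9%N - 2*q*s) fr) => x y z.
by rewrite E /tform /cubic_form /quartic_form k0 k1 k2 k10 k11 k6 k7 k12 k13 q2 k8 k4 k5 -ka2 /=; ring.
Qed.

(** With the conic as a local coordinate, excluding [A_2] to [A_5] at [u] kills in turn [k1], [c0],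
    [c1] and [c2], leaving [c3 z y^3]. *)
Lemma exist_9 u w : two_pts F u w -> singular_pt F u ->
 ~ Apt F 2 u -> ~ Apt F 3 u -> ~ Apt F 4 u -> ~ Apt F 5 u -> ~ Apt F 6 u -> exists c l C', vis F c l C'.
Proof.
move=> [u2 w2 d [q q0 Eq]] su na2 na3 na4 na5 na6.
pose E2 := pt 0 0 (1 : C).
have coefs e2 k : afr u w e2 -> fform F u w e2 k ->
  [/\ k 10%N = 0, k 11%N = 0, k 6%N = 0, k 12%N = q^+2 & [/\ k 13%N = 0, k 14%N = 0 & k 7%N^+2 = 4*q^+2*k 3%N]].
 move=> fr E; have [k10 k11 k6 d7] := vertex0 fr E su na2.
 have [_ _ k12 k13 k14] : [/\ k 10%N - 0 = 0, k 11%N - 0 = 0, k 12%N - q^+2 = 0, k 13%N = 0 & k 14%N = 0].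
  apply: quartic0 => x y; transitivity (tform 4 k x y 0 - (q*x*y)^+2); last by rewrite -E Eq subrr.
  by rewrite /tform /quartic_form; ring.
 have {}k12 : k 12%N = q^+2 by apply/eqP; rewrite -subr_eq0 k12.
 by split=> //; split=> //; rewrite d7 k12.
have fr0 : afr u w E2 by exact: afr_Linf.
have [k' E'] := frame_form Fh u w E2; have [k10' k11' k6' k12' [k13' k14' k7']] := coefs _ _ fr0 E'.
have [t k7E k3E] := rank_one q0 (erefl _) k7'.
(* Moving [e2] by [t/q] along [w] cancels the coefficient of [x^2 z^2]; the discriminant at [u] then
   cancels that of [x^2 y z]. *)
pose e2 : vec := fun j => E2 j - t/q*w j.
have fr : afr u w e2 by apply: afr_Linf => //; rewrite /e2 w2 mulr0 subr0.
have [_ [D _]] := afr_perm fr; have [k E] := frame_form Fh u w e2.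
have [k10 k11 k6 k12 [k13 k14 k7]] := coefs _ _ fr E.
have k3 : k 3%N = 0.
 have [|_ _ h _ _] := @quartic0 R 0 (k 6%N - (k' 6%N - k' 7%N*(t/q)*0)) (k 3%N) (k 1%N - (k' 1%N - k' 4%N*(t/q) + k' 8%N*(t/q)^+2))
   (k 0%N - (k' 0%N - k' 2%N*(t/q) + k' 5%N*(t/q)^+2 - k' 9%N*(t/q)^+3)); last by [].
 move=> x z; transitivity (tform 4 k x 0 z - tform 4 k' x (- (t/q)*z) z).
  by rewrite /tform /cubic_form /quartic_form k10 k11 k12 k13 k14 k10' k11' k12' k13' k14' k6' k7E k3E; field.
 rewrite -E -E' (_ : cmb u w e2 x 0 z = cmb u w E2 x (- (t/q)*z) z) ?subrr //.
 by apply/funext => j; rewrite /cmb /e2; ring.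
have {}k7 : k 7%N = 0 by apply/eqP; rewrite -sqrf_eq0 k7 k3 mulr0.
have D1 : (0 : C)*0 - 1*1 != 0 by rewrite mulr1 mulr0 sub0r oppr_eq0 oner_neq0.
have k1 : k 1%N = 0.
 apply/eqP/negPn/negP => h; apply: na3.
 apply: (Apt_local (c0 := 1) (X := snd) (Y := fst) (j := 2) (k := 3) (a := fun p => k 4%N + k 2%N * p.2)
  (b := fun p => q^+2 + k 8%N * p.2 + k 5%N * p.2^+2 + k 9%N * p.1 * p.2)
  (c := fun p => k 1%N + k 0%N * p.2) (u := fun=> 1) D (oner_neq0 _) isT isT (@sdiff_snd R) (@sdiff_fst R) D1 (erefl _) (erefl _)); try by sdauto.
 - by rewrite [(_, _).1]/= [(_, _).2]/= (_ : _ + _ = q^+2) ?expf_neq0 //; ring.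
 - exact: oner_neq0.
 - by move=> p; rewrite E /tform /cubic_form /quartic_form k10 k11 k6 k12 k13 k14 k3 k7; ring.
 - by change (k 1%N + k 0%N*(0 : C) != 0); rewrite mulr0 addr0.
pose al := k 4%N/(2*q); pose be := k 8%N/(2*q).
pose c0 := k 0%N - al^+2; pose c1 := k 2%N - 2*al*be; pose c2 := k 5%N - be^+2; pose c3 := k 9%N.
have EE x y z : ev (cmb u w e2 x y z) = (q*x*y + al*z^+2 + be*y*z)^+2 + z*(c0*z^+3 + c1*y*z^+2 + c2*y^+2*z + c3*y^+3).
 by rewrite E /tform /cubic_form /quartic_form k10 k11 k6 k12 k13 k14 k3 k7 k1 /c0 /c1 /c2 /c3 /al /be; field.
clearbody al be c0 c1 c2 c3.
(* In the affine coordinates [(y, z)] at [u] the conic is [Y = y B + al z^2]; the unit [B^3] clears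
   the denominators when [y] is eliminated. *)
pose B (p : P) := q + be * p.2; pose Y (p : P) := q * p.1 + al * p.2^+2 + be * p.1 * p.2.
have sB : sd B by rewrite /B; sdauto. have B0 : B (0, 0) = q by rewrite /B [(_, _).2]/=; ring.
have sY0 : sd Y by rewrite /Y; sdauto.
have sY : sdiff Y q 0.
 apply: (@sdiff_lin0 R _ (fun p => be * p.2) (fun p => al * p.2)); try by sdauto.
 - by pring.
 - by pring.
 by move=> p; rewrite /Y; ring.
have Y0 : Y (0, 0) = 0 by rewrite /Y [(_, _).1]/= [(_, _).2]/=; ring.
pose b (p : P) := B p^+3 + p.2*(c2*B p * p.2 + c3*(Y p - 3*al * p.2^+2)).
have sb : sd b by rewrite /b; sdauto. have b0 : b (0, 0) = q^+3 by rewrite /b B0 Y0 [(_, _).2]/=; ring.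
have D2 : 0*0 - 1*q != 0 by rewrite mul0r mul1r sub0r oppr_eq0.
have loc j kk a cc : (0 < kk)%N -> (kk <= j.*2)%N -> sd a -> sd cc ->
  (forall p : P, B p^+3*ev (cmb u w e2 1 p.1 p.2) = b p*Y p^+2 + p.2^+j*a p*Y p + p.2^+kk*cc p) ->
  (if kk == j.*2 then a (0, 0)^+2 - 4*b (0, 0)*cc (0, 0) != 0 else cc (0, 0) != 0) -> Apt F kk u.
 move=> h1 h2 sa sc EL cd.
 apply: (Apt_local (c0 := 1) (X := snd) (Y := Y) (j := j) (k := kk) (a := a) (b := b) (c := cc) (u := fun p => B p^+3)
  D (oner_neq0 _) h1 h2 (@sdiff_snd R) sY D2 (erefl _) Y0); try by sdauto.
 - by rewrite b0 expf_neq0.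
 - by rewrite B0 expf_neq0.
 - by move=> p; rewrite mul1r EL.
have c00 : c0 = 0.
 apply/eqP/negPn/negP => h; apply: na4.
 apply: (loc 2%N 4%N (fun p => c1*B p^+2 * p.2 - 2*al*c2*B p * p.2^+2 + 3*c3*al^+2 * p.2^+3)
  (fun p => c0*B p^+3 - al*c1*B p^+2 * p.2 + al^+2*c2*B p * p.2^+2 - al^+3*c3 * p.2^+3)) => //; try by sdauto.
 - by move=> p; rewrite EE /b /Y /B; ring.
 - rewrite eqxx b0 B0 [(_, _).2]/= (_ : _ - _ = - 4*c0*q^+6); last by ring.
  by rewrite !mulf_neq0 ?expf_neq0 // oppr_eq0 four_neq0.
have al0 : al != 0.
 apply/eqP => al0; apply: (irr_frame irr D (g := fun x y z => y) (h := fun x y z => y*(q*x + be*z)^+2 + z*(c1*z^+2 + c2*y*z + c3*y^+2))).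
 - exact: pfun_y.
 - by pfauto.
 - by [].
 - by ring.
 by move=> x y z; rewrite EE c00 al0; ring.
have c10 : c1 = 0.
 apply/eqP/negPn/negP => h; apply: na5.
 apply: (loc 3%N 5%N (fun p => c1*B p^+2 - 2*al*c2*B p * p.2 + 3*c3*al^+2 * p.2^+2)
  (fun p => - al*c1*B p^+2 + al^+2*c2*B p * p.2 - al^+3*c3 * p.2^+2)) => //; try by sdauto.
 - by move=> p; rewrite EE c00 /b /Y /B; ring.
 - change (- al*c1*B (0, 0)^+2 + al^+2*c2*B (0, 0)*(0 : C) - al^+3*c3*(0 : C)^+2 != 0).
  rewrite B0 (_ : _ - _ = - al*c1*q^+2); last by ring.
  by rewrite !mulf_neq0 ?expf_neq0 // oppr_eq0.
have c20 : c2 = 0.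
 apply/eqP/negPn/negP => h; apply: na6.
 apply: (loc 3%N 6%N (fun p => - 2*al*c2*B p * p.2 + 3*c3*al^+2 * p.2^+2)
  (fun p => al^+2*c2*B p - al^+3*c3 * p.2)) => //; try by sdauto.
 - by move=> p; rewrite EE c00 c10 /b /Y /B; ring.
 - rewrite eqxx b0 B0 [(_, _).2]/= (_ : _ - _ = - 4*q^+4*al^+2*c2); last by ring.
  by rewrite !mulf_neq0 ?expf_neq0 // oppr_eq0 four_neq0.
apply: (mkvis1 (m := nth 0 [:: al; 0; be; 0; q; 0]) (ga := c3) fr) => x y z.
by rewrite EE c00 c10 c20 /tform /=; ring.
Qed.

End Curve.
End Existence.

(** * The individual configurations *)
Section Types.
Variable R : realType.
Local Notation C := (R[i]).
Local Notation P := (C*C)%type.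
Local Notation vec := ('I_3 -> C).
Implicit Types (u v w e : vec).

Lemma aff_indep (P0 P1 : vec) : P0 i2 = 1 -> P1 i2 = 1 -> P0 <> P1 -> exists w, det3 P0 P1 w != 0.
Proof.
move=> z0 z1 n; have [w [/afr_perm[_ [D _]] _]] := aff_pair z0 z1 n; exists w.
by rewrite (_ : det3 P0 P1 w = det3 (fun j => P1 j - P0 j) w P0) // /det3; ring.
Qed.

Section Curve.
Variable F : {mpoly C[3]}.
Hypothesis irr : irreducible_quartic F.
Local Notation ev v := (F.@[v]).

Lemma has_typeZ v s (l : C) : l != 0 -> has_type F v s -> has_type F (fun j => l*v j) s.
Proof.
move=> l0 [i vi te]; exists i; first by rewrite mulf_neq0.
have e a b : l*v a/(l*v b) = v a/v b by rewrite -mulf_div divff // mul1r.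
suff -> : chart_coord i (fun j => l*v j) = chart_coord i v by [].
by move: {vi te}i; apply: ord3; rewrite /chart_coord /= !e.
Qed.

Local Notation ty ll k := (nth (A 0, false) ll k).

(** A configuration with representatives scaled to last coordinate 1 or 0, so that equality of
    affine points is equality of vectors. *)
Definition cfg ll (ps : nat -> vec) := [/\ forall k, (k < size ll)%N -> [/\ singular_pt F (ps k), has_type F (ps k) (ty ll k).1
  & ps k i2 = if (ty ll k).2 then 0 else 1],
 forall k k', (k < size ll)%N -> (k' < size ll)%N -> k <> k' -> ~ proj_eq (ps k) (ps k')
 & forall v, singular_pt F v -> exists2 k, (k < size ll)%N & proj_eq v (ps k)].

Lemma cfg_norm ll : sing_config F ll -> exists ps, cfg ll ps.
Proof.
move=> [ps [hp hd hs]]; pose sc k : C := if (ty ll k).2 then 1 else (ps k i2)^-1.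
have sc0 k : (k < size ll)%N -> sc k != 0.
 move=> kl; have [_ _ on] := hp k kl; rewrite /sc; case b: (ty ll k).2; first exact: oner_neq0.
 by rewrite invr_eq0; apply/eqP => z; have := on.1 z; rewrite b.
exists (fun k j => sc k * ps k j); split.
- move=> k kl; have [s t on] := hp k kl; split; [exact: (singularZ irr (sc0 k kl) s)|exact: has_typeZ (sc0 k kl) t|].
 rewrite /sc; case b: (ty ll k).2; first by rewrite (on.2 b : ps k i2 = 0) mulr0.
 by rewrite mulVf //; apply/eqP => z; have := on.1 z; rewrite b.
- move=> k k' kl kl' kk [l l0 e]; apply: (hd k k' kl kl' kk); exists (l*sc k'/sc k).
  by rewrite !mulf_neq0 ?sc0 // invr_eq0 sc0.
 by move=> j; apply: (mulfI (sc0 k kl)); rewrite e; field; exact: sc0.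
- move=> v /hs[k kl [l l0 e]]; exists k => //; exists (l/sc k); first by rewrite mulf_neq0 ?invr_eq0 ?sc0.
 by move=> j; rewrite e; field; exact: sc0.
Qed.

Lemma cfg_aff ll ps v : cfg ll ps -> singular_pt F v -> v i2 = 1 -> exists2 k, (k < size ll)%N & (ty ll k).2 = false /\ v = ps k.
Proof.
move=> [hp _ hs] sv v2; have [k kl [l l0 e]] := hs v sv; have [_ _ z] := hp k kl.
exists k => //; have := e i2; rewrite v2 z; case: (ty ll k).2; first by rewrite mulr0 => /eqP; rewrite oner_eq0.
by rewrite mulr1 => l1; split=> //; apply/funext => j; rewrite e -l1 mul1r.
Qed.

Lemma cfg_inf ll ps v : cfg ll ps -> singular_pt F v -> v i2 = 0 -> exists2 k, (k < size ll)%N & (ty ll k).2 /\ proj_eq v (ps k).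
Proof.
move=> [hp _ hs] sv v2; have [k kl [l l0 e]] := hs v sv; have [_ _ z] := hp k kl.
exists k => //; have := e i2; rewrite v2 z; case: (ty ll k).2; first by split=> //; exists l.
by rewrite mulr1 => l1; rewrite -l1 eqxx in l0.
Qed.

Lemma cfg_Apt ll ps k n : cfg ll ps -> (k < size ll)%N -> (1 < n < 7)%N -> Apt F n (ps k) -> (ty ll k).1 = A n.-1.
Proof.
move=> [hp _ _] kl n7 ap; have [_ ht _] := hp k kl.
by apply: (Apt_type irr n7 ap ht (oner_neq0 C)) => j; rewrite mul1r.
Qed.

Lemma cfg_distinct ll ps k k' : cfg ll ps -> (k < size ll)%N -> (k' < size ll)%N -> k <> k' -> ps k <> ps k'.
Proof. by move=> [_ hd _] kl kl' kk e; apply: (hd k k' kl kl' kk); exists 1; [exact: oner_neq0|move=> j; rewrite mul1r e]. Qed.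

(** The three cube roots of [2 mu] give three different affine cusps, each of which must be in the
    list. *)
Lemma inv_cusps ll ps c G2 G3 e0 e1 e2 mu : cfg ll ps -> c != 0 -> afr e0 e1 e2 -> mu != 0 -> inv_nf F c G2 G3 e0 e1 e2 mu ->
 exists (k : nat -> nat) (t : nat -> C), (forall i, [/\ (k i < size ll)%N, ty ll (k i) = (A 2, false), t i^+3 = 2 * mu &
  ps (k i) = cmb e0 e1 e2 (t i) (t i^+2) 1]) /\ [/\ k 0%N != k 1%N, k 0%N != k 2%N & k 1%N != k 2%N].
Proof.
move=> cf c0 fr mu0 E; have [xi x3] := cube_root (2 * mu); have [w [_ w3 w1 [w2 w21]]] := @omega_ex R.
have [h0 h1 h2 D] := fr.
have xi0 : xi != 0 by apply: contraTneq mu0 => z; move: x3; rewrite z expr0n => /esym/eqP; rewrite mulf_eq0 pnatr_eq0 => /eqP->; rewrite eqxx.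
pose t i := xi*w^+i.
have t3 i : t i^+3 = 2 * mu by rewrite exprMn -exprM mulnC exprM w3 expr1n mulr1.
have /choice[k hk] : forall i, exists k, [/\ (k < size ll)%N, ty ll k = (A 2, false) & ps k = cmb e0 e1 e2 (t i) (t i^+2) 1].
 move=> i; have [sg ap] := invisible_cusp c0 fr mu0 E (t3 i).
 have [|k kl [b e]] := cfg_aff cf sg; first by rewrite /cmb h0 h1 h2; ring.
 rewrite e in ap; exists k; split=> //; have := cfg_Apt (n := 3) cf kl isT ap; case: (ty ll k) b => s b /= -> ->; by [].
exists k, t; split=> [i|]; first by have [] := hk i.
have inj i j : k i = k j -> w^+i = w^+j.
 by move=> e; have [_ _ q1] := hk i; have [_ _ q2] := hk j; move: q1; rewrite e q2 => /(cmb_inj D)[/(mulfI xi0)].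
by split; apply/eqP => /inj/esym/eqP; rewrite ?expr0 ?expr1 ?(negbTE w1) ?(negbTE w2) ?(negbTE w21).
Qed.

Lemma no_invisible ll : sing_config F ll -> LS F ->
 (forall k1 k2 k3, (k1 < size ll)%N -> (k2 < size ll)%N -> (k3 < size ll)%N -> k1 != k2 -> k1 != k3 -> k2 != k3 ->
  ty ll k1 = (A 2, false) -> ty ll k2 = (A 2, false) -> ty ll k3 = (A 2, false) -> False) ->
 forall c G2 G3, c != 0 -> vform 2 G2 -> vform 3 G3 -> (forall v, c*v i2^+2*ev v = G2 v^+3 + G3 v^+2) ->
   forall v, v i2 = 0 -> G2 v = 0.
Proof.
move=> sc ls H c G2 G3 c0 v2 v3 ID v vz; apply/eqP/negPn/negP => h; have [ps cf] := cfg_norm sc.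
have ex : exists2 u, u i2 = 0 & G2 u != 0 by exists v.
have [e0 [e1 [e2 [mu [fr mu0 E]]]]] := invisible_nf irr c0 v2 v3 ID ls ex.
have [k [t [hk [n1 n2 n3]]]] := inv_cusps cf c0 fr mu0 E.
by have [a1 b1 _ _] := hk 0%N; have [a2 b2 _ _] := hk 1%N; have [a3 b3 _ _] := hk 2%N; exact: (H _ _ _ a1 a2 a3).
Qed.

Section Cusps.
Variables (ll : seq (sing_type*bool)) (ps : nat -> vec).
Hypothesis cf : cfg ll ps.
Hypothesis allf : forall k, (k < size ll)%N -> (ty ll k).2 = false.

Lemma cfg_NS v : singular_pt F v -> v i2 != 0.
Proof. by move=> sv; apply/eqP => z; have [k kl [b _]] := cfg_inf cf sv z; rewrite allf in b. Qed.

Let aff k : (k < size ll)%N -> ps k i2 = 1.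
Proof. by move=> kl; have [hp _ _] := cf; have [_ _ ->] := hp k kl; rewrite allf. Qed.
Let sng k : (k < size ll)%N -> singular_pt F (ps k).
Proof. by move=> kl; have [hp _ _] := cf; have [] := hp k kl. Qed.

(** The double case of [vis_cases] allows only one affine singular point, by [double_alone]. *)
Lemma vis_two_cusps c l C' : (1 < size ll)%N -> vis F c l C' -> exists k1 k2, [/\ (k1 < size ll)%N, (k2 < size ll)%N, k1 <> k2,
  (ty ll k1).1 = A 2 /\ (ty ll k2).1 = A 2 & l (ps k1) = 0 /\ l (ps k2) = 0].
Proof.
move=> s2 V; case: (vis_cases cfg_NS V) => [[R1 [R2 [r1 r2 n [l1 l2] [s1 s2' a1 a2]]]]|].
 have [k1 kl1 [_ e1]] := cfg_aff cf s1 r1; have [k2 kl2 [_ e2]] := cfg_aff cf s2' r2.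
 exists k1, k2; split => //.
 - by move=> kk; apply: n; rewrite e1 e2 kk.
 - by rewrite e1 in a1; rewrite e2 in a2; split; [exact: (cfg_Apt (n := 3) cf)|exact: (cfg_Apt (n := 3) cf)].
 - by rewrite -e1 -e2.
move=> [e0 [e1 [e2 [m [N _ m0 m1 [m4 m3]]]]]]; exfalso.
have s1 : (0 < size ll)%N by exact: ltnW.
have d0 := double_alone irr N m0 m1 m4 m3 (sng s1) (aff s1).
have d1 := double_alone irr N m0 m1 m4 m3 (sng s2) (aff s2).
by apply: (cfg_distinct cf s1 s2) => //; rewrite d0 d1.
Qed.

(** With one singular point only the double case of [vis_cases] is possible, and both normal forms
    are centred at that point. *)
Lemma single_unique c l C' c' l' C1 : size ll = 1%N -> vis F c l C' -> vis F c' l' C1 ->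
 exists2 lam, lam != 0 & forall v, l' v = lam * l v.
Proof.
move=> s1 V V'.
have one v : singular_pt F v -> v i2 = 1 -> v = ps 0.
 by move=> sv v2; have [k kl [_ ->]] := cfg_aff cf sv v2; rewrite s1 in kl; case: k kl.
have B c2 l2 C2 : vis F c2 l2 C2 -> exists e0 e1 m, [/\ nform F c2 l2 C2 e0 e1 (ps 0) m, m 0%N = 0, m 1%N = 0 & m 4%N = 0].
 move=> V2; case: (vis_cases cfg_NS V2) => [[R1 [R2 [r1 r2 n _ [s1' s2' _ _]]]]|].
  by case: n; rewrite (one _ s1' r1) (one _ s2' r2).
 move=> [e0 [e1 [e2 [m [N se m0 m1 [m4 _]]]]]]; exists e0, e1, m; split => //.
 by have [[_ _ e22 _] _ _ _ _] := N; rewrite -(one _ se e22).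
have [e0 [e1 [m [N m0 m1 m4]]]] := B _ _ _ V; have [e0' [e1' [m' [N' m0' m1' m4']]]] := B _ _ _ V'.
exact: (double_unique V V' N m0 m1 m4 N' m0' m1' m4').
Qed.
End Cusps.

Lemma types_1234 ll : sing_config F ll -> LS F -> ll = [:: (A 2, false); (A 2, false)] \/ ll = [:: (A 2, false); (A 2, false); (A 1, false)] ->
 exists ds, dec_reps (dehom F) 1 ds.
Proof.
move=> sc ls hl; have [ps cf] := cfg_norm sc.
have allf k : (k < size ll)%N -> (ty ll k).2 = false by case: hl => ->; case: k => [|[|[|]]].
have sz : (1 < size ll)%N by case: hl => ->.
have s0 : (0 < size ll)%N by exact: ltnW.
have [hp _ _] := cf; have [sg0 ht0 z0] := hp 0%N s0; have [sg1 ht1 z1] := hp 1%N sz.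
have t0 : (ty ll 0).1 = A 2 by case: hl => ->. have t1 : (ty ll 1).1 = A 2 by case: hl => ->.
rewrite (allf 0%N s0) in z0; rewrite (allf 1%N sz) in z1.
have n01 : ps 0%N <> ps 1%N by apply: (cfg_distinct cf).
apply: one_dec => //.
- have [||c [l [C' [V _]]]] := @exist_two R F irr (ps 0%N) (ps 1%N) ls z0 z1 n01 sg0 sg1.
 + by move=> ap; have := @cfg_Apt ll ps 0 2 cf s0 isT ap; rewrite t0.
 + by move=> ap; have := @cfg_Apt ll ps 1 2 cf sz isT ap; rewrite t1.
 by exists c, l, C'.
- apply: (no_invisible sc ls) => k1 k2 k3; case: hl => -> /=.
  by case: k1 => [|[|]] //; case: k2 => [|[|]] //; case: k3 => [|[|]].
 by case: k1 => [|[|[|]]] //; case: k2 => [|[|[|]]] //; case: k3 => [|[|[|]]].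
have L c l C' : vis F c l C' -> l (ps 0%N) = 0 /\ l (ps 1%N) = 0.
 move=> V; have [k1 [k2 [kl1 kl2 kk [ta tb] [la lb]]]] := vis_two_cusps cf allf sz V.
 move: kl1 kl2 kk ta tb la lb; case: hl => -> /=; first by case: k1 => [|[|]] //; case: k2 => [|[|]].
 by case: k1 => [|[|[|]]] //; case: k2 => [|[|[|]]].
move=> c l C' c' l' C1 V V'; have [a b] := L _ _ _ V; have [a' b'] := L _ _ _ V'.
have [w D] := aff_indep z0 z1 n01; have [_ vl _ nl _] := V; have [_ vl' _ nl' _] := V'.
exact: (l_prop vl vl' nl nl' D).
Qed.

Lemma types_single ll s : sing_config F ll -> LS F -> ll = [:: (s, false)] -> s = E6 \/ s = A 5 ->
 exists ds, dec_reps (dehom F) 1 ds.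
Proof.
move=> sc ls hl hs; have [ps cf] := cfg_norm sc; have [hp _ _] := cf.
have s0 : (0 < size ll)%N by rewrite hl. have [sg ht z] := hp 0%N s0.
have allf k : (k < size ll)%N -> (ty ll k).2 = false by rewrite hl; case: k.
rewrite (allf 0%N s0) in z; rewrite hl /= in ht.
apply: one_dec => //.
- by apply: (exist_single irr ls z sg ht) => //; case: hs => ->.
- apply: (no_invisible sc ls) => k1 k2 k3; rewrite hl /=; by case: k1 => [|] //; case: k2.
- by move=> c l C' c' l' C1; apply: (single_unique cf allf); rewrite hl.
Qed.

Section AtInfinity.
Variables (u w : vec).
Hypotheses (u2 : u i2 = 0) (w2 : w i2 = 0) (dw : u i0*w i1 - u i1*w i0 != 0).

Lemma inf_coords e1 e2 : afr u e1 e2 -> exists a b, b != 0 /\ forall x y e, cmb u e1 e x y 0 = cmb u w (pt 0 0 1) (x + a*y) (b*y) 0.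
Proof.
move=> [_ e12 e22 D]; have fr : afr u w (pt 0 0 1) by exact: afr_Linf.
have [a [b eE]] := afr_span fr e12.
exists a, b; split; last by move=> x y e; rewrite eE; cmbring.
apply: contraNneq D => b0; rewrite eE b0 /det3 /cmb u2 w2; apply/eqP; ring.
Qed.

(** At infinity the conic is [y (m4 x + m5 y)]. With [m4 = 0] the quartic would restrict to a
    multiple of a fourth power and have one zero instead of two. *)
Lemma two_m4 c l C' e1 e2 m q : q != 0 -> (forall e x y, ev (cmb u w e x y 0) = (q*x*y)^+2) ->
 nform F c l C' u e1 e2 m -> m 3%N = 0 -> m 4%N != 0.
Proof.
move=> q0 E N m3; have [fr c0 _ _ En] := N; have [a [b [b0 ce]]] := inf_coords fr; apply/eqP => m4.
have h x : c*(q*(x + a)*b)^+2 = m 5%N^+2.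
 by have := En x 1 0; rewrite ce E mulr1 mulr1 => ->; rewrite /tform m3 m4; ring.
have m5 : m 5%N^+2 = 0 by rewrite -(h (- a)); ring.
have := h (1 - a); rewrite m5 subrK mulr1; apply/eqP; by rewrite !mulf_neq0 ?expf_neq0 ?mulf_neq0.
Qed.

Lemma one_m4 c l C' e1 e2 m q : (forall e x y, ev (cmb u w e x y 0) = (q*y^+2)^+2) ->
 nform F c l C' u e1 e2 m -> m 3%N = 0 -> m 4%N = 0.
Proof.
move=> E N m3; have [fr c0 _ _ En] := N; have [a [b [b0 ce]]] := inf_coords fr.
have [|_ _ h _ _] := @quartic0 R 0 0 (m 4%N^+2) (2 * m 4%N * m 5%N) (m 5%N^+2 - c*(q*b^+2)^+2).
 move=> x y; transitivity (tform 2 m x y 0^+2 + 0*y^+3 - c*ev (cmb u e1 e2 x y 0)); last by rewrite En subrr.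
 by rewrite ce E /tform /quartic_form m3; ring.
by apply/eqP; rewrite -sqrf_eq0 h.
Qed.
End AtInfinity.

Lemma cfg_inf_type ll ps k u n (l : C) : cfg ll ps -> (k < size ll)%N -> l != 0 -> (forall j, u j = l * ps k j) -> (1 < n < 7)%N -> Apt F n u ->
 (ty ll k).1 = A n.-1.
Proof. by move=> [hp _ _] kl l0 hu n7 ap; have [_ ht _] := hp k kl; exact: (Apt_type irr n7 ap ht l0 hu). Qed.

(** The line passes through [u] by [vis_Linf]. As [m 1] is nonzero, the conic has an affine zero on
    it, a singular point, which can only be [P1]. *)
Lemma type_two_line (u w P1 : vec) : u i2 = 0 -> w i2 = 0 -> u i0*w i1 - u i1*w i0 != 0 -> singular_pt F u -> P1 i2 = 1 ->
 (forall v, singular_pt F v -> v i2 = 1 -> v = P1) ->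
 (forall c l C' e1 e2 m, nform F c l C' u e1 e2 m -> m 3%N = 0 -> m 1%N <> 0) ->
 forall c l C' c' l' C1, vis F c l C' -> vis F c' l' C1 -> exists2 lam, lam != 0 & forall v, l' v = lam * l v.
Proof.
move=> u2 w2 d su z1 one m1n.
have L c l C' : vis F c l C' -> l u = 0 /\ l P1 = 0.
 move=> V; have [lu [e1 [e2 [m [N m3]]]]] := vis_Linf irr V su u2; split=> //.
 have m1 : m 1%N != 0 by apply/eqP; exact: (m1n _ _ _ _ _ _ N m3).
 have sr := vis_inf_root N m3 m1; have [[_ h1 h2 _] _ [_ [l1 l2]] _ _] := N.
 rewrite -(one _ sr); last by rewrite /cmb u2 h1 h2; ring.
 by have [_ vl _ _ _] := V; rewrite vform1_lin // lu l1 l2; ring.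
move=> c l C' c' l' C1 V V'; have [a b] := L _ _ _ V; have [a' b'] := L _ _ _ V'.
have fr : afr u w P1 by exact: afr_Linf.
have D : det3 P1 u w != 0 by have [] := afr_perm fr.
have [_ vl _ nl _] := V; have [_ vl' _ nl' _] := V'.
exact: (l_prop vl vl' nl nl' D).
Qed.

Lemma type_6 : sing_config F [:: (A 2, false); (A 3, true)] -> pos_ii F -> exists ds, dec_reps (dehom F) 1 ds.
Proof.
move=> sc po; have [ps cf] := cfg_norm sc; have [hp _ _] := cf.
have [u [w [tp su]]] := pos_ii_two irr po; have ls := two_pts_LS tp; have [u2 w2 d [q q0 Eq]] := tp.
have [sg1 ht1 z1] := hp 0%N isT; rewrite /= in z1.
have [k kl [b [l l0 hl]]] := cfg_inf cf su u2.
have k1 : k = 1%N by move: kl b {hl}; case: k => [|[|]].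
subst k; have ty2 n : (1 < n < 7)%N -> Apt F n u -> A 3 = A n.-1 by move=> n7 ap; exact: (cfg_inf_type cf kl l0 hl n7 ap).
apply: one_dec => //.
- apply: (exist_6 irr tp su z1 sg1).
 + by move=> ap; have := ty2 2%N isT ap.
 + by move=> ap; have := ty2 3%N isT ap.
 + by move=> ap; have := @cfg_Apt _ ps 0 2 cf isT isT ap.
- by apply: (no_invisible sc ls) => k1 k2 k3; case: k1 => [|[|]] //; case: k2 => [|[|]].
apply: (@type_two_line u w (ps 0%N)) => //.
 by move=> v sv v2; have [k' kl' [b' ->]] := cfg_aff cf sv v2; move: kl' b'; case: k' => [|[|]].
move=> c l' C' e1 e2 m N m3 m1; have m4 := two_m4 u2 w2 d q0 Eq N m3.
by apply: (vis_inf_none irr N m3 m1 m4 sg1); rewrite z1 oner_neq0.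
Qed.

Lemma type_10 : sing_config F [:: (A 4, true); (A 2, false)] -> pos_v F -> exists ds, dec_reps (dehom F) 1 ds.
Proof.
move=> sc [u [Qu _ su m4u]]; have [ps cf] := cfg_norm sc; have [hp _ _] := cf.
have [w op] := pos_one irr Qu m4u; have ls := one_pt_LS op; have [u2 w2 d [q q0 Eq]] := op.
have [sg1 ht1 z1] := hp 1%N isT; rewrite /= in z1.
have [k kl [b [l l0 hl]]] := cfg_inf cf su u2.
have k1 : k = 0%N by move: kl b {hl}; case: k => [|[|]].
subst k; have ty2 n : (1 < n < 7)%N -> Apt F n u -> A 4 = A n.-1 by move=> n7 ap; exact: (cfg_inf_type cf kl l0 hl n7 ap).
apply: one_dec => //.
- apply: (exist_10 irr op su z1 sg1).
 + by move=> ap; have := ty2 2%N isT ap.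
 + by move=> ap; have := ty2 4%N isT ap.
 + by move=> ap; have := @cfg_Apt _ ps 1 2 cf isT isT ap.
- by apply: (no_invisible sc ls) => k1 k2 k3; case: k1 => [|[|]] //; case: k2 => [|[|]] //; case: k3 => [|[|]].
apply: (@type_two_line u w (ps 1%N)) => //.
 by move=> v sv v2; have [k' kl' [b' ->]] := cfg_aff cf sv v2; move: kl' b'; case: k' => [|[|]].
move=> c l' C' e1 e2 m N m3 m1; have m4 := one_m4 u2 w2 d Eq N m3.
have [fr c0 _ _ En] := N; have [_ [_ D]] := afr_perm fr.
have D' : det3 e1 u e2 != 0 by rewrite -oppr_eq0 (_ : - det3 e1 u e2 = det3 e1 e2 u) // /det3; ring.
(* With [m1], [m3], [m4] zero the conic does not involve [x], so the quartic is a binary form in [y]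
   and [z]. *)
apply: (@binary_reducible R F irr e1 u e2 (c^-1 * m 5%N^+2) (c^-1*(2 * m 2%N * m 5%N + 1)) (c^-1*(m 2%N^+2 + 2 * m 0%N * m 5%N))
 (c^-1*(2 * m 0%N * m 2%N)) (c^-1 * m 0%N^+2) D') => x y z.
have -> : cmb e1 u e2 x y z = cmb u e1 e2 y x z by cmbring.
by apply: (mulfI c0); rewrite En /tform /quartic_form m1 m3 m4; field.
Qed.

Lemma type_9 : sing_config F [:: (A 6, true)] -> pos_ii F -> exists ds, dec_reps (dehom F) 1 ds.
Proof.
move=> sc po; have [ps cf] := cfg_norm sc.
have [u [w [tp su]]] := pos_ii_two irr po; have ls := two_pts_LS tp; have [u2 w2 d [q q0 Eq]] := tp.
have [k kl [b [l l0 hl]]] := cfg_inf cf su u2.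
have k1 : k = 0%N by move: kl b {hl}; case: k.
subst k; have ty2 n : (1 < n < 7)%N -> ~ Apt F n u.
 by move=> n7 ap; have := cfg_inf_type cf kl l0 hl n7 ap; case: n n7 {ap} => [|[|[|[|[|[|[|]]]]]]].
have NA v : singular_pt F v -> v i2 = 1 -> False.
 by move=> sv v2; have [k' kl' [b' _]] := cfg_aff cf sv v2; move: kl' b'; case: k'.
apply: one_dec => //.
- by apply: (exist_9 irr tp su); apply: ty2.
- by apply: (no_invisible sc ls) => k1 k2 k3; case: k1 => [|] //; case: k2.
move=> c l' C' c' l1 C1 V V'.
have H c2 l2 C2 : vis F c2 l2 C2 -> exists e1 e2 m, [/\ nform F c2 l2 C2 u e1 e2 m, m 3%N = 0, m 1%N = 0 & m 4%N != 0].
 move=> V2; have [lu [e1 [e2 [m [N m3]]]]] := vis_Linf irr V2 su u2; exists e1, e2, m; split=> //; last exact: (two_m4 u2 w2 d q0 Eq N m3).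
 apply/eqP/negPn/negP => m1; have [[_ h1 h2 _] _ _ _ _] := N.
 by apply: (NA _ (vis_inf_root N m3 m1)); rewrite /cmb u2 h1 h2; ring.
have [e1 [e2 [m [N m3 m1 _]]]] := H _ _ _ V; have [e1' [e2' [m' [N' m3' m1' m4']]]] := H _ _ _ V'.
exact: (vis_inf_unique V V' N m3 m1 N' m3' m1' m4').
Qed.

(** The line of a visible decomposition passes through the singular point [u] at infinity. If
    [m 1 = 0], there is no affine singular point, contrary to the [A_4]; if [m 1 != 0], the equation
    at [u] has type [A_3] instead of [A_2]. *)
Lemma type_13 d : sing_config F [:: (A 4, false); (A 2, true)] -> pos_ii F -> ~ torus_dec (dehom F) d.
Proof.
move=> sc po td; have [ps cf] := cfg_norm sc; have [hp _ _] := cf.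
have [u [w [tp su]]] := pos_ii_two irr po; have ls := two_pts_LS tp; have [u2 w2 dd [q q0 Eq]] := tp.
have [sg1 ht1 z1] := hp 0%N isT; rewrite /= in z1.
have [k kl [b [l l0 hl]]] := cfg_inf cf su u2.
have k1 : k = 1%N by move: kl b {hl}; case: k => [|[|]].
subst k; have [c [G2 [G3 [c0 v2 v3 ID De]]]] := dec_forms irr td.
have nv : forall v, v i2 = 0 -> G2 v = 0.
 apply: (no_invisible sc ls _ c0 v2 v3 ID) => k1 k2 k3; case: k1 => [|[|]] //; case: k2 => [|[|]] //; case: k3 => [|[|]] //.
have [l' [C' [V _]]] := visible_forms td c0 v2 v3 ID De nv.
have [lu [e1 [e2 [m [N m3]]]]] := vis_Linf irr V su u2; have m4 := two_m4 u2 w2 dd q0 Eq N m3.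
have [m1|m1] := eqVneq (m 1%N) 0.
 by apply: (vis_inf_none irr N m3 m1 m4 sg1); rewrite z1 oner_neq0.
have [fr _ _ _ En] := N; have [_ [D _]] := afr_perm fr.
suff ap : Apt F 4 u by have := @cfg_inf_type _ ps 1 u 4 l cf isT l0 hl isT ap.
pose W (p : P) := m 1%N + m 0%N * p.2 + m 2%N * p.1; have sW : sd W by rewrite /W; sdauto.
pose T (p : P) := m 1%N * p.2 + m 4%N * p.1 + m 0%N * p.2^+2 + m 2%N * p.1 * p.2 + m 5%N * p.1^+2.
have sT : sdiff T (m 4%N) (m 1%N).
 apply: (@sdiff_lin0 R _ (fun p => m 2%N * p.2 + m 5%N * p.1) (fun p => m 0%N * p.2)); try by sdauto.
 - by pring.
 - by pring.
 by move=> p; rewrite /T; ring.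
have W0 : W (0, 0) != 0 by rewrite /W [(_, _).1]/= [(_, _).2]/= !mulr0 !addr0.
apply: (Apt_local (c0 := c) (X := fst) (Y := T) (j := 3) (k := 4) (a := fun=> 1) (b := W)
  (c := fun p => - (m 4%N + m 5%N * p.1)) (u := W) D c0 isT isT (@sdiff_fst R) sT); try by sdauto.
- by rewrite mul1r mul0r subr0.
- by rewrite /T [(_, _).1]/= [(_, _).2]/=; ring.
- by move=> p; rewrite En /tform m3 /W /T; ring.
- by change (- (m 4%N + m 5%N*(0 : C)) != 0); rewrite mulr0 addr0 oppr_eq0.
Qed.

End Curve.
End Types.

(** * The tricuspidal quartic *)
Section Tricuspidal.
Variable R : realType.
Local Notation C := (R[i]).
Local Notation vec := ('I_3 -> C).
Implicit Types (u v e : vec) (w : C).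

Let two0 : (2 : C) != 0. Proof. by rewrite pnatr_eq0. Qed.

Lemma cube_omega (w X Y Z : C) : w^+3 = 1 -> (X + w*Y + w^+2*Z)^+3 = X^+3 + Y^+3 + Z^+3 + 6*X*Y*Z +
 3*w*(X^+2*Y + Y^+2*Z + Z^+2*X) + 3*w^+2*(X^+2*Z + Y^+2*X + Z^+2*Y).
Proof.
move=> w3; apply: subr0_eq.
transitivity ((w^+3 - 1)*(Y^+3 + (w^+3 + 1)*Z^+3 + 3*w*X*Z^+2 + 3*w*Y^+2*Z + 3*w^+2*Y*Z^+2 + 6*X*Y*Z)).
 by ring.
by rewrite w3; ring.
Qed.

(** The invisible decompositions of the tricuspidal quartic in barycentric coordinates of its cusps,
 one for each primitive cube root of unity [w]. *)
Definition g2 (w a b c : C) := - 3*(b*c + w*(a*b) + w^+2*(c*a)).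
Definition g3 (w a b c : C) := (3*w + 3/2)*(a^+2*b - a^+2*c - a*b^+2 + a*c^+2 + b^+2*c - b*c^+2) + 27/2*(a*b*c).

Section Omega.
Variable w : C.
Hypothesis hw : w^+2 + w + 1 = 0.

Lemma omega3 : w^+3 = 1.
Proof. by apply: subr0_eq; transitivity ((w - 1)*(w^+2 + w + 1)); [ring|rewrite hw mulr0]. Qed.
Lemma omega2 : w^+2 = - 1 - w.
Proof. by apply: subr0_eq; rewrite -[RHS]hw; ring. Qed.
Lemma omega_neq0 : w != 0.
Proof. by apply/eqP => z; move/eqP: omega3; rewrite z expr0n eq_sym oner_eq0. Qed.
Lemma omega_neq1 : w != 1.
Proof. by apply/eqP => z; move/eqP: hw; rewrite z (_ : _ + 1 = 3) ?pnatr_eq0 //; ring. Qed.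

(** [3 w + 3/2] is a square root of [-27/4]; with it the antisymmetric part of [g2^3] cancels
    against the cross term of [g3^2]. *)
Lemma steiner_id (a b c : C) : g2 w a b c^+3 + g3 w a b c^+2 =
 - (27/4)*(a + b + c)^+2*((a*b + b*c + c*a)^+2 - 4*(a*b*c)*(a + b + c)).
Proof.
rewrite /g2 exprMn (cube_omega _ _ _ omega3) /g3.
have s2 : (3*w + 3/2)^+2 = - (27/4).
 by transitivity (9*(w^+2 + w + 1) - 27/4); [field|rewrite hw; ring].
have e V T : ((3*w + 3/2)*V + T)^+2 = - (27/4)*V^+2 + 2*(3*w + 3/2)*V*T + T^+2 by rewrite -s2; ring.
by rewrite e omega2; field.
Qed.

Lemma omega_norm (a b c : C) : (a + w*b + w^+2*c)*(a + w^+2*b + w*c) = a^+2 + b^+2 + c^+2 - a*b - b*c - c*a.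
Proof.
apply: subr0_eq.
transitivity ((w^+3 - 1)*(b^+2 + c^+2 + w*b*c) + (w^+2 + w + 1)*(a*b + a*c + b*c)); first by ring.
by rewrite omega3 hw; ring.
Qed.

(** The invisible normal form [y z - x^2] with [mu = 1/2]: its cusps [(t, t^2)] have
    [t = 1, w, w^2], and barycentric coordinates turn [x], [y], [z] into these three sums. *)
Lemma g2E (a b c : C) : - (a + w*b + w^+2*c)^+2 + (a + w^+2*b + w*c)*(a + b + c) = g2 w a b c.
Proof.
apply: subr0_eq.
transitivity ((w^+2 + w + 1)*(a*b + a*c + b*c) + (1 - w^+3)*(w*c^+2 + 2*b*c)); first by rewrite /g2; ring.
by rewrite hw omega3; ring.
Qed.

Lemma g3E (a b c : C) : (a + w*b + w^+2*c)^+3 - 3/2*((a + w*b + w^+2*c)*(a + w^+2*b + w*c))*(a + b + c) +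
 1/2*(a + b + c)^+3 = g3 w a b c.
Proof. by rewrite omega_norm (cube_omega _ _ _ omega3) /g3 omega2; field. Qed.
End Omega.

Lemma omega_conj (w : C) : w^+2 + w + 1 = 0 -> (w^+2)^+2 + w^+2 + 1 = 0.
Proof. by move=> hw; transitivity ((w^+2 + w + 1)*(w^+2 - w + 1)); [ring|rewrite hw mul0r]. Qed.

Section Curve.
Variable F : {mpoly C[3]}.
Hypothesis irr : irreducible_quartic F.
Local Notation ev v := (F.@[v]).
Let Fh : F \is 4.-homog. Proof. by case: irr. Qed.

(** On [a + b + c = 0] the quartic must be the square of [w x^2 + be x y + ga y^2]. The last
    coefficient gives [ga = q], whence all three parameters agree, or [ga = - q], which makes [p]
    vanish. *)
Lemma steiner_coef (p q w be ga : C) : p != 0 -> w != 0 -> q != 0 -> 2*w^+2 + 2 * p*w - 2*w*q = 2*w*be ->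
 p^+2 + q^+2 + w^+2 + 2 * p*w + 2 * p*q - 4*w*q = be^+2 + 2*w*ga ->
 2*q^+2 + 2 * p*q - 2*w*q = 2*be*ga -> q^+2 = ga^+2 -> p = q /\ w = q.
Proof.
move=> p0 w0 q0 h1 h2 h3 h4.
have be1 : be = w + p - q.
 by apply: (mulfI (mulf_neq0 two0 w0)); rewrite -h1; ring.
have : (ga - q)*(ga + q) = 0 by rewrite -subr_sqr h4 subrr.
move/eqP; rewrite mulf_eq0 subr_eq0 addr_eq0 => /orP[] /eqP gE.
 have be2 : be = q + p - w by apply: (mulfI (mulf_neq0 two0 q0)); rewrite gE in h3; rewrite mulrAC -h3; ring.
 have wq : w = q.
  by apply: (mulfI two0); apply: subr0_eq; transitivity (be - be); [rewrite {1}be1 be2|]; ring.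
 split=> //; apply: (mulfI (mulf_neq0 two0 (mulf_neq0 two0 q0))); apply: subr0_eq.
 transitivity (p^+2 + q^+2 + w^+2 + 2 * p*w + 2 * p*q - 4*w*q - (be^+2 + 2*w*ga)); last by rewrite h2 subrr.
 by rewrite be1 gE wq; ring.
exfalso; move/eqP: p0; apply; apply: (mulfI (mulf_neq0 two0 (mulf_neq0 two0 q0))).
transitivity (2*q^+2 + 2 * p*q - 2*w*q - 2*be*ga); last by rewrite h3; ring.
by rewrite be1 gE; ring.
Qed.

Lemma sqrf_eqZ (a b : C) : a^+2 = b^+2 -> a = b \/ a = - b.
Proof. by move/eqP; rewrite eqf_sqr => /orP[] /eqP; [left|right]. Qed.

(** The three zero discriminants leave three squares whose cross terms are known up to sign. The
    wrong sign makes the quartic a square; the square at infinity makes the three parameters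
    equal. *)
Lemma steiner P0 P1 P2 : LS F -> P0 i2 = 1 -> P1 i2 = 1 -> P2 i2 = 1 -> det3 P0 P1 P2 != 0 ->
 singular_pt F P0 -> singular_pt F P1 -> singular_pt F P2 -> ~ Apt F 2 P0 -> ~ Apt F 2 P1 -> ~ Apt F 2 P2 ->
 exists2 p, p != 0 & forall a b c, ev (cmb P0 P1 P2 a b c) = p*((a*b + b*c + c*a)^+2 - 4*(a*b*c)*(a + b + c)).
Proof.
move=> ls z0 z1 z2 D s0 s1 s2 n0 n1 n2; have [k E] := frame_form Fh P0 P1 P2.
have E1 := rotE E; have E2 := rotE E1.
have D1 : det3 P1 P2 P0 != 0 by rewrite (_ : det3 P1 P2 P0 = det3 P0 P1 P2) // /det3; ring.
have D2 : det3 P2 P0 P1 != 0 by rewrite (_ : det3 P2 P0 P1 = det3 P0 P1 P2) // /det3; ring.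
have [h0 h1 h2 d2] := vertex D E s2 n2; have [h10 h11 h6 d0] := vertex D1 E1 s0 n0; have [h14 h9 h13 d1] := vertex D2 E2 s1 n1.
move: h10 h11 h6 d0 h14 h9 h13 d1; rewrite /rotf /= => h10 h11 h6 d0 h14 h9 h13 d1.
have FE x y z : ev (cmb P0 P1 P2 x y z) = k 12%N*x^+2*y^+2 + k 5%N*y^+2*z^+2 + k 3%N*x^+2*z^+2 +
  x*y*z*(k 7%N*x + k 8%N*y + k 4%N*z).
 by rewrite E /tform /cubic_form /quartic_form h0 h1 h2 h10 h11 h6 h14 h9 h13; ring.
move: (k 12%N) (k 5%N) (k 3%N) (k 7%N) (k 8%N) (k 4%N) d0 d1 d2 FE => al be ga r s t d0 d1 d2 FE {k E E1 E2 h0 h1 h2 h10 h11 h6 h14 h9 h13}.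
have sq0 (x : C) : x^+2 = 0 -> x = 0 by move/eqP; rewrite sqrf_eq0 => /eqP.
have ga0 : ga != 0.
 apply/eqP => g0; have r0 : r = 0 by apply: sq0; rewrite d0 g0; ring.
 have t0 : t = 0 by apply: sq0; rewrite d2 g0; ring.
 apply: (irr_frame irr D (g := fun x y z => y) (h := fun x y z => y*(al*x^+2 + be*z^+2 + s*x*z))); rewrite ?mul0r //; try by pfauto.
 by move=> x y z; rewrite FE g0 r0 t0; ring.
have be0 : be != 0.
 apply/eqP => g0; have r0 : s = 0 by apply: sq0; rewrite d1 g0; ring.
 have t0 : t = 0 by apply: sq0; rewrite d2 g0; ring.
 apply: (irr_frame irr D (g := fun x y z => x) (h := fun x y z => x*(al*y^+2 + ga*z^+2 + r*y*z))); rewrite ?mul0r //; try by pfauto.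
 by move=> x y z; rewrite FE g0 r0 t0; ring.
have al0 : al != 0.
 apply/eqP => g0; have r0 : r = 0 by apply: sq0; rewrite d0 g0; ring.
 have t0 : s = 0 by apply: sq0; rewrite d1 g0; ring.
 apply: (irr_frame irr D (g := fun x y z => z) (h := fun x y z => z*(be*y^+2 + ga*x^+2 + t*x*y))); rewrite ?mul0r //; try by pfauto.
 by move=> x y z; rewrite FE g0 r0 t0; ring.
have [p p2] := csqrt al; have p0 : p != 0 by apply: contraNneq al0 => e; rewrite -p2 e expr0n.
have [w rE w2] : exists2 w, r = - 2 * p*w & ga = w^+2.
 exists (- r/(2 * p)); first by field.
 have -> : (- r/(2 * p))^+2 = r^+2/(4 * p^+2) by field.
 by rewrite d0 p2; field.
have [q sE q2] : exists2 q, s = - 2 * p*q & be = q^+2.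
 exists (- s/(2 * p)); first by field.
 have -> : (- s/(2 * p))^+2 = s^+2/(4 * p^+2) by field.
 by rewrite d1 p2; field.
have w0 : w != 0 by apply: contraNneq ga0 => e; rewrite w2 e expr0n.
have q0 : q != 0 by apply: contraNneq be0 => e; rewrite q2 e expr0n.
have tE : t = - 2*w*q.
 have : t^+2 = (2*w*q)^+2 by rewrite d2 w2 q2; ring.
 case/sqrf_eqZ => tE; last by rewrite tE; ring.
 exfalso; apply: (irr_frame irr D (g := fun x y z => p*x*y - q*y*z - w*z*x) (h := fun x y z => p*x*y - q*y*z - w*z*x)); rewrite ?mulr0 ?subrr //; try by pfauto.
 by move=> x y z; rewrite FE rE sE tE -p2 w2 q2; ring.
have [pq wq] : p = q /\ w = q.
 pose u := cmb P0 P1 P2 1 0 (-1); pose u' := cmb P0 P1 P2 0 1 (-1).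
 have uz : u i2 = 0 by rewrite /u /cmb z0 z1 z2; ring.
 have uz' : u' i2 = 0 by rewrite /u' /cmb z0 z1 z2; ring.
 have [a [b [c ES]]] := ls _ _ uz uz'.
 have [|k1 k2 k3 k4 k5] := @quartic0 R (a^+2 - w^+2) (2*a*b - (2*w^+2 + 2 * p*w - 2*w*q))
  (b^+2 + 2*a*c - (p^+2 + q^+2 + w^+2 + 2 * p*w + 2 * p*q - 4*w*q))
  (2*b*c - (2*q^+2 + 2 * p*q - 2*w*q)) (c^+2 - q^+2).
  move=> x y; transitivity ((a*x^+2 + b*x*y + c*y^+2)^+2 - ev (cmb P0 P1 P2 x y (- (x + y)))).
   by rewrite FE rE sE tE -p2 w2 q2 /quartic_form; ring.
  rewrite -(ES P0); have -> : cmb u u' P0 x y 0 = cmb P0 P1 P2 x y (- (x + y)) by apply/funext => j; rewrite /u /u' /cmb; ring.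
  exact: subrr.
 move: k1 k2 k3 k4 k5 => /subr0_eq k1 /subr0_eq k2 /subr0_eq k3 /subr0_eq k4 /subr0_eq k5.
 case/sqrf_eqZ: (k1) => aw.
  by apply: (@steiner_coef p q w b c); rewrite -?k2 -?k3 -?k4 -?k5 ?aw.
 by apply: (@steiner_coef p q w (- b) (- c)); rewrite -?k2 -?k3 -?k4 -?k5 ?aw //; ring.
exists (p^+2); first by rewrite expf_neq0.
by move=> x y z; rewrite FE rE sE tE -p2 w2 q2 wq pq; ring.
Qed.

Section Points.
Variables (P0 P1 P2 : vec) (p : C).
Hypotheses (z0 : P0 i2 = 1) (z1 : P1 i2 = 1) (z2 : P2 i2 = 1) (D : det3 P0 P1 P2 != 0) (p0 : p != 0).
Hypothesis FE : forall a b c, ev (cmb P0 P1 P2 a b c) = p*((a*b + b*c + c*a)^+2 - 4*(a*b*c)*(a + b + c)).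

Lemma affine_sum a b c : cmb P0 P1 P2 a b c i2 = a + b + c.
Proof. by rewrite /cmb z0 z1 z2; ring. Qed.

Lemma affine_coords v : v i2 = 1 -> exists a b c, a + b + c = 1 /\ v = cmb P0 P1 P2 a b c.
Proof. by move=> v2; do 3!eexists; split; last exact: (cramer v D); rewrite -affine_sum -cramer. Qed.

Definition inv_form w (d : {mpoly C[2]} * {mpoly C[2]}) := forall a b c, a + b + c = 1 ->
 d.1.@[af (cmb P0 P1 P2 a b c)] = g2 w a b c /\ d.2.@[af (cmb P0 P1 P2 a b c)] = g3 w a b c.

Lemma inv_dec w : w^+2 + w + 1 = 0 -> exists d, torus_dec (dehom F) d /\ inv_form w d.
Proof.
move=> hw; pose s := 3*w + 3/2.
have [G2 [v2 E2]] := vform_coords (nth 0 [:: 0; - 3*w^+2; - 3; 0; - 3*w]) (isT : (2 <= 3)%N) D.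
have [G3 [v3 E3]] := vform_coords (nth 0 [:: 0; s; - s; - s; 27/2; s; 0; s; - s]) (isT : (3 <= 3)%N) D.
have {}E2 a b c : G2 (cmb P0 P1 P2 a b c) = g2 w a b c by rewrite E2 /tform /g2 /=; ring.
have {}E3 a b c : G3 (cmb P0 P1 P2 a b c) = g3 w a b c by rewrite E3 /tform /cubic_form /g3 /= -/s; ring.
have c0 : - (27/4)/p != 0 by rewrite mulf_neq0 ?invr_eq0 // oppr_eq0 mulf_neq0 ?invr_eq0 ?pnatr_eq0.
have aff a b c : a + b + c = 1 -> cmb P0 P1 P2 a b c i2 = 1 by rewrite affine_sum.
have [|||d [td _ dE]] := mk_dec irr c0 (isT : (2 <= 2)%N) (isT : (3 <= 3)%N) v2 v3.
- move=> v v1; have [a [b [c [s1 ->]]]] := affine_coords v1.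
 by rewrite FE E2 E3 steiner_id // s1; field.
- exists (cmb P0 P1 P2 1 0 0), (cmb P0 P1 P2 (1/2) (1/2) 0).
 rewrite !aff; [split=> //|by field|by ring]; rewrite !E2 /g2; apply/eqP => e.
 have : - (3/4)*w = 0 by transitivity (g2 w (1/2) (1/2) 0); rewrite /g2; [field|rewrite -e; ring].
 by move/eqP; rewrite mulf_eq0 (negbTE (omega_neq0 hw)) oppr_eq0 mulf_eq0 invr_eq0 !pnatr_eq0.
- exists (cmb P0 P1 P2 1 0 0), (cmb P0 P1 P2 (1/3) (1/3) (1/3)).
 rewrite !aff; [split=> //|by field|by ring]; rewrite !E3 /g3; apply/eqP => e.
 have : (1/2 : C) = 0 by transitivity (g3 w (1/3) (1/3) (1/3)); rewrite /g3; [field|rewrite -e; ring].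
 by move/eqP; rewrite mul1r invr_eq0 (negbTE two0).
by exists d; split=> // a b c s1; have [-> ->] := dE _ (aff a b c s1).
Qed.

(** An affine function vanishing at two points vanishes at their midpoint, but [g2] does not. *)
Lemma inv_not_visible w d : w != 0 -> inv_form w d -> ~ visible d.
Proof.
move=> w0 dE vd; have [L [vL EL]] := homogenize (isT : (1 <= 4)%N) vd.
have h a b c : a + b + c = 1 -> a*L P0 + b*L P1 + c*L P2 = g2 w a b c.
 by move=> s; have [<- _] := dE _ _ _ s; rewrite EL ?affine_sum // vform1_lin.
have l0 : L P0 = 0.
 by transitivity (g2 w 1 0 0); [rewrite -h|rewrite /g2]; ring.
have l1 : L P1 = 0.
 by transitivity (g2 w 0 1 0); [rewrite -h|rewrite /g2]; ring.
have s1 : 1/2 + 1/2 + 0 = 1 :> C by field.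
have := h _ _ _ s1; rewrite l0 l1 /g2 => e.
have : - (3/4)*w = 0 by rewrite -[RHS](mulr0 (1/2)) -[RHS]addr0 -[X in _ + X](mulr0 (1/2)) -[RHS]addr0 -[X in _ + X](mul0r (L P2)) e; field.
by move/eqP; rewrite mulf_eq0 (negbTE w0) oppr_eq0 mulf_eq0 invr_eq0 !pnatr_eq0.
Qed.

(** The values at the midpoints of two sides give [a = w] and [a w^2 = w^4], whence [w = 1]. *)
Lemma inv_inequiv w d d' : w^+2 + w + 1 = 0 -> inv_form w d -> inv_form (w^+2) d' -> ~ dec_equiv d d'.
Proof.
move=> hw dE dE' [a [b [a0 _ e _]]]; have w3 := omega3 hw; have w0 := omega_neq0 hw.
have h x y z : x + y + z = 1 -> g2 (w^+2) x y z = a*g2 w x y z.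
 by move=> s; have [<- _] := dE _ _ _ s; have [<- _] := dE' _ _ _ s; rewrite e mevalZ.
have t0 : - (3/4) != 0 :> C by rewrite oppr_eq0 mulf_eq0 invr_eq0 !pnatr_eq0.
have h1 : w^+2 = a*w.
 apply: (mulfI t0); transitivity (g2 (w^+2) (1/2) (1/2) 0); first by rewrite /g2; field.
 by rewrite h; [rewrite /g2|]; field.
have h2 : (w^+2)^+2 = a*w^+2.
 apply: (mulfI t0); transitivity (g2 (w^+2) (1/2) 0 (1/2)); first by rewrite /g2; field.
 by rewrite h; [rewrite /g2|]; field.
have aw : a = w by apply: (mulIf w0); rewrite -h1.
move/eqP: (omega_neq1 hw); apply; transitivity (w*w^+3); first by rewrite w3 mulr1.
by transitivity ((w^+2)^+2); [ring|rewrite h2 aw -exprS].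
Qed.

(** The ratios [t1/t0] and [t2/t0] are the two primitive cube roots of unity, and scaling by [t0]
    reduces to [g2E] and [g3E]. *)
Lemma inv_unique k G2 G3 e0 e1 e2 mu t0 t1 t2 : inv_nf F k G2 G3 e0 e1 e2 mu -> t0 != 0 ->
 t0^+3 = 2 * mu -> t1^+3 = 2 * mu -> t2^+3 = 2 * mu -> t0 <> t1 -> t0 <> t2 -> t1 <> t2 ->
 P0 = cmb e0 e1 e2 t0 (t0^+2) 1 -> P1 = cmb e0 e1 e2 t1 (t1^+2) 1 -> P2 = cmb e0 e1 e2 t2 (t2^+2) 1 ->
 exists2 w, w^+2 + w + 1 = 0 & forall a b c, G2 (cmb P0 P1 P2 a b c) = t0^+2*g2 w a b c /\
  G3 (cmb P0 P1 P2 a b c) = t0^+3*g3 w a b c.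
Proof.
move=> E t00 c0 c1 c2 n01 n02 n12 q0 q1 q2; pose w := t1/t0; pose y := t2/t0.
have t1E : t1 = t0*w by rewrite /w; field.
have t2E : t2 = t0*y by rewrite /y; field.
clearbody w y.
have root (x : C) : x*t0 <> t0 -> (x*t0)^+3 = 2 * mu -> x^+2 + x + 1 = 0.
 move=> n e; have : (x - 1)*(x^+2 + x + 1) = 0.
  apply: (mulIf (expf_neq0 3 t00)); transitivity ((x*t0)^+3 - t0^+3); first by ring.
  by rewrite e c0 subrr mul0r.
 move/eqP; rewrite mulf_eq0 subr_eq0 => /orP[] /eqP // x1.
 by case: n; rewrite x1 mul1r.
have hw : w^+2 + w + 1 = 0 by apply: root; rewrite mulrC -t1E //; exact/nesym.
have hy : y^+2 + y + 1 = 0 by apply: root; rewrite mulrC -t2E //; exact/nesym.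
have yE : y = w^+2.
 have : (y - w)*(y + w + 1) = 0 by transitivity ((y^+2 + y + 1) - (w^+2 + w + 1)); [ring|rewrite hw hy subrr].
 move/eqP; rewrite mulf_eq0 subr_eq0 => /orP[] /eqP h; first by case: n12; rewrite t1E t2E h.
 by rewrite (omega2 hw) -[LHS]subr0 -[X in _ - X]h; ring.
have w4 : (w^+2)^+2 = w by rewrite -exprM exprS (omega3 hw) mulr1.
have muE : mu = t0^+3*(1/2) by rewrite c0; field.
exists w => // a b c; rewrite q0 q1 q2 cmb_cmb.
have -> : a*t0 + b*t1 + c*t2 = t0*(a + w*b + w^+2*c) by rewrite t1E t2E yE; ring.
have -> : a*t0^+2 + b*t1^+2 + c*t2^+2 = t0^+2*(a + w^+2*b + w*c).
 by transitivity (t0^+2*(a + w^+2*b + (w^+2)^+2*c)); [rewrite t1E t2E yE; ring|rewrite w4].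
rewrite !mulr1; have [-> -> _] := E (t0*(a + w*b + w^+2*c)) (t0^+2*(a + w^+2*b + w*c)) (a + b + c).
rewrite muE; split; [rewrite -g2E //|rewrite -g3E //]; first by ring.
by ring.
Qed.
End Points.

Lemma visible_equiv (d d' : {mpoly C[2]} * {mpoly C[2]}) : dec_equiv d d' -> visible d <-> visible d'.
Proof. by move=> [a [b [a0 _ e _]]]; rewrite /visible e msizeZ. Qed.

(** On its line the conic is a quadratic polynomial vanishing at all affine singular points; three
    zeros would make [l] divide it. *)
Lemma vis_third c l C' A B D : vis F c l C' -> singular_pt F A -> singular_pt F B -> singular_pt F D ->
 A i2 = 1 -> B i2 = 1 -> D i2 = 1 -> A <> B -> A <> D -> B <> D -> l A = 0 -> l B = 0 -> l D != 0.
Proof.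
move=> V sA sB sD zA zB zD nAB nAD nBD lA lB; apply/eqP => lD.
have [e0 [e1 [e2 [fr l0 l1 l2]]]] := vis_frame V; have [m N] := vis_nform_of V fr l0 l1 l2.
have [h0 h1 h2 DD] := fr; have [_ vl _ _ _] := V.
have X v : singular_pt F v -> v i2 = 1 -> l v = 0 -> exists2 x, v = cmb e0 e1 e2 x 0 1 & m 3%N*x^+2 + m 1%N*x + m 0%N = 0.
 move=> sv zv lv; have [x [y E]] := afr_span fr zv.
 have y0 : y = 0 by rewrite -lv E vform1_lin // l0 l1 l2; ring.
 have vE : v = cmb e0 e1 e2 x 0 1 by rewrite E y0.
 exists x => //; rewrite vE in sv; have [/eqP] := (sing_nform _ _ N).1 sv.
 by rewrite expr0n addr0 sqrf_eq0 => /eqP e _ _; rewrite -[RHS]e /tform; ring.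
have [x xE rx] := X A sA zA lA; have [y yE ry] := X B sB zB lB; have [z zE rz] := X D sD zD lD.
have xy : x - y != 0 by rewrite subr_eq0; apply/eqP => e; apply: nAB; rewrite xE yE e.
have xz : x - z != 0 by rewrite subr_eq0; apply/eqP => e; apply: nAD; rewrite xE zE e.
have yz : y - z != 0 by rewrite subr_eq0; apply/eqP => e; apply: nBD; rewrite yE zE e.
have e1' : m 3%N*(x + y) + m 1%N = 0.
 by apply: (mulfI xy); transitivity ((m 3%N*x^+2 + m 1%N*x + m 0%N) - (m 3%N*y^+2 + m 1%N*y + m 0%N)); [ring|rewrite rx ry; ring].
have e2' : m 3%N*(x + z) + m 1%N = 0.
 by apply: (mulfI xz); transitivity ((m 3%N*x^+2 + m 1%N*x + m 0%N) - (m 3%N*z^+2 + m 1%N*z + m 0%N)); [ring|rewrite rx rz; ring].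
have m3 : m 3%N = 0.
 by apply: (mulfI yz); transitivity ((m 3%N*(x + y) + m 1%N) - (m 3%N*(x + z) + m 1%N)); [ring|rewrite e1' e2'; ring].
have m1 : m 1%N = 0 by rewrite -[RHS]e1' m3; ring.
have m0 : m 0%N = 0 by rewrite -[RHS]rx m3 m1; ring.
by apply: (nform_not_div irr N) => a b; rewrite /tform m3 m1 m0; ring.
Qed.

Lemma type_5 : sing_config F [:: (Defs.A 2, false); (Defs.A 2, false); (Defs.A 2, false)] -> pos_i F ->
 exists ds, dec_reps (dehom F) 5 ds /\ (forall k, (k < 5)%N -> (visible (ds k) <-> (k < 3)%N)).
Proof.
set ll := [:: _; _; _] => sc po; have [ps cf] := cfg_norm irr sc; have [hp _ _] := cf.
have [u' [w' tp]] := pos_i_two irr po; have ls := two_pts_LS tp.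
have allf k : (k < 3)%N -> (nth (Defs.A 0, false) ll k).2 = false by case: k => [|[|[|]]].
have ty k : (k < 3)%N -> (nth (Defs.A 0, false) ll k).1 = Defs.A 2 by case: k => [|[|[|]]].
have sg k : (k < 3)%N -> singular_pt F (ps k) by move=> h; have [] := hp k h.
have zz k : (k < 3)%N -> ps k i2 = 1 by move=> h; have [_ _ ->] := hp k h; rewrite allf.
have nA k : (k < 3)%N -> ~ Apt F 2 (ps k) by move=> h ap; have := @cfg_Apt R F irr ll ps k 2 cf h isT ap; rewrite ty.
have di i j : (i < 3)%N -> (j < 3)%N -> i != j -> ps i <> ps j by move=> hi hj /eqP; exact: (cfg_distinct cf).
(* A visible decomposition whose line contains the two cusps other than [ps k] and misses [ps k]. *)
pose vd k d := exists c l C', [/\ vis F c l C', torus_dec (dehom F) d, visible d, forall v, v i2 = 1 -> d.1.@[af v] = l v /\ d.2.@[af v] = C' v &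
  forall n, (n < 3)%N -> (l (ps n) == 0) = (n != k)].
have V3 i j k : (i < 3)%N -> (j < 3)%N -> (k < 3)%N -> [&& i != j, i != k & j != k] -> exists d, vd k d.
 move=> hi hj hk /and3P[ij ik jk]; have nij := di i j hi hj ij.
 have [c [l [C' [V [li lj]]]]] := exist_two irr ls (zz i hi) (zz j hj) nij (sg i hi) (sg j hj) (nA i hi) (nA j hj).
 have [d [td vs dE]] := vis_dec irr V; exists d, c, l, C'; split=> // n hn; have [->|nk] := eqVneq n k.
  by apply/negbTE; apply: (vis_third V (sg i hi) (sg j hj) (sg k hk) (zz i hi) (zz j hj) (zz k hk)); try exact: di.
 apply/eqP; suff : n = i \/ n = j by case=> ->.
 by clear -hi hj hk ij ik jk hn nk; lia.
have V' k : exists d, (k < 3)%N -> vd k d.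
 case: k => [|[|[|k]]]; last by exists (0, 0).
 - by have [d hd] := V3 1%N 2%N 0%N isT isT isT isT; exists d.
 - by have [d hd] := V3 0%N 2%N 1%N isT isT isT isT; exists d.
 - by have [d hd] := V3 0%N 1%N 2%N isT isT isT isT; exists d.
have {V3 V'}[dv dvP] := choice V'.
(* The linear form through the first two cusps does not vanish at the third, so the cusps form a
   frame. *)
have D : det3 (ps 0%N) (ps 1%N) (ps 2%N) != 0.
 have [x xD] := aff_indep (zz 0%N isT) (zz 1%N isT) (di 0%N 1%N isT isT isT).
 have [c [l [C' [V _ _ _ lP]]]] := dvP 2%N isT; have [_ vl _ _ _] := V.
 have /eqP l0 := lP 0%N isT; have /eqP l1 := lP 1%N isT; have l2 := lP 2%N isT; rewrite eqxx in l2.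
 apply: contraFneq l2 => D0; rewrite (cramer (ps 2%N) xD) vform1_lin // l0 l1 D0; apply/eqP; ring.
have [p p0 FE] := steiner ls (zz 0%N isT) (zz 1%N isT) (zz 2%N isT) D (sg 0%N isT) (sg 1%N isT) (sg 2%N isT) (nA 0%N isT) (nA 1%N isT) (nA 2%N isT).
have [w [hw w3 _ _]] := @omega_ex R; have hw2 := omega_conj hw.
have I x := @inv_dec (ps 0%N) (ps 1%N) (ps 2%N) p (zz 0%N isT) (zz 1%N isT) (zz 2%N isT) D p0 FE x.
have [dp [tdp ip]] := I _ hw; have [dm [tdm im]] := I _ hw2.
have nv x d := @inv_not_visible (ps 0%N) (ps 1%N) (ps 2%N) (zz 0%N isT) (zz 1%N isT) (zz 2%N isT) x d.
have nvp := nv _ _ (omega_neq0 hw) ip; have nvm := nv _ _ (omega_neq0 hw2) im.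
have ine x d d' := @inv_inequiv (ps 0%N) (ps 1%N) (ps 2%N) x d d'.
have ip' : inv_form (ps 0%N) (ps 1%N) (ps 2%N) ((w^+2)^+2) dp by rewrite -exprM exprS w3 mulr1.
(* Indices 0 to 2 belong to the line missing the cusp of that index, 3 and 4 to the roots of unity
   [w] and [w^2]. *)
pose ds k := if (k < 3)%N then dv k else if k == 3%N then dp else dm.
have vds k : (k < 5)%N -> visible (ds k) <-> (k < 3)%N.
 move=> k5; rewrite /ds; case: ltnP => k3; last by case: eqP => _; split.
 by split=> // _; have [c [l [C' []]]] := dvP k k3.
exists ds; split=> //; split.
- move=> k k5; rewrite /ds; case: ltnP => k3; last by case: eqP.
 by have [c [l [C' []]]] := dvP k k3.
- move=> k k' k5 k5' kk e; have := visible_equiv e; rewrite (vds k k5) (vds k' k5') => v.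
 move: e; rewrite /ds; case: ltnP v => k3 v.
  have k3' := v.1 isT; rewrite k3' => -[a [b [/negbTE a0 _ e _]]].
  have [c [l [C' [_ _ _ dE lP]]]] := dvP k k3; have [c1 [l1 [C1 [_ _ _ dE1 lP1]]]] := dvP k' k3'.
  have [e1 _] := dE _ (zz k k3); have [e2 _] := dE1 _ (zz k k3); move: e2; rewrite e mevalZ e1.
  have /eqP-> := (etrans (lP1 k k3) (introN eqP kk)) => /eqP; by rewrite mulf_eq0 a0 lP // eqxx.
 have k3' : (3 <= k')%N by rewrite leqNgt; apply/negP => h; have := v.2 h.
 rewrite ltnNge k3' /=; have [k3e|n3] := eqVneq k 3%N; have [k3e'|n3'] := eqVneq k' 3%N.
 + by case: kk; rewrite k3e k3e'.
 + exact: (ine _ _ _ hw ip im).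
 + exact: (ine _ _ _ hw2 im ip').
 + by clear -k5 k5' kk k3 k3' n3 n3'; lia.
move=> d td; have [c [G2 [G3 [c0 v2 v3 ID De]]]] := dec_forms irr td.
case: (pselect (exists2 u, u i2 = 0 & G2 u != 0)) => [ex|nex]; last first.
 have nv0 v : v i2 = 0 -> G2 v = 0 by move=> vz; apply/eqP/negPn/negP => h; apply: nex; exists v.
 have [l [C' [V dE]]] := visible_forms td c0 v2 v3 ID De nv0.
 have [k1 [k2 [kl1 kl2 k12 _ [e1 e2]]]] := vis_two_cusps irr cf allf isT V.
 have [k [k3 kk1 kk2]] : exists k, [/\ (k < 3)%N, k1 <> k & k2 <> k].
  by exists (3 - (k1 + k2))%N; clear -kl1 kl2 k12; rewrite /= in kl1 kl2; split; lia.
 exists k; first by rewrite (leq_trans k3).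
 rewrite /ds k3; have [c1 [l1 [C1 [V1 _ _ dE1 lP]]]] := dvP k k3.
 have /eqP a1 := etrans (lP k1 kl1) (introN eqP kk1); have /eqP a2 := etrans (lP k2 kl2) (introN eqP kk2).
 have [x xD] := aff_indep (zz k1 kl1) (zz k2 kl2) (di _ _ kl1 kl2 (introN eqP k12)).
 have [_ vl _ nl _] := V; have [_ vl1 _ nl1 _] := V1.
 have [lam lam0 El] := l_prop vl vl1 nl nl1 xD e1 e2 a1 a2; have [s s0 EC] := vis_unique irr V V1 lam0 El.
 exists lam, s; split=> //; apply: proportional => v hv; have [q1 q2] := dE v hv; have [q1' q2'] := dE1 v hv.
  by rewrite q1 q1' El.
 by rewrite q2 q2' EC.
have [e0 [e1 [e2 [mu [fr mu0 E]]]]] := invisible_nf irr c0 v2 v3 ID ls ex.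
have [k [t' [hk [k01 k02 k12]]]] := inv_cusps irr cf c0 fr mu0 E.
have nz t : t^+3 = 2 * mu -> t != 0.
 by move=> t3; apply: contraTneq mu0 => z; move: t3; rewrite z expr0n => /esym/eqP; rewrite mulf_eq0 (negbTE two0) negbK.
have /choice[t tP] : forall j, exists t, (j < 3)%N -> t^+3 = 2 * mu /\ ps j = cmb e0 e1 e2 t (t^+2) 1.
 move=> j; case: (ltnP j 3) => [j3|_]; last by exists 0.
 have [s0 _ _ _] := hk 0%N; have [s1 _ _ _] := hk 1%N; have [s2 _ _ _] := hk 2%N; rewrite /= in s0 s1 s2.
 have [i ->] : exists i, j = k i.
  have [e|[e|e]] : j = k 0%N \/ j = k 1%N \/ j = k 2%N by clear -s0 s1 s2 k01 k02 k12 j3; lia.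
  - by exists 0%N. - by exists 1%N. - by exists 2%N.
 by have [_ _ t3 e] := hk i; exists (t' i).
have [a0 b0] := tP 0%N isT; have [a1 b1] := tP 1%N isT; have [a2 b2] := tP 2%N isT.
have tn i j : (i < 3)%N -> (j < 3)%N -> i != j -> t i <> t j.
 by move=> hi hj ij e; apply: (di i j hi hj ij); have [_ ->] := tP i hi; have [_ ->] := tP j hj; rewrite e.
have [x hx GE] := inv_unique E (nz _ a0) a0 a1 a2 (tn 0%N 1%N isT isT isT) (tn 0%N 2%N isT isT isT) (tn 1%N 2%N isT isT isT) b0 b1 b2.
have t00 := nz _ a0.
have fin d' : inv_form (ps 0%N) (ps 1%N) (ps 2%N) x d' -> dec_equiv d d'.
 move=> id; exists (t 0%N^+2)^-1, (t 0%N^+3)^-1; rewrite !invr_eq0 !expf_neq0 //.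
 split=> //; apply: proportional => v hv; have [q1 q2] := De v hv; rewrite ?q1 ?q2 {q1 q2};
  have [a [b [c' [s1 ->]]]] := affine_coords (zz 0%N isT) (zz 1%N isT) (zz 2%N isT) D hv;
  have [q1 q2] := id _ _ _ s1; have [q3 q4] := GE a b c'; by rewrite ?q1 ?q2 ?q3 ?q4 mulKf ?expf_neq0.
(* The root of unity of the given decomposition is [w] or [w^2], which selects index 3 or 4. *)
have : (x - w)*(x + w + 1) = 0 by transitivity ((x^+2 + x + 1) - (w^+2 + w + 1)); [ring|rewrite hw hx subrr].
move/eqP; rewrite mulf_eq0 subr_eq0 => /orP[] /eqP h.
 by exists 3%N => //; apply: fin; rewrite h.
have xw : x = w^+2 by rewrite (omega2 hw) -[LHS]subr0 -[X in _ - X]h; ring.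
by exists 4%N => //; apply: fin; rewrite xw.
Qed.
End Curve.
End Tricuspidal.

Theorem theorem1 (R : realType) (F : {mpoly R[i][3]}) :
  irreducible_quartic F ->
  [/\ QL_config F 13 -> forall d, ~ torus_dec (dehom F) d,
      QL_config F 5 ->
        exists ds, dec_reps (dehom F) 5 ds /\
          (forall k, (k < 5)%N -> (visible (ds k) <-> (k < 3)%N))
    & forall n, n \in [:: 1; 2; 3; 4; 6; 7; 8; 9; 10; 11; 12]%N ->
        QL_config F n -> exists ds, dec_reps (dehom F) 1 ds].
Proof.
move=> irr; split=> [[sc po] d|[sc po]|n]; [exact: type_13|exact: type_5|].
have LSi : pos_i F -> LS F by move/(pos_i_two irr) => [u [w /two_pts_LS]].
have LSiv : pos_iv F -> LS F by move=> [p [Qp _ _ m4]]; have [w /one_pt_LS] := pos_one irr Qp m4.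
rewrite !inE => /or4P[/eqP->|/eqP->|/eqP->|]; last case/or4P=> [/eqP->|/eqP->|/eqP->|]; last case/or4P=> [/eqP->|/eqP->|/eqP->|/orP[]/eqP->].
all: move=> [sc po].
- by apply: (types_1234 irr sc (LSi po)); left.
- by apply: (types_1234 irr sc (LSiv po)); left.
- by apply: (types_1234 irr sc (LSi po)); right.
- by apply: (types_1234 irr sc (LSiv po)); right.
- exact: type_6.
- by apply: (types_single irr sc (LSi po)) => //; right.
- by apply: (types_single irr sc (LSiv po)) => //; right.
- exact: type_9.
- exact: type_10.
- by apply: (types_single irr sc (LSi po)) => //; left.
- by apply: (types_single irr sc (LSiv po)) => //; left.
Qed.
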